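(* Let $d\in\mathbb{N}$, $d\geq 1$. Let $(w_0,\dot w_0)\in H^1(\mathbb{T}^d)\times L^2(\mathbb{T}^d)$ with $(w_0,\dot w_0)\neq(0,0)$, and assume that one of the following two conditions holds: (a) $w_0\neq 0$ and $\langle w_0,e^{ikx}\rangle_{L^2}=0$ for all but a finite set of $k\in\mathbb{Z}^d$; or (b) $w_0=0$, $\dot w_0\neq 0$ and $\langle \dot w_0,e^{ikx}\rangle_{L^2}=0$ for all but a finite set of $k\in\mathbb{Z}^d$. Then, for any $(w_1,\dot w_1)\in H^1(\mathbb{T}^d)\times L^2(\mathbb{T}^d)$ and any $\varepsilon,T>0$, there exists a piecewise constant control law $p=(p_0,\dots,p_{2d}):[0,T]\to\mathbb{R}^{2d+1}$ such that the solution $w$ of $$\frac{\partial^2}{\partial t^2}w(x,t)=\Big(\Delta+\sum_{j=0}^{2d}p_j(t)\mu_j(x)\Big)w(x,t),\qquad (x,t)\in\mathbb{T}^d\times[0,T],$$ with initial condition $\big(w(\cdot,0),\frac{\partial}{\partial t}w(\cdot,0)\big)=(w_0,\dot w_0)$ satisfies $$\Big\|\Big(w(\cdot,T),\frac{\partial}{\partial t}w(\cdot,T)\Big)-(w_1,\dot w_1)\Big\|_{H^1\times L^2(\mathbb{T}^d)}<\varepsilon.$$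
   Context: $\mathbb{T}^d=\mathbb{R}^d/(2\pi\mathbb{Z})^d$ is the $d$-dimensional torus, $\Delta=\sum_{i=1}^d\partial_{x_i}^2$ is the Laplacian, and $\langle\cdot,\cdot\rangle_{L^2}$ is the $L^2(\mathbb{T}^d)$ scalar product. States are real-valued: $H^1\times L^2(\mathbb{T}^d)$ denotes $H^1(\mathbb{T}^d,\mathbb{R})\times L^2(\mathbb{T}^d,\mathbb{R})$, with $H^1$ the usual Sobolev space. The fixed spatial control functions are $$(\mu_0(x),\dots,\mu_{2d}(x))=(1,\cos(e_1x),\sin(e_1x),\dots,\cos(e_dx),\sin(e_dx)),$$ where $e_1,\dots,e_d\in\mathbb{Z}^d$ is the standard basis of $\mathbb{R}^d$ and $kx$ denotes the scalar product of $k\in\mathbb{Z}^d$ and $x$ (so $e_ix=x_i$). Solutions are understood in the following (weak/mild) sense. Put $\mathcal{A}=\begin{pmatrix}0&I\\ \Delta&0\end{pmatrix}$, with domain $H^2\times H^1(\mathbb{T}^d)$, which generates a strongly continuous group $e^{t\mathcal{A}}$ on $H^1\times L^2(\mathbb{T}^d)$, and $\mathcal{B}=\begin{pmatrix}0&0\\ I&0\end{pmatrix}$. For $p\in L^1([0,T],\mathbb{R}^{2d+1})$ and $W_0=(w_0,\dot w_0)\in H^1\times L^2(\mathbb{T}^d)$, the solution is the unique $W=(w,\frac{\partial}{\partial t}w)\in C^0([0,T],H^1\times L^2(\mathbb{T}^d))$ such that $$W(t)=e^{t\mathcal{A}}W_0+\int_0^te^{(t-s)\mathcal{A}}\Big(\sum_{j=0}^{2d}p_j(s)\mu_j\mathcal{B}\Big)W(s)\,ds,\qquad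 t\in[0,T],$$ where $\mu_j\mathcal{B}(u,v)=(0,\mu_ju)$. *)

(* Defs.v *)
From HB Require Import structures.
From mathcomp Require Import all_boot all_order all_algebra.
From mathcomp Require Import complex.
From mathcomp Require Import all_classical all_reals all_analysis.

Set Implicit Arguments.
Unset Strict Implicit.
Unset Printing Implicit Defensive.

Import Order.TTheory GRing.Theory Num.Theory.
Import numFieldNormedType.Exports.

Local Open Scope classical_set_scope.
Local Open Scope ring_scope.
Local Open Scope complex_scope.

(** The torus R^d / (2 pi Z)^d is represented by its fundamental domain
    [0, 2 pi[^d: functions on it are functions on [d.-tuple R], taken modulo
    equality almost everywhere for [torus_measure d], the d-dimensional
    Lebesgue measure restricted to [0, 2 pi[^d. *)

Section torus_measure.
Variable R : realType.

Definition period : interval R := `[0, 2 * pi[.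

Lemma period_finite : (@lebesgue_measure R [set` period] < +oo)%E.
Proof. by rewrite lebesgue_measure_itv /=; case: ifP => _; rewrite ?ltry. Qed.

Definition circle_measure : set (measurableTypeR R) -> \bar R :=
  @mfrestr _ (measurableTypeR R) R [set` period] lebesgue_measure
    (measurable_itv period) period_finite.

HB.instance Definition _ := FiniteMeasure.on circle_measure.

Definition torus (d : nat) : Type := d.-tuple (measurableTypeR R).
HB.instance Definition _ d := Measurable.on (torus d).

Definition tcons (d : nat) (p : measurableTypeR R * torus d) : torus d.+1 :=
  [tuple of p.1 :: p.2].

Fixpoint torus_measure (d : nat) : set (torus d) -> \bar R :=
  if d is d'.+1
  then pushforward (circle_measure \x @torus_measure d')%E (@tcons d')
  else \d_([tuple] : torus 0).

Lemma measurable_tcons d : measurable_fun setT (@tcons d).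
Proof. exact: measurable_cons. Qed.

Let torus_measureP d : exists m : {finite_measure set (torus d) -> \bar R},
  @torus_measure d = m.
Proof.
elim: d => [|d [m mE]] /=; first by exists (\d_([tuple] : torus 0)).
pose M : {measure set (torus d.+1) -> \bar R} :=
  measure_function_pushforward__canonical__measure_function_Measure
    (circle_measure \x m)%E (@measurable_tcons d).
have MT : (M setT < +oo)%E.
  rewrite /M /= /pushforward preimage_setT -setXTT product_measure1E//.
  by rewrite lte_mul_pinfty// ?fin_num_measure// ltey_eq fin_num_measure.
exists (mfrestr measurableT MT); rewrite mE.
by apply/funext => A; rewrite /= /mfrestr /mrestr /M /= setIT.
Qed.

Let torus_measure0 d : @torus_measure d set0 = 0%E.
Proof. by have [m ->] := torus_measureP d; exact: measure0. Qed.

Let torus_measure_ge0 d A : (0 <= @torus_measure d A)%E.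
Proof. by have [m ->] := torus_measureP d; exact: measure_ge0. Qed.

Let torus_measure_sigma_additive d : semi_sigma_additive (@torus_measure d).
Proof.
by have [m ->] := torus_measureP d; exact: measure_semi_sigma_additive.
Qed.

HB.instance Definition _ d := isMeasure.Build _ _ _ (@torus_measure d)
  (torus_measure0 d) (@torus_measure_ge0 d) (@torus_measure_sigma_additive d).

Let torus_measure_finite d : fin_num_fun (@torus_measure d).
Proof. by have [m ->] := torus_measureP d; exact: fin_num_measure. Qed.

HB.instance Definition _ d :=
  Measure_isFinite.Build _ _ _ (@torus_measure d) (@torus_measure_finite d).

End torus_measure.

Arguments torus_measure {R d}.

Section sobolev_spaces.
Context {R : realType} {d : nat}.
Implicit Types (f g : torus R d -> R) (k : d.-tuple int).

Definition coordinate (x : torus R d) (i : 'I_d) : R := tnth x i.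

(* the scalar product kx *)
Definition freq_dot k (x : torus R d) : R :=
  \sum_(i < d) (tnth k i)%:~R * coordinate x i.

Definition freq_sqnorm k : R := \sum_(i < d) (tnth k i)%:~R ^+ 2.

(** [fourier f k] is <f, e^{ikx}> in L^2, the integral of f(x) e^{-ikx}. *)
Definition fourier f k : R[i] :=
  (\int[torus_measure]_x (f x * cos (freq_dot k x)))
  -i* (\int[torus_measure]_x (f x * sin (freq_dot k x))).

Definition sqmod (z : R[i]) : R := complex.Re z ^+ 2 + complex.Im z ^+ 2.

(** With the above unnormalized coefficients, (2 pi)^-d times
    [sobolev_sum 1 f] is |f|_{L^2}^2 + |grad f|_{L^2}^2. *)
Definition sobolev_sum (s : nat) f : \bar R :=
  (\esum_(k in [set: d.-tuple int])
    (((1 + freq_sqnorm k) ^+ s * sqmod (fourier f k))%R)%:E)%E.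

Definition L2 : set (torus R d -> R) :=
  [set f | f \in Lfun (@torus_measure R d) 2%:E].

Definition sobolev (s : nat) : set (torus R d -> R) :=
  [set f | L2 f /\ (sobolev_sum s f < +oo)%E].

Definition L2norm f : R := fine ('N[@torus_measure R d]_2%:E[EFin \o f])%E.

Definition H1norm f : R :=
  Num.sqrt ((2 * pi) ^- d * fine (sobolev_sum 1 f)).

Definition ae_zero f : Prop := f = cst 0 %[ae @torus_measure R d].

(** g is the distributional Laplacian of f: tested on e^{ikx}, whose Laplacian
    is -|k|^2 e^{ikx}; the exponentials span a dense subspace of the smooth
    functions on the torus. *)
Definition is_laplacian f g : Prop :=
  forall k, fourier g k = (- freq_sqnorm k)%:C * fourier f k.

End sobolev_spaces.

(** Strongly continuous groups and Bochner integrals in the space of elements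
    of [V] satisfying [C], with seminorm [N], modulo the elements of
    seminorm 0. *)
Section seminormed.
Context {R : realType} {V : lmodType R}.
Variables (C : set V) (N : V -> R).

Definition bounded_linear_op (L : V -> V) : Prop :=
  [/\ forall u, C u -> C (L u),
      forall (a : R) u v, C u -> C v ->
        N (L (a *: u + v) - (a *: L u + L v)) = 0
    & exists M : R, forall u, C u -> N (L u) <= M * N u].

Definition strongly_continuous_group (S : R -> V -> V) : Prop :=
  [/\ forall t, bounded_linear_op (S t),
      forall u, C u -> N (S 0 u - u) = 0,
      forall s t u, C u -> N (S (s + t) u - S s (S t u)) = 0
    & forall u, C u -> N (S t u - u) @[t --> (0 : R)] --> (0 : R)].

(** [S] is the group generated by the unbounded operator of graph [A]. *)
Definition generates (A : V -> V -> Prop) (S : R -> V -> V) : Prop :=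
  strongly_continuous_group S /\
  forall u v, C u -> C v ->
    (N (h^-1 *: (S h u - u) - v) @[h --> (0 : R)^'] --> (0 : R)) <-> A u v.

(** The list [:: (A_1, v_1); ...; (A_n, v_n)] stands for the simple function
    \sum_i 1_{A_i} v_i. *)
Definition simple_eval (s : seq (set R * V)) (x : R) : V :=
  \sum_(p <- s) \1_(p.1) x *: p.2.

Definition simple_integral (s : seq (set R * V)) : V :=
  \sum_(p <- s) fine (lebesgue_measure p.1) *: p.2.

Definition simple_on (D : set R) (s : seq (set R * V)) : Prop :=
  forall p, p \in s -> [/\ measurable p.1, p.1 `<=` D & C p.2].

(** [I] is the Bochner integral of [F] over the bounded set [D]. *)
Definition is_bochner_integral (D : set R) (F : R -> V) (I : V) : Prop :=
  exists s : nat -> seq (set R * V),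
  [/\ forall n, simple_on D (s n),
      forall n, measurable_fun D (fun x => N (F x - simple_eval (s n) x)),
      (\int[lebesgue_measure]_(x in D) (N (F x - simple_eval (s n) x))%:E)%E
        @[n --> \oo] --> 0%E
    & N (simple_integral (s n) - I) @[n --> \oo] --> (0 : R)].

Definition continuous_path (T : R) (W : R -> V) : Prop :=
  (forall t : R, t \in `[0, T] -> C (W t)) /\
  forall t : R, t \in `[0, T] ->
    N (W s - W t) @[s --> within `[0, T]%classic (nbhs t)] --> (0 : R).

End seminormed.

Section wave_equation.
Context {R : realType} {d : nat}.

Definition state : Type := ((torus R d -> R) * (torus R d -> R))%type.
Implicit Types u v W : state.

Definition state_space : set state := [set u | sobolev 1 u.1 /\ L2 u.2].

Definition state_norm u : R :=
  Num.sqrt (H1norm u.1 ^+ 2 + L2norm u.2 ^+ 2).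

(** The graph of the operator A : (u, v) |-> (v, Laplacian u), of domain
    H^2 x H^1. *)
Definition wave_operator u v : Prop :=
  [/\ sobolev 2 u.1, sobolev 1 u.2, v.1 = u.2 %[ae @torus_measure R d]
    & is_laplacian u.1 v.2].

(** 1, cos x_1, sin x_1, ..., cos x_d, sin x_d *)
Definition control_fun (j : 'I_(d.*2.+1)) (x : torus R d) : R :=
  if val j is m.+1 then
    let xi : R := nth 0 (x : d.-tuple R) m./2 in
    if odd m then sin xi else cos xi
  else 1.

Definition control_term (q : 'rV[R]_(d.*2.+1)) u : state :=
  (cst 0, fun x => \sum_j q 0 j * control_fun j x * u.1 x).

(** [W0] and [W] are known only up to states of seminorm 0, and so is the
    Duhamel formula
      W t = S t W0 + \int_0^t S (t - s) (control_term (p s) (W s)) ds. *)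
Definition mild_solution (T : R) (p : R -> 'rV[R]_(d.*2.+1)) (W0 : state)
    (W : R -> state) : Prop :=
  exists2 S : R -> state -> state,
    generates state_space state_norm wave_operator S &
    continuous_path state_space state_norm T W /\
    forall t : R, t \in `[0, T] ->
      is_bochner_integral state_space state_norm `[0, t]%classic
        (fun s => S (t - s) (control_term (p s) (W s))) (W t - S t W0).

Definition piecewise_constant (T : R) (p : R -> 'rV[R]_(d.*2.+1)) : Prop :=
  exists2 s : seq R, itv_partition 0 T s &
    forall i, (i < size s)%N ->
      {in `[nth 0 (0 :: s) i, nth 0 s i[ &, forall x y, p x = p y}.

End wave_equation.

(* Main.v *)
Require Import Defs.
From mathcomp Require Import all_boot all_order all_algebra.
From mathcomp Require Import complex.
From mathcomp Require Import all_classical all_reals all_analysis.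
From mathcomp Require Import measurable_realfun.
From mathcomp Require Import ring lra.

Import Order.TTheory GRing.Theory Num.Theory.
Import numFieldNormedType.Exports.

Set Implicit Arguments.
Unset Strict Implicit.
Unset Printing Implicit Defensive.

Local Open Scope classical_set_scope.
Local Open Scope ring_scope.

(** The wave group is diagonal in the Fourier basis, and a control of size s
    acting during the time 1/s changes, in the limit, the velocity v into
    v + phi u, where u is the position and phi the combination of the mu_j in
    use ([impulse]): the control operator has square zero, so that its
    exponential is affine.  Such a change is called a kick by phi, and
    everything rests on making kicks by more functions than the combinations
    of the mu_j.

    A kick by s phi, followed by a free flow of duration s^-2 and by a kick by
    - s phi, tends to the kick by - phi^2 ([kick_square]).  Kicks compose by
    addition of the functions, and cos (k + l) as well as - cos (k + l) is a
    constant minus a sum of two squares of combinations of the cosines and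
    sines of k and l; the same holds for the sine ([kickable_squares],
    [kickable_freqD]).  From 1 and the cosines and sines of the coordinates
    all real trigonometric polynomials are thus obtained ([trig_kicks]), in
    arbitrarily short time.

    Let now the position be a nonzero trigonometric polynomial p, which is what
    a finite set of frequencies means.  It vanishes on a null set only
    ([trig_ae_neq0]), hence the products phi p with phi a trigonometric
    polynomial are dense in L^2 ([trig_multiples_dense]), and the velocity can
    be steered to any prescribed function, instantaneously and without moving
    the position ([NR_velocity]).  To move the position to another
    trigonometric polynomial q, prescribe the velocity (q - p) / delta, let the
    waves flow during delta, and prescribe the velocity again ([NR_trig]);
    trigonometric polynomials being dense, every state is approached in
    arbitrarily short time.  If the position is zero, a short free flow makes
    it a nonzero trigonometric polynomial ([NR_rest]).  Finally, to arrive at Z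
    at the time T exactly, approach wave (- T) Z in a very short time and
    let the waves flow until T ([control_in_time]).

    Two theories support this argument.  In a complete seminormed space, with a
    strongly continuous group and bounded controls, the Duhamel formula with a
    piecewise constant control has a solution ([csol_exists], [csol_concat],
    [steer_exists]), which depends on the initial state in a Lipschitz way
    ([mild_dist]), so that approximate reachability is transitive
    ([reach_trans]) and closed; and a group is determined by its generator
    ([generator_group_eq]).  On the torus, a function with vanishing Fourier
    coefficients is zero almost everywhere ([fourier_unique0]), which together
    with the completeness of L^2 gives the theorems of Riesz-Fischer and
    Parseval ([riesz_fischer], [parseval]); the state space is then a weighted
    space of square summable coefficients ([state_norm_sqr],
    [state_seminorm]), where the wave group is a Fourier multiplier
    ([wave_generates]). *)


(** * Gronwall's lemma *)

Section small_sequences.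
Context {R : realType}.

Lemma inv_nat_small (e : R) : 0 < e ->
  exists n0, forall n, (n0 <= n)%N -> n.+1%:R^-1 <= e.
Proof.
move=> e0; have [n0 _ h] := near_infty_natSinv_lt (PosNum e0).
by exists n0 => n /h/ltW.
Qed.

Lemma cvg0_eps (f : nat -> R) : (forall n, 0 <= f n) ->
  (forall e, 0 < e -> exists n0, forall n, (n0 <= n)%N -> f n <= e) <->
  f n @[n --> \oo] --> (0 : R).
Proof.
move=> f0; split=> [h|/cvgrPdist_le h e /h[n0 _ {}h]]; last first.
  by exists n0 => n /h; rewrite sub0r normrN ger0_norm.
apply/cvgrPdist_le => e /h[n0 {}h]; exists n0 => // n /= /h.
by rewrite sub0r normrN ger0_norm.
Qed.

Lemma lebesgue_shift (a : R) (A : set R) : measurable A ->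
  lebesgue_measure [set x | A (x - a)] = lebesgue_measure A.
Proof.
move=> mA.
have mf : measurable_fun setT (fun x : measurableTypeR R => x - a : measurableTypeR R).
  exact: measurable_funB.
pose m := measure_function_pushforward__canonical__measure_function_Measure
  (@lebesgue_measure R) mf.
rewrite (_ : lebesgue_measure [set x | A (x - a)] = m A)//.
apply/esym/lebesgue_measure_unique => // X [[x y] _ <-] /=.
rewrite /pushforward (_ : _ @^-1` _ = `]x + a, y + a]%classic).
  rewrite !lebesgue_measure_itv /= !lte_fin ltrD2r; case: ifP => // _.
  by rewrite !EFinD -EFinB -EFinD; congr EFin; lra.
by apply/seteqP; split => z /=; rewrite !in_itv/=; lra.
Qed.

Lemma within_continuous_eps (a b : R) (f : R -> R) :
  (forall x, x \in `[a, b] -> forall e, 0 < e -> exists2 d, 0 < d &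
    forall y, y \in `[a, b] -> `|y - x| < d -> `|f y - f x| <= e) ->
  {within `[a, b], continuous f}.
Proof.
move=> h; apply/subspace_continuousP => x xab; apply/cvgrPdist_le => e e0.
have [d d0 {}h] := h x xab e e0.
rewrite /prop_near1 /within /=; exists d => // y /=; rewrite distrC => yx yab.
by rewrite distrC; apply: h.
Qed.

Lemma measurable_expRM (l : R) (D : set R) : measurable_fun D (fun s => expR (l * s)).
Proof.
apply: measurable_funTS; apply: (@measurableT_comp _ _ _ _ _ _ expR).
  exact: measurable_expR.
exact: measurable_funM.
Qed.

Lemma integral_expR_le (l t : R) : 0 < l -> 0 <= t ->
  (\int[lebesgue_measure]_(s in `[0%R, t]) (expR (l * s))%:E <=
   (expR (l * t) / l)%:E)%E.
Proof.
move=> l0; rewrite le_eqVlt => /predU1P[<-|t0].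
  by rewrite set_itv1 integral_set1 lee_fin divr_ge0// ltW// expR_gt0.
have dF x : is_derive x (1 : R) (fun s => expR (l * s) / l) (expR (l * x)).
  apply: is_derive_eq; rewrite scaler0 add0r /GRing.scale/= mulr1.
  by rewrite mulrCA mulVf ?mulr1// gt_eqF.
have cF : continuous (fun s => expR (l * s) / l).
  by move=> x; apply: differentiable_continuous; apply/derivable1_diffP.
rewrite (@continuous_FTC2 _ _ (fun s => expR (l * s) / l))//.
- by rewrite -EFinB lee_fin lerBlDr lerDl divr_ge0// ltW// expR_gt0.
- apply: continuous_subspaceT => x; apply: differentiable_continuous.
  by apply/derivable1_diffP.
- split.
  + by move=> x _; have [] := dF x.
  + by apply: cvg_at_right_filter; exact: cF.
  + by apply: cvg_at_left_filter; exact: cF.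
- by move=> x _; rewrite derive1E; have [] := dF x.
Qed.

(** Take s0 maximizing g(s) e^{-ls} on [0, T]. Since l = 2 K + 1, the integral
    on [0, s0] is at most half of g(s0), and can be absorbed in the left-hand
    side. *)
Lemma gronwall (T K c : R) (g : R -> R) : 0 <= K -> 0 <= c ->
  {within `[0, T], continuous g} -> (forall t, t \in `[0, T] -> 0 <= g t) ->
  (forall t, t \in `[0, T] ->
    ((g t)%:E <= c%:E + \int[lebesgue_measure]_(s in `[0%R, t]) (K * g s)%:E)%E) ->
  forall t, t \in `[0, T] -> g t <= 2 * c * expR ((2 * K + 1) * T).
Proof.
move=> K0 c0 cg g0 hg t tT.
have T0 : 0 <= T by move: tT; rewrite in_itv/= => /andP[]; exact: le_trans.
set l := 2 * K + 1; have l0 : 0 < l by rewrite /l; lra.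
have [s0 s0T hs0] : exists2 s0, s0 \in `[0, T] & forall t, t \in `[0, T] ->
    g t * expR (- (l * t)) <= g s0 * expR (- (l * s0)).
  apply: (@EVT_max _ (fun t => g t * expR (- (l * t)))) => //.
  apply/subspace_continuousP => x xT.
  apply: cvgM; first by move/subspace_continuousP : cg; apply.
  apply: cvg_within_filter; move: x {xT}.
  suff : continuous (fun t => expR (- (l * t))) by [].
  move=> x.
  apply: (@continuous_comp _ _ _ (fun t => - (l * t)) expR).
    by apply: continuousN; apply: mulrl_continuous.
  exact: continuous_expR.
set m := g s0 * expR (- (l * s0)) in hs0.
have m0 : 0 <= m by rewrite mulr_ge0 ?expR_ge0// g0.
have gm s : s \in `[0, T] -> g s <= m * expR (l * s).
  by move=> /hs0; rewrite expRN ler_pdivrMr// expR_gt0.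
have s00 : 0 <= s0 by move: s0T; rewrite in_itv/= => /andP[].
have sub s : s \in `[0, s0] -> s \in `[0, T].
  by move: s0T; rewrite !in_itv/=; lra.
have key : g s0 <= c + m / 2 * expR (l * s0).
  rewrite -lee_fin; apply: le_trans (hg _ s0T) _.
  rewrite EFinD leeD2l//.
  apply: (@le_trans _ _ (\int[lebesgue_measure]_(s in `[0%R, s0]) ((K * m)%:E * (expR (l * s))%:E))%E).
    apply: ge0_le_integral => //.
    - by move=> s /= /sub sT; rewrite lee_fin mulr_ge0// g0.
    - apply/measurable_EFinP; apply: measurable_funM => //.
      apply: subspace_continuous_measurable_fun => //.
      by apply: continuous_subspaceW cg => s /= /sub.
    - by apply/measurable_EFinP; apply: measurable_funM => //; exact: measurable_expRM.
    - move=> s /= /sub sT; rewrite -EFinM lee_fin -mulrA ler_wpM2l//.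
      exact: gm.
  rewrite ge0_integralZl//; last 2 first.
  - by apply/measurable_EFinP; exact: measurable_expRM.
  - by rewrite lee_fin mulr_ge0.
  apply: le_trans (lee_wpmul2l _ (integral_expR_le l0 s00)) _.
    by rewrite lee_fin mulr_ge0.
  rewrite -EFinM lee_fin mulrA mulrAC ler_wpM2r ?expR_ge0//.
  rewrite ler_pdivrMr// /l mulrC ; nra.
have : m <= c + m / 2.
  have e1 : expR (l * s0) * expR (- (l * s0)) = 1 by rewrite expRN divff// gt_eqF// expR_gt0.
  apply: le_trans (ler_wpM2r (expR_ge0 (- (l * s0))) key) _.
  rewrite mulrDl -[X in _ + X <= _]mulrA e1 mulr1 lerD2r ler_piMr// expRN invf_le1 ?expR_gt0//.
  by rewrite -expR0 ler_expR mulr_ge0// ltW.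
move=> mc; apply: le_trans (gm _ tT) _.
apply: (@le_trans _ _ (2 * c * expR (l * t))).
  by rewrite ler_wpM2r ?expR_ge0//; lra.
rewrite ler_wpM2l ?mulr_ge0// ler_expR ler_pM2l//.
by move: tT; rewrite in_itv/= => /andP[].
Qed.

End small_sequences.

(** * Complete seminorms *)

Section seminorm.
Context {R : realType} {V : lmodType R}.

(** The states form a Banach space only inside the set [C] and modulo the
    vectors of seminorm 0: in what follows the equality of two vectors is
    replaced by the vanishing of the seminorm of their difference. *)
Record complete_seminorm (C : set V) (N : V -> R) : Prop := CompleteSeminorm {
  cs_lin : forall (a : R) u v, C u -> C v -> C (a *: u + v) ;
  cs_zero : C 0 ;
  cs_ge0 : forall u, 0 <= N u ;
  cs_scale : forall (a : R) u, C u -> N (a *: u) = `|a| * N u ;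
  cs_triangle : forall u v, C u -> C v -> N (u + v) <= N u + N v ;
  cs_complete : forall u_ : nat -> V, (forall n, C (u_ n)) ->
    (forall e, 0 < e -> exists n0, forall m n, (n0 <= m)%N -> (n0 <= n)%N ->
       N (u_ m - u_ n) <= e) ->
    exists2 u, C u & forall e, 0 < e -> exists n0, forall n, (n0 <= n)%N ->
       N (u_ n - u) <= e }.

Variables (C : set V) (N : V -> R).
Hypothesis csN : complete_seminorm C N.
Implicit Types (u v w : V) (a : R).

Lemma csD u v : C u -> C v -> C (u + v).
Proof. by move=> Cu Cv; rewrite -[u]scale1r; apply: (cs_lin csN). Qed.

Lemma csZ a u : C u -> C (a *: u).
Proof. by move=> Cu; rewrite -[_ *: _]addr0; apply/(cs_lin csN)/(cs_zero csN). Qed.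

Lemma cs0 : C 0. Proof. exact: cs_zero csN. Qed.

Lemma csNN u : C u -> C (- u).
Proof. by move=> Cu; rewrite -scaleN1r; exact: csZ. Qed.

Lemma csB u v : C u -> C v -> C (u - v).
Proof. by move=> Cu Cv; apply/csD/csNN. Qed.

Hint Resolve csD csZ cs0 csNN csB : cspace.
Local Ltac cc := auto 10 with cspace.

Lemma sn_ge0 u : 0 <= N u. Proof. exact: cs_ge0 csN u. Qed.

Lemma sn0 : N 0 = 0.
Proof. by rewrite -(scale0r (0 : V)) (cs_scale csN) ?normr0 ?mul0r //; cc. Qed.

Lemma snN u : C u -> N (- u) = N u.
Proof. by move=> Cu; rewrite -scaleN1r (cs_scale csN)// normrN1 mul1r. Qed.

Lemma snC u v : C u -> C v -> N (u - v) = N (v - u).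
Proof. by move=> Cu Cv; rewrite -snN ?opprB//; cc. Qed.

Lemma snD u v : C u -> C v -> N (u + v) <= N u + N v.
Proof. exact: cs_triangle csN u v. Qed.

Lemma snB u v : C u -> C v -> N (u - v) <= N u + N v.
Proof. by move=> Cu Cv; rewrite -(snN Cv); apply: snD; cc. Qed.

Lemma sn_dist v u w : C u -> C v -> C w -> N (u - w) <= N (u - v) + N (v - w).
Proof. by move=> Cu Cv Cw; rewrite -[u - w](subrKA v) snD//; cc. Qed.

Lemma sn_le u v : C u -> C v -> N u <= N v + N (u - v).
Proof. by move=> Cu Cv; rewrite -{1}[u](subrKC v); apply: snD; cc. Qed.

Lemma sn_diff u v : C u -> C v -> `|N u - N v| <= N (u - v).
Proof.
move=> Cu Cv; have h1 := sn_le Cu Cv; have h2 := sn_le Cv Cu.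
by rewrite snC// in h2; rewrite ler_norml; apply/andP; split; lra.
Qed.

Lemma sn_eq u v : C u -> C v -> N (u - v) = 0 -> N u = N v.
Proof.
by move=> Cu Cv uv; have := sn_diff Cu Cv; rewrite uv normr_le0 subr_eq0 => /eqP.
Qed.

Lemma sn_eq_sub u v u' v' : C u -> C v -> C u' -> C v' ->
  N (u - u') = 0 -> N (v - v') = 0 -> N (u - v) = N (u' - v').
Proof.
move=> Cu Cv Cu' Cv' uu vv; apply: sn_eq; cc.
apply/eqP; rewrite eq_le sn_ge0 andbT.
rewrite (_ : u - v - (u' - v') = (u - u') - (v - v')); last first.
  by rewrite !opprB [v' - u']addrC addrACA [- v + _]addrC.
by rewrite (le_trans (snB _ _)) ?uu ?vv ?addr0//; cc.
Qed.

Lemma sn_eq_trans v u w : C u -> C v -> C w ->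
  N (u - v) = 0 -> N (v - w) = 0 -> N (u - w) = 0.
Proof.
move=> Cu Cv Cw uv vw; apply/eqP; rewrite eq_le sn_ge0 andbT.
by rewrite (le_trans (sn_dist (v := v) _ _ _))// uv vw addr0.
Qed.

(** * Simple functions *)

Notation leb := (@lebesgue_measure R).

Lemma simple_eval_nil x : simple_eval (@nil (set R * V)) x = 0.
Proof. exact: big_nil. Qed.

Lemma simple_eval_cons p (s : seq (set R * V)) x :
  simple_eval (p :: s) x = \1_(p.1) x *: p.2 + simple_eval s x.
Proof. exact: big_cons. Qed.

Lemma simple_eval_cat (s1 s2 : seq (set R * V)) x :
  simple_eval (s1 ++ s2) x = simple_eval s1 x + simple_eval s2 x.
Proof. exact: big_cat. Qed.

Lemma simple_integral_cat (s1 s2 : seq (set R * V)) :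
  simple_integral (s1 ++ s2) = simple_integral s1 + simple_integral s2.
Proof. exact: big_cat. Qed.

Lemma simple_on_cons D p (s : seq (set R * V)) :
  simple_on C D (p :: s) <->
  [/\ measurable p.1, p.1 `<=` D & C p.2] /\ simple_on C D s.
Proof.
split=> [h|[h1 h2] q]; last by rewrite inE => /predU1P[->|/h2].
split=> [|q qs]; first by apply: h; rewrite mem_head.
by apply: h; rewrite inE qs orbT.
Qed.

Lemma simple_on_cat D (s1 s2 : seq (set R * V)) :
  simple_on C D s1 -> simple_on C D s2 -> simple_on C D (s1 ++ s2).
Proof. by move=> h1 h2 p; rewrite mem_cat => /orP[/h1|/h2]. Qed.

Lemma simple_on_sub D D' (s : seq (set R * V)) :
  D `<=` D' -> simple_on C D s -> simple_on C D' s.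
Proof. by move=> DD' h p /h[? pD ?]; split => //; exact: subset_trans DD'. Qed.

Lemma simple_eval_C D (s : seq (set R * V)) x :
  simple_on C D s -> C (simple_eval s x).
Proof.
elim: s => [|p s ih]; first by rewrite simple_eval_nil; cc.
by move=> /simple_on_cons[[_ _ Cp] /ih Cs]; rewrite simple_eval_cons; cc.
Qed.

Lemma simple_integral_C D (s : seq (set R * V)) :
  simple_on C D s -> C (simple_integral s).
Proof.
elim: s => [|p s ih]; first by rewrite /simple_integral big_nil; cc.
move=> /simple_on_cons[[_ _ Cp] /ih Cs]; rewrite /simple_integral big_cons.
by apply: csD; cc.
Qed.

Lemma simple_eval_out D (s : seq (set R * V)) x :
  simple_on C D s -> ~ D x -> simple_eval s x = 0.
Proof.
move=> + Dx; elim: s => [|p s ih]; first by rewrite simple_eval_nil.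
move=> /simple_on_cons[[_ pD _] /ih Cs]; rewrite simple_eval_cons Cs addr0.
by rewrite indicE memNset ?scale0r// => /pD.
Qed.

Definition simple_opp (s : seq (set R * V)) := [seq (p.1, - p.2) | p <- s].

Lemma simple_on_opp D s : simple_on C D s -> simple_on C D (simple_opp s).
Proof. by move=> h p /mapP[q /h[? ? ?] ->]; split => //=; cc. Qed.

Lemma simple_eval_opp s x : simple_eval (simple_opp s) x = - simple_eval s x.
Proof.
rewrite /simple_eval big_map -sumrN.
by apply: eq_bigr => p _; rewrite scalerN.
Qed.

Lemma simple_integral_opp s : simple_integral (simple_opp s) = - simple_integral s.
Proof.
rewrite /simple_integral big_map -sumrN.
by apply: eq_bigr => p _; rewrite scalerN.
Qed.

(** Cutting [E] along the first set of the list leaves on both pieces a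
    function of the same form with a shorter list, the value on that set being
    added to [w]. *)
Lemma measurable_simple_norm D s w (E : set R) : measurable E ->
  simple_on C D s -> C w -> measurable_fun E (fun x => N (w + simple_eval s x)).
Proof.
move=> mE; elim: s w => [|p s ih] w hs Cw.
  under eq_fun do rewrite simple_eval_nil addr0.
  exact: measurable_cst.
move: hs => /simple_on_cons[[mp pD Cp] hs].
rewrite -(setUIDK E p.1); apply/measurable_funU.
- exact: measurableI.
- exact: measurableD.
split.
  apply: (@eq_measurable_fun _ _ _ _ _ (fun x => N (w + p.2 + simple_eval s x))).
    move=> x; rewrite inE => -[_ px].
    by rewrite simple_eval_cons indicE mem_set// scale1r addrA.
  by apply: measurable_funS (ih _ hs (csD Cw Cp)) => //; exact: subIsetl.
apply: (@eq_measurable_fun _ _ _ _ _ (fun x => N (w + simple_eval s x))).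
  move=> x; rewrite inE => -[_ px].
  by rewrite simple_eval_cons indicE memNset// scale0r add0r.
by apply: measurable_funS (ih _ hs Cw) => //; exact: subDsetl.
Qed.

(** The sets of the list may overlap, so that the triangle inequality cannot
    be applied term by term. Cutting [E] along the first set leaves on both
    pieces the same inequality for a shorter list. *)
Lemma simple_integral_norm_aux D s E w : measurable E -> (leb E < +oo)%E ->
  simple_on C D s -> C w ->
  ((N (fine (leb E) *: w + \sum_(p <- s) fine (leb (p.1 `&` E)) *: p.2))%:E <=
   \int[leb]_(x in E) (N (w + simple_eval s x))%:E)%E.
Proof.
elim: s E w => [|p s ih] E w mE fE.
  move=> _ Cw; rewrite big_nil addr0.
  under eq_integral do rewrite simple_eval_nil addr0.
  rewrite integral_cst// (cs_scale csN)// ger0_norm ?fine_ge0//.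
  by rewrite EFinM fineK 1?muleC// ge0_fin_numE.
move=> hps Cw; have /simple_on_cons[[mp pD Cp] hs] := hps.
have mE1 : measurable (E `&` p.1) by exact: measurableI.
have mE2 : measurable (E `\` p.1) by exact: measurableD.
have fE1 : (leb (E `&` p.1) < +oo)%E.
  by apply: le_lt_trans fE; rewrite le_measure ?inE//; exact: subIsetl.
have fE2 : (leb (E `\` p.1) < +oo)%E.
  by apply: le_lt_trans fE; rewrite le_measure ?inE//; exact: subDsetl.
have E12 : E = (E `&` p.1) `|` (E `\` p.1) by rewrite setUIDK.
have dis : [disjoint E `&` p.1 & E `\` p.1].
  by apply/disj_setPS => x [[_ px] [_ npx]].
have mS A : measurable A -> fine (leb (A `&` E)) =
    fine (leb (A `&` (E `&` p.1))) + fine (leb (A `&` (E `\` p.1))).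
  move=> mA; have mAE := measurableI _ _ mA mE.
  have fA B : B `<=` E -> measurable B -> leb (A `&` B) \is a fin_num.
    move=> BE mB; rewrite ge0_fin_numE//; apply: le_lt_trans fE.
    by rewrite le_measure ?inE//; [exact: measurableI|move=> x [_ /BE]].
  rewrite {1}E12 setIUr measureU//; [|exact: measurableI..|].
    by rewrite fineD ?fA//.
  by apply/seteqP; split => // x [[_ [_ px]] [_ [_ npx]]].
have i1 := ih _ (w + p.2) mE1 fE1 hs (csD Cw Cp).
have i2 := ih _ w mE2 fE2 hs Cw.
have e1 x : (E `&` p.1) x ->
    N (w + simple_eval (p :: s) x) = N (w + p.2 + simple_eval s x).
  by move=> [_ px]; rewrite simple_eval_cons indicE mem_set// scale1r addrA.
have e2 x : (E `\` p.1) x ->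
    N (w + simple_eval (p :: s) x) = N (w + simple_eval s x).
  by move=> [_ px]; rewrite simple_eval_cons indicE memNset// scale0r add0r.
have mtot := measurable_simple_norm mE hps Cw.
rewrite [in leRHS]E12 ge0_integral_setU//; last 2 first.
- by rewrite -E12; apply/measurable_EFinP.
- by move=> x _; rewrite lee_fin sn_ge0.
have -> : fine (leb E) *: w + \sum_(q <- p :: s) fine (leb (q.1 `&` E)) *: q.2 =
   (fine (leb (E `&` p.1)) *: (w + p.2) +
      \sum_(q <- s) fine (leb (q.1 `&` (E `&` p.1))) *: q.2) +
   (fine (leb (E `\` p.1)) *: w +
      \sum_(q <- s) fine (leb (q.1 `&` (E `\` p.1))) *: q.2).
  rewrite big_cons [p.1 `&` E]setIC.
  have -> : fine (leb E) = fine (leb (E `&` p.1)) + fine (leb (E `\` p.1)).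
    by have := mS setT measurableT; rewrite !setTI.
  have -> : \sum_(q <- s) fine (leb (q.1 `&` E)) *: q.2 =
     \sum_(q <- s) fine (leb (q.1 `&` (E `&` p.1))) *: q.2 +
     \sum_(q <- s) fine (leb (q.1 `&` (E `\` p.1))) *: q.2.
    rewrite -big_split/=; apply: eq_big_seq => q qs.
    by rewrite mS ?scalerDl//; have [] := hs _ qs.
  rewrite scalerDl scalerDr !addrA; congr (_ + _).
  rewrite -!addrA; congr (_ + _).
  rewrite addrCA; congr (_ + _).
  by rewrite addrC.
apply: (@le_trans _ _ ((N (fine (leb (E `&` p.1)) *: (w + p.2) +
      \sum_(q <- s) fine (leb (q.1 `&` (E `&` p.1))) *: q.2))%:E +
   (N (fine (leb (E `\` p.1)) *: w +
      \sum_(q <- s) fine (leb (q.1 `&` (E `\` p.1))) *: q.2))%:E)%E).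
  have Cs A : C (\sum_(q <- s) fine (leb (q.1 `&` A)) *: q.2).
    rewrite big_seq; elim/big_ind: _ => //; cc => q qs.
    by apply: csZ; have [] := hs _ qs.
  by rewrite -EFinD lee_fin snD//; cc.
apply: leeD.
- apply: (le_trans i1); rewrite le_eqVlt; apply/orP; left; apply/eqP.
  by apply: eq_integral => x; rewrite inE => /e1 ->.
- apply: (le_trans i2); rewrite le_eqVlt; apply/orP; left; apply/eqP.
  by apply: eq_integral => x; rewrite inE => /e2 ->.
Qed.

Lemma simple_integral_norm D s : measurable D -> (leb D < +oo)%E ->
  simple_on C D s ->
  ((N (simple_integral s))%:E <= \int[leb]_(x in D) (N (simple_eval s x))%:E)%E.
Proof.
move=> mD fD hs.
have := simple_integral_norm_aux mD fD hs cs0.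
under eq_integral do rewrite add0r.
rewrite scaler0 add0r; apply: le_trans.
rewrite lee_fin le_eqVlt; apply/orP; left; apply/eqP; congr N.
apply: eq_big_seq => p /hs[_ pD _]; congr (fine (leb _) *: _).
by apply/esym/setIidl.
Qed.


(** * Integrals of uniform limits of simple functions *)

(** Uniform approximation replaces the measurability clause of the Bochner
    integral, which is not stable under bounded operators. *)
Definition reg_int (D : set R) (F : R -> V) (I : V) : Prop :=
  forall e, 0 < e -> exists s, [/\ simple_on C D s,
    forall x, D x -> N (F x - simple_eval s x) <= e &
    N (simple_integral s - I) <= e].

Definition regulated (D : set R) (F : R -> V) : Prop :=
  forall e, 0 < e -> exists2 s, simple_on C D s &
    forall x, D x -> N (F x - simple_eval s x) <= e.

Lemma measurable_simple_dist D s1 s2 (E : set R) : measurable E ->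
  simple_on C D s1 -> simple_on C D s2 ->
  measurable_fun E (fun x => N (simple_eval s1 x - simple_eval s2 x)).
Proof.
move=> mE h1 h2.
have h := simple_on_cat h1 (simple_on_opp h2).
apply: eq_measurable_fun (measurable_simple_norm mE h cs0) => x _.
by rewrite add0r simple_eval_cat simple_eval_opp.
Qed.

Lemma simple_integral_dist D s1 s2 : measurable D -> (leb D < +oo)%E ->
  simple_on C D s1 -> simple_on C D s2 ->
  ((N (simple_integral s1 - simple_integral s2))%:E <=
   \int[leb]_(x in D) (N (simple_eval s1 x - simple_eval s2 x))%:E)%E.
Proof.
move=> mD fD h1 h2.
have := simple_integral_norm mD fD (simple_on_cat h1 (simple_on_opp h2)).
rewrite simple_integral_cat simple_integral_opp => /le_trans; apply.
rewrite le_eqVlt; apply/orP; left; apply/eqP; apply: eq_integral => x _.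
by rewrite simple_eval_cat simple_eval_opp.
Qed.

Lemma int_le_cst D (f : R -> R) e : measurable D -> (leb D < +oo)%E ->
  measurable_fun D f -> (forall x, D x -> 0 <= f x <= e) ->
  (\int[leb]_(x in D) (f x)%:E <= (e * fine (leb D))%:E)%E.
Proof.
move=> mD fD mf h.
rewrite EFinM fineK ?ge0_fin_numE// -integral_cst//.
apply: ge0_le_integral => //.
- by move=> x /h/andP[].
- exact/measurable_EFinP.
- by move=> x /h/andP[_]; rewrite lee_fin.
Qed.

(** The measurability of N(F - s_n) comes from that of N(s_m - s_n), of which
    it is the limit as m tends to infinity. *)
Lemma reg_int_bochner D F I : measurable D -> (leb D < +oo)%E ->
  (forall x, D x -> C (F x)) -> reg_int D F I ->
  is_bochner_integral C N D F I.
Proof.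
move=> mD fD CF h.
have /choice[s hs] : forall n : nat, exists s, [/\ simple_on C D s,
    forall x, D x -> N (F x - simple_eval s x) <= n.+1%:R^-1 &
    N (simple_integral s - I) <= n.+1%:R^-1] by move=> n; apply: h.
have mes n : measurable_fun D (fun x => N (F x - simple_eval (s n) x)).
  apply: (@measurable_fun_cvg _ _ _ _
    (fun m x => N (simple_eval (s m) x - simple_eval (s n) x))).
    move=> m; have [hm _ _] := hs m; have [hn _ _] := hs n.
    exact: measurable_simple_dist hm hn.
  move=> x Dx; apply/cvgrPdist_le => e e0.
  have [n0 hn0] := inv_nat_small e0.
  exists n0 => // m /= /hn0; have [hm Fm _] := hs m; have [hn _ _] := hs n.
  apply: le_trans; apply: le_trans (Fm _ Dx).
  have Cm := simple_eval_C x hm; have Cn := simple_eval_C x hn.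
  have CFx := CF _ Dx.
  apply: le_trans (sn_diff _ _) _; cc.
  by rewrite opprB addrA subrK.
exists s; split=> //.
- by move=> n; have [] := hs n.
- apply: (@squeeze_cvge _ _ _ _ (cst 0%E) _
     (fun n => ((n.+1%:R^-1 * fine (leb D))%:E))).
  + near=> n; apply/andP; split.
      by apply: integral_ge0 => x _; rewrite lee_fin sn_ge0.
    apply: int_le_cst => // x Dx; rewrite sn_ge0/=.
    by have [_ ? _] := hs n; auto.
  + exact: cvg_cst.
  + apply: cvg_EFin; first by near=> n.
    rewrite -(mul0r (fine (leb D))); apply: cvgMl.
    apply/cvg0_eps; last exact: inv_nat_small.
    by move=> n; rewrite invr_ge0.
- apply/cvg0_eps => [n|e e0]; first exact: sn_ge0.
  have [n0 hn0] := inv_nat_small e0; exists n0 => n /hn0; apply: le_trans.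
  by have [] := hs n.
Unshelve. all: by end_near. Qed.

(** Approximants s_n of F and t_n of F' satisfy the inequality with
    h + N(F - s_n) + N(F' - t_n) in place of h, and the integrals of the last
    two terms tend to 0. *)
Lemma bochner_dist D F I F' I' (h : R -> R) :
  measurable D -> (leb D < +oo)%E ->
  (forall x, D x -> C (F x)) -> (forall x, D x -> C (F' x)) -> C I -> C I' ->
  is_bochner_integral C N D F I -> is_bochner_integral C N D F' I' ->
  measurable_fun D h ->
  (forall x, D x -> N (F x - F' x) <= h x) ->
  ((N (I - I'))%:E <= \int[leb]_(x in D) (h x)%:E)%E.
Proof.
move=> mD fD CF CF' CI CI' [s [hs ms is' es]] [t [ht mt it et]] mh Fh.
have h0 x : D x -> 0 <= h x by move=> /Fh; apply: le_trans; exact: sn_ge0.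
apply/lee_addgt0Pr => e e0.
have e40 : 0 < e / 4 by rewrite divr_gt0.
move/fine_cvgP : is' => [f1 /cvgrPdist_le /(_ _ e40) c1].
move/fine_cvgP : it => [f2 /cvgrPdist_le /(_ _ e40) c2].
move/cvgrPdist_le : es => /(_ _ e40) c3.
move/cvgrPdist_le : et => /(_ _ e40) c4.
near \oo => n.
have f1n : (\int[leb]_(x in D) (N (F x - simple_eval (s n) x))%:E <= (e / 4)%:E)%E.
  rewrite -[leLHS]fineK; last by near: n.
  rewrite lee_fin; apply: le_trans (ler_norm _) _; rewrite -normrN -sub0r.
  by near: n; exact: c1.
have f2n : (\int[leb]_(x in D) (N (F' x - simple_eval (t n) x))%:E <= (e / 4)%:E)%E.
  rewrite -[leLHS]fineK; last by near: n.
  rewrite lee_fin; apply: le_trans (ler_norm _) _; rewrite -normrN -sub0r.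
  by near: n; exact: c2.
have c3n : N (simple_integral (s n) - I) <= e / 4.
  apply: le_trans (ler_norm _) _; rewrite -normrN -sub0r.
  by near: n.
have c4n : N (simple_integral (t n) - I') <= e / 4.
  apply: le_trans (ler_norm _) _; rewrite -normrN -sub0r.
  by near: n.
have Cs := simple_integral_C (hs n); have Ct := simple_integral_C (ht n).
have st : ((N (simple_integral (s n) - simple_integral (t n)))%:E <=
    \int[leb]_(x in D) (h x)%:E + (e / 4)%:E + (e / 4)%:E)%E.
  apply: le_trans (simple_integral_dist mD fD (hs n) (ht n)) _.
  apply: (@le_trans _ _ (\int[leb]_(x in D) ((h x)%:E +
     (N (F x - simple_eval (s n) x))%:E + (N (F' x - simple_eval (t n) x))%:E))%E).
    apply: ge0_le_integral => //.
    - by move=> x _; rewrite lee_fin sn_ge0.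
    - apply/measurable_EFinP; exact: measurable_simple_dist (hs n) (ht n).
    - apply: emeasurable_funD; last by apply/measurable_EFinP; exact: mt.
      by apply: emeasurable_funD; apply/measurable_EFinP; [exact: mh|exact: ms].
    - move=> x Dx; rewrite -!EFinD lee_fin.
      have Csx := simple_eval_C x (hs n); have Ctx := simple_eval_C x (ht n).
      have CFx := CF _ Dx; have CFx' := CF' _ Dx.
      have k1 := sn_dist Csx CFx Ctx; have k2 := sn_dist CFx CFx' Ctx.
      by have k3 := Fh _ Dx; rewrite (snC Csx CFx) in k1; lra.
  rewrite ge0_integralD//; last 4 first.
  - by move=> x Dx; rewrite adde_ge0// lee_fin ?sn_ge0//; exact: h0.
  - by apply: emeasurable_funD; apply/measurable_EFinP; [exact: mh|exact: ms].
  - by move=> x Dx; rewrite lee_fin sn_ge0.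
  - by apply/measurable_EFinP; exact: mt.
  rewrite ge0_integralD//; last 3 first.
  - by apply/measurable_EFinP; exact: mh.
  - by move=> x Dx; rewrite lee_fin sn_ge0.
  - by apply/measurable_EFinP; exact: ms.
  by apply: leeD => //; apply: leeD.
have : (\int[leb]_(x in D) (h x)%:E \is a fin_num \/ \int[leb]_(x in D) (h x)%:E = +oo)%E.
  have : (0 <= \int[leb]_(x in D) (h x)%:E)%E.
    by apply: integral_ge0 => x Dx; rewrite lee_fin h0.
  by case: (\int[leb]_(x in D) (h x)%:E)%E => //=; [left|right].
case=> [hf|->]; last by rewrite leey.
move: st; rewrite -(fineK hf) -!EFinD !lee_fin => st.
apply: le_trans (sn_dist (v := simple_integral (s n)) _ _ _) _ => //.
rewrite snC//.
have := sn_dist CI' Ct Cs; rewrite snC// => st2.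
have := sn_dist Cs Ct CI'.
by lra.
Unshelve. all: by end_near. Qed.

(** The integrals of the approximants form a Cauchy sequence because [D] has
    finite measure. *)
Lemma reg_int_exists D F : measurable D -> (leb D < +oo)%E ->
  (forall x, D x -> C (F x)) -> regulated D F ->
  exists2 I, C I & reg_int D F I.
Proof.
move=> mD fD CF rF.
have /choice[s hs] : forall n : nat, exists s, simple_on C D s /\
    forall x, D x -> N (F x - simple_eval s x) <= n.+1%:R^-1.
  by move=> n; have [|s ? ?] := rF n.+1%:R^-1 _; [rewrite invr_gt0|exists s].
pose I_ n := simple_integral (s n).
have CI n : C (I_ n) by have [h _] := hs n; exact: simple_integral_C h.
pose m := fine (leb D).
have m0 : 0 <= m by rewrite fine_ge0.
have dI k n : N (I_ k - I_ n) <= (k.+1%:R^-1 + n.+1%:R^-1) * m.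
  have [hk Fk] := hs k; have [hn Fn] := hs n.
  rewrite -lee_fin; apply: le_trans (simple_integral_dist mD fD hk hn) _.
  apply: int_le_cst => //; first exact: measurable_simple_dist hk hn.
  move=> x Dx; rewrite sn_ge0/=.
  have Ck := simple_eval_C x hk; have Cn := simple_eval_C x hn.
  have CFx := CF _ Dx.
  apply: le_trans (sn_dist (v := F x) _ _ _) _ => //.
  by rewrite snC// lerD//; [exact: Fk|exact: Fn].
have [I CI' hI] : exists2 u, C u & forall e, 0 < e ->
    exists n0, forall n, (n0 <= n)%N -> N (I_ n - u) <= e.
  apply: (cs_complete csN) => // e e0.
  have e1 : 0 < e / 2 / (m + 1) by rewrite !divr_gt0// ltr_wpDl.
  have [n0 hn0] := inv_nat_small e1; exists n0 => k n /hn0 hk /hn0 hn.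
  apply: le_trans (dI k n) _.
  apply: (@le_trans _ _ ((e / 2 / (m + 1) + e / 2 / (m + 1)) * m)).
    by rewrite ler_wpM2r// lerD.
  set q := e / 2 / (m + 1) in e1 *.
  have : q * (m + 1) = e / 2 by rewrite divfK// gt_eqF// ltr_wpDl.
  by rewrite mulrDl mulrDr mulr1; lra.
exists I => // e e0.
have [n1 hn1] := inv_nat_small e0; have [n2 hn2] := hI _ e0.
exists (s (maxn n1 n2)); have [h1 h2] := hs (maxn n1 n2); split => //.
  by move=> x Dx; apply: le_trans (h2 _ Dx) _; apply/hn1/leq_maxl.
exact/hn2/leq_maxr.
Qed.

Lemma reg_int_unique D F I I' : measurable D -> (leb D < +oo)%E ->
  (forall x, D x -> C (F x)) -> C I -> C I' ->
  reg_int D F I -> reg_int D F I' -> N (I - I') = 0.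
Proof.
move=> mD fD CF CI CI' /(reg_int_bochner mD fD CF) b /(reg_int_bochner mD fD CF) b'.
apply/eqP; rewrite eq_le sn_ge0 andbT -lee_fin.
have := bochner_dist (h := cst 0) mD fD CF CF CI CI' b b' _ _.
rewrite integral0; apply => // x Dx.
by rewrite subrr sn0.
Qed.

Lemma reg_int_congr D F I F' I' : (forall x, D x -> C (F x)) ->
  (forall x, D x -> C (F' x)) -> C I -> C I' ->
  (forall x, D x -> N (F x - F' x) = 0) -> N (I - I') = 0 ->
  reg_int D F I -> reg_int D F' I'.
Proof.
move=> CF CF' CI CI' FF II h e /h[s [hs h1 h2]]; exists s; split => //.
  move=> x Dx; have Cs := simple_eval_C x hs.
  rewrite -(@sn_eq_sub (F x) (simple_eval s x)) ?subrr ?sn0//; auto.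
have Cs := simple_integral_C hs.
by rewrite -(@sn_eq_sub (simple_integral s) I) ?subrr ?sn0//; auto.
Qed.

Lemma reg_int_setU D1 D2 F I1 I2 : D1 `&` D2 = set0 ->
  (forall x, D1 x -> C (F x)) -> (forall x, D2 x -> C (F x)) ->
  C I1 -> C I2 ->
  reg_int D1 F I1 -> reg_int D2 F I2 -> reg_int (D1 `|` D2) F (I1 + I2).
Proof.
move=> D12 CF1 CF2 CI1 CI2 r1 r2 e e0.
have e20 : 0 < e / 2 by rewrite divr_gt0.
have ee : e / 2 <= e by lra.
have [s1 [h1 a1 b1]] := r1 _ e20; have [s2 [h2 a2 b2]] := r2 _ e20.
exists (s1 ++ s2); split.
- apply: simple_on_cat.
    by apply: simple_on_sub h1; exact: subsetUl.
  by apply: simple_on_sub h2; exact: subsetUr.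
- move=> x [D1x|D2x]; rewrite simple_eval_cat.
    rewrite (simple_eval_out h2) ?addr0; first by apply: le_trans ee; auto.
    by move=> D2x; have : (D1 `&` D2) x by []; rewrite D12.
  rewrite (simple_eval_out h1) ?add0r; first by apply: le_trans ee; auto.
  by move=> D1x; have : (D1 `&` D2) x by []; rewrite D12.
- have C1 := simple_integral_C h1; have C2 := simple_integral_C h2.
  rewrite simple_integral_cat opprD addrACA.
  apply: le_trans (snD _ _) _; cc.
  by lra.
Qed.

Lemma reg_int_null_subset D D' F I : measurable D' -> D' `<=` D ->
  leb (D `\` D') = 0%E -> measurable D ->
  reg_int D F I -> reg_int D' F I.
Proof.
move=> mD' DD' D0 mD r e /r[s [hs a b]].
exists [seq (p.1 `&` D', p.2) | p <- s]; split.
- move=> p /mapP[q /hs[? qD ?] ->]; split => //=; first exact: measurableI.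
- move=> x D'x; have := a _ (DD' _ D'x); congr (N (_ - _) <= _).
  rewrite /simple_eval big_map; apply: eq_bigr => p _ /=.
  congr (_ *: _); rewrite !indicE; congr (_%:R); congr nat_of_bool.
  by rewrite in_setI [x \in D']mem_set ?andbT.
- move: b; congr (N (_ - _) <= _).
  rewrite /simple_integral big_map; apply: eq_big_seq => p /hs[mp pD _] /=.
  have -> : leb p.1 = (leb (p.1 `\` D') + leb (p.1 `&` D'))%E.
    exact: (measureDI leb mp mD').
  rewrite (_ : leb (p.1 `\` D') = 0%E) ?add0e//.
  apply/eqP; rewrite eq_le measure_ge0 andbT -D0.
  by apply: le_measure; rewrite ?inE; [exact: measurableD..|exact: setSD].
Qed.


Lemma geometric_small (E e : R) : 0 < e -> exists n, E * 2^-1 ^+ n <= e.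
Proof.
move=> e0; have E1 : 0 < `|E| + 1 by rewrite ltr_wpDl.
have [n hn] := inv_nat_small (divr_gt0 e0 E1); exists n.
have := hn n (leqnn n); rewrite ler_pdivlMr// => {}hn.
have gn : 2^-1 ^+ n <= (n.+1%:R^-1 : R).
  rewrite exprVn lef_pV2 ?posrE ?exprn_gt0// -natrX ler_nat.
  exact: ltn_expl.
have g0 : 0 <= (2^-1 : R) ^+ n by rewrite exprn_ge0// invr_ge0.
apply: le_trans hn; apply: (@le_trans _ _ (`|E| * 2^-1 ^+ n)).
  by rewrite ler_wpM2r// ler_norm.
by rewrite mulrC; apply: ler_pM => //; rewrite lerDl.
Qed.

Lemma geometric_complete (u_ : nat -> V) E : (forall n, C (u_ n)) ->
  (forall n, N (u_ n.+1 - u_ n) <= E * 2^-1 ^+ n) ->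
  exists2 v, C v & forall n, N (u_ n - v) <= 2 * E * 2^-1 ^+ n.
Proof.
move=> Cu hu.
have E0 : 0 <= E by have := hu 0%N; rewrite expr0 mulr1; apply: le_trans; exact: sn_ge0.
have g0 n : 0 <= (2^-1 : R) ^+ n by rewrite exprn_ge0// invr_ge0.
have hk n k : N (u_ (k + n)%N - u_ n) <= 2 * E * 2^-1 ^+ n.
  apply: (@le_trans _ _ (E * 2^-1 ^+ n * (2 - 2 * 2^-1 ^+ k))).
    elim: k => [|k ih]; first by rewrite add0n subrr sn0 expr0 mulr1 subrr mulr0.
    rewrite addSn; apply: le_trans (sn_dist (v := u_ (k + n)%N) _ _ _) _ => //.
    have := hu (k + n)%N; rewrite exprD => h.
    apply: le_trans (lerD h ih) _; rewrite exprS le_eqVlt; apply/orP; left; apply/eqP.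
    by field.
  have h1 : 0 <= E * 2^-1 ^+ n by rewrite mulr_ge0.
  by have := mulr_ge0 h1 (g0 k); nra.
have [|v Cv hv] := cs_complete csN Cu.
  move=> e e0; have [n0 hn0] := @geometric_small (2 * E * 2) _ e0.
  exists n0 => m n m0 n00.
  rewrite -(subnK m0) -(subnK n00).
  apply: le_trans (sn_dist (v := u_ n0) _ _ _) _ => //.
  have := hk n0 (m - n0)%N; have := hk n0 (n - n0)%N; rewrite (snC (Cu (n - n0 + n0)%N))//.
  by lra.
exists v => // n; apply/ler_addgt0Pr => e e0.
have [n0 hn0] := hv _ e0.
apply: le_trans (sn_dist (v := u_ (n0 + n)%N) _ _ _) _ => //.
by rewrite snC// lerD// hn0// leq_addr.
Qed.

Definition simple_map (L : V -> V) (s : seq (set R * V)) := [seq (p.1, L p.2) | p <- s].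

Section bounded_operator.
Variable L : V -> V.
Hypothesis blL : bounded_linear_op C N L.

Lemma bl_C u : C u -> C (L u). Proof. by case: blL => + _ _; apply. Qed.

Hint Resolve bl_C : cspace.

Lemma bl_bound : exists2 M, 0 <= M & forall u, C u -> N (L u) <= M * N u.
Proof.
case: blL => _ _ [M hM]; exists `|M| => // u Cu; apply: le_trans (hM _ Cu) _.
by rewrite ler_wpM2r ?sn_ge0// ler_norm.
Qed.

Lemma bl_lin a u v : C u -> C v -> N (L (a *: u + v) - (a *: L u + L v)) = 0.
Proof. by case: blL => _ + _ => h Cu Cv; apply: h. Qed.

Lemma bl0 : N (L 0) = 0.
Proof.
have [M M0 h] := bl_bound; apply/eqP; rewrite eq_le sn_ge0 andbT.
by apply: le_trans (h _ cs0) _; rewrite sn0 mulr0.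
Qed.

Lemma bl_null u : C u -> N u = 0 -> N (L u) = 0.
Proof.
have [M M0 h] := bl_bound => Cu u0; apply/eqP; rewrite eq_le sn_ge0 andbT.
by apply: le_trans (h _ Cu) _; rewrite u0 mulr0.
Qed.

Lemma blZ a u : C u -> N (L (a *: u) - a *: L u) = 0.
Proof.
move=> Cu; have := bl_lin a Cu cs0; rewrite addr0 => h.
apply: sn_eq_trans h _; cc.
by rewrite addrAC subrr add0r bl0.
Qed.

Lemma blB u v : C u -> C v -> N (L (u - v) - (L u - L v)) = 0.
Proof.
move=> Cu Cv; have := bl_lin (-1) Cv Cu.
by rewrite !scaleN1r [- v + _]addrC [- L v + _]addrC.
Qed.

Lemma bl_distE u v : C u -> C v -> N (L u - L v) = N (L (u - v)).
Proof. by move=> Cu Cv; apply/esym/sn_eq; [cc..|exact: blB]. Qed.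

Lemma bl_eq u v : C u -> C v -> N (u - v) = 0 -> N (L u - L v) = 0.
Proof. by move=> Cu Cv uv; rewrite bl_distE// bl_null//; cc. Qed.

Lemma simple_map_on D s : simple_on C D s -> simple_on C D (simple_map L s).
Proof. by move=> h p /mapP[q /h[? ? ?] ->]; split => //=; cc. Qed.

Lemma simple_map_eval D s x : simple_on C D s ->
  N (L (simple_eval s x) - simple_eval (simple_map L s) x) = 0.
Proof.
elim: s => [_|p s ih hs]; first by rewrite !simple_eval_nil subr0 bl0.
have Cs := simple_eval_C x (simple_map_on hs).
move: hs Cs => /simple_on_cons[[_ _ Cp] hs]; rewrite /= !simple_eval_cons/= => Cs.
have C1 := simple_eval_C x hs; have C2 := simple_eval_C x (simple_map_on hs).
apply: (@sn_eq_trans (\1_(p.1) x *: L p.2 + L (simple_eval s x))); cc.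
  exact: bl_lin.
by rewrite opprD addrACA subrr add0r ih.
Qed.

Lemma simple_map_integral D s : simple_on C D s ->
  N (L (simple_integral s) - simple_integral (simple_map L s)) = 0.
Proof.
rewrite /simple_integral; elim: s => [_|p s ih hs]; first by rewrite !big_nil subr0 bl0.
have C2 := simple_integral_C (simple_map_on hs).
have C1 := simple_integral_C hs; move: C1 C2.
move: hs => /simple_on_cons[[_ _ Cp] hs]; rewrite /= /simple_integral !big_cons/= => _ _.
have C1 := simple_integral_C hs; have C2 := simple_integral_C (simple_map_on hs).
apply: (@sn_eq_trans (fine (leb p.1) *: L p.2 + L (simple_integral s))); cc.
  exact: bl_lin.
by rewrite opprD addrACA subrr add0r ih.
Qed.

(** A bounded operator is Lipschitz, hence preserves uniform approximation. *)
Lemma reg_int_map D F I : (forall x, D x -> C (F x)) -> C I ->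
  reg_int D F I -> reg_int D (L \o F) (L I).
Proof.
move=> CF CI r e e0; have [M M0 hM] := bl_bound.
have M1 : 0 < M + 1 by rewrite ltr_wpDl.
have [s [hs a b]] := r (e / (M + 1)) (divr_gt0 e0 M1).
have key u v w : C u -> C v -> C w -> N (L v - w) = 0 -> N (u - v) <= e / (M + 1) ->
    N (L u - w) <= e.
  move=> Cu Cv Cw vw uv.
  rewrite (@sn_eq_sub _ _ (L u) (L v)) ?subrr ?sn0 //; cc; last by rewrite snC//; cc.
  rewrite bl_distE//; apply: le_trans (hM _ _) _; cc.
  apply: le_trans (ler_wpM2l M0 uv) _.
  rewrite mulrCA ger_pMr// ler_pdivrMr// mul1r lerDl//.
exists (simple_map L s); split.
- exact: simple_map_on.
- move=> x Dx; apply: (key _ (simple_eval s x)); auto.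
  + exact: simple_eval_C hs.
  + exact: simple_eval_C (simple_map_on hs).
  + exact: simple_map_eval hs.
- have C1 := simple_integral_C hs; have C2 := simple_integral_C (simple_map_on hs).
  rewrite snC//; cc; apply: (key _ (simple_integral s)) => //.
  + exact: simple_map_integral hs.
  + by rewrite snC.
Qed.

End bounded_operator.

Lemma reg_int_shift a D F I : reg_int D F I ->
  reg_int [set x | D (x - a)] (fun x => F (x - a)) I.
Proof.
move=> r e /r[s [hs h1 h2]].
exists [seq ([set x | p.1 (x - a)], p.2) | p <- s]; split.
- move=> p /mapP[q /hs[mq qD Cq] ->]; split => //=; last by move=> x /qD.
  rewrite -[X in measurable X]setTI.
  have mf : measurable_fun setT (fun x : R => x - a) by exact: measurable_funB.
  exact: mf.
- move=> x Dx; apply: le_trans (h1 _ Dx); rewrite le_eqVlt; apply/orP; left.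
  apply/eqP; congr (N (_ - _)); rewrite /simple_eval big_map.
  by apply: eq_bigr => p _ /=; rewrite !indicE; congr (_%:R *: _); congr nat_of_bool;
    apply/idP/idP; rewrite !inE.
- apply: le_trans h2; rewrite le_eqVlt; apply/orP; left.
  apply/eqP; congr (N (_ - _)); rewrite /simple_integral big_map.
  by apply: eq_big_seq => p /hs[mp _ _] /=; rewrite lebesgue_shift.
Qed.

(** * Continuous paths are uniform limits of simple functions *)

Definition cont_on (a b : R) (F : R -> V) : Prop :=
  (forall x, x \in `[a, b] -> C (F x)) /\
  forall x, x \in `[a, b] -> forall e, 0 < e -> exists2 d, 0 < d &
    forall y, y \in `[a, b] -> `|y - x| < d -> N (F y - F x) <= e.

(** The value of the approximant at a point is that attached to the first set
    of the cover which contains the point. *)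
Lemma simple_of_cover (F : R -> V) e (l : seq (set R * V)) D : measurable D ->
  (forall p : set R * V, p \in l -> [/\ measurable p.1, C p.2 &
     forall x, D x -> p.1 x -> N (F x - p.2) <= e]) ->
  (forall x, D x -> exists2 p, p \in l & p.1 x) ->
  exists2 s, simple_on C D s & forall x, D x -> N (F x - simple_eval s x) <= e.
Proof.
elim: l D => [|p l ih] D mD hl hD.
  by exists [::] => // x /hD[].
have [mp Cp hp] := hl p (mem_head _ _).
have mDp : measurable (D `\` p.1) by exact: measurableD.
have [||s hs Fs] := ih (D `\` p.1) mDp.
- move=> q ql; have [|? ? h] := hl q; first by rewrite inE ql orbT.
  by split=> // x [Dx _]; exact: h.
- move=> x [Dx px]; have [q] := hD _ Dx.
  by rewrite inE => /predU1P[->|ql] qx //; exists q.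
exists ((D `&` p.1, p.2) :: s).
  apply/simple_on_cons; split; last by apply: simple_on_sub hs; exact: subDsetl.
  by split => //; [exact: measurableI|exact: subIsetl].
move=> x Dx; rewrite simple_eval_cons/= indicE.
have [px|px] := pselect (p.1 x).
  rewrite mem_set// scale1r (simple_eval_out hs) ?addr0; first exact: hp.
  by move=> [].
rewrite memNset; last by move=> [].
by rewrite scale0r add0r; exact: Fs.
Qed.

(** By compactness, finitely many of the balls on which F oscillates by at
    most e cover the segment. *)
Lemma cont_on_regulated a b F : cont_on a b F -> regulated `[a, b]%classic F.
Proof.
move=> [CF cF] e e0.
have /choice[d hd] : forall x, exists d, 0 < d /\ (x \in `[a, b] ->
    forall y, y \in `[a, b] -> `|y - x| < d -> N (F y - F x) <= e).
  move=> x; have [xab|_] := boolP (x \in `[a, b]); last by exists 1.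
  by have [d d0 h] := cF x xab e e0; exists d.
have : cover_compact (`[a, b]%classic : set R).
  by rewrite -compact_cover; exact: segment_compact.
move=> /(_ R `[a, b]%classic (fun x => ball x (d x))) [].
- by move=> x _; apply: ball_open; have [] := hd x.
- move=> x xab; exists x => //; apply: ballxx; have [] := hd x => //.
move=> D' D'ab cov.
apply: (@simple_of_cover F e [seq (ball x (d x), F x) | x <- finmap.enum_fset D']) => //.
- move=> p /mapP[x xD' ->] /=.
  have xab : x \in `[a, b] by have := D'ab _ xD'; rewrite inE.
  split; [exact: measurable_ball|exact: CF|].
  move=> y yab; rewrite /ball/= distrC => xy.
  by have [_] := hd x; apply.
- move=> x /cov[y yD' xy].
  by exists (ball y (d y), F y) => //; apply/mapP; exists y.
Qed.


Lemma cont_on_norm_sub a b F G : cont_on a b F -> cont_on a b G ->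
  {within `[a, b], continuous (fun t => N (F t - G t))}.
Proof.
move=> [CF cF] [CG cG]; apply: within_continuous_eps => x xab e e0.
have e20 : 0 < e / 2 by rewrite divr_gt0.
have [d1 d10 h1] := cF x xab _ e20; have [d2 d20 h2] := cG x xab _ e20.
exists (Num.min d1 d2); first by rewrite lt_min d10.
move=> y yab; rewrite lt_min => /andP[/(h1 _ yab) k1 /(h2 _ yab) k2].
have CFx := CF _ xab; have CFy := CF _ yab.
have CGx := CG _ xab; have CGy := CG _ yab.
apply: le_trans (sn_diff _ _) _; cc.
rewrite (_ : F y - G y - (F x - G x) = (F y - F x) - (G y - G x)); last first.
  by rewrite !opprB [G x - F x]addrC addrACA [- G y + _]addrC.
by apply: le_trans (snB _ _) _; cc; lra.
Qed.

Lemma cont_on_cst a b u : C u -> cont_on a b (fun=> u).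
Proof.
move=> Cu; split=> // x _ e e0; exists 1 => // y _ _.
by rewrite subrr sn0 ltW.
Qed.

Lemma cont_on_norm a b F : cont_on a b F ->
  {within `[a, b], continuous (fun t => N (F t))}.
Proof.
move=> cF; have := cont_on_norm_sub cF (cont_on_cst a b cs0).
rewrite (_ : (fun t => N (F t - 0)) = fun t => N (F t))//.
by apply/funext => t; rewrite subr0.
Qed.

Lemma cont_on_bounded a b F : a <= b -> cont_on a b F ->
  exists2 M, 0 <= M & forall t, t \in `[a, b] -> N (F t) <= M.
Proof.
move=> ab /cont_on_norm /(EVT_max ab)[c _ h].
by exists (N (F c)) => //; exact: sn_ge0.
Qed.

Lemma cont_on_glue a b c F G : a <= b <= c -> cont_on a b F -> cont_on b c G ->
  N (F b - G b) = 0 -> cont_on a c (fun s => if s < b then F s else G s).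
Proof.
move=> /andP[ab bc] [CF cF] [CG cG] FG; split.
  move=> x xac; case: ltP => xb; [apply: CF|apply: CG];
    by move: xac; rewrite !in_itv/=; lra.
move=> x xac e e0; case: (ltP x b) => xb.
  have xab : x \in `[a, b] by move: xac; rewrite !in_itv/=; lra.
  have [d d0 h] := cF x xab e e0.
  exists (Num.min d (b - x)); first by rewrite lt_min d0 subr_gt0.
  move=> y yac; rewrite lt_min => /andP[yx yb].
  have ybb : y < b by move: yb; rewrite ltr_norml; lra.
  by rewrite ybb; apply: h => //; move: yac; rewrite !in_itv/=; lra.
have xbc : x \in `[b, c] by move: xac; rewrite !in_itv/=; lra.
have [d d0 h] := cG x xbc e e0.
have [xbE|xbE] := eqVneq x b; last first.
  exists (Num.min d (x - b)); first by rewrite lt_min d0 subr_gt0 lt_neqAle eq_sym xbE.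
  move=> y yac; rewrite lt_min => /andP[yx yb].
  have ybb : (y < b) = false by apply/negbTE; move: yb; rewrite ltr_norml -leNgt; lra.
  rewrite ybb; apply: h => //; move: yac ybb; rewrite !in_itv/= => ? /negbT; rewrite -leNgt.
  lra.
subst x; have bab : b \in `[a, b] by rewrite in_itv/= ab lexx.
have [d2 d20 h2] := cF b bab e e0.
exists (Num.min d d2); first by rewrite lt_min d0.
move=> y yac; rewrite lt_min => /andP[y1 y2]; case: (ltP y b) => yb.
  have yab : y \in `[a, b] by move: yac; rewrite !in_itv/=; lra.
  rewrite -(@sn_eq_sub (F y) (F b)) ?subrr ?sn0//; try exact: CF; first exact: h2.
  by apply: CG; rewrite in_itv/= lexx bc.
by apply: h => //; move: yac; rewrite !in_itv/=; lra.
Qed.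

Lemma cont_on_shift a b c F : cont_on a b F ->
  cont_on (a + c) (b + c) (fun s => F (s - c)).
Proof.
move=> [CF cF]; split=> [x xab|x xab e e0].
  by apply: CF; move: xab; rewrite !in_itv/=; lra.
have xcab : x - c \in `[a, b] by move: xab; rewrite !in_itv/=; lra.
have [d d0 h] := cF _ xcab e e0; exists d => // y yab yx.
apply: h; first by move: yab; rewrite !in_itv/=; lra.
by rewrite opprB addrA subrK.
Qed.

Lemma lebesgue_itvcc_lty (a b : R) : (leb `[a, b]%classic < +oo)%E.
Proof. by rewrite lebesgue_measure_itv/=; case: ifP => // _; rewrite -EFinB ltry. Qed.

Hint Resolve lebesgue_itvcc_lty : core.

Lemma fine_lebesgue_itvcc (a b : R) : a <= b -> fine (leb `[a, b]%classic) = b - a.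
Proof.
rewrite lebesgue_measure_itv/= lte_fin le_eqVlt => /predU1P[->|->//].
by rewrite ltxx subrr.
Qed.

Lemma regulated_subset D D' F : measurable D' -> D' `<=` D ->
  regulated D F -> regulated D' F.
Proof.
move=> mD' DD' r e /r[s hs a].
exists [seq (p.1 `&` D', p.2) | p <- s].
  by move=> p /mapP[q /hs[? qD ?] ->]; split => //=; exact: measurableI.
move=> x D'x; have := a _ (DD' _ D'x); congr (N (_ - _) <= _).
rewrite /simple_eval big_map; apply: eq_bigr => p _ /=.
congr (_ *: _); rewrite !indicE; congr (_%:R); congr nat_of_bool.
by rewrite in_setI [x \in D']mem_set ?andbT.
Qed.

Lemma reg_int0 D : reg_int D (fun=> 0) 0.
Proof.
move=> e e0; exists [::]; split => //.
  by move=> x _; rewrite simple_eval_nil subrr sn0 ltW.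
by rewrite /simple_integral big_nil subrr sn0 ltW.
Qed.

Lemma reg_int_le D F I (h : R -> R) : measurable D -> (leb D < +oo)%E ->
  (forall x, D x -> C (F x)) -> C I -> reg_int D F I ->
  measurable_fun D h -> (forall x, D x -> N (F x) <= h x) ->
  ((N I)%:E <= \int[leb]_(x in D) (h x)%:E)%E.
Proof.
move=> mD fD CF CI rF mh Fh.
have C0 (x : R) : D x -> C 0 by move=> _; exact: cs0.
have := bochner_dist mD fD CF C0 CI cs0 (reg_int_bochner mD fD CF rF)
  (reg_int_bochner mD fD C0 (reg_int0 D)) mh.
by rewrite subr0; apply => x Dx; rewrite subr0; exact: Fh.
Qed.

Lemma reg_int_le_cst D F I M : measurable D -> (leb D < +oo)%E ->
  (forall x, D x -> C (F x)) -> C I -> reg_int D F I ->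
  (forall x, D x -> N (F x) <= M) -> N I <= M * fine (leb D).
Proof.
move=> mD fD CF CI rF FM; rewrite -lee_fin.
have := reg_int_le mD fD CF CI rF (@measurable_cst _ _ _ _ _ M) FM.
move=> /le_trans; apply.
by rewrite EFinM fineK ?ge0_fin_numE// -integral_cst.
Qed.

Lemma reg_int_set1 (a : R) F : C (F a) -> reg_int [set a] F 0.
Proof.
move=> CF e e0; exists [:: ([set a], F a)]; split.
- by move=> p; rewrite inE => /eqP ->; split => //=.
- move=> x ->; rewrite simple_eval_cons simple_eval_nil/= addr0 indicE.
  by rewrite mem_set// scale1r subrr sn0 ltW.
- by rewrite /simple_integral big_seq1/= lebesgue_measure_set1 scale0r subrr sn0 ltW.
Qed.

(** * Linear equations with bounded strongly continuous coefficients *)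

Section linear_ode.
Variables (T M : R) (G : R -> V -> V).
Hypothesis T0 : 0 <= T.
Hypothesis M0 : 0 <= M.
Hypothesis blG : forall s, s \in `[0, T] -> bounded_linear_op C N (G s).
Hypothesis GM : forall s u, s \in `[0, T] -> C u -> N (G s u) <= M * N u.
Hypothesis Gcont : forall F, cont_on 0 T F -> cont_on 0 T (fun s => G s (F s)).

Let sub0 t : t \in `[0, T] -> `[0, t] `<=` `[0, T].
Proof. by rewrite in_itv/= => tT s /=; rewrite !in_itv/=; lra. Qed.

(** The integrand is bounded, so that its primitive is Lipschitz: Picard's
    iteration stays among continuous paths. *)
Lemma picard_step X F : C X -> cont_on 0 T F ->
  exists F', cont_on 0 T F' /\ forall t, t \in `[0, T] ->
    reg_int `[0, t]%classic (fun s => G s (F s)) (F' t - X).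
Proof.
move=> CX cF; have cGF := Gcont cF; have [CGF _] := cGF.
have [B B0 hB] := cont_on_bounded T0 cGF.
have rGF := cont_on_regulated cGF.
have /choice[J hJ] : forall t, exists J, C J /\ (t \in `[0, T] ->
    reg_int `[0, t]%classic (fun s => G s (F s)) J).
  move=> t; have [tT|_] := boolP (t \in `[0, T]); last by exists 0; split => //; exact: cs0.
  have [J CJ rJ] : exists2 J, C J & reg_int `[0, t]%classic (fun s => G s (F s)) J.
    apply: reg_int_exists => //; first by move=> s /(sub0 tT) sT; exact: CGF.
    by apply: regulated_subset rGF => //; exact: sub0.
  by exists J.
exists (fun t => J t + X); split; last first.
  by move=> t tT; rewrite addrK; have [_] := hJ t; apply.
have CJ t : C (J t) by have [] := hJ t.
split=> [t _|]; first exact: csD.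
have lip t t' : t \in `[0, T] -> t' \in `[0, T] -> t <= t' ->
    N (J t' - J t) <= B * (t' - t).
  move=> tT t'T tt'; have [_ /(_ tT) rt] := hJ t; have [_ /(_ t'T) rt'] := hJ t'.
  have sub : `]t, t'] `<=` `[0, T].
    by move: tT t'T; rewrite !in_itv/= => ? ? s /=; rewrite !in_itv/=; lra.
  have fin : (leb `]t, t']%classic < +oo)%E.
    by rewrite lebesgue_measure_itv/=; case: ifP => // _; rewrite -EFinB ltry.
  have Csub s : `]t, t']%classic s -> C (G s (F s)) by move=> /sub; exact: CGF.
  have [K CK rK] : exists2 K, C K & reg_int `]t, t']%classic (fun s => G s (F s)) K.
    apply: reg_int_exists => //.
    by apply: regulated_subset rGF.
  have dis : `[0, t] `&` `]t, t'] = set0.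
    by apply/seteqP; split => // s [] /=; rewrite !in_itv/=; lra.
  have C0 s : `[0, t]%classic s -> C (G s (F s)) by move=> /(sub0 tT); exact: CGF.
  have E : `[0, t] `|` `]t, t'] = `[0, t']%classic.
    apply/seteqP; split => s /=; rewrite !in_itv/=; first by move: tT; rewrite in_itv/=; lra.
    by case: (lerP s t); [left|right]; lra.
  have := reg_int_setU dis C0 Csub (CJ t) CK rt rK; rewrite E => rJK.
  have C1 s : `[0, t']%classic s -> C (G s (F s)) by move=> /(sub0 t'T); exact: CGF.
  have eq0 := reg_int_unique (measurable_itv _) (lebesgue_itvcc_lty _ _) C1 (CJ t')
    (csD (CJ t) CK) rt' rJK.
  have -> : N (J t' - J t) = N K.
    apply: sn_eq; [exact: csB|by []|].
    by rewrite -addrA -opprD.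
  apply: le_trans (reg_int_le_cst (measurable_itv _) fin Csub CK rK (M := B) _) _.
    by move=> s /sub; exact: hB.
  rewrite ler_wpM2l// lebesgue_measure_itv/= lte_fin.
  by case: ltP => // _; rewrite subr_ge0.
move=> t tT e e0; exists (e / (B + 1)); first by rewrite divr_gt0// ltr_wpDl.
move=> t' t'T tt'.
rewrite opprD addrACA subrr addr0.
apply: (@le_trans _ _ (B * `|t' - t|)).
  have [tt|/ltW tt] := leP t t'.
    by rewrite ger0_norm ?subr_ge0//; exact: lip.
  by rewrite snC// ler0_norm ?subr_le0// opprB; exact: lip.
apply: le_trans (ler_wpM2l B0 (ltW tt')) _.
by rewrite mulrCA ger_pMr// ler_pdivrMr ?ltr_wpDl// mul1r lerDl.
Qed.


(** For the distance weighted by e^{-lt}, with l = 2 M + 1, the integral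
    equation is a contraction of ratio 1/2, so that Picard's iterates converge
    geometrically on the whole of [0, T]. *)
Lemma ode_exists X : C X -> exists Y, cont_on 0 T Y /\
  forall t, t \in `[0, T] -> reg_int `[0, t]%classic (fun s => G s (Y s)) (Y t - X).
Proof.
move=> CX.
have /choice[J hJ] : forall F, exists F', cont_on 0 T F -> cont_on 0 T F' /\
    forall t, t \in `[0, T] ->
      reg_int `[0, t]%classic (fun s => G s (F s)) (F' t - X).
  move=> F; have [cF|ncF] := pselect (cont_on 0 T F); last by exists F.
  by have [F' ?] := picard_step CX cF; exists F'.
pose Y_ n := iter n J (fun=> X).
have cY n : cont_on 0 T (Y_ n).
  by elim: n => [|n /hJ[]//]; exact: cont_on_cst.
have rY n t : t \in `[0, T] ->
    reg_int `[0, t]%classic (fun s => G s (Y_ n s)) (Y_ n.+1 t - X).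
  by have [_] := hJ _ (cY n); apply.
have CY n t : t \in `[0, T] -> C (Y_ n t) by case: (cY n) => + _; apply.
have CGY n t : t \in `[0, T] -> C (G t (Y_ n t)).
  by case: (Gcont (cY n)) => + _; apply.
set l := 2 * M + 1; have l0 : 0 < l by rewrite /l ltr_wpDl// mulr_ge0.
have [c c0 hc] : exists2 c, 0 <= c & forall t, t \in `[0, T] -> N (Y_ 1%N t - Y_ 0%N t) <= c.
  have [c1 c10 h1] := cont_on_bounded T0 (cY 1%N).
  exists (c1 + N X); first by rewrite addr_ge0 ?sn_ge0.
  move=> t tT; apply: le_trans (snB _ _) _; [exact: CY|by []|].
  by rewrite lerD2r h1.
have key t (I I' : V) (F F' : R -> V) q : t \in `[0, T] -> cont_on 0 T F -> cont_on 0 T F' ->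
    C I -> C I' -> 0 <= q ->
    (forall s, s \in `[0, T] -> N (F s - F' s) <= q * expR (l * s)) ->
    reg_int `[0, t]%classic (fun s => G s (F s)) I ->
    reg_int `[0, t]%classic (fun s => G s (F' s)) I' ->
    N (I - I') <= q / 2 * expR (l * t).
  move=> tT cF cF' CI CI' q0 hq rI rI'.
  have t0 : 0 <= t by move: tT; rewrite in_itv/= => /andP[].
  have C1 s : `[0, t]%classic s -> C (G s (F s)).
    by move=> /(sub0 tT) sT; case: (Gcont cF) => + _; apply.
  have C2 s : `[0, t]%classic s -> C (G s (F' s)).
    by move=> /(sub0 tT) sT; case: (Gcont cF') => + _; apply.
  rewrite -lee_fin.
  apply: le_trans (bochner_dist (h := fun s => M * q * expR (l * s)) _ _ C1 C2 CI CI' _ _ _ _) _ => //.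
  - exact: reg_int_bochner.
  - exact: reg_int_bochner.
  - by apply: measurable_funM => //; exact: measurable_expRM.
  - move=> s /(sub0 tT) sT.
    have CFs : C (F s) by case: cF => + _; apply.
    have CFs' : C (F' s) by case: cF' => + _; apply.
    rewrite (bl_distE (blG sT))//; apply: le_trans (GM sT _) _; first exact: csB.
    by rewrite -mulrA ler_wpM2l// hq.
  under eq_integral do rewrite EFinM.
  rewrite ge0_integralZl//; last 2 first.
  - by apply/measurable_EFinP; exact: measurable_expRM.
  - by rewrite lee_fin mulr_ge0.
  apply: le_trans (lee_wpmul2l _ (integral_expR_le l0 t0)) _.
    by rewrite lee_fin mulr_ge0.
  rewrite -EFinM lee_fin mulrA mulrAC ler_wpM2r ?expR_ge0//.
  rewrite ler_pdivrMr// /l; nra.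
have g0 n : 0 <= (2^-1 : R) ^+ n by rewrite exprn_ge0// invr_ge0.
have dY n t : t \in `[0, T] ->
    N (Y_ n.+1 t - Y_ n t) <= c * 2^-1 ^+ n * expR (l * t).
  elim: n t => [|n ih] t tT.
    rewrite expr0 mulr1; apply: le_trans (hc _ tT) _.
    rewrite ler_peMr// -expR0 ler_expR mulr_ge0 ?(ltW l0)//.
    by move: tT; rewrite in_itv/= => /andP[].
  have -> : N (Y_ n.+2 t - Y_ n.+1 t) = N ((Y_ n.+2 t - X) - (Y_ n.+1 t - X)).
    by rewrite opprB addrA subrK.
  rewrite exprSr mulrA; apply: (key t _ _ _ _ _ tT (cY n.+1) (cY n)) => //.
  - by apply: csB => //; exact: CY.
  - by apply: csB => //; exact: CY.
  - by rewrite mulr_ge0.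
  - exact: rY.
  - exact: rY.
set E := c * expR (l * T).
have E0 : 0 <= E by rewrite mulr_ge0 ?expR_ge0.
have dYE n t : t \in `[0, T] -> N (Y_ n.+1 t - Y_ n t) <= E * 2^-1 ^+ n.
  move=> tT; apply: le_trans (dY n t tT) _.
  rewrite /E -!mulrA ler_wpM2l// mulrC ler_wpM2r// ler_expR ler_pM2l//.
  by move: tT; rewrite in_itv/= => /andP[].
have /choice[Y hY] : forall t, exists v, t \in `[0, T] -> C v /\
    forall n, N (Y_ n t - v) <= 2 * E * 2^-1 ^+ n.
  move=> t; have [tT|_] := boolP (t \in `[0, T]); last by exists 0.
  have [|n|v Cv hv] := @geometric_complete (fun n => Y_ n t) E.
  - by move=> n; exact: CY.
  - exact: dYE.
  by exists v.
have cYY : cont_on 0 T Y.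
  split=> [t tT|t tT e e0]; first by have [] := hY _ tT.
  have e30 : 0 < e / 3 by rewrite divr_gt0.
  have [n hn] := @geometric_small (2 * E) _ e30.
  have [d d0 hd] := (cY n).2 t tT _ e30; exists d => // y yT yt.
  have [Ct ht] := hY _ tT; have [Cy hy] := hY _ yT.
  have := sn_dist Cy (CY n y yT) Ct.
  have := sn_dist (CY n y yT) (CY n t tT) Ct.
  have := hd y yT yt; have := ht n; have := hy n; rewrite [N (Y_ n y - Y y)]snC//; last exact: CY.
  by lra.
exists Y; split => // t tT.
have [CGYY _] := Gcont cYY.
have CI s : `[0, t]%classic s -> C (G s (Y s)) by move=> /(sub0 tT); exact: CGYY.
have [I CI' rI] : exists2 I, C I & reg_int `[0, t]%classic (fun s => G s (Y s)) I.
  apply: reg_int_exists => //; apply: regulated_subset (cont_on_regulated (Gcont cYY)) => //.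
  exact: sub0.
have CYt : C (Y t) by have [] := hY _ tT.
apply: (reg_int_congr _ _ CI' _ _ _ rI) => //; [exact: csB|by move=> x Dx; rewrite subrr sn0|].
apply/eqP; rewrite eq_le sn_ge0 andbT; apply/ler_addgt0Pr => e e0; rewrite add0r.
set q := 2 * E * expR (l * t) + 2 * E.
have q0 : 0 <= q by rewrite addr_ge0// !mulr_ge0// expR_ge0.
have [n hn] := @geometric_small q _ e0.
have := sn_dist CI' (csB (CY n.+1 t tT) CX) (csB CYt CX).
have -> : Y_ n.+1 t - X - (Y t - X) = Y_ n.+1 t - Y t by rewrite opprB subrKA.
move=> h; apply: le_trans h _; apply: le_trans hn.
have [_ hYt] := hY _ tT.
rewrite /q mulrDl; apply: lerD; last first.
  apply: le_trans (hYt _) _; rewrite exprS ler_wpM2l ?mulr_ge0//.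
  by have := g0 n; lra.
have q'0 : 0 <= 2 * E * 2^-1 ^+ n by rewrite !mulr_ge0.
apply: le_trans (key t I _ Y (Y_ n) _ tT cYY (cY n) CI' _ q'0 _ rI (rY _ _ tT)) _.
- by apply: csB => //; exact: CY.
- move=> s sT; have [CYs hYs] := hY _ sT; rewrite snC//; last exact: CY.
  apply: le_trans (hYs n) _; rewrite ler_peMr// -expR0 ler_expR mulr_ge0 ?(ltW l0)//.
  by move: sT; rewrite in_itv/= => /andP[].
have := mulr_ge0 q'0 (expR_ge0 (l * t)); lra.
Qed.

End linear_ode.

(** * Mild solutions for a strongly continuous group *)

Lemma bl_comp L1 L2 : bounded_linear_op C N L1 -> bounded_linear_op C N L2 ->
  bounded_linear_op C N (L1 \o L2).
Proof.
move=> b1 b2; split.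
- by move=> u Cu /=; do 2 apply: bl_C => //.
- move=> a u v Cu Cv /=.
  have [C2u C2v] : C (L2 u) /\ C (L2 v) by split; exact: bl_C.
  have Cl : C (L2 (a *: u + v)) by apply: (bl_C b2); cc.
  apply: (@sn_eq_trans (L1 (a *: L2 u + L2 v))); cc.
  + by apply: bl_C.
  + by apply: (bl_C b1); cc.
  + by apply: csD; [apply: csZ|]; exact: bl_C.
  + by apply: bl_eq => //; [cc|exact: (bl_lin b2)].
  + exact: (bl_lin b1).
- have [M1 M10 h1] := bl_bound b1; have [M2 M20 h2] := bl_bound b2.
  exists (M1 * M2) => u Cu /=; apply: le_trans (h1 _ (bl_C b2 Cu)) _.
  by rewrite -mulrA ler_wpM2l// h2.
Qed.

Section group.
Variable S : R -> V -> V.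
Hypothesis gS : strongly_continuous_group C N S.
Hypothesis bS : forall T, exists2 M, 0 <= M &
  forall t u, `|t| <= T -> C u -> N (S t u) <= M * N u.

Lemma S_bl t : bounded_linear_op C N (S t). Proof. by case: gS. Qed.

Lemma S_C t u : C u -> C (S t u). Proof. exact: bl_C (S_bl t) u. Qed.

Hint Resolve S_C : cspace.

Lemma S_0 u : C u -> N (S 0 u - u) = 0. Proof. by case: gS => _ + _ _; apply. Qed.

Lemma S_add s t u : C u -> N (S (s + t) u - S s (S t u)) = 0.
Proof. by case: gS => _ _ + _; apply. Qed.

Lemma S_cont0 u e : C u -> 0 < e ->
  exists2 d, 0 < d & forall t, `|t| < d -> N (S t u - u) <= e.
Proof.
case: gS => _ _ _ /[apply] /cvgrPdist_le /[apply] -[d d0 h].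
exists d => // t td; have := h t; rewrite /= !sub0r !normrN => /(_ td).
by rewrite ger0_norm// sn_ge0.
Qed.

Lemma S_cont u t e : C u -> 0 < e ->
  exists2 d, 0 < d & forall s, `|s - t| < d -> N (S s u - S t u) <= e.
Proof.
move=> Cu e0; have [M M0 hM] := bl_bound (S_bl t).
have M1 : 0 < M + 1 by rewrite ltr_wpDl.
have [d d0 h] := S_cont0 Cu (divr_gt0 e0 M1); exists d => // s /h hs.
have := S_add t (s - t) Cu; rewrite subrKC => E.
rewrite (@sn_eq_sub _ _ (S t (S (s - t) u)) (S t u)) ?subrr ?sn0//; cc.
rewrite (bl_distE (S_bl t)); cc; apply: le_trans (hM _ _) _; cc.
apply: le_trans (ler_wpM2l M0 hs) _.
by rewrite mulrCA ger_pMr// ler_pdivrMr// mul1r lerDl.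
Qed.

Lemma S_path a b F g : (forall x y, `|g x - g y| <= `|x - y|) ->
  cont_on a b F -> cont_on a b (fun s => S (g s) (F s)).
Proof.
move=> lg [CF cF]; split=> [x xab|x xab e e0]; first by apply/S_C/CF.
have [M M0 hM] := bS (`|g x| + (b - a)).
have M1 : 0 < M + 1 by rewrite ltr_wpDl.
have e20 : 0 < e / 2 by rewrite divr_gt0.
have CFx := CF _ xab.
have [d1 d10 h1] := cF x xab _ (divr_gt0 e20 M1).
have [d2 d20 h2] := S_cont (g x) CFx e20.
exists (Num.min d1 d2); first by rewrite lt_min d10.
move=> y yab; rewrite lt_min => /andP[y1 y2]; have CFy := CF _ yab.
apply: le_trans (sn_dist (v := S (g y) (F x)) _ _ _) _; cc.
rewrite [leRHS](splitr e); apply: lerD; last first.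
  by apply: h2; apply: le_lt_trans y2; exact: lg.
rewrite (bl_distE (S_bl _)); cc; apply: le_trans (hM _ _ _ _) _; cc.
  rewrite -[g y](subrKC (g x)); apply: le_trans (ler_normD _ _) _.
  rewrite lerD2l; apply: le_trans (lg _ _) _.
  by move: xab yab; rewrite !in_itv/= ler_norml; lra.
apply: le_trans (ler_wpM2l M0 (h1 _ yab y1)) _.
by rewrite mulrCA ger_pMr// ler_pdivrMr// mul1r lerDl.
Qed.

Lemma bl_path L a b F : bounded_linear_op C N L ->
  cont_on a b F -> cont_on a b (fun s => L (F s)).
Proof.
move=> bL [CF cF]; split=> [x xab|x xab e e0]; first by apply: bl_C => //; exact: CF.
have [M M0 hM] := bl_bound bL.
have M1 : 0 < M + 1 by rewrite ltr_wpDl.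
have CFx := CF _ xab.
have [d1 d10 h1] := cF x xab _ (divr_gt0 e0 M1); exists d1 => // y yab yx.
have CFy := CF _ yab.
rewrite bl_distE//; apply: le_trans (hM _ _) _; cc.
apply: le_trans (ler_wpM2l M0 (h1 _ yab yx)) _.
by rewrite mulrCA ger_pMr// ler_pdivrMr// mul1r lerDl.
Qed.

(** Two notions of solution of the Duhamel formula. Solutions are built as
    [csol], whose integrands are uniformly approximable, and compared as
    [mild], whose integrals are arbitrary Bochner integrals. *)
Definition csol T (P : R -> V -> V) X W := cont_on 0 T W /\
  forall t, t \in `[0, T] ->
    reg_int `[0, t]%classic (fun s => S (t - s) (P s (W s))) (W t - S t X).

Definition mild T (P : R -> V -> V) X W := cont_on 0 T W /\
  forall t, t \in `[0, T] ->
    is_bochner_integral C N `[0, t]%classic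
      (fun s => S (t - s) (P s (W s))) (W t - S t X).

Lemma csol_mild T P X W :
  (forall s u, C u -> C (P s u)) -> csol T P X W -> mild T P X W.
Proof.
move=> CP [cW h]; split => // t tT; apply: reg_int_bochner (h t tT) => //.
move=> s /= st; apply/S_C/CP; case: cW => + _; apply.
by move: tT st; rewrite !in_itv/=; lra.
Qed.

(** The path Y(t) = S(-t) W(t) has to satisfy Y' = S(-t) B S(t) Y, an equation
    with bounded coefficients. *)
Lemma csol_exists T B X : 0 <= T -> bounded_linear_op C N B -> C X ->
  exists W, csol T (fun=> B) X W.
Proof.
move=> T0 bB CX; have [M M0 hM] := bS T; have [b b0 hb] := bl_bound bB.
have CB u : C u -> C (B u) by exact: bl_C.
pose G s u := S (- s) (B (S s u)).
have blG s : s \in `[0, T] -> bounded_linear_op C N (G s).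
  by move=> _; apply: (bl_comp (S_bl _)); apply: bl_comp => //; exact: S_bl.
have GM s u : s \in `[0, T] -> C u -> N (G s u) <= (M * (b * M)) * N u.
  rewrite in_itv/= => sT Cu; apply: le_trans (hM _ _ _ _) _; cc.
    by rewrite normrN ger0_norm; lra.
  rewrite -mulrA ler_wpM2l//; apply: le_trans (hb _ _) _; cc.
  by rewrite -mulrA ler_wpM2l//; apply: hM => //; rewrite ger0_norm; lra.
have Gcont F : cont_on 0 T F -> cont_on 0 T (fun s => G s (F s)).
  move=> cF; apply: (@S_path _ _ _ -%R).
    by move=> x y; rewrite -opprD normrN.
  by apply: bl_path => //; apply: (@S_path _ _ _ id).
have MM : 0 <= M * (b * M) by rewrite !mulr_ge0.
have [Y [cY hY]] := ode_exists T0 MM blG GM Gcont CX.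
have cW : cont_on 0 T (fun t => S t (Y t)) by apply: (@S_path _ _ _ id).
exists (fun t => S t (Y t)); split => // t tT.
have CY s : s \in `[0, T] -> C (Y s) by case: cY => + _; apply.
have sub s : `[0, t]%classic s -> s \in `[0, T].
  by move: tT; rewrite /= !in_itv/=; lra.
have CG s : `[0, t]%classic s -> C (G s (Y s)) by move=> /sub/CY ?; rewrite /G; cc.
have CYt := CY _ tT.
have := reg_int_map (S_bl t) CG (csB CYt CX) (hY _ tT).
apply: reg_int_congr; cc.
- by move=> s st; apply/S_C; exact: CG.
- move=> s st; have Cs := CY _ (sub _ st); have CGs := CG _ st.
  by rewrite /= snC; [apply: S_add; cc|exact: S_C|cc].
- exact: blB (S_bl t) _ _ CYt CX.
Qed.

(** Gronwall's lemma for the Duhamel formula. The case X = X' is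
    uniqueness. *)
Lemma mild_dist T P X W X' W' M b : 0 <= M -> 0 <= b -> C X -> C X' ->
  (forall t u, `|t| <= T -> C u -> N (S t u) <= M * N u) ->
  (forall s u, C u -> C (P s u)) ->
  (forall s u v, s \in `[0, T] -> C u -> C v -> N (P s u - P s v) <= b * N (u - v)) ->
  mild T P X W -> mild T P X' W' ->
  forall t, t \in `[0, T] ->
    N (W t - W' t) <= 2 * (M * N (X - X')) * expR ((2 * (M * b) + 1) * T).
Proof.
move=> M0 b0 CX CX' hM CP hP [cW hW] [cW' hW'].
have CW s : s \in `[0, T] -> C (W s) by case: cW => + _; apply.
have CW' s : s \in `[0, T] -> C (W' s) by case: cW' => + _; apply.
apply: gronwall.
- by rewrite mulr_ge0.
- by rewrite mulr_ge0 ?sn_ge0.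
- exact: cont_on_norm_sub.
- by move=> t _; exact: sn_ge0.
move=> t tT.
have sub s : `[0, t]%classic s -> s \in `[0, T].
  by move: tT; rewrite /= !in_itv/=; lra.
have CWt := CW _ tT; have CWt' := CW' _ tT.
have C1 s : `[0, t]%classic s -> C (S (t - s) (P s (W s))).
  by move=> /sub/CW/CP ?; cc.
have C2 s : `[0, t]%classic s -> C (S (t - s) (P s (W' s))).
  by move=> /sub/CW'/CP ?; cc.
apply: (@le_trans _ _ ((N (S t X - S t X'))%:E +
    (N ((W t - S t X) - (W' t - S t X')))%:E)%E).
  rewrite -EFinD lee_fin.
  rewrite (_ : W t - W' t = (S t X - S t X') + ((W t - S t X) - (W' t - S t X'))).
    by apply: snD; cc.
  by rewrite opprB [RHS]addrC addrAC !subrKA.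
apply: leeD.
  rewrite lee_fin (bl_distE (S_bl t))//; apply: hM; cc.
  by move: tT; rewrite in_itv/= => tT; rewrite ger0_norm; lra.
apply: bochner_dist C1 C2 _ _ (hW _ tT) (hW' _ tT) _ _ => //; cc.
  apply: measurable_funM => //.
  apply: subspace_continuous_measurable_fun => //.
  apply: continuous_subspaceW (cont_on_norm_sub cW cW') => s /= /sub //.
move=> s st; have Cs := CW _ (sub _ st); have Cs' := CW' _ (sub _ st).
have CPs := CP s _ Cs; have CPs' := CP s _ Cs'.
rewrite (bl_distE (S_bl _))//; apply: le_trans (hM _ _ _ _) _; cc.
  move: st tT; rewrite /= !in_itv/= => st tT; rewrite ger0_norm; lra.
by rewrite -mulrA ler_wpM2l//; apply: hP => //; exact: sub.
Qed.


Lemma mild_init T P X W : 0 <= T -> C X -> (forall s u, C u -> C (P s u)) ->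
  mild T P X W -> N (W 0 - X) = 0.
Proof.
move=> T0 CX CP [[CW cW] h].
have T00 : (0 : R) \in `[0, T] by rewrite in_itv/= lexx.
have C0 (s : R) : `[0, 0]%classic s -> C 0 by move=> _; exact: cs0.
have C1 (s : R) : `[0, 0]%classic s -> C (S (0 - s) (P s (W s))).
  rewrite /= in_itv/= => s0; apply/S_C/CP/CW; rewrite in_itv/=; lra.
have CI : C (W 0 - S 0 X) by apply: csB; [exact: CW|exact: S_C].
have := bochner_dist (h := fun s => N (S (0 - s) (P s (W s)) - 0))
  (measurable_itv `[0, 0]) (lebesgue_itvcc_lty 0 0) C1 C0 CI cs0 (h _ T00)
  (reg_int_bochner (measurable_itv _) (lebesgue_itvcc_lty _ _) C0 (reg_int0 _)) _ _.
rewrite set_itv1 integral_set1 subr0 lee_fin => h0.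
apply: (@sn_eq_trans (S 0 X)) => //; [exact: CW|exact: S_C| |exact: S_0].
apply/eqP; rewrite eq_le sn_ge0 andbT; apply: h0 => //.
exact: measurable_fun_set1.
Qed.

(** After the time T1 the Duhamel integral splits at T1. Its first part is
    S(t - T1) applied to the integral for W1 at the time T1, its second part a
    translate of the integral for W2. *)
Lemma csol_concat T1 T2 P1 P2 X Y W1 W2 : 0 <= T1 -> 0 <= T2 -> C X -> C Y ->
  (forall s u, C u -> C (P1 s u)) -> (forall s u, C u -> C (P2 s u)) ->
  csol T1 P1 X W1 -> csol T2 P2 Y W2 -> N (W1 T1 - Y) = 0 ->
  csol (T1 + T2) (fun s => if s < T1 then P1 s else P2 (s - T1)) X
    (fun s => if s < T1 then W1 s else W2 (s - T1)).
Proof.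
move=> T10 T20 CX CY CP1 CP2 s1 s2 WY.
have W20 := mild_init T20 CY CP2 (csol_mild CP2 s2).
case: s1 s2 => [cW1 h1] [cW2 h2].
have CW1 s : s \in `[0, T1] -> C (W1 s) by case: cW1 => + _; apply.
have CW2 s : s \in `[0, T2] -> C (W2 s) by case: cW2 => + _; apply.
have T1T1 : T1 \in `[0, T1] by rewrite in_itv/= T10 lexx.
have T200 : 0 \in `[0, T2] by rewrite in_itv/= T20 lexx.
have CW1T := CW1 _ T1T1; have CW20 := CW2 _ T200.
set W := fun s => if s < T1 then W1 s else W2 (s - T1).
set P := fun s => if s < T1 then P1 s else P2 (s - T1).
have cW : cont_on 0 (T1 + T2) W.
  apply: cont_on_glue cW1 _ _; first by rewrite T10/= lerDl.
    by have := cont_on_shift T1 cW2; rewrite add0r addrC.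
  by rewrite subrr; apply: sn_eq_trans WY _ => //; rewrite snC.
have CW s : s \in `[0, T1 + T2] -> C (W s) by case: cW => + _; apply.
split => // t tT; have CWt := CW _ tT.
have [tT1|tT1] := ltP t T1.
  have tT1' : t \in `[0, T1] by move: tT; rewrite !in_itv/=; lra.
  have C1 s : `[0, t]%classic s -> C (S (t - s) (P1 s (W1 s))).
    by rewrite /= in_itv/= => st; apply/S_C/CP1/CW1; rewrite in_itv/=; lra.
  have E s : `[0, t]%classic s -> S (t - s) (P s (W s)) = S (t - s) (P1 s (W1 s)).
    by rewrite /= in_itv/= /P /W => st; have -> : s < T1 by lra.
  have Wt : W t = W1 t by rewrite /W tT1.
  apply: (reg_int_congr C1 _ _ _ _ _ (h1 _ tT1')).
  - by move=> s st; rewrite E//; exact: C1.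
  - by apply: csB; [exact: CW1|exact: S_C].
  - by apply: csB => //; exact: S_C.
  - by move=> s st; rewrite E// subrr sn0.
  - by rewrite Wt subrr sn0.
(* the common end point T1 is removed from the first integral *)
set r := t - T1; have r0 : 0 <= r by rewrite subr_ge0.
have rT : r \in `[0, T2] by move: tT; rewrite /r !in_itv/=; lra.
have CW2r := CW2 _ rT.
have C1 s : `[0, T1]%classic s -> C (S (T1 - s) (P1 s (W1 s))).
  by rewrite /= in_itv/= => st; apply/S_C/CP1/CW1; rewrite in_itv/=; lra.
have CI1 : C (W1 T1 - S T1 X) by apply: csB => //; exact: S_C.
have CI2 : C (W2 r - S r Y) by apply: csB => //; exact: S_C.
have i1 := reg_int_map (S_bl r) C1 CI1 (h1 _ T1T1).
have sub1 : `[0, T1[ `<=` `[0, T1] by move=> s /=; rewrite !in_itv/=; lra.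
have nul : leb (`[0, T1] `\` `[0, T1[)%classic = 0%E.
  rewrite (_ : _ `\` _ = [set T1]) ?lebesgue_measure_set1//.
  apply/seteqP; split => s /=; rewrite !in_itv/=; last by move=> ->; split; lra.
  by move=> [a /negP b]; apply/eqP; rewrite eq_le; move: a b; lra.
have {i1} := reg_int_null_subset (measurable_itv _) sub1 nul (measurable_itv _) i1.
have C1' s : `[0, T1[%classic s -> C (S r (S (T1 - s) (P1 s (W1 s)))).
  by move=> /sub1/C1 ?; exact: S_C.
have tsE s : S (t - s) = S (r + (T1 - s)) by congr S; rewrite /r; lra.
have E1 s : `[0, T1[%classic s -> S (t - s) (P s (W s)) = S (r + (T1 - s)) (P1 s (W1 s)).
  by rewrite /= in_itv/= -tsE /P /W => st; have -> : s < T1 by lra.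
have CPW1 s : `[0, T1[%classic s -> C (P1 s (W1 s)).
  by move=> /sub1 st; apply/CP1/CW1.
have C1'' s : `[0, T1[%classic s -> C (S (t - s) (P s (W s))).
  by move=> st; rewrite E1//; apply/S_C/CPW1.
move=> /(reg_int_congr (F' := fun s => S (t - s) (P s (W s))) C1' C1'' (S_C r CI1) (S_C r CI1)) i1.
have {i1} := i1 _ _; rewrite subrr sn0 => i1.
have {}i1 : reg_int `[0, T1[%classic (fun s => S (t - s) (P s (W s))) (S r (W1 T1 - S T1 X)).
  apply: i1 => // s st; rewrite E1//= snC; [apply: S_add|exact: C1'|apply: S_C];
    exact: CPW1.
have := reg_int_shift T1 (h2 _ rT).
rewrite (_ : [set x | `[0, r]%classic (x - T1)] = `[T1, t]%classic); last first.
  by apply/seteqP; split => s /=; rewrite !in_itv/= /r; lra.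
have E2 s : `[T1, t]%classic s -> S (t - s) (P s (W s)) =
    S (r - (s - T1)) (P2 (s - T1) (W2 (s - T1))).
  rewrite /= in_itv/= => st; rewrite /P /W.
  have -> : (s < T1) = false by apply/negbTE; rewrite -leNgt; lra.
  by have -> : t - s = r - (s - T1) by rewrite /r; lra.
have C2 s : `[T1, t]%classic s -> C (S (r - (s - T1)) (P2 (s - T1) (W2 (s - T1)))).
  rewrite /= in_itv/= => st; apply/S_C/CP2/CW2.
  by move: rT; rewrite /r !in_itv/=; lra.
have C2' s : `[T1, t]%classic s -> C (S (t - s) (P s (W s))).
  by move=> st; rewrite E2//; exact: C2.
move=> /(reg_int_congr (F' := fun s => S (t - s) (P s (W s))) C2 C2' CI2 CI2) i2.
have {}i2 : reg_int `[T1, t]%classic (fun s => S (t - s) (P s (W s))) (W2 r - S r Y).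
  by apply: i2; [move=> s st; rewrite E2// subrr sn0|rewrite subrr sn0].
have dis : (`[0, T1[ `&` `[T1, t])%classic = set0.
  by apply/seteqP; split => // s [] /=; rewrite !in_itv/=; lra.
have := reg_int_setU dis C1'' C2' (S_C r CI1) CI2 i1 i2.
have -> : (`[0, T1[ `|` `[T1, t])%classic = `[0, t]%classic.
  apply/seteqP; split => s /=; rewrite !in_itv/=; first by lra.
  by case: (ltP s T1); [left|right]; lra.
have C3 s : `[0, t]%classic s -> C (S (t - s) (P s (W s))).
  rewrite /= in_itv/= => st; apply: S_C.
  have CWs : C (W s) by apply: CW; move: tT; rewrite !in_itv/=; lra.
  by rewrite /P; case: ifP => _; [exact: CP1|exact: CP2].
have CWX : C (W t - S t X) by apply: csB => //; exact: S_C.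
have Wt : W t = W2 r by rewrite /W ifF//; apply/negbTE; rewrite -leNgt.
apply: reg_int_congr => //; first by apply: csD => //; exact: S_C.
  by move=> s st; rewrite subrr sn0.
have Crr : C (S r (S T1 X)) by do 2 apply: S_C.
apply: (@sn_eq_trans ((S r Y - S r (S T1 X)) + (W2 r - S r Y))) => //.
- by apply: csD => //; exact: S_C.
- by apply: csD => //; apply: csB => //; exact: S_C.
- rewrite opprD addrACA subrr addr0.
  apply: (@sn_eq_trans (S r (W1 T1) - S r (S T1 X))); try by [apply: S_C|apply: csB => //; apply: S_C].
    by apply: (blB (S_bl r)) => //; exact: S_C.
  by rewrite opprB subrKA; apply: (bl_eq (S_bl r)).
rewrite Wt [X in N (X - _)]addrC subrKA opprB addrC subrKA.
have -> : S t X = S (r + T1) X by congr (S _ X); rewrite /r; lra.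
exact: S_add.
Qed.


(** The integrands differ at the time T at most, a null set. The half-open
    interval is that on which a piecewise constant control takes a prescribed
    value. *)
Lemma csol_congr T P P' X W :
  C X -> (forall s u, C u -> C (P s u)) -> (forall s u, C u -> C (P' s u)) ->
  (forall s, s \in `[0, T[ -> P s = P' s) -> csol T P X W -> csol T P' X W.
Proof.
move=> CX CP CP' PP [cW h]; split => // t tT.
have CW s : s \in `[0, T] -> C (W s) by case: cW => + _; apply.
have sub s : `[0, t]%classic s -> s \in `[0, T].
  by move: tT; rewrite /= !in_itv/=; lra.
have C1 s : `[0, t]%classic s -> C (S (t - s) (P s (W s))).
  by move=> /sub/CW st; apply/S_C/CP.
have C2 s : `[0, t]%classic s -> C (S (t - s) (P' s (W s))).
  by move=> /sub/CW st; apply/S_C/CP'.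
have t0 : 0 <= t by move: tT; rewrite in_itv/= => /andP[].
have CI : C (W t - S t X) by apply: csB; [exact: CW|exact: S_C].
have sub1 : `[0, t[ `<=` `[0, t] by move=> s /=; rewrite !in_itv/=; lra.
have nul : leb (`[0, t] `\` `[0, t[)%classic = 0%E.
  rewrite (_ : _ `\` _ = [set t]) ?lebesgue_measure_set1//.
  apply/seteqP; split => s /=; rewrite !in_itv/=; last by move=> ->; split; lra.
  by move=> [a /negP b]; apply/eqP; rewrite eq_le; move: a b; lra.
have r1 := reg_int_null_subset (measurable_itv _) sub1 nul (measurable_itv _) (h _ tT).
have {}r1 : reg_int `[0, t[%classic (fun s => S (t - s) (P' s (W s))) (W t - S t X).
  apply: (reg_int_congr _ _ CI CI _ _ r1).
  - by move=> s /sub1; exact: C1.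
  - by move=> s /sub1; exact: C2.
  - move=> s /= st; rewrite PP ?subrr ?sn0//.
    by move: st tT; rewrite !in_itv/=; lra.
  - by rewrite subrr sn0.
have tt : `[0, t]%classic t by rewrite /= in_itv/= t0 lexx.
have r2 : reg_int [set t] (fun s => S (t - s) (P' s (W s))) 0.
  by apply: reg_int_set1; exact: C2.
have dis : `[0, t[ `&` [set t] = set0.
  by apply/seteqP; split => // s [] /=; rewrite in_itv/= => + E; rewrite E ltxx andbF.
have := reg_int_setU dis _ _ CI cs0 r1 r2; rewrite addr0.
have -> : (`[0, t[ `|` [set t])%classic = `[0, t]%classic.
  apply/seteqP; split => s /=; rewrite !in_itv/=; first by case=> [|->]; lra.
  by move=> st; have [<-|] := eqVneq s t; [right|rewrite neq_lt; left; lra].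
by apply=> s; [move=> /sub1; exact: C2|move=> ->; exact: C2].
Qed.

(** * Piecewise constant controls *)

Section control.
Variables (Q : lmodType R) (B : Q -> V -> V).
Hypothesis BC : forall q u, C u -> C (B q u).
Hypothesis Blin : forall q a u v, B q (a *: u + v) = a *: B q u + B q v.
Hypothesis BZ : forall a q u, B (a *: q) u = a *: B q u.
Hypothesis Bbound : forall q, exists2 b, 0 <= b & forall u, C u -> N (B q u) <= b * N u.
Hypothesis Bnil : forall q u, C u -> N (B q (B q u)) = 0.

Hint Resolve BC : cspace.

Lemma Bbl q : bounded_linear_op C N (B q).
Proof.
split; first by move=> u; exact: BC.
  by move=> a u v _ _; rewrite Blin subrr sn0.
by have [b _ h] := Bbound q; exists b.
Qed.

Lemma BB q u v : B q (u - v) = B q u - B q v.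
Proof. by rewrite addrC -scaleN1r Blin scaleN1r addrC. Qed.

(** The word [:: (t1, q1); ..; (tn, qn)] stands for the control that takes the
    value q1 during a time t1, then q2 during a time t2, and so on. *)
Implicit Type c : seq (R * Q).

Fixpoint wdur c : R := if c is p :: c' then p.1 + wdur c' else 0.

Fixpoint wctrl c (s : R) : Q :=
  if c is p :: c' then if s < p.1 then p.2 else wctrl c' (s - p.1) else 0.

Definition wpos c := forall p, p \in c -> 0 < p.1.

Lemma wpos_cons p c : wpos (p :: c) <-> 0 < p.1 /\ wpos c.
Proof.
split=> [h|[p0 h] q]; last by rewrite inE => /predU1P[->|/h].
by split=> [|q qw]; apply: h; rewrite inE ?eqxx// qw orbT.
Qed.

Lemma wpos_cat c1 c2 : wpos c1 -> wpos c2 -> wpos (c1 ++ c2).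
Proof. by move=> h1 h2 p; rewrite mem_cat => /orP[/h1|/h2]. Qed.

Lemma wdur_cat c1 c2 : wdur (c1 ++ c2) = wdur c1 + wdur c2.
Proof. by elim: c1 => [|p c ih] /=; rewrite ?add0r// ih addrA. Qed.

Lemma wdur_ge0 c : wpos c -> 0 <= wdur c.
Proof.
elim: c => [|p c ih] //= /wpos_cons[p0 /ih w0].
by rewrite addr_ge0// ltW.
Qed.

Lemma wctrl_cat c1 c2 s : wpos c1 -> 0 <= s ->
  wctrl (c1 ++ c2) s = if s < wdur c1 then wctrl c1 s else wctrl c2 (s - wdur c1).
Proof.
elim: c1 s => [|p c ih] s /=; first by move=> _ s0; rewrite ltNge s0/= subr0.
move=> /wpos_cons[p0 w0] s0; have := wdur_ge0 w0.
case: ltP => sp wd0; first by rewrite ifT//; lra.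
rewrite ih//; last by lra.
have -> : (s - p.1 < wdur c) = (s < p.1 + wdur c) by rewrite ltrBlDl.
by case: ifP => // _; congr (wctrl _ _); lra.
Qed.

Lemma wctrl_bound c : exists2 b, 0 <= b & forall s u, C u -> N (B (wctrl c s) u) <= b * N u.
Proof.
elim: c => [|p c [b b0 h]] /=.
  by exists 0 => // s u Cu; rewrite -(scale0r (0 : Q)) BZ scale0r sn0 mul0r.
have [b' b'0 hb'] := Bbound p.2; exists (b + b'); first exact: addr_ge0.
move=> s u Cu; case: ifP => _; rewrite mulrDl.
  by apply: le_trans (hb' _ Cu) _; rewrite lerDr mulr_ge0// sn_ge0.
by apply: le_trans (h _ _ Cu) _; rewrite lerDl mulr_ge0// sn_ge0.
Qed.

Definition steer c X Y := exists W,
  csol (wdur c) (fun s => B (wctrl c s)) X W /\ N (W (wdur c) - Y) = 0.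

Lemma steer_nil X : C X -> steer [::] X X.
Proof.
move=> CX; exists (fun=> X); split; last by rewrite subrr sn0.
split=> [|t]; first exact: cont_on_cst.
rewrite /= => t0; have -> : t = 0 by move: t0; rewrite in_itv/=; lra.
have C0 (s : R) : [set 0] s -> C (S (0 - s) (B 0 X)) by move=> _; cc.
rewrite set_itv1.
apply: (reg_int_congr C0 C0 cs0 _ _ _ (@reg_int_set1 0 _ _)); cc.
- by move=> s _; rewrite subrr sn0.
- by rewrite sub0r snN; [rewrite snC; cc; exact: S_0|cc].
Qed.

Lemma steer_cat c1 c2 X Y Z : wpos c1 -> wpos c2 -> C X -> C Y ->
  C Z -> steer c1 X Y -> steer c2 Y Z -> steer (c1 ++ c2) X Z.
Proof.
move=> p1 p2 CX CY CZ [W1 [s1 e1]] [W2 [s2 e2]].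
have d1 := wdur_ge0 p1; have d2 := wdur_ge0 p2.
eexists; split.
  have := csol_concat d1 d2 CX CY _ _ s1 s2 e1; rewrite wdur_cat => h.
  have {}h := h (fun s u => @BC _ u) (fun s u => @BC _ u).
  apply: csol_congr h => //.
  - by move=> s u Cu; case: ifP => _; exact: BC.
  - by move=> s u; exact: BC.
  - move=> s; rewrite in_itv/= => s0.
    by rewrite wctrl_cat//; [case: ifP|lra].
rewrite wdur_cat ltNge lerDl d2/=.
by rewrite addrAC subrr add0r.
Qed.

Lemma steer_exists c X : wpos c -> C X -> exists2 Y, C Y & steer c X Y.
Proof.
elim: c X => [|p c ih] X; first by move=> _ CX; exists X => //; exact: steer_nil.
move=> /wpos_cons[p0 hw] CX.
have [W sW] := csol_exists (ltW p0) (Bbl p.2) CX.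
have CW : C (W p.1) by case: sW => -[+ _] _; apply; rewrite in_itv/= lexx ltW.
have [Y CY sY] := ih _ hw CW; exists Y => //.
rewrite -cat1s; apply: steer_cat sY => //.
  by move=> q; rewrite inE => /eqP ->.
exists W; rewrite /= addr0; split; last by rewrite subrr sn0.
apply: csol_congr sW => //.
- by move=> s u; exact: BC.
- by move=> s u; exact: BC.
- by move=> s; rewrite in_itv/= => /andP[_ ->].
Qed.

(** Letting the same control act on nearby states: the constant L depends on
    the control. *)
Lemma steer_dist c X Y : wpos c -> C X -> C Y -> steer c X Y ->
  exists2 L, 0 <= L & forall X', C X' -> exists Y',
    [/\ C Y', steer c X' Y' & N (Y - Y') <= L * N (X - X')].
Proof.
move=> pc CX CY [W [sW eW]]; have d0 := wdur_ge0 pc.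
have [M M0 hM] := bS (wdur c); have [b b0 hb] := wctrl_bound c.
exists (2 * M * expR ((2 * (M * b) + 1) * wdur c)).
  by rewrite !mulr_ge0// expR_ge0.
move=> X' CX'; have [Y' CY' sY'] := steer_exists pc CX'; exists Y'; split => //.
case: sY' => W' [sW' eW'].
have dT : wdur c \in `[0, wdur c] by rewrite in_itv/= lexx d0.
have CW : C (W (wdur c)) by case: sW => -[+ _] _; apply.
have CW' : C (W' (wdur c)) by case: sW' => -[+ _] _; apply.
rewrite -(sn_eq_sub CW CW')//.
have CB (s : R) u : C u -> C (B (wctrl c s) u) by exact: BC.
have := mild_dist M0 b0 CX CX' hM CB _ (csol_mild CB sW) (csol_mild CB sW') dT.
move=> /(_ _)/le_trans; apply; last by rewrite mulrA mulrAC.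
by move=> s u v _ Cu Cv; rewrite -BB; apply: hb; cc.
Qed.

(** * Approximate reachability *)

Definition reach (tau : R) X Y := forall e, 0 < e -> exists c Z,
  [/\ wpos c, wdur c <= tau, C Z, steer c X Z & N (Z - Y) <= e].

Definition near_reach X Y := forall tau, 0 < tau -> reach tau X Y.

(** The second control is chosen first: its Lipschitz constant tells how well
    the first one has to reach Y. *)
Lemma reach_trans t1 t2 X Y Z : C X -> C Y -> C Z ->
  reach t1 X Y -> reach t2 Y Z -> reach (t1 + t2) X Z.
Proof.
move=> CX CY CZ r1 r2 e e0.
have e20 : 0 < e / 2 by rewrite divr_gt0.
have [c2 [Z2 [p2 d2 CZ2 s2 n2]]] := r2 _ e20.
have [L L0 hL] := steer_dist p2 CY CZ2 s2.
have L1 : 0 < L + 1 by rewrite ltr_wpDl.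
have [c1 [Y1 [p1 d1 CY1 s1 n1]]] := r1 _ (divr_gt0 e20 L1).
have [Z' [CZ' s2' n2']] := hL _ CY1.
exists (c1 ++ c2), Z'; split => //.
- exact: wpos_cat.
- by rewrite wdur_cat lerD.
- exact: steer_cat s1 s2'.
apply: le_trans (sn_dist CZ' CZ2 CZ) _; rewrite [leRHS](splitr e) lerD// snC//.
apply: (le_trans n2'); rewrite snC//; apply: le_trans (ler_wpM2l L0 n1) _.
by rewrite mulrCA ger_pMr// ler_pdivrMr// mul1r lerDl.
Qed.

Lemma reach_closed t X Y : C X -> C Y ->
  (forall e, 0 < e -> exists Y', [/\ C Y', reach t X Y' & N (Y' - Y) <= e]) ->
  reach t X Y.
Proof.
move=> CX CY h e e0; have e20 : 0 < e / 2 by rewrite divr_gt0.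
have [Y' [CY' r n']] := h _ e20; have [c [Z [pc dc CZ sc nc]]] := r _ e20.
exists c, Z; split => //; apply: le_trans (sn_dist CZ CY' CY) _.
by rewrite [leRHS](splitr e) lerD.
Qed.

Lemma reach_le t t' X Y : t <= t' -> reach t X Y -> reach t' X Y.
Proof.
move=> tt h e /h[c [Z [pc dc CZ sc nc]]]; exists c, Z; split => //.
exact: le_trans tt.
Qed.

Lemma near_reach_trans X Y Z : C X -> C Y -> C Z ->
  near_reach X Y -> near_reach Y Z -> near_reach X Z.
Proof.
move=> CX CY CZ h1 h2 t t0; rewrite (splitr t).
by apply: reach_trans CY _ _ _ => //; [apply: h1|apply: h2]; rewrite divr_gt0.
Qed.

Lemma near_reach_closed X Y : C X -> C Y ->
  (forall e, 0 < e -> exists Y', [/\ C Y', near_reach X Y' & N (Y' - Y) <= e]) ->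
  near_reach X Y.
Proof.
move=> CX CY h t t0; apply: reach_closed => // e /h[Y' [CY' r n']].
by exists Y'; split => //; exact: r.
Qed.

Lemma near_reach_null X Y : C X -> C Y -> N (X - Y) = 0 -> near_reach X Y.
Proof.
move=> CX CY XY t t0 e e0; exists [::], X; split => //=.
- exact: ltW.
- exact: steer_nil.
- by rewrite XY ltW.
Qed.

Lemma steer_free t X : 0 < t -> C X -> steer [:: (t, 0)] X (S t X).
Proof.
move=> t0 CX; exists (fun s => S s X); rewrite /= addr0; split; last by rewrite subrr sn0.
have B0 u : B 0 u = 0 by rewrite -(scale0r (0 : Q)) BZ scale0r.
have BX0 s u : B (if s < t then 0 else 0) u = 0 by case: ifP => _; rewrite B0.
split; first by apply: (@S_path _ _ _ id) => //; exact: cont_on_cst.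
move=> s st; rewrite subrr.
apply: (reg_int_congr _ _ cs0 cs0 _ _ (reg_int0 _)) => /=; cc.
- by move=> x _; rewrite BX0 sub0r snN; [exact: (bl0 (S_bl _))|exact/S_C/cs0].
- by rewrite subrr sn0.
Qed.

Lemma reach_free t X : 0 < t -> C X -> reach t X (S t X).
Proof.
move=> t0 CX e e0; exists [:: (t, 0)], (S t X); split.
- by move=> p; rewrite inE => /eqP ->.
- by rewrite /= addr0.
- exact: S_C.
- exact: steer_free.
- by rewrite subrr sn0 ltW.
Qed.

(** During the time delta the control q / delta acts like the exponential of B
    q, which is I + B q because B q has square zero, while S hardly moves. The
    solution is compared with the affine path Z joining X to X + B q X. *)
Lemma impulse q X : C X -> near_reach X (X + B q X).
Proof.
move=> CX tau tau0 e e0.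
have [M M0 hM] := bS 1; have [b b0 hb] := Bbound q.
set D := B q X; have CD : C D by exact: BC.
(* the constant of the Gronwall estimate does not depend on the duration de *)
set K1 := expR (2 * (M * b) + 1).
have K10 : 0 < K1 by exact: expR_gt0.
set eta := e / (4 * K1); have eta0 : 0 < eta by rewrite divr_gt0// mulr_gt0.
have [d1 d10 h1] := S_cont0 CX eta0; have [d2 d20 h2] := S_cont0 CD eta0.
set de := Num.min (Num.min tau 1) (Num.min d1 d2) / 2.
have [de0 [det [de1 [ded1 ded2]]]] :
    0 < de /\ (de <= tau /\ (de <= 1 /\ (de < d1 /\ de < d2))).
  have m0 : 0 < Num.min (Num.min tau 1) (Num.min d1 d2).
    by rewrite !lt_min tau0 ltr01 d10.
  have : Num.min (Num.min tau 1) (Num.min d1 d2) <= Num.min tau 1.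
    by rewrite ge_min lexx.
  have : Num.min (Num.min tau 1) (Num.min d1 d2) <= Num.min d1 d2.
    by rewrite ge_min lexx orbT.
  by rewrite !le_min => /andP[? ?] /andP[? ?]; rewrite /de; lra.
clearbody de.
have [W sW] := csol_exists (ltW de0) (Bbl (de^-1 *: q)) CX.
have pc : wpos [:: (de, de^-1 *: q)] by move=> p; rewrite inE => /eqP ->.
have deT : de \in `[0, de] by rewrite in_itv/= lexx ltW.
have CW s : s \in `[0, de] -> C (W s) by case: sW => -[+ _] _; apply.
exists [:: (de, de^-1 *: q)], (W de); split => //=.
- by rewrite addr0.
- exact: CW.
- exists W; rewrite /= addr0; split; last by rewrite subrr sn0.
  apply: csol_congr sW => //.
  + by move=> s u; exact: BC.
  + by move=> s u; exact: BC.
  + by move=> s; rewrite in_itv/= => /andP[_ ->].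
pose Z t := X + (t / de) *: D.
have CZ t : C (Z t) by rewrite /Z; cc.
have -> : X + D = Z de by rewrite /Z divff ?scale1r// gt_eqF.
have cZ : cont_on 0 de Z.
  split => // x _ e' e'0; exists (e' * de / (N D + 1)).
    by apply: divr_gt0; [exact: mulr_gt0|rewrite ltr_wpDl ?sn_ge0].
  move=> y _; rewrite ltr_pdivlMr ?ltr_wpDl ?sn_ge0// => yx.
  rewrite /Z opprD addrACA subrr add0r -scalerBl (cs_scale csN)//.
  have -> : y / de - x / de = (y - x) / de by rewrite mulrBl.
  rewrite normrM normfV (gtr0_norm de0) mulrAC ler_pdivrMr//.
  apply: le_trans (ltW yx); rewrite mulrDr lerDl mulr1//.
case: (sW) => cW dW.
have dei0 : 0 <= de^-1 by rewrite invr_ge0 ltW.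
have K0 : 0 <= de^-1 * (M * b) by rewrite !mulr_ge0.
have e20 : 0 <= eta + eta by rewrite addr_ge0// ltW.
have gr := gronwall K0 e20 (cont_on_norm_sub cW cZ) (fun t _ => sn_ge0 _) _ deT.
apply: le_trans (gr _) _; last first.
  apply: (@le_trans _ _ (2 * (eta + eta) * K1)).
    rewrite ler_wpM2l ?mulr_ge0// ler_expR mulrDl mul1r.
    have -> : 2 * (de^-1 * (M * b)) * de = 2 * (M * b) by field; rewrite gt_eqF.
    by rewrite lerD2l.
  rewrite le_eqVlt; apply/orP; left; apply/eqP; rewrite /eta; field.
  by rewrite gt_eqF.
move=> t tT; have t01 : 0 <= t <= de by move: tT; rewrite in_itv.
have sub s : `[0, t]%classic s -> s \in `[0, de].
  by move: tT; rewrite /= !in_itv/=; lra.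
have C1 s : `[0, t]%classic s -> C (S (t - s) (B (de^-1 *: q) (W s))).
  by move=> /sub/CW ?; cc.
have C2 (s : R) : `[0, t]%classic s -> C (de^-1 *: D) by move=> _; cc.
have i2 : reg_int `[0, t]%classic (fun=> de^-1 *: D) ((t / de) *: D).
  move=> e' e'0; exists [:: (`[0, t]%classic, de^-1 *: D)]; split.
  - by move=> p; rewrite inE => /eqP -> /=; split => //; cc.
  - move=> x xt; rewrite simple_eval_cons simple_eval_nil addr0/= indicE mem_set//.
    by rewrite scale1r subrr sn0 ltW.
  - rewrite /simple_integral big_seq1/= fine_lebesgue_itvcc; last by case/andP: t01.
    by rewrite subr0 scalerA subrr sn0 ltW.
have CWt := CW _ tT.
have CI1 : C (W t - S t X) by cc.
have CI2 : C ((t / de) *: D) by cc.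
apply: (@le_trans _ _ ((N (S t X - X))%:E + (N ((W t - S t X) - (t / de) *: D))%:E)%E).
  rewrite -EFinD lee_fin (_ : W t - Z t = (S t X - X) + (W t - S t X - (t / de) *: D)).
    by apply: snD; cc.
  by rewrite /Z opprD addrA [RHS]addrC [RHS]addrAC subrKA.
have StX : N (S t X - X) <= eta.
  by apply: h1; rewrite ger0_norm; lra.
apply: (@le_trans _ _ (eta%:E + (eta%:E + \int[leb]_(s in `[0%R, t]) (de^-1 * (M * b) * N (W s - Z s))%:E)))%E.
  apply: leeD; first by rewrite lee_fin.
  have mN : measurable_fun `[0, t]%classic (fun s => N (W s - Z s)).
    apply: subspace_continuous_measurable_fun => //.
    by apply: continuous_subspaceW (cont_on_norm_sub cW cZ) => s /= /sub.
  apply: le_trans (bochner_dist (h := fun s => de^-1 * eta + de^-1 * (M * b) * N (W s - Z s))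
    (measurable_itv _) (lebesgue_itvcc_lty _ _) C1 C2 CI1 CI2
    (reg_int_bochner (measurable_itv _) (lebesgue_itvcc_lty _ _) C1 (dW _ tT))
    (reg_int_bochner (measurable_itv _) (lebesgue_itvcc_lty _ _) C2 i2) _ _) _.
  - by apply: measurable_funD => //; exact: measurable_funM.
  - move=> s st; have Cs := CW _ (sub _ st).
    have st01 : 0 <= s <= t by move: st; rewrite /= in_itv.
    rewrite BZ; set y := B q (W s); have Cy : C y by exact: BC.
    have -> : N (S (t - s) (de^-1 *: y) - de^-1 *: D) = N (de^-1 *: S (t - s) y - de^-1 *: D).
      by apply: sn_eq_sub; cc; [exact: (blZ (S_bl _))|rewrite subrr sn0].
    rewrite -scalerBr (cs_scale csN); cc.
    rewrite (ger0_norm dei0) -[de^-1 * (M * b) * _]mulrA -mulrDr.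
    rewrite ler_wpM2l//.
    apply: le_trans (sn_dist (v := S (t - s) D) _ _ _) _; cc.
    rewrite addrC; apply: lerD; first by apply: h2; rewrite ger0_norm; lra.
    rewrite (bl_distE (S_bl _)); cc; apply: le_trans (hM _ _ _ _) _; cc.
      by rewrite ger0_norm; lra.
    rewrite -mulrA ler_wpM2l//.
    have -> : y - D = (s / de) *: B q D + B q (W s - Z s).
      rewrite -Blin -BB; congr (B q _).
      by rewrite /Z opprD [W s + (_ - _)]addrA [RHS]addrC subrK.
    apply: le_trans (snD _ _) _; cc.
    by rewrite (cs_scale csN) ?Bnil ?mulr0 ?add0r; cc; apply: hb; cc.
  - under eq_integral do rewrite EFinD.
    rewrite ge0_integralD//; last 3 first.
    - by move=> s _; rewrite lee_fin mulr_ge0// ltW.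
    - by move=> s _; rewrite lee_fin mulr_ge0 ?sn_ge0.
    - by apply/measurable_EFinP; exact: measurable_funM.
    rewrite leeD2r//.
    apply: le_trans (int_le_cst (f := fun=> de^-1 * eta) (e := de^-1 * eta)
      (measurable_itv _) (lebesgue_itvcc_lty _ _) _ _) _ => //.
      by move=> x _; rewrite lexx andbT mulr_ge0// ltW.
    rewrite fine_lebesgue_itvcc; last by case/andP: t01.
    rewrite subr0 lee_fin mulrAC ler_piMl ?(ltW eta0)// mulrC ler_pdivrMr// mul1r.
    by case/andP: t01.
by rewrite addeA -EFinD.
Qed.

End control.

End group.

(** * A generator determines its group *)

Section generator.
Variable (A : V -> V -> Prop) (S S' : R -> V -> V).
Hypothesis gS : generates C N A S.
Hypothesis gS' : generates C N A S'.
Hypothesis bS : forall T, exists2 M, 0 <= M &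
  forall t u, `|t| <= T -> C u -> N (S t u) <= M * N u.

Lemma generates_eps S0 u v : generates C N A S0 -> C u -> C v ->
  (forall e, 0 < e -> exists2 d, 0 < d & forall h, h != 0 -> `|h| < d ->
     N (h^-1 *: (S0 h u - u) - v) <= e) <-> A u v.
Proof.
move=> [_ g] Cu Cv; rewrite -g//; split=> [h|/cvgrPdist_le h e /h].
  apply/cvgrPdist_le => e /h[d d0 {}h].
  exists d => // x; rewrite /= sub0r normrN => xd x0.
  by rewrite sub0r normrN ger0_norm ?sn_ge0// h.
move=> [d d0 {}h]; exists d => // x x0 xd.
have := h x; rewrite /= sub0r normrN => /(_ xd x0).
by rewrite sub0r normrN ger0_norm ?sn_ge0.
Qed.

(** The path f(s) = S(-s) S'(s) u has zero derivative, hence is constant up to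
    vectors of seminorm 0. *)
Lemma generator_group_eq_dom t u v : C u -> C v -> A u v -> N (S' t u - S t u) = 0.
Proof.
move=> Cu Cv Auv.
have scg := gS.1; have scg' := gS'.1.
have CS s x : C x -> C (S s x) by exact: S_C.
have CS' s x : C x -> C (S' s x) by exact: S_C.
pose f s := S (- s) (S' s u).
have Cf s : C (f s) by apply/CS/CS'.
(* the orbit of u under S' stays in the domain, where both groups have the
   same derivative *)
have dom s : A (S' s u) (S' s v).
  apply/(generates_eps gS'); [exact: CS'..|] => e e0.
  have [M M0 hM] := bl_bound (S_bl scg' s).
  have M1 : 0 < M + 1 by rewrite ltr_wpDl.
  have [d d0 h] := (generates_eps gS' Cu Cv).2 Auv _ (divr_gt0 e0 M1).
  exists d => // x x0 xd; have {h} := h x x0 xd => h.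
  have Cx : C (x^-1 *: (S' x u - u)) by apply/csZ/csB => //; exact: CS'.
  have eq1 : N (S' s (x^-1 *: (S' x u - u)) - x^-1 *: (S' x (S' s u) - S' s u)) = 0.
    have CD : C (S' x u - u) by apply: csB => //; exact: CS'.
    apply: (@sn_eq_trans (x^-1 *: S' s (S' x u - u))).
    - exact: CS'.
    - by apply/csZ/CS'.
    - by apply/csZ/csB; [exact/CS'/CS'|exact: CS'].
    - exact: (blZ (S_bl scg' s)).
    rewrite -scalerBr (cs_scale csN); last first.
      by apply: csB; [exact: CS'|apply: csB; [exact/CS'/CS'|exact: CS']].
    suff -> : N (S' s (S' x u - u) - (S' x (S' s u) - S' s u)) = 0 by rewrite mulr0.
    apply: (@sn_eq_trans (S' s (S' x u) - S' s u)).
    - exact: CS'.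
    - by apply: csB; [exact/CS'/CS'|exact: CS'].
    - by apply: csB; [exact/CS'/CS'|exact: CS'].
    - by apply: (blB (S_bl scg' s)) => //; exact: CS'.
    rewrite opprB subrKA.
    apply: (@sn_eq_trans (S' (s + x) u)); try (by exact/CS'/CS'); try exact: CS'.
      by rewrite snC; [exact: (S_add scg')|exact/CS'/CS'|exact: CS'].
    by rewrite [s + x]addrC; exact: (S_add scg').
  rewrite -(sn_eq_sub (u := S' s (x^-1 *: (S' x u - u))) (v := S' s v)) //; last 5 first.
  - exact: CS'.
  - exact: CS'.
  - by apply/csZ/csB; [exact/CS'/CS'|exact: CS'].
  - exact: CS'.
  - by rewrite subrr sn0.
  rewrite (bl_distE (S_bl scg' s))//; apply: le_trans (hM _ (csB Cx Cv)) _.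
  apply: le_trans (ler_wpM2l M0 h) _.
  by rewrite mulrCA ger_pMr// ler_pdivrMr// mul1r lerDl.
have key s e : 0 < e -> exists2 d, 0 < d & forall h, `|h| < d ->
    N (f (h + s) - f s) <= e * `|h|.
  move=> e0; set y := S' s u; have Cy : C y by exact: CS'.
  have Cy' : C (S' s v) by exact: CS'.
  have [M M0 hM] := bS (`|s| + 1).
  have M1 : 0 < M + 1 by rewrite ltr_wpDl.
  have e1 : 0 < e / 2 / (M + 1) by rewrite !divr_gt0.
  have [d1 d10 h1] := (generates_eps gS Cy Cy').2 (dom s) _ e1.
  have [d2 d20 h2] := (generates_eps gS' Cy Cy').2 (dom s) _ e1.
  exists (Num.min 1 (Num.min d1 d2)); first by rewrite !lt_min ltr01 d10.
  move=> x; rewrite !lt_min => /and3P[x1 xd1 xd2].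
  have -> : N (f (x + s) - f s) = N (S (- (x + s)) (S' x y) - S (- (x + s)) (S x y)).
    apply: sn_eq_sub => //; [exact/CS/CS'|exact/CS/CS|..].
      apply: (bl_eq (S_bl scg _)); [exact: CS'|exact: CS'|exact: (S_add scg')].
    by have := S_add scg (- (x + s)) x Cy; rewrite opprD addrAC addNr add0r.
  rewrite (bl_distE (S_bl scg _)); [|exact: CS'|exact: CS].
  apply: le_trans (hM _ _ _ _) _.
  - rewrite normrN; apply: le_trans (ler_normD _ _) _.
    by rewrite addrC lerD2l ltW.
  - by apply: csB; [exact: CS'|exact: CS].
  have [->|x0] := eqVneq x 0.
    suff -> : N (S' 0 y - S 0 y) = 0 by rewrite mulr0 normr0 mulr0.
    apply: (@sn_eq_trans y); [exact: CS'|by []|exact: CS|exact: (S_0 scg')|].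
    by rewrite snC//; [exact: (S_0 scg)|exact: CS].
  have n0 : 0 < `|x| by rewrite normr_gt0.
  have k1 := h1 x x0 xd1; have k2 := h2 x x0 xd2.
  have C1 : C (x^-1 *: (S x y - y)) by apply/csZ/csB => //; exact: CS.
  have C2 : C (x^-1 *: (S' x y - y)) by apply/csZ/csB => //; exact: CS'.
  have := sn_dist C2 Cy' C1; rewrite [N (S' s v - _)]snC// -scalerBr opprB subrKA => k3.
  have {}k3 : N (x^-1 *: (S' x y - S x y)) <= e / (M + 1).
    by apply: le_trans k3 _; lra.
  move: k3; rewrite (cs_scale csN); last by apply: csB; [exact: CS'|exact: CS].
  rewrite normfV ler_pdivrMl// => k3.
  apply: le_trans (ler_wpM2l M0 k3) _.
  rewrite mulrCA [leRHS]mulrC ler_wpM2l//.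
  by rewrite mulrCA ger_pMr// ler_pdivrMr// mul1r lerDl.
pose phi s := N (f s - f 0).
have dphi s : is_derive s (1 : R) phi 0.
  have cv : (fun h => h^-1 *: (phi (h *: 1 + s) - phi s)) @ (0 : R)^' --> (0 : R).
    apply/cvgrPdist_le => e e0; have [d d0 h] := key s e e0.
    exists d => // x; rewrite /= sub0r normrN => xd x0; rewrite sub0r normrN.
    rewrite /GRing.scale/= mulr1 normrM normfV ler_pdivrMl ?normr_gt0// [leRHS]mulrC.
    apply: le_trans (sn_diff _ _) _; [exact: csB..|].
    by rewrite opprB subrKA; exact: h.
  by apply: DeriveDef; [apply/cvg_ex; exists 0|apply/cvg_lim].
have := is_derive_0_is_cst t 0 dphi; rewrite {2}/phi subrr sn0 /phi => ft.
have f0 : N (f 0 - u) = 0.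
  apply: (@sn_eq_trans (S' 0 u)) => //; [exact: CS'| |exact: (S_0 scg')].
  by rewrite /f oppr0; apply: (S_0 scg); exact: CS'.
have fu : N (f t - u) = 0 by exact: (sn_eq_trans _ _ _ ft f0).
have := bl_eq (S_bl scg t) (Cf t) Cu fu => E.
apply: sn_eq_trans E; [exact: CS'|exact: CS|exact: CS|].
apply: (@sn_eq_trans (S 0 (S' t u))); [exact: CS'|by apply/CS/CS'|exact: CS| |].
  by rewrite snC; [exact: (S_0 scg) (CS' t u Cu)|exact: CS'|by apply/CS/CS'].
by have := S_add scg t (- t) (CS' t u Cu); rewrite subrr.
Qed.

(** Both operators are bounded and agree on the domain of the generator, which
    is dense. *)
Lemma generator_group_eq t u : C u ->
  (forall e, 0 < e -> exists u' v', [/\ C u', C v', A u' v' & N (u - u') <= e]) ->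
  N (S' t u - S t u) = 0.
Proof.
move=> Cu dense; have scg := gS.1; have scg' := gS'.1.
have CS s x : C x -> C (S s x) by exact: S_C.
have CS' s x : C x -> C (S' s x) by exact: S_C.
have [M M0 hM] := bl_bound (S_bl scg t); have [M' M'0 hM'] := bl_bound (S_bl scg' t).
apply/eqP; rewrite eq_le sn_ge0 andbT; apply/ler_addgt0Pr => e e0; rewrite add0r.
have K : 0 < M + M' + 1 by rewrite ltr_wpDl// addr_ge0.
have [u' [v' [Cu' Cv' Auv uu]]] := dense _ (divr_gt0 e0 K).
have k1 := sn_dist (CS' t _ Cu) (CS' t _ Cu') (CS t _ Cu).
have k2 := sn_dist (CS' t _ Cu') (CS t _ Cu') (CS t _ Cu).
rewrite (generator_group_eq_dom t Cu' Cv' Auv) add0r in k2.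
rewrite (bl_distE (S_bl scg' t)) // in k1; rewrite snC in k2; [|exact: CS'|exact: CS].
rewrite [N (S t u' - S t u)]snC in k2; [|exact: CS|exact: CS].
rewrite (bl_distE (S_bl scg t)) // in k2.
have l1 := hM' _ (csB Cu Cu'); have l2 := hM _ (csB Cu Cu').
have k2' : N (S' t u' - S t u) <= M * N (u - u').
  by apply: le_trans l2; rewrite snC; [exact: k2|exact: CS'|exact: CS].
apply: le_trans k1 _; apply: (@le_trans _ _ ((M + M' + 1) * N (u - u'))).
  by have := sn_ge0 (u - u'); nra.
by apply: le_trans (ler_wpM2l (ltW K) uu) _; rewrite mulrC divfK// gt_eqF.
Qed.

End generator.

End seminorm.

(** * Square integrable functions on a finite measure space *)

Section square_integrable.
Context {d} {T : measurableType d} {R : realType}.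
Variable mu : {finite_measure set T -> \bar R}.
Implicit Types f g h : T -> R.

Definition sqint f := measurable_fun setT f /\
  mu.-integrable setT (EFin \o (fun x => f x ^+ 2)).

Lemma Lfun2P f : f \in Lfun mu 2%:E <-> sqint f.
Proof.
split=> [l2f|[mf /integrableP[_ if2]]].
  by split; [by move: l2f; rewrite inE => /andP[]; rewrite inE|exact: Lfun2_integrable_sqr].
rewrite inE/=; apply/andP; split; rewrite inE//=.
rewrite /finite_norm unlock poweR_lty//.
apply: le_lt_trans if2; rewrite le_eqVlt; apply/orP; left; apply/eqP.
apply: eq_integral => x _; rewrite /= powR_mulrn// normrX.
by [].
Qed.

Definition ip f g : R := \int[mu]_x (f x * g x).

Lemma sqint_ip f : sqint f -> (\int[mu]_x ((f x ^+ 2)%:E) = (ip f f)%:E)%E.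
Proof.
move=> [mf if2]; rewrite /ip /Rintegral fineK//.
by apply: integrable_fin_num.
Qed.

Lemma Lnorm2E f : sqint f -> fine ('N[mu]_2%:E[EFin \o f])%E = Num.sqrt (ip f f).
Proof.
move=> sf; rewrite unlock.
under eq_integral => x _ do rewrite /= powR_mulrn//.
rewrite (eq_integral (fun x => (f x ^+ 2)%:E)); last first.
  by move=> x _; rewrite real_normK// num_real.
rewrite sqint_ip//= powR12_sqrt// /ip.
by apply: Rintegral_ge0 => x _; rewrite -expr2 sqr_ge0.
Qed.

Lemma sqint_mul f g : sqint f -> sqint g -> mu.-integrable setT (EFin \o (f \* g)).
Proof.
move=> /Lfun2P sf /Lfun2P sg; apply/Lfun1_integrable.
exact: Lfun2_mul_Lfun1.
Qed.

Lemma integrableZ (a : R) f : mu.-integrable setT (EFin \o f) ->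
  mu.-integrable setT (EFin \o (fun x => a * f x)).
Proof. by move=> h; have := integrableZl measurableT a h. Qed.

Lemma integrableA f g : mu.-integrable setT (EFin \o f) ->
  mu.-integrable setT (EFin \o g) -> mu.-integrable setT (EFin \o (fun x => f x + g x)).
Proof. by move=> h k; have := integrableD measurableT h k. Qed.

Lemma sqint_lin a f g : sqint f -> sqint g -> sqint (fun x => a * f x + g x).
Proof.
move=> sf sg; have [[mf if2] [mg ig2]] := (sf, sg).
split; first by apply: measurable_funD => //; exact: measurable_funM.
rewrite (_ : (fun x => (a * f x + g x) ^+ 2) = fun x => a ^+ 2 * (f x ^+ 2) +
    ((2 * a) * (f x * g x) + g x ^+ 2)); last by apply/funext => x; ring.
apply: integrableA; first exact: integrableZ.
by apply: integrableA => //; apply: integrableZ; exact: sqint_mul.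
Qed.

Lemma sqint_bounded f (M : R) : measurable_fun setT f ->
  (forall x, `|f x| <= M) -> sqint f.
Proof.
move=> mf fM; split => //; apply: measurable_bounded_integrable => //.
- by rewrite ltey_eq fin_num_measure.
- exact: measurable_funX.
- exists (M ^+ 2); split; first exact: num_real.
  move=> y My x _; apply: le_trans (ltW My).
  by rewrite normrX lerXn2r// ?nnegrE// (le_trans _ (fM x)).
Qed.

Lemma sqint_mul_bounded f g (M : R) : measurable_fun setT g ->
  (forall x, `|g x| <= M) -> sqint f -> sqint (fun x => g x * f x).
Proof.
move=> mg gM [mf if2]; split; first exact: measurable_funM.
apply: (le_integrable measurableT _ _ (integrableZ (M ^+ 2) if2)).
  by apply/measurable_EFinP; apply: measurable_funX; exact: measurable_funM.
move=> x _; rewrite lee_fin exprMn normrM [leRHS]normrM.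
rewrite ler_wpM2r// !normrX lerXn2r// ?nnegrE//.
exact: le_trans (gM x) (ler_norm _).
Qed.

Lemma ipC f g : ip f g = ip g f.
Proof. by apply: eq_Rintegral => x _; rewrite mulrC. Qed.

Lemma ipDl a f g h : sqint f -> sqint g -> sqint h ->
  ip (fun x => a * f x + g x) h = a * ip f h + ip g h.
Proof.
move=> sf sg sh; have ifh := sqint_mul sf sh.
rewrite /ip -RintegralZl// -RintegralD//; first by apply: eq_Rintegral => x _; ring.
- exact: integrableZ.
- exact: sqint_mul.
Qed.

Lemma ip_ge0 f : 0 <= ip f f.
Proof. by apply: Rintegral_ge0 => x _; rewrite -expr2 sqr_ge0. Qed.

Lemma ip_expand a f g : sqint f -> sqint g ->
  ip (fun x => a * f x + g x) (fun x => a * f x + g x) =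
  a ^+ 2 * ip f f + 2 * a * ip f g + ip g g.
Proof.
move=> sf sg; have sfg := sqint_lin a sf sg.
rewrite ipDl// [ip f (fun _ => _)]ipC [ip g (fun _ => _)]ipC !ipDl// [ip g f]ipC; ring.
Qed.

(** A sequence whose squared increments are summable against 2^k converges;
    the bound on the limit comes from the Cauchy-Schwarz inequality. *)
Lemma weighted_increments_cvg (u : nat -> R) (G : R) :
  (forall n, \sum_(k < n) 2 ^+ k * (u k.+1 - u k) ^+ 2 <= G) ->
  cvgn u /\ forall n, (limn u - u n) ^+ 2 <= 2 * 2^-1 ^+ n * G.
Proof.
move=> hG.
have g0 n : 0 < (2^-1 : R) ^+ n by rewrite exprn_gt0// invr_gt0.
have G0 : 0 <= G by have := hG 0%N; rewrite big_ord0.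
have tail n m : \sum_(k < m) 2 ^+ (k + n) * (u (k + n).+1 - u (k + n)%N) ^+ 2 <= G.
  apply: le_trans (hG (n + m)%N); rewrite big_split_ord/=.
  under eq_bigr do rewrite addnC.
  by rewrite lerDr sumr_ge0// => i _; rewrite mulr_ge0 ?sqr_ge0// exprn_ge0.
have key n m : (u (m + n)%N - u n) ^+ 2 <=
   (\sum_(k < m) 2^-1 ^+ (k + n)) * \sum_(k < m) 2 ^+ (k + n) * (u (k + n).+1 - u (k + n)%N) ^+ 2.
  elim: m => [|m ih]; first by rewrite subrr expr0n/= !big_ord0 mul0r.
  rewrite !big_ord_recr/=.
  set A := \sum_(k < m) _ in ih *; set D := \sum_(k < m) _ in ih *.
  set x := u (m + n)%N - u n in ih *; set y := u (m + n).+1 - u (m + n)%N.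
  have -> : u (m.+1 + n)%N - u n = x + y by rewrite addSn /x /y [RHS]addrC subrKA.
  set p := 2^-1 ^+ (m + n); have p0 : 0 < p by exact: g0.
  have -> : (2 : R) ^+ (m + n) = p^-1 by rewrite /p exprVn invrK.
  have A0 : 0 <= A by rewrite sumr_ge0// => i _; rewrite ltW.
  have D0 : 0 <= D by rewrite sumr_ge0// => i _; rewrite mulr_ge0 ?sqr_ge0// exprn_ge0.
  have -> : (A + p) * (D + p^-1 * y ^+ 2) =
      A * D + p * D + A * p^-1 * y ^+ 2 + y ^+ 2 by field; rewrite gt_eqF.
  have h1 : 2 * (x * y) <= p * D + A * p^-1 * y ^+ 2.
    (* x^2 <= A D by induction; then the arithmetic-geometric mean inequality *)
    have P0 : 0 <= p * D + A * p^-1 * y ^+ 2.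
      by rewrite addr_ge0// mulr_ge0 ?sqr_ge0// ?mulr_ge0// ?invr_ge0// ltW.
    apply: le_trans (ler_norm _) _; rewrite -ler_sqr ?nnegrE//.
    rewrite -normrX ger0_norm ?sqr_ge0//.
    have -> : (2 * (x * y)) ^+ 2 = 4 * y ^+ 2 * x ^+ 2 by ring.
    apply: (@le_trans _ _ (4 * y ^+ 2 * (A * D))).
      by rewrite ler_wpM2l// mulr_ge0// sqr_ge0.
    rewrite -subr_ge0.
    have -> : (p * D + A / p * y ^+ 2) ^+ 2 - 4 * y ^+ 2 * (A * D) =
      (p * D - A / p * y ^+ 2) ^+ 2 by field; rewrite gt_eqF.
    exact: sqr_ge0.
  have -> : (x + y) ^+ 2 = x ^+ 2 + 2 * (x * y) + y ^+ 2 by ring.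
  by lra.
have geo n m : \sum_(k < m) (2^-1 : R) ^+ (k + n) <= 2 * 2^-1 ^+ n.
  suff -> : \sum_(k < m) (2^-1 : R) ^+ (k + n) = 2 * 2^-1 ^+ n * (1 - 2^-1 ^+ m).
    by have := g0 n; have := g0 m; nra.
  elim: m => [|m ih]; first by rewrite big_ord0 expr0 subrr mulr0.
  by rewrite big_ord_recr/= ih exprD exprS; field.
have bnd n m : (u (m + n)%N - u n) ^+ 2 <= 2 * 2^-1 ^+ n * G.
  apply: le_trans (key n m) _; apply: ler_pM => //.
    by rewrite sumr_ge0// => i _; rewrite ltW.
  by rewrite sumr_ge0// => i _; rewrite mulr_ge0 ?sqr_ge0// exprn_ge0.
have cv : cvgn u.
  apply/cauchy_cvgP/cauchy_exP => e e0.
  have [n hn] := geometric_small (2 * G) (exprn_gt0 2 (divr_gt0 e0 (ltr0Sn _ 1))).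
  exists (u n), n => // m /= nm; rewrite /ball/= distrC -(subnK nm).
  apply: (@le_lt_trans _ _ (e / 2)); last by lra.
  rewrite -ler_sqr ?nnegrE//; last by lra.
  by rewrite -normrX ger0_norm ?sqr_ge0//; apply: le_trans (bnd _ _) _; lra.
split => // n.
have c1 : (fun m => u (m + n)%N - u n) @ \oo --> limn u - u n.
  by apply: cvgB; [rewrite (@cvg_shiftn n _ u)|exact: cvg_cst].
have c2 := @cvgM _ _ _ eventually_filter _ _ _ _ c1 c1; rewrite expr2.
rewrite -(cvg_lim _ c2)//; apply: limr_le; first by apply/cvg_ex; eexists; exact: c2.
by apply: nearW => m /=; rewrite -expr2; exact: bnd.
Qed.


(** The sum over k of 2^k |f_{k+1} - f_k|^2 has a finite integral, so that it
    is finite almost everywhere. Where it is finite the sequence converges, at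
    a rate that can be integrated. *)
Lemma L2_fast_complete (f : nat -> T -> R) : (forall n, sqint (f n)) ->
  (forall n, ip (fun x => f n.+1 x - f n x) (fun x => f n.+1 x - f n x) <= 4^-1 ^+ n) ->
  exists2 F, sqint F &
    forall n, ip (fun x => f n x - F x) (fun x => f n x - F x) <= 4 * 2^-1 ^+ n.
Proof.
move=> sf hf.
have sd n : sqint (fun x => f n.+1 x - f n x).
  rewrite (_ : (fun x => _) = fun x => (-1) * f n x + f n.+1 x); first exact: sqint_lin.
  by apply/funext => x; rewrite mulN1r addrC.
pose t k x : \bar R := (2 ^+ k * (f k.+1 x - f k x) ^+ 2)%:E.
have t0 k x : (0 <= t k x)%E by rewrite lee_fin mulr_ge0 ?sqr_ge0// exprn_ge0.
have mt k : measurable_fun setT (t k).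
  apply/measurable_EFinP; apply: measurable_funM => //; apply: measurable_funX.
  by have [] := sd k.
pose g x := (\sum_(0 <= k <oo) t k x)%E.
have mg : measurable_fun setT g by apply: ge0_emeasurable_sum.
have g_ge0 x : (0 <= g x)%E by apply: nneseries_ge0 => *; exact: t0.
have ig : (\int[mu]_x g x <= 2%:E)%E.
  rewrite /g integral_nneseries//.
  apply: lime_le; first by apply: is_cvg_nneseries => n _ _; apply: integral_ge0 => x _; exact: t0.
  apply: nearW => n.
  apply: (@le_trans _ _ (\sum_(0 <= k < n) (2^-1 ^+ k)%:E)%E).
    apply: lee_sum => k _.
    under eq_integral do rewrite /t EFinM.
    rewrite ge0_integralZl//; last 2 first.
    - by apply/measurable_EFinP; apply: measurable_funX; have [] := sd k.
    - by move=> x _; rewrite lee_fin sqr_ge0.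
    rewrite sqint_ip// -EFinM lee_fin.
    have -> : (2^-1 : R) ^+ k = 2 ^+ k * 4^-1 ^+ k.
      by rewrite -exprMn; congr (_ ^+ _); field.
    by rewrite ler_wpM2l ?exprn_ge0.
  rewrite sumEFin lee_fin big_mkord.
  have -> : \sum_(k < n) (2^-1 : R) ^+ k = 2 * (1 - 2^-1 ^+ n).
    elim: n => [|n ih]; first by rewrite big_ord0 expr0 subrr mulr0.
    by rewrite big_ord_recr/= ih exprS; field.
  have : 0 <= (2^-1 : R) ^+ n by rewrite exprn_ge0// invr_ge0.
  by lra.
pose E := [set x | (g x < +oo)%E].
have mE : measurable E.
  rewrite -[E]setTI; exact: emeasurable_fun_infty_o.
(* replaced by 0 outside E, the sequence converges everywhere *)
pose h n x := f n x * \1_E x.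
have hE x : E x -> cvgn (h^~ x) /\ forall n, (limn (h^~ x) - h n x) ^+ 2 <= 2 * 2^-1 ^+ n * fine (g x).
  move=> Ex; apply: weighted_increments_cvg => n.
  rewrite -lee_fin fineK ?ge0_fin_numE//.
  apply: le_trans (nneseries_lim_ge n _) => //.
  rewrite -sumEFin big_mkord le_eqVlt; apply/orP; left; apply/eqP.
  by apply: eq_bigr => k _; rewrite /t /h indicE mem_set// !mulr1.
have nE x : ~ E x -> h^~ x = fun=> 0.
  by move=> Ex; apply/funext => n; rewrite /h indicE memNset// mulr0.
pose F x := limn (h^~ x).
have cF x : h n x @[n --> \oo] --> F x.
  have [/hE[]//|/nE E0] := pselect (E x).
  by rewrite /F E0 lim_cst//; exact: cvg_cst.
have mF : measurable_fun setT F.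
  apply: (@measurable_fun_cvg _ _ _ _ h) => // n.
  by apply: measurable_funM; [have [] := sf n|exact: measurable_indic].
have bnd n x : (((f n x - F x) ^+ 2)%:E <= (2 * 2^-1 ^+ n)%:E * g x)%E.
  have [Ex|Ex] := pselect (E x).
    have hnE : h n x = f n x by rewrite /h indicE mem_set// mulr1.
    have [_ /(_ n)] := hE _ Ex; rewrite hnE -/(F x).
    rewrite -[g x]fineK ?ge0_fin_numE// -EFinM lee_fin; apply: le_trans.
    by rewrite -sqrrN opprB.
  have -> : g x = +oo%E by apply/eqP; move/negP: Ex; rewrite -leNgt leye_eq.
  by rewrite gt0_muley ?leey// lte_fin mulr_gt0// exprn_gt0// invr_gt0.
have md n : measurable_fun setT (fun x => f n x - F x).
  by apply: measurable_funB => //; have [] := sf n.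
have int n : (\int[mu]_x ((f n x - F x) ^+ 2)%:E <= (4 * 2^-1 ^+ n)%:E)%E.
  apply: (@le_trans _ _ (\int[mu]_x ((2 * 2^-1 ^+ n)%:E * g x))%E).
    apply: ge0_le_integral => //.
    - by move=> x _; rewrite lee_fin sqr_ge0.
    - by apply/measurable_EFinP; exact: measurable_funX.
    - by apply: emeasurable_funM => //; exact: measurable_cst.
  have q0 : 0 <= 2 * (2^-1 : R) ^+ n by rewrite mulr_ge0// exprn_ge0// invr_ge0.
  rewrite ge0_integralZl//.
  apply: le_trans (lee_wpmul2l _ ig) _; first by rewrite lee_fin.
  by rewrite -EFinM lee_fin; lra.
have sdF n : sqint (fun x => f n x - F x).
  split => //; apply/integrableP; split.
    by apply/measurable_EFinP; exact: measurable_funX.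
  under eq_integral => x _ do rewrite /= ger0_norm ?sqr_ge0//.
  by apply: le_lt_trans (int n) _; rewrite ltry.
exists F.
  rewrite (_ : F = fun x => (-1) * (f 0%N x - F x) + f 0%N x); first exact: sqint_lin.
  by apply/funext => x; rewrite mulN1r opprB subrK.
by move=> n; rewrite -lee_fin -sqint_ip.
Qed.

End square_integrable.

(** * Integration over the torus *)

Section circle.
Context {R : realType}.
Local Notation circ := (@circle_measure R).

Lemma circle_measureE A : measurable A -> A `<=` [set` @period R] ->
  circ A = lebesgue_measure A.
Proof. by move=> mA AP; rewrite /circle_measure /mfrestr /mrestr setIidl. Qed.

Lemma circle_measure_out : circ (~` [set` @period R]) = 0%E.
Proof. by rewrite /circle_measure /mfrestr /mrestr setICl measure0. Qed.

Lemma circle_measure_set1 (a : R) : circ [set a] = 0%E.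
Proof.
apply/eqP; rewrite eq_le measure_ge0 andbT -(@lebesgue_measure_set1 R a).
by apply: le_measure; rewrite ?inE//; exact: measurableI.
Qed.

Lemma Rintegral_circle (f : R -> R) : circ.-integrable setT (EFin \o f) ->
  \int[circ]_x f x = \int[lebesgue_measure]_(x in [set` @period R]) f x.
Proof.
move=> intf; rewrite /Rintegral; congr fine.
transitivity (\int[circ]_(x in setT `\` (~` [set` @period R])) (f x)%:E)%E.
  apply: negligible_integral => //; [exact: measurableC|exact: circle_measure_out].
rewrite setDE setCK setTI; apply: eq_measure_integral => A mA AP.
exact: circle_measureE.
Qed.

Lemma cos_sin_int2pi (n : int) :
  cos (n%:~R * (2 * pi) : R) = 1 /\ sin (n%:~R * (2 * pi) : R) = 0.
Proof.
have h (m : nat) : cos (m%:R * (2 * pi) : R) = 1 /\ sin (m%:R * (2 * pi) : R) = 0.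
  elim: m => [|m [c s]]; first by rewrite mul0r cos0 sin0.
  rewrite -natr1 mulrDl mul1r cosD sinD c s.
  by rewrite !mulrDl !mul1r -mulr2n cos2pi sin2pi !mul0r subr0 addr0.
case: n => n; first exact: h.
by have [c s] := h n.+1; rewrite NegzE mulrNz mulNr cosN sinN c s oppr0.
Qed.

Lemma continuous_integrable_circle (f : R -> R) : continuous f ->
  (exists M, forall x, `|f x| <= M) -> circ.-integrable setT (EFin \o f).
Proof.
move=> cf [M fM]; apply: measurable_bounded_integrable => //.
- by rewrite ltey_eq fin_num_measure.
- exact: continuous_measurable_fun.
- exists M; split; first exact: num_real.
  by move=> y My x _; apply: le_trans (ltW My).
Qed.

Lemma is_derive_sinM (l x : R) : l != 0 ->
  is_derive x (1 : R) (fun x : R => sin (l * x) / l) (cos (l * x)).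
Proof.
move=> l0; apply: is_derive_eq; rewrite scaler0 add0r /GRing.scale/= mulr1.
by rewrite mulrCA mulVf// mulr1.
Qed.

Lemma is_derive_cosM (l x : R) : l != 0 ->
  is_derive x (1 : R) (fun x : R => - cos (l * x) / l) (sin (l * x)).
Proof.
move=> l0; apply: is_derive_eq; rewrite scaler0 add0r /GRing.scale/= mulr1.
by rewrite mulNr opprK mulrCA mulVf// mulr1.
Qed.

Lemma integral_circle_trig (n : int) :
  \int[circ]_x cos (n%:~R * x) = (n == 0)%:R * (2 * pi) /\
  \int[circ]_x sin (n%:~R * x) = 0.
Proof.
have bc (f : R -> R) : continuous f -> continuous (fun x : R => f (n%:~R * x)).
  move=> cf x; apply: (@continuous_comp R R R (fun x : R => n%:~R * x : R) f); last exact: cf.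
  exact: mulrl_continuous.
have cc := bc _ (@continuous_cos R); have cs := bc _ (@continuous_sin R).
have ic : circ.-integrable setT (EFin \o (fun x => cos (n%:~R * x))).
  apply: continuous_integrable_circle => //.
  by exists 1 => x; rewrite ler_norml cos_geN1 cos_le1.
have isn : circ.-integrable setT (EFin \o (fun x => sin (n%:~R * x))).
  apply: continuous_integrable_circle => //.
  by exists 1 => x; rewrite ler_norml sin_geN1 sin_le1.
have pi20 : 0 < 2 * pi :> R by rewrite mulr_gt0// pi_gt0.
rewrite !Rintegral_circle// /period.
have [->|n0] := eqVneq n 0.
  split.
    under eq_Rintegral do rewrite mul0r cos0.
    rewrite (_ : \int[_]_(_ in _) _ = 1 * fine (lebesgue_measure `[0%R, 2 * pi[%classic));
      last exact: Rintegral_cst.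
    by rewrite lebesgue_measure_itv/= lte_fin pi20/= subr0.
  under eq_Rintegral do rewrite mul0r sin0.
  rewrite (_ : \int[_]_(_ in _) _ = 0 * fine (lebesgue_measure `[0%R, 2 * pi[%classic));
    last exact: Rintegral_cst.
  by rewrite mul0r.
have nn0 : n%:~R != 0 :> R by rewrite intr_eq0.
have [c1 s1] := cos_sin_int2pi n.
have ftc (f F : R -> R) : continuous f -> (forall x, is_derive x (1 : R) F (f x)) ->
    \int[lebesgue_measure]_(x in `[0%R, 2 * pi[) f x = F (2 * pi) - F 0.
  move=> cf dF.
  have cF : continuous F.
    by move=> x; apply: differentiable_continuous; apply/derivable1_diffP; have [] := dF x.
  rewrite /Rintegral integral_itv_bndo_bndc; last first.
    by apply/measurable_EFinP; apply: measurable_funTS; exact: continuous_measurable_fun.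
  rewrite (@continuous_FTC2 _ _ F)//.
  - by apply: continuous_subspaceT => x; exact: cf.
  - split.
    + by move=> x _; have [] := dF x.
    + by apply: cvg_at_right_filter; exact: cF.
    + by apply: cvg_at_left_filter; exact: cF.
  - by move=> x _; rewrite derive1E; have [] := dF x.
have d1 (x : R) := is_derive_sinM x nn0.
have d2 (x : R) := is_derive_cosM x nn0.
rewrite (ftc _ _ cc d1) (ftc _ _ cs d2) s1 c1 !mulr0 sin0 cos0 !mul0r !subrr.
by [].
Qed.

End circle.

Section torus_integration.
Context {R : realType}.
Local Notation circ := (@circle_measure R).
Local Notation tor d := (@torus_measure R d).

Lemma tnth_tcons0 d (p : measurableTypeR R * torus R d) : tnth (tcons p) ord0 = p.1.
Proof. by []. Qed.

Lemma tnth_tconsS d (p : measurableTypeR R * torus R d) (i : 'I_d) :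
  tnth (tcons p) (lift ord0 i) = tnth p.2 i.
Proof. exact: tnthS. Qed.

Lemma torus_measureS d A : tor d.+1 A = (circ \x tor d)%E (@tcons R d @^-1` A).
Proof. by []. Qed.

Lemma coordinate_null d (i : 'I_d) (Y : set R) : measurable Y -> circ Y = 0%E ->
  tor d [set x | Y (tnth x i)] = 0%E.
Proof.
move=> mY Y0; elim: d i => [[]//|d ih] i.
have mi (j : 'I_d) : measurable [set x : torus R d | Y (tnth x j)].
  by rewrite -[X in measurable X]setTI; exact: (@measurable_tnth _ (measurableTypeR R) d j).
rewrite torus_measureS; case: (unliftP ord0 i) => [j ->|->]; last first.
  rewrite (_ : _ @^-1` _ = Y `*` setT).
    by rewrite product_measure1E// [X in (X * _)%E](_ : _ = 0%E) ?mul0e.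
  by apply/seteqP; split => p /=; rewrite ?tnth_tcons0//; case.
rewrite (_ : _ @^-1` _ = setT `*` [set x | Y (tnth x j)]).
  rewrite product_measure1E; [|exact: measurableT|exact: (mi j)].
  by rewrite [X in (_ * X)%E](_ : _ = 0%E) ?mule0//; exact: (ih j).
by apply/seteqP; split => p /=; rewrite ?tnth_tconsS//; case.
Qed.

Lemma bounded_integrable d (f : torus R d -> R) (M : R) : measurable_fun setT f ->
  (forall x, `|f x| <= M) -> (tor d).-integrable setT (EFin \o f).
Proof.
move=> mf fM; apply: measurable_bounded_integrable => //.
- by rewrite ltey_eq fin_num_measure.
- exists M; split; first exact: num_real.
  by move=> y My x _; apply: le_trans (ltW My).
Qed.

Lemma torus_Fubini d (F : torus R d.+1 -> R) (M : R) : measurable_fun setT F ->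
  (forall x, `|F x| <= M) ->
  \int[tor d.+1]_x F x = \int[circ]_x \int[tor d]_y F (tcons (x, y)).
Proof.
move=> mF FM.
pose P := measure_function_pushforward__canonical__measure_function_Measure
    (circ \x tor d)%E (@measurable_tcons R d).
have mFt : measurable_fun setT (F \o @tcons R d).
  by apply: measurableT_comp mF _; exact: measurable_tcons.
have fin : ((circ \x tor d)%E setT < +oo)%E.
  rewrite -setXTT product_measure1E//.
  by rewrite lte_mul_pinfty// ?fin_num_measure// ltey_eq fin_num_measure.
have iFt : (circ \x tor d)%E.-integrable setT (EFin \o (F \o @tcons R d)).
  apply: measurable_bounded_integrable => //.
  - exists M; split; first exact: num_real.
    by move=> y My x _; apply: le_trans (ltW My); exact: FM.
rewrite /Rintegral; congr fine.
transitivity (\int[P]_x (F x)%:E)%E; first exact: eq_measure_integral.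
rewrite integral_pushforward//; last 2 first.
- exact: measurable_tcons.
- exact/measurable_EFinP.
rewrite -integral12_prod_meas1//.
apply: eq_integral => x _; rewrite /fubini_F/=.
rewrite fineK//; apply: integrable_fin_num => //.
apply: (@bounded_integrable _ (fun y => F (tcons (x, y))) M) => // .
apply: measurableT_comp mF _; apply: (measurableT_comp (@measurable_tcons R d)).
exact: pair1_measurable.
Qed.

End torus_integration.

(** * Frequencies and trigonometric functions *)

Section frequencies.
Context {d : nat}.
Implicit Types k l : d.-tuple int.

Definition negt k : d.-tuple int := [tuple - tnth k i | i < d].
Definition addt k l : d.-tuple int := [tuple tnth k i + tnth l i | i < d].
Definition zerot : d.-tuple int := [tuple 0 | i < d].

Lemma negtK : involutive negt.
Proof. by move=> k; apply: eq_from_tnth => i; rewrite !tnth_mktuple opprK. Qed.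

Lemma addtNt_eq0 k l : (addt k (negt l) == zerot) = (k == l).
Proof.
apply/eqP/eqP => [|->].
  move=> h; apply: eq_from_tnth => i; have := congr1 (fun t => tnth t i) h.
  by rewrite !tnth_mktuple => /eqP; rewrite subr_eq0 => /eqP.
by apply: eq_from_tnth => i; rewrite !tnth_mktuple subrr.
Qed.

Lemma addt_eq0 k l : (addt k l == zerot) = (k == negt l).
Proof. by rewrite -(addtNt_eq0 k (negt l)) negtK. Qed.

Lemma addtK k l : addt (addt k l) (negt l) = k.
Proof. by apply: eq_from_tnth => i; rewrite !tnth_mktuple addrK. Qed.

Context {R : realType}.
Implicit Types x : torus R d.

Lemma freq_dotD k l x : freq_dot (addt k l) x = freq_dot k x + freq_dot l x.
Proof.
rewrite /freq_dot -big_split; apply: eq_bigr => i _.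
by rewrite tnth_mktuple intrD mulrDl.
Qed.

Lemma freq_dotN k x : freq_dot (negt k) x = - freq_dot k x.
Proof.
rewrite /freq_dot -sumrN; apply: eq_bigr => i _.
by rewrite tnth_mktuple mulrNz mulNr.
Qed.

Lemma freq_dot0 x : freq_dot zerot x = 0.
Proof. by rewrite /freq_dot big1// => i _; rewrite tnth_mktuple mul0r. Qed.

Lemma measurable_freq_dot k : measurable_fun setT (@freq_dot R d k).
Proof.
apply: measurable_sum => i; apply: measurable_funM => //.
exact: (@measurable_tnth _ (measurableTypeR R)).
Qed.

Lemma measurable_cos_freq k : measurable_fun setT (fun x => cos (freq_dot k x)).
Proof.
apply: (measurableT_comp (continuous_measurable_fun (@continuous_cos R))).
exact: measurable_freq_dot.
Qed.

Lemma measurable_sin_freq k : measurable_fun setT (fun x => sin (freq_dot k x)).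
Proof.
apply: (measurableT_comp (continuous_measurable_fun (@continuous_sin R))).
exact: measurable_freq_dot.
Qed.

End frequencies.

Lemma freq_dot_tcons {R : realType} d (k : d.+1.-tuple int) (p : measurableTypeR R * torus R d) :
  freq_dot k (tcons p) = (tnth k ord0)%:~R * p.1 +
    freq_dot [tuple tnth k (lift ord0 i) | i < d] p.2.
Proof.
rewrite /freq_dot big_ord_recl; congr (_ + _); apply: eq_bigr => i _.
by rewrite tnth_mktuple /coordinate tnth_tconsS.
Qed.

(** By the addition formulas and Fubini's theorem the integral factors over
    the coordinates. *)
Lemma integral_trig_freq {R : realType} d (k : d.-tuple int) :
  \int[@torus_measure R d]_x cos (freq_dot k x) = (k == zerot)%:R * (2 * pi) ^+ d /\
  \int[@torus_measure R d]_x sin (freq_dot k x) = 0.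
Proof.
elim: d k => [|d ih] k.
  have fd x : @freq_dot R 0 k x = 0 by rewrite /freq_dot big_ord0.
  under eq_Rintegral do rewrite fd cos0.
  under [X in _ /\ X = _]eq_Rintegral do rewrite fd sin0.
  have -> : k == zerot by apply/eqP; rewrite tuple0 [RHS]tuple0.
  split.
    rewrite (_ : \int[_]_(_ in _) _ = 1 * fine (@torus_measure R 0 setT)); last exact: Rintegral_cst.
    have -> : @torus_measure R 0 setT = 1%E by exact: diracT.
    by rewrite expr0.
  rewrite (_ : \int[_]_(_ in _) _ = 0 * fine (@torus_measure R 0 setT)); last exact: Rintegral_cst.
  by rewrite mul0r.
set k' := [tuple tnth k (lift ord0 i) | i < d].
have [c' s'] := ih k'.
have [c1 s1] := @integral_circle_trig R (tnth k ord0).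
have ic := @bounded_integrable R d _ 1 (measurable_cos_freq k') (fun x => cos_max _).
have is' := @bounded_integrable R d _ 1 (measurable_sin_freq k') (fun x => sin_max _).
have cc (n : int) : (@circle_measure R).-integrable setT (EFin \o (fun x : R => cos (n%:~R * x))).
  apply: continuous_integrable_circle; last by exists 1 => x; exact: cos_max.
  move=> x; apply: (@continuous_comp R R R (fun x : R => n%:~R * x : R) cos); last exact: continuous_cos.
  exact: mulrl_continuous.
have cs (n : int) : (@circle_measure R).-integrable setT (EFin \o (fun x : R => sin (n%:~R * x))).
  apply: continuous_integrable_circle; last by exists 1 => x; exact: sin_max.
  move=> x; apply: (@continuous_comp R R R (fun x : R => n%:~R * x : R) sin); last exact: continuous_sin.
  exact: mulrl_continuous.
have kE : (k == zerot) = (tnth k ord0 == 0) && (k' == zerot).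
  apply/eqP/andP => [kz|[/eqP k0 /eqP k'0]].
    split; apply/eqP; first by rewrite kz tnth_mktuple.
    by apply: eq_from_tnth => i; rewrite /k' !tnth_mktuple kz tnth_mktuple.
  apply: eq_from_tnth => i; rewrite tnth_mktuple; case: (unliftP ord0 i) => [j ->|-> //].
  by have := congr1 (fun t => tnth t j) k'0; rewrite !tnth_mktuple.
split.
  rewrite (torus_Fubini (measurable_cos_freq k) (fun x => cos_max _)).
  transitivity (\int[@circle_measure R]_x ((k' == zerot)%:R * (2 * pi) ^+ d * cos ((tnth k ord0)%:~R * x))).
    apply: eq_Rintegral => x _.
    under eq_Rintegral do rewrite freq_dot_tcons cosD.
    rewrite RintegralB//=; last 2 first.
    - exact: integrableZ.
    - exact: integrableZ.
    by rewrite !RintegralZl// c' s' mulr0 subr0 mulrC.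
  by rewrite RintegralZl// c1 kE exprS; case: (_ == 0); case: (_ == zerot); rewrite /= ?mul0r ?mulr0 ?mul1r// mulrC.
rewrite (torus_Fubini (measurable_sin_freq k) (fun x => sin_max _)).
transitivity (\int[@circle_measure R]_x ((k' == zerot)%:R * (2 * pi) ^+ d * sin ((tnth k ord0)%:~R * x))).
  apply: eq_Rintegral => x _.
  under eq_Rintegral do rewrite freq_dot_tcons sinD.
  rewrite RintegralD//=; last 2 first.
  - exact: integrableZ.
  - exact: integrableZ.
  by rewrite !RintegralZl// c' s' mulr0 addr0 mulrC.
by rewrite RintegralZl// s1 mulr0.
Qed.

(** * Trigonometric polynomials *)

Section step_kernel.
Context {R : realType}.
Implicit Types t s : R.

(** Polynomials in t converging on [0, 1] to the indicator of t < 1/2, off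
    t = 1/2. They are those of Brosowski and Deutsch in their proof of the
    Stone-Weierstrass theorem; both bounds come from Bernoulli's
    inequality. *)
Definition step_kernel n t := (1 - t ^+ n) ^+ (2 ^ n).

Lemma onem_expr_ge s m : 0 <= s <= 1 -> 1 - m%:R * s <= (1 - s) ^+ m.
Proof.
move=> /andP[s0 s1]; elim: m => [|m ih]; first by rewrite mul0r subr0 expr0.
rewrite exprS -natr1; have m0 : 0 <= m%:R :> R by [].
have : 0 <= m%:R * s * s by rewrite !mulr_ge0.
have : (1 - s) * (1 - m%:R * s) <= (1 - s) * (1 - s) ^+ m.
  by rewrite ler_wpM2l// subr_ge0.
by nra.
Qed.

Lemma onem_expr_le s m : 0 <= s <= 1 -> m%:R * s * (1 - s) ^+ m <= 1.
Proof.
move=> /andP[s0 s1].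
have h : m%:R * s <= (1 + s) ^+ m.
  elim: m => [|m ih]; first by rewrite mul0r expr0.
  rewrite exprS -natr1; have : 1 <= (1 + s) ^+ m by rewrite exprn_ege1// lerDl.
  by nra.
have p0 : 0 <= (1 - s) ^+ m by rewrite exprn_ge0// subr_ge0.
apply: le_trans (ler_wpM2r p0 h) _; rewrite -exprMn exprn_ile1//; nra.
Qed.

Lemma step_kernel01 n t : 0 <= t <= 1 -> 0 <= step_kernel n t <= 1.
Proof.
move=> /andP[t0 t1]; have : t ^+ n <= 1 by rewrite exprn_ile1.
have : 0 <= t ^+ n by rewrite exprn_ge0.
by move=> a b; rewrite exprn_ge0 ?subr_ge0//= exprn_ile1//; lra.
Qed.

Lemma step_kernel_lt t : 0 <= t -> t < 1 / 2 -> step_kernel n t @[n --> \oo] --> (1 : R).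
Proof.
move=> t0 t2.
have c : 1 - (2 * t) ^+ n @[n --> \oo] --> (1 : R).
  rewrite -[X in _ --> X]subr0; apply: cvgB; first exact: cvg_cst.
  by apply: cvg_expr; rewrite ger0_norm; lra.
apply: (squeeze_cvgr _ c (cvg_cst (1 : R))); apply: nearW => n.
have t01 : 0 <= t <= 1 by lra.
have /andP[_ ->] := step_kernel01 n t01; rewrite andbT.
have := @onem_expr_ge (t ^+ n) (2 ^ n); rewrite natrX -exprMn; apply.
by rewrite exprn_ge0//= exprn_ile1//; lra.
Qed.

Lemma step_kernel_gt t : 1 / 2 < t -> t <= 1 -> step_kernel n t @[n --> \oo] --> (0 : R).
Proof.
move=> t2 t1.
have c : ((2 * t)^-1) ^+ n @[n --> \oo] --> (0 : R).
  by apply: cvg_expr; rewrite ger0_norm ?invr_ge0 ?invf_lt1; lra.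
apply: (squeeze_cvgr _ (cvg_cst (0 : R)) c); apply: nearW => n.
have t01 : 0 <= t <= 1 by lra.
have /andP[-> _] := step_kernel01 n t01.
have := @onem_expr_le (t ^+ n) (2 ^ n); rewrite natrX -exprMn => h.
rewrite exprVn -[leRHS]mul1r ler_pdivlMr ?exprn_gt0//; last by lra.
by rewrite mulrC; apply: h; rewrite exprn_ge0//= ?exprn_ile1//; lra.
Qed.

End step_kernel.

Section arcs.
Context {R : realType}.
Variables (a b x : R).
Hypothesis ab : 0 <= a /\ a < b /\ b <= 2 * pi.
Hypothesis x2pi : 0 < x < 2 * pi.

Let m := (a + b) / 2.
Let h := (b - a) / 2.

Let cos_lt (y z : R) : 0 <= y -> y < z -> z <= pi -> cos z < cos y.
Proof.
move=> y0 yz zp; rewrite ltr_cos ?in_itv/= ?y0//; lra.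
Qed.

Let cos_2piB (y : R) : cos (2 * pi - y) = cos y.
Proof.
rewrite cosB mulrDl !mul1r -mulr2n cos2pi sin2pi; ring.
Qed.

(** An arc of the circle is a superlevel set of a cosine. *)
Lemma arc_in : a < x < b -> cos h < cos (x - m).
Proof.
move=> xab; rewrite -[cos (x - m)]cos_norm; have [a0 [ab' b2]] := ab.
apply: cos_lt => //.
  by rewrite ltr_norml /m /h; lra.
by rewrite /h; lra.
Qed.

Lemma arc_out : x < a \/ b < x -> cos (x - m) < cos h.
Proof.
move=> xab; rewrite -[cos (x - m)]cos_norm; have [a0 [ab' b2]] := ab.
have hy : h < `|x - m| < 2 * pi - h.
  move: (x2pi) xab a0 ab' b2; clear.
  move=> x2 [xa|bx] a0 ab' b2; rewrite /m /h; set y := x - (a + b) / 2.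
    have y0 : y < 0 by rewrite /y; lra.
    by rewrite (ltr0_norm y0) /y; lra.
  have y0 : 0 < y by rewrite /y; lra.
  by rewrite (gtr0_norm y0) /y; lra.
have h0 : 0 <= h by rewrite /h; lra.
have [yp|yp] := leP `|x - m| pi; first by apply: cos_lt => //; lra.
by rewrite -[cos `|_|]cos_2piB; apply: cos_lt; lra.
Qed.

End arcs.

Section trig_poly.
Context {R : realType} {d : nat}.
Local Notation mu := (@torus_measure R d).
Implicit Types (f g : torus R d -> R) (k l : d.-tuple int).

Inductive trig_poly : (torus R d -> R) -> Prop :=
| trig_cos k : trig_poly (fun x => cos (freq_dot k x))
| trig_sin k : trig_poly (fun x => sin (freq_dot k x))
| trig_lin a f g : trig_poly f -> trig_poly g -> trig_poly (fun x => a * f x + g x).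

Lemma trig_eq f g : (forall x, f x = g x) -> trig_poly f -> trig_poly g.
Proof. by move=> /funext ->. Qed.

Lemma trig_zero : trig_poly (fun=> 0).
Proof.
by apply: (trig_eq _ (trig_lin (-1) (trig_cos zerot) (trig_cos zerot))) => x; ring.
Qed.

Lemma trigZ a f : trig_poly f -> trig_poly (fun x => a * f x).
Proof. by move=> tf; apply: (trig_eq _ (trig_lin a tf trig_zero)) => x; ring. Qed.

Lemma trigD f g : trig_poly f -> trig_poly g -> trig_poly (fun x => f x + g x).
Proof. by move=> tf tg; apply: (trig_eq _ (trig_lin 1 tf tg)) => x; ring. Qed.

Lemma trig_cst a : trig_poly (fun=> a).
Proof.
apply: (trig_eq _ (trigZ a (trig_cos zerot))) => x.
by rewrite freq_dot0 cos0 mulr1.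
Qed.

Lemma trig_sum (I : Type) (r : seq I) (F : I -> torus R d -> R) :
  (forall i, trig_poly (F i)) -> trig_poly (fun x => \sum_(i <- r) F i x).
Proof.
move=> tF; elim: r => [|i r ih].
  by apply: (trig_eq _ trig_zero) => x; rewrite big_nil.
by apply: (trig_eq _ (trigD (tF i) ih)) => x; rewrite big_cons.
Qed.

Lemma trigM f g : trig_poly f -> trig_poly g -> trig_poly (fun x => f x * g x).
Proof.
have hc k g' : trig_poly g' -> trig_poly (fun x => cos (freq_dot k x) * g' x).
  elim=> {g'} [l|l|a f' g' _ h1 _ h2].
  - apply: (trig_eq _ (trig_lin (2^-1) (trig_cos (addt k l))
      (trigZ (2^-1) (trig_cos (addt k (negt l)))))) => x.
    by rewrite !freq_dotD freq_dotN !cosD cosN sinN; field.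
  - apply: (trig_eq _ (trig_lin (2^-1) (trig_sin (addt k l))
      (trigZ (- 2^-1) (trig_sin (addt k (negt l)))))) => x.
    by rewrite !freq_dotD freq_dotN !sinD cosN sinN; field.
  - by apply: (trig_eq _ (trig_lin a h1 h2)) => x; ring.
have hs k g' : trig_poly g' -> trig_poly (fun x => sin (freq_dot k x) * g' x).
  elim=> {g'} [l|l|a f' g' _ h1 _ h2].
  - apply: (trig_eq _ (trig_lin (2^-1) (trig_sin (addt k l))
      (trigZ (2^-1) (trig_sin (addt k (negt l)))))) => x.
    by rewrite !freq_dotD freq_dotN !sinD cosN sinN; field.
  - apply: (trig_eq _ (trig_lin (- 2^-1) (trig_cos (addt k l))
      (trigZ (2^-1) (trig_cos (addt k (negt l)))))) => x.
    by rewrite !freq_dotD freq_dotN !cosD cosN sinN; field.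
  - by apply: (trig_eq _ (trig_lin a h1 h2)) => x; ring.
elim=> {f} [k|k|a f1 f2 _ h1 _ h2] tg; [exact: hc|exact: hs|].
by apply: (trig_eq _ (trig_lin a (h1 tg) (h2 tg))) => x; ring.
Qed.

Lemma trigX f n : trig_poly f -> trig_poly (fun x => f x ^+ n).
Proof.
move=> tf; elim: n => [|n ih]; first by apply: (trig_eq _ (trig_cst 1)).
by apply: (trig_eq _ (trigM tf ih)) => x; rewrite exprS.
Qed.

Lemma trig_measurable f : trig_poly f -> measurable_fun setT f.
Proof.
elim=> [k|k|a f1 f2 _ h1 _ h2]; [exact: measurable_cos_freq|exact: measurable_sin_freq|].
by apply: measurable_funD => //; exact: measurable_funM.
Qed.

Lemma trig_bounded f : trig_poly f -> exists2 M, 0 <= M & forall x, `|f x| <= M.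
Proof.
elim=> [k|k|a f1 f2 _ [M1 M10 h1] _ [M2 M20 h2]].
- by exists 1 => // x; exact: cos_max.
- by exists 1 => // x; exact: sin_max.
exists (`|a| * M1 + M2); first by rewrite addr_ge0// mulr_ge0.
move=> x; apply: le_trans (ler_normD _ _) _; rewrite lerD// normrM.
by rewrite ler_wpM2l.
Qed.

Lemma trig_sqint f : trig_poly f -> sqint mu f.
Proof.
move=> tf; have [M _ fM] := trig_bounded tf.
exact: sqint_bounded (trig_measurable tf) fM.
Qed.

Lemma sqint_integrable f : sqint mu f -> mu.-integrable setT (EFin \o f).
Proof.
move=> sf; have := sqint_mul sf (trig_sqint (trig_cst 1)).
by congr (integrable _ _ _); apply/funext => x /=; rewrite mulr1.
Qed.

Lemma integrable_trigM f g : mu.-integrable setT (EFin \o f) -> trig_poly g ->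
  mu.-integrable setT (EFin \o (fun x => f x * g x)).
Proof.
move=> intf tg; have [M M0 gM] := trig_bounded tg.
have mf : measurable_fun setT f by apply/measurable_EFinP; exact: measurable_int intf.
apply: (le_integrable measurableT _ _ (integrableZ M (integrable_norm intf))).
  apply/measurable_EFinP; apply: measurable_funM => //; exact: trig_measurable.
by move=> x _; rewrite lee_fin /= !normrM normr_id [leRHS]mulrC ler_wpM2l// (le_trans (gM x))// ler_norm.
Qed.

(** ** Fourier coefficients *)

Definition fcos f k : R := \int[mu]_x (f x * cos (freq_dot k x)).
Definition fsin f k : R := \int[mu]_x (f x * sin (freq_dot k x)).

Lemma fourierE f k : fourier f k = (fcos f k -i* fsin f k)%C.
Proof. by []. Qed.

Lemma integral_trigM0 f g : mu.-integrable setT (EFin \o f) ->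
  (forall k, fcos f k = 0) -> (forall k, fsin f k = 0) -> trig_poly g ->
  \int[mu]_x (f x * g x) = 0.
Proof.
move=> intf c0 s0; elim=> [k|k|a f1 f2 t1 h1 t2 h2]; [exact: c0|exact: s0|].
under eq_Rintegral do rewrite mulrDr mulrCA.
rewrite RintegralD//; last 2 first.
- by apply: integrableZ; exact: integrable_trigM.
- exact: integrable_trigM.
rewrite RintegralZl//; last exact: integrable_trigM.
by rewrite h1 h2 mulr0 addr0.
Qed.

(** ** Indicator functions as limits of trigonometric polynomials *)

(** The bounds 0 and 1 make products converge and provide the domination in
    [trig_indicator_integral0]. *)
Definition trig_indicator (A : set (torus R d)) := measurable A /\
  exists p : nat -> torus R d -> R, [/\ forall n, trig_poly (p n),
    forall n x, 0 <= p n x <= 1 &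
    {ae mu, forall x, p n x @[n --> \oo] --> (\1_A x : R)}].

Lemma trig_indicatorI A B :
  trig_indicator A -> trig_indicator B -> trig_indicator (A `&` B).
Proof.
move=> [mA [p [tp p01 cp]]] [mB [q [tq q01 cq]]]; split; first exact: measurableI.
exists (fun n x => p n x * q n x); split.
- by move=> n; exact: trigM.
- move=> n x; have /andP[? ?] := p01 n x; have /andP[? ?] := q01 n x.
  by rewrite mulr_ge0//= mulr_ile1.
- apply: filterS2 cp cq => x cp cq.
  have -> : (\1_(A `&` B) x : R) = \1_A x * \1_B x by rewrite indicI.
  exact: cvgM.
Qed.

Lemma trig_indicator_integral0 f A : mu.-integrable setT (EFin \o f) ->
  (forall k, fcos f k = 0) -> (forall k, fsin f k = 0) -> trig_indicator A ->
  (\int[mu]_(x in A) (f x)%:E)%E = 0%E.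
Proof.
move=> intf c0 s0 [mA [p [tp p01 cp]]].
have mf : measurable_fun setT f by apply/measurable_EFinP; exact: measurable_int intf.
have mp n : measurable_fun setT (p n) by apply: trig_measurable.
have [] := @dominated_convergence _ _ _ mu setT measurableT
  (fun n x => (f x * p n x)%:E) (fun x => (f x * \1_A x)%:E) (fun x => `|(f x)%:E|%E).
- by move=> n; apply/measurable_EFinP; exact: measurable_funM.
- apply/measurable_EFinP; apply: measurable_funM => //; exact: measurable_indic.
- apply: filterS cp => x cp _; apply: cvg_EFin; first by near=> n.
  by apply: cvgM => //; exact: cvg_cst.
- exact: integrable_abse.
- apply: nearW => x n _ /=; rewrite lee_fin normrM ler_piMr//.
  by have /andP[? ?] := p01 n x; rewrite ger0_norm.
move=> _ _ /cvg_unique h.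
have {h} : 0%E = (\int[mu]_x (f x * \1_A x)%:E)%E.
  apply/esym/h => //; apply: cvg_near_cst; apply: nearW => n.
  have := integral_trigM0 intf c0 s0 (tp n); rewrite /Rintegral => fin0.
  rewrite -[LHS]fineK ?fin0//.
  by apply: integrable_fin_num => //; exact: integrable_trigM.
move=> ->.
rewrite [in LHS]integral_mkcond; apply: eq_integral => x _.
rewrite patchE indicE; case: ifPn => xA; first by rewrite mulr1.
by rewrite mulr0.
Unshelve. all: by end_near. Qed.


Lemma ae_coordinate_neq (i : 'I_d) (a : R) : {ae mu, forall x, tnth x i != a}.
Proof.
exists [set x | [set a] (tnth x i)]; split.
- by rewrite -[X in measurable X]setTI; apply: (@measurable_tnth _ (measurableTypeR R)).
- by apply: coordinate_null; [exact: measurable_set1|exact: circle_measure_set1].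
- by move=> x /= /negP; rewrite negbK => /eqP.
Qed.

Lemma ae_coordinate_period (i : 'I_d) : {ae mu, forall x, 0 < tnth x i < 2 * pi}.
Proof.
have h : {ae mu, forall x, 0 <= tnth x i < 2 * pi}.
  exists [set x | (~` [set` @period R]) (tnth x i)]; split.
  - rewrite -[X in measurable X]setTI; apply: (@measurable_tnth _ (measurableTypeR R)) => //.
    exact: measurableC.
  - by apply: coordinate_null; [exact: measurableC|exact: circle_measure_out].
  - by move=> x /= h; rewrite in_itv.
have F : Filter (nbhs (almost_everywhere mu)) by exact: ae_filter_ringOfSetsType.
apply: (filterS2 F _ h (ae_coordinate_neq i 0)) => x /andP[x0 ->] xn0.
by rewrite andbT lt_neqAle eq_sym xn0.
Qed.

Definition unit_freq (i : 'I_d) : d.-tuple int := [tuple (j == i)%:R | j < d].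

Lemma freq_dot_unit (i : 'I_d) x : freq_dot (unit_freq i) x = tnth x i :> R.
Proof.
rewrite /freq_dot (bigD1 i)//= tnth_mktuple eqxx mul1r big1 ?addr0// => j ji.
by rewrite tnth_mktuple (negbTE ji) mul0r.
Qed.

(** Up to null sets, the slab is the set of points whose i-th coordinate lies
    in an arc. A cosine is larger inside the arc than outside, and
    [step_kernel] turns an affine function of it into an approximation of the
    indicator. *)
Lemma trig_indicator_slab (i : 'I_d) (a b : R) :
  trig_indicator [set x | `]a, b]%classic (tnth x i)].
Proof.
have mA : measurable [set x : torus R d | `]a, b]%classic (tnth x i)].
  by rewrite -[X in measurable X]setTI; apply: (@measurable_tnth _ (measurableTypeR R)).
split => //.
(* the part of ]a, b] in the fundamental domain *)
set a' := Num.max a 0; set b' := Num.min b (2 * pi).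
have pi0 : 0 < pi :> R by exact: pi_gt0.
pose xi (x : torus R d) : R := tnth x i.
have E (x : torus R d) : 0 < xi x < 2 * pi -> xi x != a' -> xi x != b' ->
    (\1_[set x : torus R d | `]a, b]%classic (tnth x i)] x : R) = ((a' < xi x < b')%R)%:R.
  move=> xp xa xb; rewrite indicE; congr (_%:R); congr nat_of_bool.
  rewrite /a' /b' gt_max lt_min; apply/idP/idP.
    rewrite inE/= in_itv/= => /andP[ax xb']; rewrite ax.
    move: xa xb; rewrite /a' /b' => xa xb.
    case/andP: xp => -> x2; rewrite x2 andbT/= lt_neqAle xb' andbT.
    move: xb; rewrite andbT /Num.min; case: ltP => // bp _.
    by rewrite lt_eqF// (lt_le_trans x2 bp).
  by rewrite inE/= in_itv/= => /andP[/andP[-> _] /andP[/ltW -> _]].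
have F : Filter (nbhs (almost_everywhere mu)) by exact: ae_filter_ringOfSetsType.
have [ab|ba] := ltP a' b'; last first.
  exists (fun _ _ => 0); split.
  - by move=> _; exact: trig_zero.
  - by move=> _ x; rewrite lexx ler01.
  - apply: (filterS3 F _ (ae_coordinate_period i) (ae_coordinate_neq i a') (ae_coordinate_neq i b')).
    move=> x xp xa xb; rewrite E//.
    have -> : a' < xi x < b' = false by apply/negbTE; rewrite negb_and -!leNgt; apply/orP; lra.
    exact: cvg_cst.
have ab' : 0 <= a' /\ a' < b' /\ b' <= 2 * pi.
  by split; [rewrite /a' le_max lexx orbT|split=> //; rewrite /b' ge_min lexx orbT].
set m := (a' + b') / 2; set h := (b' - a') / 2.
(* t < 1/2 inside the arc; dividing by 4 keeps t in [0, 1] *)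
pose t (x : torus R d) := 1 / 2 - (cos (xi x - m) - cos h) / 4.
have t01 x : 0 <= t x <= 1.
  have := cos_geN1 (xi x - m); have := cos_le1 (xi x - m).
  by have := cos_geN1 h; have := cos_le1 h; rewrite /t; lra.
have tt : trig_poly t.
  apply: (trig_eq _ (trig_lin (- (cos m / 4)) (trig_cos (unit_freq i))
    (trig_lin (- (sin m / 4)) (trig_sin (unit_freq i)) (trig_cst (1 / 2 + cos h / 4))))) => x.
  by rewrite !freq_dot_unit /t cosB; field.
exists (fun n x => step_kernel n (t x)); split.
- move=> n; apply: trigX; apply: (trig_eq _ (trig_lin (-1) (trigX n tt) (trig_cst 1))) => x.
  by ring.
- by move=> n x; exact: step_kernel01.
apply: (filterS3 F _ (ae_coordinate_period i) (ae_coordinate_neq i a') (ae_coordinate_neq i b')).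
move=> x xp xa xb; rewrite E//.
have /andP[t0 t1] := t01 x.
have [xab|xab] := boolP (a' < xi x < b').
  apply: step_kernel_lt => //; have := arc_in ab' xab; rewrite -/m -/h /t; lra.
apply: step_kernel_gt => //.
have : xi x < a' \/ b' < xi x.
  move: xab; rewrite negb_and -!leNgt => /orP[|] xx; [left|right];
    by rewrite lt_neqAle xx ?andbT ?xa// eq_sym.
by move=> /(arc_out ab' xp); rewrite -/m -/h /t; lra.
Qed.

End trig_poly.

(** * Uniqueness of Fourier coefficients *)

Section uniqueness.
Context {R : realType} {d : nat}.
Local Notation mu := (@torus_measure R d).
Implicit Types (f g : torus R d -> R) (k l : d.-tuple int).

Lemma trig_indicatorT : trig_indicator [set: torus R d].
Proof.
split; first exact: measurableT.
exists (fun _ _ => 1); split.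
- by move=> _; exact: trig_cst.
- by move=> _ x; rewrite ler01 lexx.
- by apply: nearW => x; rewrite indicT; exact: cvg_cst.
Qed.

(** The coordinates generate the measurable sets, and slabs are the preimages
    of intervals by a coordinate. *)
Lemma measurable_torus_sub :
  @measurable _ (torus R d) `<=` <<s @trig_indicator R d >>.
Proof.
apply: smallest_sub; first exact: smallest_sigma_algebra.
set G := <<s trig_indicator >>.
apply: (big_ind (fun A : set (set (torus R d)) => A `<=` G)) => [//|A B hA hB|i _].
  by move=> X [/hA|/hB].
move=> _ [B mB <-].
pose H : set (set R) := image_set_system setT (fun x : torus R d => tnth x i) G.
have sH : sigma_algebra setT H.
  by apply: sigma_algebra_image; exact: smallest_sigma_algebra.
suff : H B by [].
apply: (smallest_sub sH _ mB) => _ [[a b] _ <-].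
rewrite /H /image_set_system/= setTI.
by apply: sub_sigma_algebra; exact: trig_indicator_slab.
Qed.

(** The sets on which f has integral 0 form a Dynkin system. It contains the
    sets whose indicator is a limit of trigonometric polynomials, which are
    stable under intersection and generate the measurable sets. *)
Lemma fourier_unique0 f : mu.-integrable setT (EFin \o f) ->
  (forall k, fcos f k = 0) -> (forall k, fsin f k = 0) -> ae_zero f.
Proof.
move=> intf c0 s0.
have I0 A : trig_indicator A -> (\int[mu]_(x in A) (f x)%:E)%E = 0%E.
  by move=> tA; exact: trig_indicator_integral0.
have IT : (\int[mu]_x (f x)%:E)%E = 0%E by apply: I0; exact: trig_indicatorT.
pose D := [set A : set (torus R d) | measurable A /\ (\int[mu]_(x in A) (f x)%:E)%E = 0%E].
have sub : @measurable _ (torus R d) `<=` D.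
  apply: (subset_trans measurable_torus_sub).
  rewrite -setI_closed_g_dynkin_g_sigma_algebra; last by move=> A B; exact: trig_indicatorI.
  apply: smallest_sub; last by move=> A tA; split; [case: tA|exact: I0].
  split.
  - by split; [exact: measurableT|].
  - move=> A [mA A0]; split; first exact: measurableC.
    have : (\int[mu]_(x in A `|` ~` A) (f x)%:E)%E = 0%E by rewrite setUv.
    rewrite integral_setU//; last 3 first.
    + exact: measurableC.
    + by rewrite setUv; exact: measurable_int intf.
    + by rewrite /disj_set setICr.
    by rewrite A0 add0e.
  - move=> F tF DF; split; first by apply: bigcup_measurable => n _; case: (DF n).
    rewrite integral_bigcup//.
    + by rewrite eseries0// => n _ _; case: (DF n).
    + by move=> n; case: (DF n).
    + apply: (@integrableS _ _ _ mu setT) => //.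
      by apply: bigcup_measurable => n _; case: (DF n).
have h : ae_eq mu setT (EFin \o f) (EFin \o cst 0).
  apply: integral_ae_eq => //.
  - by apply/measurable_EFinP; exact: measurable_cst.
  - by move=> E _ mE; rewrite (sub E mE).2 integral0.
by apply: filterS h => x /(_ I)[].
Qed.

End uniqueness.

(** * Zero sets of trigonometric polynomials *)

Section one_variable.
Context {R : realType}.
Implicit Types g : R -> R.

Lemma poly_roots_finite (p : {poly R}) : p != 0 -> finite_set [set x | root p x].
Proof.
move: {2}(size p) (leqnn (size p)) => n; elim: n p => [|n ih] p.
  by rewrite leqn0 size_poly_eq0 => ->.
move=> sp p0; have [[a pa]|nr] := pselect (exists a, root p a); last first.
  suff -> : [set x | root p x] = set0 by [].
  by apply/seteqP; split=> x //= px; apply: nr; exists x.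
have /factor_theorem[q pE] := pa; have q0 : q != 0 by apply: contra_neq p0 => q0; rewrite pE q0 mul0r.
have sq : (size q <= n)%N by move: sp; rewrite pE size_Mmonic ?monicXsubC// size_XsubC addn2.
apply: sub_finite_set (_ : _ `<=` [set a] `|` [set x | root q x]) _.
  by move=> x /=; rewrite pE rootM root_XsubC => /orP[|/eqP]; [right|left].
by rewrite finite_setU; split; [exact: finite_set1|exact: ih].
Qed.

(** The functions A(cos t) + sin(t) B(cos t): a polynomial in cos t vanishing at
    every zero of such a function is A^2 - (1 - X^2) B^2. *)
Definition circle_poly g := exists A B : {poly R}, forall t, g t = A.[cos t] + sin t * B.[cos t].

Lemma circle_poly_lin a g h : circle_poly g -> circle_poly h ->
  circle_poly (fun t => a * g t + h t).
Proof.
move=> [A [B gE]] [A' [B' hE]]; exists (a *: A + A'), (a *: B + B') => t.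
by rewrite gE hE !hornerD !hornerZ; ring.
Qed.

Lemma circle_poly_cos g : circle_poly g -> circle_poly (fun t => cos t * g t).
Proof.
move=> [A [B gE]]; exists ('X * A), ('X * B) => t; rewrite gE !hornerM !hornerX; ring.
Qed.

Lemma circle_poly_sin g : circle_poly g -> circle_poly (fun t => sin t * g t).
Proof.
move=> [A [B gE]]; exists ((1 - 'X^2) * B), A => t; rewrite gE hornerM hornerD hornerN hornerC hornerXn.
by rewrite cos2sin2; ring.
Qed.

Lemma circle_poly_cst a : circle_poly (fun=> a).
Proof. by exists a%:P, 0 => t; rewrite hornerC horner0 mulr0 addr0. Qed.

Lemma circle_poly_eq g h : (forall t, g t = h t) -> circle_poly g -> circle_poly h.
Proof. by move=> /funext ->. Qed.

Lemma circle_poly_nat (n : nat) :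
  circle_poly (fun t => cos (n%:R * t)) /\ circle_poly (fun t => sin (n%:R * t)).
Proof.
elim: n => [|n [hc hs]].
  split; [apply: (circle_poly_eq _ (circle_poly_cst 1))|apply: (circle_poly_eq _ (circle_poly_cst 0))];
    by move=> t; rewrite mul0r ?cos0 ?sin0.
split.
  apply: (circle_poly_eq _ (circle_poly_lin (-1) (circle_poly_sin hs) (circle_poly_cos hc))) => t.
  by rewrite -natr1 mulrDl mul1r cosD; ring.
apply: (circle_poly_eq _ (circle_poly_lin 1 (circle_poly_sin hc) (circle_poly_cos hs))) => t.
by rewrite -natr1 mulrDl !mul1r [in RHS]sinD; ring.
Qed.

Lemma circle_poly_int (n : int) (c : R) :
  circle_poly (fun t => cos (n%:~R * t + c)) /\ circle_poly (fun t => sin (n%:~R * t + c)).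
Proof.
have [hc hs] : circle_poly (fun t => cos (n%:~R * t)) /\ circle_poly (fun t => sin (n%:~R * t)).
  case: (intP n) => [|m|m]; [exact: (circle_poly_nat 0)|exact: (circle_poly_nat m.+1)|].
  have [hc hs] := circle_poly_nat m.+1; split.
    by apply: circle_poly_eq hc => t; rewrite mulrNz mulNr cosN.
  apply: circle_poly_eq (circle_poly_lin (-1) hs (circle_poly_cst 0)) => t.
  by rewrite -[RHS]opprK -sinN -mulNr -mulrNz opprK mulN1r addr0.
have z := circle_poly_cst 0.
split.
  apply: circle_poly_eq (circle_poly_lin (cos c) hc (circle_poly_lin (- sin c) hs z)) => t.
  by rewrite cosD; ring.
apply: circle_poly_eq (circle_poly_lin (sin c) hc (circle_poly_lin (cos c) hs z)) => t.
by rewrite sinD; ring.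
Qed.

Lemma circle_poly_measurable g : circle_poly g -> measurable_fun setT g.
Proof.
move=> [A [B /funext ->]].
have mc : measurable_fun setT (cos : R -> R) by apply: continuous_measurable_fun; exact: continuous_cos.
have ms : measurable_fun setT (sin : R -> R) by apply: continuous_measurable_fun; exact: continuous_sin.
have mp (p : {poly R}) : measurable_fun setT (fun t : R => p.[cos t]).
  elim/poly_ind: p => [|p c ih].
    by under eq_fun do rewrite horner0; exact: measurable_cst.
  under eq_fun do rewrite hornerMXaddC.
  by apply: measurable_funD => //; exact: measurable_funM.
by apply: measurable_funD => //; exact: measurable_funM.
Qed.

Lemma circle_poly_zeros g t0 : circle_poly g -> g t0 != 0 ->
  @circle_measure R [set t | g t = 0] = 0%E.
Proof.
move=> cg g0; have mg := circle_poly_measurable cg.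
have mZ : measurable [set t | g t = 0].
  by rewrite -[X in measurable X]setTI; apply: (mg measurableT [set 0]).
have [A [B gE]] := cg.
pose Q := A ^+ 2 - (1 - 'X^2) * B ^+ 2.
(* otherwise A^2 = - (X^2 - 1) B^2, where the leading coefficients have
   opposite signs *)
have Q0 : Q != 0.
  apply/eqP => Q0; have B0 : B = 0.
    apply/eqP/negP => /negP B0.
    have : lead_coef (A ^+ 2) = lead_coef (- (('X^2 - 1) * B ^+ 2)).
      by congr lead_coef; apply/eqP; rewrite -subr_eq0 -Q0 /Q; apply/eqP; ring.
    have X1 : 'X^2 - 1 \is @monic R by exact: monicXnsubC.
    rewrite lead_coefN [in RHS]lead_coefM (monicP X1) mul1r !lead_coef_exp => h.
    have := sqr_ge0 (lead_coef A); rewrite h oppr_ge0 leNgt => /negP; apply.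
    by rewrite exprn_even_gt0//= lead_coef_eq0.
  have A0 : A = 0.
    move: Q0; rewrite /Q B0 expr0n/= mulr0 subr0 => /eqP.
    by rewrite expf_eq0/= => /eqP.
  by move: g0; rewrite gE A0 B0 !horner0 mulr0 addr0 eqxx.
have fQ := poly_roots_finite Q0.
pose F := (@acos R @` [set x | root Q x]) `|` ((fun x => 2 * pi - acos x) @` [set x | root Q x]).
have fF : finite_set F.
  by rewrite finite_setU; split; exact: finite_image.
have sub : [set t | g t = 0] `&` [set` @period R] `<=` F.
  move=> t [/= gt0]; rewrite in_itv/= => /andP[t0' t2].
  have rt : root Q (cos t).
    apply/rootP; rewrite /Q !expr2 !(hornerD, hornerN, hornerM, hornerC, hornerX) -!expr2 cos2sin2.
    have : A.[cos t] = - (sin t * B.[cos t]) by apply/eqP; rewrite -addr_eq0 -gE gt0.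
    by move=> ->; ring.
  have [tp|tp] := leP t pi.
    by left; exists (cos t) => //; rewrite cosK// in_itv/= t0'.
  right; exists (cos t) => //.
  have -> : cos t = cos (2 * pi - t).
    by rewrite cosB mulrDl !mul1r -mulr2n cos2pi sin2pi; ring.
  by rewrite cosK ?in_itv/=; [ring|lra].
rewrite /circle_measure /mfrestr /mrestr.
apply: countable_lebesgue_measure0; apply: finite_set_countable.
exact: sub_finite_set sub fF.
Qed.

End one_variable.

Section trig_zeros.
Context {R : realType}.
Local Notation tor d := (@torus_measure R d).

Lemma trig_section d (f : torus R d.+1 -> R) : trig_poly f ->
  (forall t, trig_poly (fun y => f (tcons (t, y)))) /\
  (forall y, circle_poly (fun t => f (tcons (t, y)))).
Proof.
elim=> [k|k|a g h _ [g1 g2] _ [h1 h2]].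
- pose tk := [tuple tnth k (lift ord0 i) | i < d]; split=> [t|y].
  + apply: (trig_eq _ (trig_lin (cos ((tnth k ord0)%:~R * t)) (trig_cos tk)
      (trigZ (- sin ((tnth k ord0)%:~R * t)) (trig_sin tk)))) => y.
    by rewrite freq_dot_tcons cosD; ring.
  + apply: (circle_poly_eq _ (circle_poly_int (tnth k ord0) (freq_dot tk y)).1) => t.
    by rewrite freq_dot_tcons.
- pose tk := [tuple tnth k (lift ord0 i) | i < d]; split=> [t|y].
  + apply: (trig_eq _ (trig_lin (sin ((tnth k ord0)%:~R * t)) (trig_cos tk)
      (trigZ (cos ((tnth k ord0)%:~R * t)) (trig_sin tk)))) => y.
    by rewrite freq_dot_tcons sinD; ring.
  + apply: (circle_poly_eq _ (circle_poly_int (tnth k ord0) (freq_dot tk y)).2) => t.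
    by rewrite freq_dot_tcons.
- split=> [t|y]; first exact: trig_lin.
  exact: circle_poly_lin.
Qed.

Lemma trig_zeros_measurable d (f : torus R d -> R) : trig_poly f ->
  measurable [set x | f x = 0].
Proof.
by move=> tf; have := trig_measurable tf measurableT (measurable_set1 0); rewrite setTI.
Qed.

(** Fix y0 with f(x, y0) not identically zero in x. Then f(x, y0) = 0 for a
    null set of x only, and for the other x the section f(x, .) is a nonzero
    trigonometric polynomial in d variables, whose zero set is null by
    induction. *)
Lemma trig_zeros_null d (f : torus R d -> R) x0 : trig_poly f -> f x0 != 0 ->
  tor d [set x | f x = 0] = 0%E.
Proof.
elim: d f x0 => [|d ih] f x0 tf f0.
  rewrite /= diracE memNset//= => f0'; move: f0; rewrite -f0' => /eqP; apply.
  by rewrite (tuple0 x0).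
have [ft fy] := trig_section tf.
have mZ : measurable [set x | f x = 0].
  exact: trig_zeros_measurable.
rewrite torus_measureS /product_measure1.
pose y0 : torus R d := behead_tuple x0.
have x0E : x0 = tcons (tnth x0 ord0, y0) by rewrite {}/y0; apply/val_inj; case/tupleP: x0 {f0} => t y /=.
have z0 : @circle_measure R [set t | f (tcons (t, y0)) = 0] = 0%E.
  by apply: (@circle_poly_zeros _ _ (tnth x0 ord0) (fy y0)); rewrite -x0E.
have mz0 : measurable [set t | f (tcons (t, y0)) = 0].
  have := circle_poly_measurable (fy y0) measurableT (measurable_set1 0).
  by rewrite setTI.
rewrite (ae_eq_integral (cst 0%E))//.
- by rewrite integral0.
- apply: measurable_fun_xsection.
  rewrite -[X in measurable X]setTI; apply: measurable_tcons => //.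
exists [set t | f (tcons (t, y0)) = 0]; split => //.
move=> t /= h; apply: contrapT => /eqP ft0; apply: h => _ /=.
rewrite -[RHS](ih _ y0 (ft t) ft0); congr (tor d _).
by apply/seteqP; split => y; rewrite /xsection/= inE.
Qed.

Lemma trig_ae_neq0 d (f : torus R d -> R) : trig_poly f -> ~ ae_zero f ->
  {ae tor d, forall x, f x != 0}.
Proof.
move=> tf fn0; have [[x0 f0]|h] := pselect (exists x, f x != 0).
  exists [set x | f x = 0]; split.
  - exact: trig_zeros_measurable.
  - exact: trig_zeros_null f0.
  - by move=> x /= /negP; rewrite negbK => /eqP.
exfalso; apply: fn0; apply: nearW => x _ /=; apply/eqP/negP => /negP fx; apply: h; by exists x.
Qed.

End trig_zeros.

(** * Sums of nonnegative families *)

Section nonneg_sums.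
Context {R : realType} {K : countType}.
Implicit Types (a b : K -> R) (r s : seq K).

Definition fsummable a := (\esum_(k in [set: K]) (a k)%:E < +oo)%E.
Definition tsum a : R := fine (\esum_(k in [set: K]) (a k)%:E)%E.

Lemma esum_leP a (M : R) : (forall k, 0 <= a k) ->
  (\esum_(k in [set: K]) (a k)%:E <= M%:E)%E <->
  (forall r, uniq r -> \sum_(k <- r) a k <= M).
Proof.
move=> a0; split=> [h r ur|h].
  rewrite -lee_fin; apply: le_trans h; rewrite -sumEFin fsbig_seq//.
  apply: ereal_sup_ubound; exists [set` r]; last by [].
  by split; [exact: finite_seq|].
apply: ge_ereal_sup => _ [A [fA _] <-].
by rewrite fsbig_finite//= sumEFin lee_fin; apply: h; exact: finmap.fset_uniq.
Qed.

Lemma fsummable_ge0 a : (forall k, 0 <= a k) -> (0 <= \esum_(k in [set: K]) (a k)%:E)%E.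
Proof. by move=> a0; apply: esum_ge0 => k _; rewrite lee_fin. Qed.

Lemma tsumE a : (forall k, 0 <= a k) -> fsummable a ->
  (\esum_(k in [set: K]) (a k)%:E = (tsum a)%:E)%E.
Proof.
move=> a0 sa; rewrite /tsum fineK// ge0_fin_numE//; exact: fsummable_ge0.
Qed.

Lemma tsum_ge a r : (forall k, 0 <= a k) -> fsummable a -> uniq r ->
  \sum_(k <- r) a k <= tsum a.
Proof. by move=> a0 sa ur; apply: (esum_leP (tsum a) a0).1 => //; rewrite tsumE. Qed.

Lemma tsum_ge_term a k : (forall k, 0 <= a k) -> fsummable a -> a k <= tsum a.
Proof. by move=> a0 sa; have := @tsum_ge a [:: k] a0 sa isT; rewrite big_seq1. Qed.

Lemma tsum_ge0 a : (forall k, 0 <= a k) -> 0 <= tsum a.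
Proof. by move=> a0; rewrite /tsum fine_ge0//; exact: fsummable_ge0. Qed.

Lemma tsum_le a (M : R) : (forall k, 0 <= a k) ->
  (forall r, uniq r -> \sum_(k <- r) a k <= M) -> fsummable a /\ tsum a <= M.
Proof.
move=> a0 /(esum_leP M a0) h; have sa : fsummable a by apply: le_lt_trans h _; exact: ltry.
by split=> //; rewrite -lee_fin -tsumE.
Qed.

Lemma tsum_mono a b : (forall k, 0 <= a k <= b k) -> fsummable b ->
  fsummable a /\ tsum a <= tsum b.
Proof.
move=> ab sb; have a0 k : 0 <= a k by case/andP: (ab k).
have b0 k : 0 <= b k by case/andP: (ab k) => x /(le_trans x).
apply: tsum_le => // r ur; apply: le_trans (tsum_ge b0 sb ur).
by apply: ler_sum => k _; case/andP: (ab k).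
Qed.

Lemma tsumD a b : (forall k, 0 <= a k) -> (forall k, 0 <= b k) ->
  fsummable a -> fsummable b ->
  fsummable (fun k => a k + b k) /\ tsum (fun k => a k + b k) = tsum a + tsum b.
Proof.
move=> a0 b0 sa sb.
have E : (\esum_(k in [set: K]) (a k + b k)%:E = (tsum a + tsum b)%:E)%E.
  rewrite EFinD -!tsumE// -esumD//.
  - by move=> k _; rewrite lee_fin.
  - by move=> k _; rewrite lee_fin.
by rewrite /fsummable /tsum E ltry.
Qed.

Lemma tsumZ c a : 0 <= c -> (forall k, 0 <= a k) -> fsummable a ->
  fsummable (fun k => c * a k) /\ tsum (fun k => c * a k) = c * tsum a.
Proof.
move=> c0 a0 sa.
have ca0 k : 0 <= c * a k by rewrite mulr_ge0.
have [s1 h1] : fsummable (fun k => c * a k) /\ tsum (fun k => c * a k) <= c * tsum a.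
  apply: tsum_le => // r ur; rewrite -mulr_sumr ler_wpM2l//; exact: tsum_ge.
split=> //; apply/le_anti; rewrite h1/=.
have [->|cn0] := eqVneq c 0; first by rewrite mul0r tsum_ge0// => k; rewrite mul0r.
have cp : 0 < c by rewrite lt_neqAle eq_sym cn0.
rewrite mulrC -ler_pdivlMr//; apply: (tsum_le a0 _).2 => r ur.
by rewrite ler_pdivlMr// mulrC mulr_sumr tsum_ge.
Qed.

Lemma tsum_approx a (e : R) : (forall k, 0 <= a k) -> fsummable a -> 0 < e ->
  exists2 r, uniq r & forall s, uniq s -> {subset r <= s} -> tsum a - e <= \sum_(k <- s) a k.
Proof.
move=> a0 sa e0; have [r /andP[ur hr]] : exists r, uniq r && (tsum a - e < \sum_(k <- r) a k).
  apply: contrapT => h; have := (@tsum_le a (tsum a - e) a0 _).2.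
  have -> : (tsum a <= tsum a - e) = false by apply/negbTE; rewrite -ltNge; lra.
  move=> h'; suff : false by []; apply: h' => r ur.
  by rewrite leNgt; apply/negP => hr; apply: h; exists r; rewrite ur.
exists r => // s us rs; apply: le_trans (ltW hr) _.
rewrite (perm_big _ (_ : perm_eq s (r ++ [seq k <- s | k \notin r]))).
  by rewrite big_cat/= lerDl sumr_ge0.
apply: uniq_perm => //.
  rewrite cat_uniq ur filter_uniq// andbT; apply/hasPn => k /=.
  by rewrite mem_filter => /andP[].
move=> k; rewrite mem_cat mem_filter.
by have [/rs ->|] := boolP (k \in r).
Qed.

Lemma tsum_tail a (e : R) : (forall k, 0 <= a k) -> fsummable a -> 0 < e ->
  exists2 r, uniq r & forall s, uniq s -> (forall k, k \in s -> k \notin r) -> \sum_(k <- s) a k <= e.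
Proof.
move=> a0 sa e0; have [r ur hr] := tsum_approx a0 sa e0; exists r => // s us sr.
have urs : uniq (r ++ s).
  by rewrite cat_uniq ur us andbT; apply/hasPn => k /sr.
have := tsum_ge a0 sa urs; rewrite big_cat/=.
have := hr r ur; have ss : {subset r <= r} by [].
by move=> /(_ ss) h; lra.
Qed.

(** Dominated convergence for sums. Outside a finite set of indices the sum is
    small by domination; on this finite set every term is small. *)
Lemma tsum_dominated (T : Type) (F : set_system T) (FF : Filter F) (g : T -> K -> R) a (M : R) :
  (forall k, 0 <= a k) -> fsummable a -> 0 <= M ->
  (\forall t \near F, forall k, 0 <= g t k <= M * a k) ->
  (forall k, forall e, 0 < e -> \forall t \near F, g t k <= e) ->
  forall e, 0 < e -> \forall t \near F, fsummable (g t) /\ tsum (g t) <= e.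
Proof.
move=> a0 sa M0 dom ptw e e0.
have M1 : 0 < M + 1 by rewrite ltr_wpDl.
have e1 : 0 < e / (2 * (M + 1)) by rewrite divr_gt0// mulr_gt0.
have [r ur hr] := tsum_tail a0 sa e1.
have hfin : forall e', 0 < e' -> \forall t \near F, forall k, k \in r -> g t k <= e'.
  move=> e' e'0; elim: {ur hr} r => [|k r ih]; first by apply: nearW.
  have := ptw k _ e'0 => hk.
  near=> t => l; rewrite inE => /orP[/eqP ->|lr]; first by near: t.
  by move: l lr; near: t.
have e2 : 0 < e / (2 * (size r).+1%:R) by rewrite divr_gt0// mulr_gt0.
near=> t.
have gt : forall k, 0 <= g t k <= M * a k by near: t.
have gr : forall k, k \in r -> g t k <= e / (2 * (size r).+1%:R) by near: t; exact: hfin.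
apply: tsum_le => [k|s us]; first by case/andP: (gt k).
rewrite (bigID (mem r))/=.
have h1 : \sum_(k <- s | k \in r) g t k <= e / 2.
  rewrite -big_filter; set s' := [seq _ <- s | _].
  have us' : uniq s' by rewrite filter_uniq.
  have ss' : (size s' <= size r)%N by apply: uniq_leq_size => // k; rewrite mem_filter => /andP[].
  apply: (@le_trans _ _ (\sum_(k <- s') e / (2 * (size r).+1%:R))).
    rewrite big_seq [leRHS]big_seq; apply: ler_sum => k; rewrite mem_filter => /andP[kr _].
    exact: gr.
  rewrite big_const_seq count_predT iter_addr_0.
  have : (size s')%:R <= (size r).+1%:R :> R by rewrite ler_nat (leq_trans ss').
  have p : 0 < (size r).+1%:R :> R by [].
  set x := e / _ => h; have xE : x * (size r).+1%:R = e / 2 by rewrite /x; field; lra.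
  by rewrite -[leLHS]mulr_natr -xE ler_wpM2l// ltW.
have h2 : \sum_(k <- s | k \notin r) g t k <= e / 2.
  rewrite -big_filter; set s' := [seq _ <- s | _].
  have us' : uniq s' by rewrite filter_uniq.
  have := hr s' us'; rewrite /s' => h.
  apply: (@le_trans _ _ (M * \sum_(k <- s') a k)).
    by rewrite mulr_sumr; apply: ler_sum => k _; case/andP: (gt k).
  apply: (@le_trans _ _ (M * (e / (2 * (M + 1))))).
    by rewrite ler_wpM2l//; apply: h => k; rewrite mem_filter => /andP[].
  set x := e / (2 * _); have xE : x * (M + 1) = e / 2 by rewrite /x; field; lra.
  by rewrite -xE mulrC ler_wpM2l ?lerDl// ltW.
by lra.
Unshelve. all: by end_near. Qed.

(** Minkowski's inequality for the square roots of [tsum]. The hypothesis on s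
    is what |x + y|^2 <= (1 + t) |x|^2 + (1 + 1/t) |y|^2 provides, and the
    best t gives the triangle inequality. *)
Lemma tsum_minkowski (p q s : K -> R) : (forall k, 0 <= p k) -> (forall k, 0 <= q k) ->
  (forall k, 0 <= s k) -> fsummable p -> fsummable q ->
  (forall t k, 0 < t -> s k <= (1 + t) * p k + (1 + t^-1) * q k) ->
  fsummable s /\ Num.sqrt (tsum s) <= Num.sqrt (tsum p) + Num.sqrt (tsum q).
Proof.
move=> p0 q0 s0 sp sq h.
have H t : 0 < t -> fsummable s /\ tsum s <= (1 + t) * tsum p + (1 + t^-1) * tsum q.
  move=> t0; have t1 : 0 <= 1 + t by rewrite addr_ge0// ltW.
  have t2 : 0 <= 1 + t^-1 by rewrite addr_ge0// invr_ge0 ltW.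
  apply: tsum_le => // r ur.
  apply: (@le_trans _ _ (\sum_(k <- r) ((1 + t) * p k + (1 + t^-1) * q k))).
    by apply: ler_sum => k _; exact: h.
  by rewrite big_split/= -!mulr_sumr lerD// ler_wpM2l//; exact: tsum_ge.
split; first exact: (H 1 ltr01).1.
set P := Num.sqrt (tsum p); set Q := Num.sqrt (tsum q).
have PE : tsum p = P ^+ 2 by rewrite sqr_sqrtr ?tsum_ge0.
have QE : tsum q = Q ^+ 2 by rewrite sqr_sqrtr ?tsum_ge0.
have P0 : 0 <= P by exact: sqrtr_ge0.
have Q0 : 0 <= Q by exact: sqrtr_ge0.
rewrite -[leRHS]ger0_norm ?addr_ge0// -sqrtr_sqr ler_sqrt ?sqr_ge0//.
apply/ler_addgt0Pr => e e0.
(* the optimal t is Q / P; both are shifted to avoid a division by zero *)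
have [d d0 dE] : exists2 d, 0 < d & 2 * d * (P + Q) + 2 * d ^+ 2 <= e.
  pose d := Num.min 1 (e / (2 * (P + Q) + 2)).
  have c0 : 0 < 2 * (P + Q) + 2 by rewrite ltr_wpDl// mulr_ge0// addr_ge0.
  have d0 : 0 < d by rewrite lt_min ltr01 divr_gt0.
  exists d => //; have d1 : d <= 1 by rewrite ge_min lexx.
  have : d * (2 * (P + Q) + 2) <= e by rewrite -ler_pdivlMr// ge_min lexx orbT.
  nra.
have P1 : 0 < P + d by rewrite ltr_wpDl.
have Q1 : 0 < Q + d by rewrite ltr_wpDl.
have t0 : 0 < (Q + d) / (P + d) by rewrite divr_gt0.
apply: le_trans (H _ t0).2 _; rewrite PE QE invf_div.
apply: (@le_trans _ _ ((1 + (Q + d) / (P + d)) * (P + d) ^+ 2 + (1 + (P + d) / (Q + d)) * (Q + d) ^+ 2 + (P ^+ 2 - (P+d)^+2) + (Q ^+ 2 - (Q+d)^+2))).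
  have a1 : 0 <= (Q + d) / (P + d) by rewrite ltW.
  have a2 : 0 <= (P + d) / (Q + d) by rewrite divr_ge0// ltW.
  have b1 : P ^+ 2 <= (P + d) ^+ 2 by nra.
  have b2 : Q ^+ 2 <= (Q + d) ^+ 2 by nra.
  by nra.
have -> : (1 + (Q + d) / (P + d)) * (P + d) ^+ 2 = (P + d) ^+ 2 + (Q + d) * (P + d).
  by field; lra.
have -> : (1 + (P + d) / (Q + d)) * (Q + d) ^+ 2 = (Q + d) ^+ 2 + (P + d) * (Q + d).
  by field; lra.
by nra.
Qed.

End nonneg_sums.

(** * Fourier series *)

Section fourier_series.
Context {R : realType} {d : nat}.
Local Notation mu := (@torus_measure R d).
Local Notation freq := (d.-tuple int).
Implicit Types (f g : torus R d -> R) (k l : freq) (r s : seq freq) (a b : freq -> R).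

(** The first frequencies of an enumeration and their opposites: the partial
    sums of the Fourier series of a real function are real on symmetric sets
    of frequencies. *)
Definition sym_freqs n : seq freq :=
  let r := pmap (@pickle_inv freq) (iota 0 n) in undup (r ++ map negt r).

Definition sym_list r := uniq r /\ forall k, (negt k \in r) = (k \in r).

Lemma mem_sym_freqs n k :
  (k \in sym_freqs n) = (pickle k < n)%N || (pickle (negt k) < n)%N.
Proof.
have h l : (l \in pmap (@pickle_inv freq) (iota 0 n)) = (pickle l < n)%N.
  rewrite mem_pmap; apply/mapP/idP => [[m]|ln].
    rewrite mem_iota add0n => /andP[_ mn] lE.
    by have := @pickle_invK freq m; rewrite -lE/= => ->.
  by exists (pickle l); rewrite ?mem_iota// pickleK_inv.
rewrite mem_undup mem_cat h; congr (_ || _).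
by rewrite -[k in LHS]negtK (mem_map (can_inj negtK)) h.
Qed.

Lemma sym_freqs_symmetric n : sym_list (sym_freqs n).
Proof. by split=> [|k]; [exact: undup_uniq|rewrite !mem_sym_freqs negtK orbC]. Qed.

Lemma sym_freqs_mono m n : (m <= n)%N -> {subset sym_freqs m <= sym_freqs n}.
Proof.
move=> mn k; rewrite !mem_sym_freqs => /orP[] h; rewrite (leq_trans h mn) ?orbT//.
Qed.

Lemma sym_freqs_cover r : exists n, {subset r <= sym_freqs n}.
Proof.
elim: r => [|k r [n ih]]; first by exists 0.
exists (maxn (pickle k).+1 n) => l; rewrite inE => /orP[/eqP->|/ih].
  by rewrite mem_sym_freqs leq_max leqnn.
by apply: sym_freqs_mono; rewrite leq_maxr.
Qed.

(** For a symmetric [r], an even a and an odd b, the sum over k in r of (2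
    pi)^-d (a_k - i b_k) e^{ikx}. *)
Definition fsum r a b : torus R d -> R := fun x =>
  (2 * pi) ^- d * \sum_(k <- r) (a k * cos (freq_dot k x) + b k * sin (freq_dot k x)).

Lemma trig_fsum r a b : trig_poly (fsum r a b).
Proof.
apply: trigZ; apply: trig_sum => k.
by apply: trig_lin; [exact: trig_cos|apply: trigZ; exact: trig_sin].
Qed.

Lemma sqint_fsum r a b : sqint mu (fsum r a b).
Proof. by apply: trig_sqint; exact: trig_fsum. Qed.

Lemma ip_fsum r a b g : sqint mu g ->
  ip mu (fsum r a b) g = (2 * pi) ^- d * \sum_(k <- r) (a k * fcos g k + b k * fsin g k).
Proof.
move=> sg; have s0 : sqint mu (fun=> 0 : R) by apply: trig_sqint; exact: trig_zero.
have h c f : sqint mu f -> ip mu (fun x => c * f x) g = c * ip mu f g.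
  move=> sf; have := ipDl c sf s0 sg.
  have -> : (fun x => c * f x + 0) = (fun x => c * f x) by apply/funext => x; rewrite addr0.
  move=> ->; rewrite [X in _ + X](_ : _ = 0) ?addr0//.
  by rewrite /ip; under eq_Rintegral do rewrite mul0r; rewrite /Rintegral integral0.
rewrite h; last first.
  apply: trig_sqint; apply: trig_sum => k.
  by apply: trig_lin; [exact: trig_cos|apply: trigZ; exact: trig_sin].
congr (_ * _); elim: r => [|k r ih].
  under eq_fun do rewrite big_nil.
  by rewrite big_nil /ip; under eq_Rintegral do rewrite mul0r; rewrite /Rintegral integral0.
rewrite big_cons -ih -addrA.
have -> : (fun x => \sum_(k0 <- k :: r) (a k0 * cos (freq_dot k0 x) + b k0 * sin (freq_dot k0 x))) =
   (fun x => a k * cos (freq_dot k x) + (b k * sin (freq_dot k x) +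
     \sum_(k0 <- r) (a k0 * cos (freq_dot k0 x) + b k0 * sin (freq_dot k0 x)))).
  by apply/funext => x; rewrite big_cons addrA.
have st : trig_poly (fun x => \sum_(k0 <- r) (a k0 * cos (freq_dot k0 x) + b k0 * sin (freq_dot k0 x)) : R).
  apply: trig_sum => k'.
  by apply: trig_lin; [exact: trig_cos|apply: trigZ; exact: trig_sin].
rewrite ipDl//; last 2 first.
- by apply: trig_sqint; exact: trig_cos.
- by apply: trig_sqint; apply: trig_lin => //; exact: trig_sin.
rewrite ipDl//; last 2 first.
- by apply: trig_sqint; exact: trig_sin.
- exact: trig_sqint.
by rewrite ipC [X in _ + (_ * X + _)]ipC.
Qed.

Let p0 : (2 * pi : R) ^+ d != 0.
Proof. by rewrite expf_neq0// mulf_neq0// gt_eqF// pi_gt0. Qed.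

Lemma product_integrals k l :
  [/\ fcos (fun x => cos (freq_dot l x)) k = (2 * pi) ^+ d / 2 * ((k == l)%:R + (k == negt l)%:R) :> R,
    fsin (fun x => cos (freq_dot l x)) k = 0 :> R,
    fcos (fun x => sin (freq_dot l x)) k = 0 :> R &
    fsin (fun x => sin (freq_dot l x)) k = (2 * pi) ^+ d / 2 * ((k == l)%:R - (k == negt l)%:R) :> R].
Proof.
have int h : trig_poly h -> mu.-integrable setT (EFin \o h) by move=> th; apply/sqint_integrable/trig_sqint.
have lin (c c' : R) h h' : trig_poly h -> trig_poly h' ->
    \int[mu]_x (c * h x + c' * h' x) = c * \int[mu]_x h x + c' * \int[mu]_x h' x.
  move=> th th'; rewrite RintegralD//; [|by apply: integrableZ; exact: int..].
  by rewrite !RintegralZl//; exact: int.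
have [Cp Sp] := @integral_trig_freq R d (addt l k).
have [Cm Sm] := @integral_trig_freq R d (addt l (negt k)).
have e1 : (addt l k == zerot) = (k == negt l) by rewrite addt_eq0 -(inj_eq (can_inj negtK)) negtK eq_sym.
have e2 : (addt l (negt k) == zerot) = (k == l) by rewrite addtNt_eq0 eq_sym.
rewrite e1 in Cp; rewrite e2 in Cm.
have tc x := trig_cos x; have ts x := trig_sin x.
rewrite /fcos /fsin; split.
- transitivity (\int[mu]_x (2^-1 * cos (freq_dot (addt l k) x) + 2^-1 * cos (freq_dot (addt l (negt k)) x))).
    by apply: eq_Rintegral => x _; rewrite !freq_dotD freq_dotN !cosD cosN sinN; field.
  by rewrite lin// Cp Cm; field.
- transitivity (\int[mu]_x (2^-1 * sin (freq_dot (addt l k) x) + - 2^-1 * sin (freq_dot (addt l (negt k)) x))).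
    by apply: eq_Rintegral => x _; rewrite !freq_dotD freq_dotN !sinD cosN sinN; field.
  by rewrite lin// Sp Sm; field.
- transitivity (\int[mu]_x (2^-1 * sin (freq_dot (addt l k) x) + 2^-1 * sin (freq_dot (addt l (negt k)) x))).
    by apply: eq_Rintegral => x _; rewrite !freq_dotD freq_dotN !sinD cosN sinN; field.
  by rewrite lin// Sp Sm; field.
- transitivity (\int[mu]_x (- 2^-1 * cos (freq_dot (addt l k) x) + 2^-1 * cos (freq_dot (addt l (negt k)) x))).
    by apply: eq_Rintegral => x _; rewrite !freq_dotD freq_dotN !cosD cosN sinN; field.
  by rewrite lin// Cp Cm; field.
Qed.

Lemma sum_delta r a l : uniq r -> \sum_(k <- r) a k * (k == l)%:R = (l \in r)%:R * a l.
Proof.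
move=> ur; have -> : \sum_(k <- r) a k * (k == l)%:R = \sum_(k <- r | k == l) a k.
  by rewrite [RHS]big_mkcond; apply: eq_bigr => k _; case: eqP; rewrite ?mulr1 ?mulr0.
have [lr|lr] := boolP (l \in r).
  by rewrite -big_filter filter_pred1_uniq// big_seq1 mul1r.
by rewrite mul0r big_seq_cond big_pred0// => k; apply/andP => -[kr /eqP kl]; rewrite -kl kr in lr.
Qed.

Definition even_coef a := forall k, a (negt k) = a k.
Definition odd_coef b := forall k, b (negt k) = - b k.

Lemma coef_fsum r a b l : sym_list r -> even_coef a -> odd_coef b ->
  fcos (fsum r a b) l = (l \in r)%:R * a l /\ fsin (fsum r a b) l = (l \in r)%:R * b l.
Proof.
move=> [ur sr] ea ob; split.
- rewrite -[LHS]/(ip mu (fsum r a b) (fun x => cos (freq_dot l x))) ip_fsum; last first.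
    by apply: trig_sqint; exact: trig_cos.
  under eq_bigr => k _ do have [-> -> _ _] := product_integrals k l.
  transitivity (2^-1 * (\sum_(k <- r) a k * (k == l)%:R + \sum_(k <- r) a k * (k == negt l)%:R)).
    rewrite -big_split/= !mulr_sumr; apply: eq_bigr => k _.
    by rewrite -exprVn; move: p0; rewrite exprVn; set c := (2 * pi) ^+ d => c0; field.
  by rewrite !sum_delta// sr ea; field.
- rewrite -[LHS]/(ip mu (fsum r a b) (fun x => sin (freq_dot l x))) ip_fsum; last first.
    by apply: trig_sqint; exact: trig_sin.
  under eq_bigr => k _ do have [_ _ -> ->] := product_integrals k l.
  transitivity (2^-1 * (\sum_(k <- r) b k * (k == l)%:R - \sum_(k <- r) b k * (k == negt l)%:R)).
    rewrite -sumrB/= !mulr_sumr; apply: eq_bigr => k _.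
    by move: p0; set c := (2 * pi) ^+ d => c0; field.
  by rewrite !sum_delta// sr ob; field.
Qed.

Lemma fcos_even f : even_coef (fcos f).
Proof. by move=> k; apply: eq_Rintegral => x _; rewrite freq_dotN cosN. Qed.

Lemma fsin_odd f : mu.-integrable setT (EFin \o f) -> odd_coef (fsin f).
Proof.
move=> intf k; rewrite -mulN1r /fsin -RintegralZl//; last first.
  by apply: integrable_trigM => //; exact: trig_sin.
by apply: eq_Rintegral => x _; rewrite freq_dotN sinN mulrN mulN1r.
Qed.

Definition power f k := fcos f k ^+ 2 + fsin f k ^+ 2.

Lemma power_ge0 f k : 0 <= power f k.
Proof. by rewrite addr_ge0// sqr_ge0. Qed.

Lemma ip_fsum_fsum r a b : sym_list r -> even_coef a -> odd_coef b ->
  ip mu (fsum r a b) (fsum r a b) = (2 * pi) ^- d * \sum_(k <- r) (a k ^+ 2 + b k ^+ 2).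
Proof.
move=> sr ea ob; rewrite ip_fsum; last exact: sqint_fsum.
congr (_ * _); rewrite big_seq [RHS]big_seq; apply: eq_bigr => k kr.
by have [-> ->] := coef_fsum k sr ea ob; rewrite kr !mul1r !expr2.
Qed.

(** The partial sums of the Fourier series of f are orthogonal projections. *)
Lemma ip_sub_fsum r f : sqint mu f -> sym_list r ->
  let h := fun x => - 1 * fsum r (fcos f) (fsin f) x + f x in
  ip mu h h = ip mu f f - (2 * pi) ^- d * \sum_(k <- r) power f k.
Proof.
move=> sf sr /=; rewrite ip_expand//; last exact: sqint_fsum.
have intf := sqint_integrable sf.
rewrite ip_fsum_fsum//; [|exact: fcos_even|exact: fsin_odd].
rewrite ip_fsum//; under [X in 2 * -1 * (_ * X)]eq_bigr do rewrite -!expr2.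
rewrite /power; ring.
Qed.

Lemma bessel f : sqint mu f ->
  fsummable (power f) /\ tsum (power f) <= (2 * pi) ^+ d * ip mu f f.
Proof.
move=> sf; apply: tsum_le => [k|r ur]; first exact: power_ge0.
have [n rn] := sym_freqs_cover r; have sn := sym_freqs_symmetric n.
apply: (@le_trans _ _ (\sum_(k <- sym_freqs n) power f k)).
  rewrite [leRHS](bigID (mem r))/= -[leLHS]addr0 lerD//; last first.
    by apply: sumr_ge0 => k _; exact: power_ge0.
  rewrite -[leRHS]big_filter (perm_big [seq k <- sym_freqs n | k \in r])//.
  apply: uniq_perm => //; first by rewrite filter_uniq//; case: sn.
  by move=> k; rewrite mem_filter; case: (boolP (k \in r)) => // /rn ->.
have := ip_ge0 mu (fun x => - 1 * fsum (sym_freqs n) (fcos f) (fsin f) x + f x).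
rewrite ip_sub_fsum// subr_ge0 mulrC ler_pdivrMr; last by rewrite exprn_gt0// mulr_gt0// pi_gt0.
by rewrite mulrC.
Qed.


Lemma coef_lin c f g k : mu.-integrable setT (EFin \o f) -> mu.-integrable setT (EFin \o g) ->
  fcos (fun x => c * f x + g x) k = c * fcos f k + fcos g k /\
  fsin (fun x => c * f x + g x) k = c * fsin f k + fsin g k.
Proof.
move=> intf intg.
have h u : trig_poly u -> \int[mu]_x ((c * f x + g x) * u x) = c * \int[mu]_x (f x * u x) + \int[mu]_x (g x * u x).
  move=> tu; have If := integrable_trigM intf tu; have Ig := integrable_trigM intg tu.
  rewrite -RintegralZl// -RintegralD//; last exact: integrableZ.
  by apply: eq_Rintegral => x _; ring.
by split; apply: h; [exact: trig_cos|exact: trig_sin].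
Qed.

Lemma coef_bound f k : sqint mu f ->
  fcos f k ^+ 2 <= (2 * pi) ^+ d * ip mu f f /\ fsin f k ^+ 2 <= (2 * pi) ^+ d * ip mu f f.
Proof.
move=> sf; have [s1 s2] := bessel sf.
have := tsum_ge_term k (power_ge0 f) s1; rewrite /power => h.
by have := sqr_ge0 (fcos f k); have := sqr_ge0 (fsin f k); lra.
Qed.

Lemma ae_eq_fun f g : sqint mu f -> sqint mu g ->
  (forall k, fcos f k = fcos g k) -> (forall k, fsin f k = fsin g k) ->
  f = g %[ae mu].
Proof.
move=> sf sg c s; have If := sqint_integrable sf; have Ig := sqint_integrable sg.
have : ae_zero (fun x => -1 * g x + f x).
  apply: fourier_unique0 => [|k|k].
  - by apply: integrableA => //; exact: integrableZ.
  - by rewrite (coef_lin _ _ Ig If).1 c; ring.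
  - by rewrite (coef_lin _ _ Ig If).2 s; ring.
apply: filterS => x h /h /= e; apply/eqP; rewrite -subr_eq0 addrC -mulN1r; exact/eqP.
Qed.

Lemma eq_ae_fun f g : sqint mu f -> sqint mu g -> f = g %[ae mu] ->
  forall u, trig_poly u -> \int[mu]_x (f x * u x) = \int[mu]_x (g x * u x).
Proof.
move=> sf sg fg u tu; rewrite /Rintegral; congr fine.
apply: ae_eq_integral => //.
- by apply: measurable_int; apply: integrable_trigM tu; exact: sqint_integrable.
- by apply: measurable_int; apply: integrable_trigM tu; exact: sqint_integrable.
- by apply: filterS fg => x h xT /=; rewrite h.
Qed.

(** Along symmetric sets of frequencies whose tails decrease fast enough, the
    partial sums are rapidly Cauchy in L^2. The limit has the prescribed
    coefficients because coefficients are continuous for the L^2 norm, by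
    [bessel]. *)
Lemma riesz_fischer a b : even_coef a -> odd_coef b ->
  fsummable (fun k => a k ^+ 2 + b k ^+ 2) ->
  exists F, [/\ sqint mu F, forall k, fcos F k = a k, forall k, fsin F k = b k &
    forall e, 0 < e -> exists2 r, sym_list r &
      ip mu (fun x => - 1 * fsum r a b x + F x) (fun x => - 1 * fsum r a b x + F x) <= e].
Proof.
move=> ea ob sab; have ab0 k : 0 <= a k ^+ 2 + b k ^+ 2 by rewrite addr_ge0 ?sqr_ge0.
have pp : 0 < (2 * pi : R) ^+ d by rewrite exprn_gt0// mulr_gt0// pi_gt0.
have e0 n : 0 < (2 * pi : R) ^+ d * 4^-1 ^+ n by rewrite mulr_gt0// exprn_gt0.
have tail n : exists m, forall s, uniq s -> (forall k, k \in s -> k \notin sym_freqs m) ->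
    \sum_(k <- s) (a k ^+ 2 + b k ^+ 2) <= (2 * pi) ^+ d * 4^-1 ^+ n.
  have [r ur hr] := tsum_tail ab0 sab (e0 n); have [m rm] := sym_freqs_cover r.
  exists m => s us sm; apply: hr => // k /sm; apply: contraNN; exact: rm.
(* a strictly increasing sequence M above m *)
have [m mP] := choice tail; pose M n := (\sum_(i < n.+1) (m i).+1)%N.
pose L n := sym_freqs (M n).
have Lmono n : {subset L n <= L n.+1}.
  by apply: sym_freqs_mono; rewrite /M [leqRHS]big_ord_recr/= leq_addr.
have mM n : (m n <= M n)%N by rewrite /M big_ord_recr/= addnS ltnW// ltnS leq_addl.
have nM n : (n < M n)%N.
  by elim: n => [|n ih]; rewrite /M big_ord_recr/= ?big_ord0// addnS ltnS (leq_trans ih)// leq_addr.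
pose L' n := [seq k <- L n.+1 | k \notin L n].
have sL n : sym_list (L n) by exact: sym_freqs_symmetric.
have sL' n : sym_list (L' n).
  split; first by rewrite filter_uniq//; case: (sL n.+1).
  by move=> k; rewrite !mem_filter (sL n).2 (sL n.+1).2.
have [F sF hF] : exists2 F, sqint mu F & forall n,
    ip mu (fun x => fsum (L n) a b x - F x) (fun x => fsum (L n) a b x - F x) <= 4 * 2^-1 ^+ n.
  apply: L2_fast_complete => [n|n]; first exact: sqint_fsum.
  have -> : (fun x => fsum (L n.+1) a b x - fsum (L n) a b x) = fsum (L' n) a b.
    apply/funext => x; rewrite /fsum -mulrBr; congr (_ * _).
    rewrite (bigID (mem (L n)))/= -big_filter.
    rewrite (perm_big (L n)) /=; first by rewrite [in RHS]big_filter addrAC subrr add0r.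
    apply: uniq_perm; first by rewrite filter_uniq//; case: (sL n.+1).
      by case: (sL n).
    by move=> k; rewrite mem_filter; case: (boolP (k \in L n)) => // /Lmono ->.
  rewrite ip_fsum_fsum// mulrC ler_pdivrMr// mulrC; apply: mP.
    by case: (sL' n).
  move=> k; rewrite mem_filter => /andP[+ _]; apply: contraNN.
  exact: sym_freqs_mono.
have small (e : R) : 0 < e -> exists n, 4 * 2^-1 ^+ n <= e.
  move=> ep; have : 4 * 2^-1 ^+ n @[n --> \oo] --> (0 : R).
    by rewrite -(mulr0 4); apply: cvgM; [exact: cvg_cst|apply: cvg_expr; rewrite ger0_norm; lra].
  move=> /cvgrPdist_le /(_ e ep)[n _ /(_ n (leqnn n))]; rewrite sub0r normrN => h.
  by exists n; apply: le_trans (ler_norm _) h.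
have approx (e : R) : 0 < e -> exists n, forall n', (n <= n')%N ->
      ip mu (fun x => - 1 * fsum (L n') a b x + F x) (fun x => - 1 * fsum (L n') a b x + F x) <= e.
  move=> /small[n hn]; exists n => n' nn'; apply: le_trans hn.
  apply: (@le_trans _ _ (4 * 2^-1 ^+ n')); last first.
    by rewrite ler_wpM2l// ler_wiXn2l//; lra.
  apply: le_trans (hF n'); rewrite le_eqVlt; apply/orP; left; apply/eqP.
  by apply: eq_Rintegral => x _; ring.
have IF := sqint_integrable sF.
have coefs k : forall e : R, 0 < e -> (fcos F k - a k) ^+ 2 <= e /\ (fsin F k - b k) ^+ 2 <= e.
  move=> e ep; have e1 : 0 < e / (2 * pi) ^+ d by rewrite divr_gt0.
  have [n hn] := approx _ e1.
  have [n2 kn2] : exists n2, forall n', (n2 <= n')%N -> k \in L n'.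
    exists (pickle k) => n' kn; rewrite mem_sym_freqs (leq_ltn_trans kn)//; exact: nM.
  pose n' := maxn n n2.
  have sS := sqint_fsum (L n') a b; have IS := sqint_integrable sS.
  have := @coef_bound (fun x => - 1 * fsum (L n') a b x + F x) k (sqint_lin _ sS sF).
  rewrite (coef_lin _ _ IS IF).1 (coef_lin _ _ IS IF).2.
  have [-> ->] := coef_fsum k (sL n') ea ob; rewrite kn2 ?leq_maxr//.
  have := hn n' (leq_maxl _ _); rewrite ler_pdivlMr// mulrC => h.
  by move=> [h1 h2]; split; (apply: le_trans; last exact: h); [move: h1|move: h2];
    rewrite mul1r mulN1r addrC.
have sq0 (x : R) : (forall e, 0 < e -> x ^+ 2 <= e) -> x = 0.
  move=> h; apply/eqP; rewrite -sqrf_eq0 eq_le sqr_ge0 andbT; apply/ler_addgt0Pr => e ep.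
  by rewrite add0r; exact: h.
exists F; split => // [k|k|e ep].
- by apply/eqP; rewrite -subr_eq0; apply/eqP/sq0 => e /(coefs k)[].
- by apply/eqP; rewrite -subr_eq0; apply/eqP/sq0 => e /(coefs k)[].
- by have [n hn] := approx e ep; exists (L n) => //; exact: hn.
Qed.

Lemma ip_ae f g : sqint mu f -> sqint mu g -> f = g %[ae mu] -> ip mu f f = ip mu g g.
Proof.
move=> sf sg fg; rewrite /ip /Rintegral; congr fine.
have m h : sqint mu h -> measurable_fun setT (fun x => (h x * h x)%:E).
  by move=> [mh _]; apply/measurable_EFinP; exact: measurable_funM.
apply: ae_eq_integral => //; [exact: m|exact: m|].
by apply: filterS fg => x h xT /=; rewrite h.
Qed.

(** The function built by [riesz_fischer] from the coefficients of f is f, by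
    uniqueness. *)
Lemma fourier_approx f (e : R) : sqint mu f -> 0 < e ->
  exists2 r, sym_list r &
    ip mu (fun x => - 1 * fsum r (fcos f) (fsin f) x + f x)
          (fun x => - 1 * fsum r (fcos f) (fsin f) x + f x) <= e.
Proof.
move=> sf e0; have If := sqint_integrable sf.
have [F [sF Fc Fs hF]] := riesz_fischer (@fcos_even f) (fsin_odd If) (bessel sf).1.
have [r sr hr] := hF e e0; exists r => //; apply: le_trans hr.
have sS := sqint_fsum r (fcos f) (fsin f).
rewrite (@ip_ae _ (fun x => - 1 * fsum r (fcos f) (fsin f) x + F x))//; [exact: sqint_lin|exact: sqint_lin|].
have := @ae_eq_fun f F sf sF (fun k => esym (Fc k)) (fun k => esym (Fs k)).
by apply: filterS => x h xT; rewrite h.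
Qed.

(** Bessel's inequality has the defect [ip_sub_fsum], which [fourier_approx]
    makes arbitrarily small. *)
Lemma parseval f : sqint mu f -> ip mu f f = (2 * pi) ^- d * tsum (power f).
Proof.
move=> sf; have [s1 s2] := bessel sf.
have pp : 0 < (2 * pi : R) ^+ d by rewrite exprn_gt0// mulr_gt0// pi_gt0.
apply/le_anti/andP; split; last first.
  by rewrite mulrC ler_pdivrMr// mulrC.
apply/ler_addgt0Pr => e e0; have [r sr] := fourier_approx sf e0.
rewrite ip_sub_fsum// lerBlDr => /le_trans; apply.
rewrite [leRHS]addrC lerD2l ler_wpM2l//; first by rewrite invr_ge0 ltW.
by apply: tsum_ge => //; [exact: power_ge0|case: sr].
Qed.

Lemma coef_trig_cos k l : fcos (fun x => cos (freq_dot l x)) k = (2 * pi) ^+ d / 2 * ((k == l)%:R + (k == negt l)%:R) :> R.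
Proof. by case: (product_integrals k l). Qed.

End fourier_series.

(** * The space of states *)

Section states.
Context {R : realType} {d : nat}.
Local Notation mu := (@torus_measure R d).
Local Notation freq := (d.-tuple int).
Local Notation St := (@state R d).
Local Notation C := (@state_space R d).
Local Notation N := (@state_norm R d).
Implicit Types (f g : torus R d -> R) (k l : freq) (u v X Y : St) (c : bool).

(** The cosine and the sine coefficients, treated at once: the wave equation
    acts on them in the same way. *)
Definition tcoef c f k : R := if c then fcos f k else fsin f k.

Definition weight k : R := 1 + freq_sqnorm k.

Definition energy k (z : R * R) : R := weight k * z.1 ^+ 2 + z.2 ^+ 2.

(** The coefficients of the position and of the velocity at one frequency, a
    plane in which the wave group acts linearly. *)
Definition mode c u k : R * R := (tcoef c u.1 k, tcoef c u.2 k).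

Definition state_energy u k : R := energy k (mode true u k) + energy k (mode false u k).

Lemma freq_sqnorm_ge0 k : 0 <= freq_sqnorm k :> R.
Proof. by apply: sumr_ge0 => i _; exact: sqr_ge0. Qed.

Lemma freq_sqnorm_neg k : freq_sqnorm (negt k) = freq_sqnorm k :> R.
Proof.
by apply: eq_bigr => i _; rewrite tnth_mktuple rmorphN sqrrN.
Qed.

Lemma weight_ge1 k : 1 <= weight k.
Proof. by rewrite lerDl freq_sqnorm_ge0. Qed.

Lemma weight_gt0 k : 0 < weight k.
Proof. exact: lt_le_trans ltr01 (weight_ge1 k). Qed.

Lemma weight_ge0 k : 0 <= weight k.
Proof. exact: ltW (weight_gt0 k). Qed.

Lemma energy_ge0 k z : 0 <= energy k z.
Proof.
by apply: addr_ge0; [apply: mulr_ge0; [exact: weight_ge0|exact: sqr_ge0]|exact: sqr_ge0].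
Qed.

Lemma state_energy_ge0 u k : 0 <= state_energy u k.
Proof. by rewrite addr_ge0// energy_ge0. Qed.

Lemma power_tcoef f k : power f k = tcoef true f k ^+ 2 + tcoef false f k ^+ 2.
Proof. by []. Qed.

Lemma state_energyE u k : state_energy u k = weight k * power u.1 k + power u.2 k.
Proof. by rewrite /state_energy /energy !power_tcoef/=; ring. Qed.

Lemma L2P f : L2 f <-> sqint mu f.
Proof. exact: Lfun2P. Qed.

Lemma sobolev_sumE s f : sobolev_sum s f =
  (\esum_(k in [set: freq]) (weight k ^+ s * power f k)%:E)%E.
Proof.
by apply: eq_esum => k _; rewrite /sqmod fourierE/= sqrrN.
Qed.

Lemma sobolevP s f : sobolev s f <-> sqint mu f /\ fsummable (fun k => weight k ^+ s * power f k).
Proof. by rewrite /sobolev/= L2P sobolev_sumE. Qed.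

Lemma weight_power_ge0 s f k : 0 <= weight k ^+ s * power f k.
Proof. by rewrite mulr_ge0 ?power_ge0// exprn_ge0// ltW// weight_gt0. Qed.

Let pp : 0 < (2 * pi : R) ^+ d.
Proof. by rewrite exprn_gt0// mulr_gt0// pi_gt0. Qed.

Let pp' : 0 <= (2 * pi : R) ^- d.
Proof. by rewrite invr_ge0 ltW. Qed.

Lemma H1norm_sqr f : sobolev 1 f ->
  H1norm f ^+ 2 = (2 * pi) ^- d * tsum (fun k => weight k * power f k).
Proof.
move=> /sobolevP[sf hf]; rewrite /H1norm sobolev_sumE.
have E : (fun k => weight k ^+ 1 * power f k) = (fun k => weight k * power f k).
  by apply/funext => k; rewrite expr1.
rewrite sqr_sqrtr; last first.
  by rewrite mulr_ge0//; exact: (tsum_ge0 (weight_power_ge0 1 f)).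
by rewrite -E.
Qed.

Lemma L2norm_sqr f : sqint mu f -> L2norm f ^+ 2 = ip mu f f.
Proof. by move=> sf; rewrite /L2norm Lnorm2E// sqr_sqrtr// ip_ge0. Qed.

Lemma stateP u : C u <-> [/\ sqint mu u.1, sqint mu u.2 & fsummable (state_energy u)].
Proof.
have E1 : (fun k => weight k ^+ 1 * power u.1 k) = (fun k => weight k * power u.1 k).
  by apply/funext => k; rewrite expr1.
have a0 k : 0 <= weight k * power u.1 k by rewrite mulr_ge0 ?power_ge0 ?weight_ge0.
rewrite /state_space/= sobolevP L2P E1; split=> [[[s1 h1] s2]|[s1 s2 h]].
  split => //; have [h _] := tsumD a0 (power_ge0 u.2) h1 (bessel s2).1.
  by move: h; congr fsummable; apply/funext => k; rewrite state_energyE.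
split=> //; split=> //; apply: (tsum_mono _ h).1 => k.
by rewrite state_energyE a0/= lerDl power_ge0.
Qed.

Lemma state_normE u : C u -> N u = Num.sqrt ((2 * pi) ^- d * tsum (state_energy u)).
Proof.
move=> Cu; have [s1 s2 h] := (stateP u).1 Cu; rewrite /state_norm.
rewrite H1norm_sqr ?L2norm_sqr//; last by case: Cu.
rewrite parseval// -mulrDr; congr (Num.sqrt (_ * _)).
have a0 k : 0 <= weight k * power u.1 k by rewrite mulr_ge0 ?power_ge0 ?weight_ge0.
rewrite -(tsumD a0 (power_ge0 u.2) _ (bessel s2).1).2.
  by congr tsum; apply/funext => k; rewrite state_energyE.
by apply: (tsum_mono _ h).1 => k; rewrite state_energyE a0/= lerDl power_ge0.
Qed.

Lemma state_norm_sqr u : C u -> (2 * pi) ^+ d * N u ^+ 2 = tsum (state_energy u).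
Proof.
move=> Cu; rewrite state_normE// sqr_sqrtr; last by rewrite mulr_ge0// tsum_ge0//; exact: state_energy_ge0.
by rewrite mulrA mulfV ?mul1r// gt_eqF.
Qed.

Lemma state_norm_le u (e : R) : C u -> 0 <= e -> tsum (state_energy u) <= (2 * pi) ^+ d * e ^+ 2 -> N u <= e.
Proof.
move=> Cu e0; rewrite -state_norm_sqr// ler_pM2l// => h.
by rewrite -(@ler_pXn2r _ 2)// ?nnegrE// sqrtr_ge0.
Qed.

Lemma tcoef_even c f k : sqint mu f -> tcoef c f (negt k) = (if c then 1 else -1) * tcoef c f k.
Proof.
move=> sf; case: c; rewrite /tcoef ?mul1r ?mulN1r; first exact: fcos_even.
by apply: fsin_odd; exact: sqint_integrable.
Qed.

Lemma tcoef_lin c a f g k : sqint mu f -> sqint mu g ->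
  tcoef c (a *: f + g) k = a * tcoef c f k + tcoef c g k.
Proof.
move=> sf sg; have [h1 h2] := coef_lin a k (sqint_integrable sf) (sqint_integrable sg).
by case: c.
Qed.

Definition zlin (a : R) (z w : R * R) : R * R := (a * z.1 + w.1, a * z.2 + w.2).

Lemma mode_lin c a u v k : C u -> C v -> mode c (a *: u + v) k = zlin a (mode c u k) (mode c v k).
Proof.
move=> /stateP[u1 u2 _] /stateP[v1 v2 _].
by rewrite /mode /zlin/=; congr (_, _); exact: tcoef_lin.
Qed.

(** The Riesz-Fischer theorem for each component; the hypothesis on z is the
    symmetry of the coefficients of a real function. *)
Lemma state_of_coefs (z : bool -> freq -> R * R) :
  (forall c k, z c (negt k) = ((if c then 1 else -1) * (z c k).1, (if c then 1 else -1) * (z c k).2)) ->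
  fsummable (fun k => energy k (z true k) + energy k (z false k)) ->
  exists2 u, C u & forall c k, mode c u k = z c k.
Proof.
move=> hz hs.
have ev k : z true (negt k) = z true k by rewrite hz !mul1r -surjective_pairing.
have od k : z false (negt k) = (- (z false k).1, - (z false k).2) by rewrite hz !mulN1r.
have [f [sf fc fs _]] : exists f, [/\ sqint mu f, forall k, fcos f k = (z true k).1,
    forall k, fsin f k = (z false k).1 & True].
  have [||| f [sf fc fs _]] := @riesz_fischer R d (fun k => (z true k).1) (fun k => (z false k).1).
  - by move=> k; rewrite ev.
  - by move=> k; rewrite od.
  - apply: (tsum_mono _ hs).1 => k; rewrite addr_ge0 ?sqr_ge0//= /energy.
    have := weight_ge1 k; have := sqr_ge0 (z true k).1; have := sqr_ge0 (z false k).1.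
    by have := sqr_ge0 (z true k).2; have := sqr_ge0 (z false k).2; nra.
  by exists f.
have [g [sg gc gs _]] : exists f, [/\ sqint mu f, forall k, fcos f k = (z true k).2,
    forall k, fsin f k = (z false k).2 & True].
  have [||| g [sg gc gs _]] := @riesz_fischer R d (fun k => (z true k).2) (fun k => (z false k).2).
  - by move=> k; rewrite ev.
  - by move=> k; rewrite od.
  - apply: (tsum_mono _ hs).1 => k; rewrite addr_ge0 ?sqr_ge0//= /energy.
    have := weight_ge1 k; have := sqr_ge0 (z true k).1; have := sqr_ge0 (z false k).1.
    by have := sqr_ge0 (z true k).2; have := sqr_ge0 (z false k).2; nra.
  by exists g.
have E c k : mode c (f, g) k = z c k.
  by rewrite /mode; case: c => /=; rewrite ?fc ?fs ?gc ?gs -surjective_pairing.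
exists (f, g) => //; apply/stateP; split => //.
by move: hs; congr fsummable; apply/funext => k; rewrite /state_energy !E.
Qed.

Lemma mode_even c u k : C u ->
  mode c u (negt k) = ((if c then 1 else -1) * (mode c u k).1, (if c then 1 else -1) * (mode c u k).2).
Proof. by move=> /stateP[u1 u2 _]; rewrite /mode !tcoef_even. Qed.

Lemma energy_lin (t : R) k z w (a : R) : 0 < t ->
  energy k (zlin a z w) <= (1 + t) * (a ^+ 2 * energy k z) + (1 + t^-1) * energy k w.
Proof.
move=> t0; have h (x y : R) : (x + y) ^+ 2 <= (1 + t) * x ^+ 2 + (1 + t^-1) * y ^+ 2.
  rewrite -subr_ge0; have -> : (1 + t) * x ^+ 2 + (1 + t^-1) * y ^+ 2 - (x + y) ^+ 2 = t^-1 * (t * x - y) ^+ 2.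
    by field; lra.
  by rewrite mulr_ge0 ?sqr_ge0// invr_ge0 ltW.
rewrite /energy /zlin/=; have w0 := weight_gt0 k.
have := h (a * z.1) w.1; have := h (a * z.2) w.2; rewrite !exprMn; nra.
Qed.

Lemma state_energy_lin (t : R) k u v (a : R) : 0 < t -> C u -> C v ->
  state_energy (a *: u + v) k <= (1 + t) * (a ^+ 2 * state_energy u k) + (1 + t^-1) * state_energy v k.
Proof.
move=> t0 Cu Cv; rewrite /state_energy !mode_lin//.
have := energy_lin k (mode true u k) (mode true v k) a t0.
by have := energy_lin k (mode false u k) (mode false v k) a t0; lra.
Qed.

Lemma state_lin a u v : C u -> C v -> C (a *: u + v).
Proof.
move=> Cu Cv; have /stateP[u1 u2 hu] := Cu; have /stateP[v1 v2 hv] := Cv.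
apply/stateP; split; [exact: sqint_lin|exact: sqint_lin|].
have [h1 _] := tsumZ (sqr_ge0 a) (state_energy_ge0 u) hu.
have aen0 k : 0 <= a ^+ 2 * state_energy u k by rewrite mulr_ge0 ?sqr_ge0 ?state_energy_ge0.
by apply: (tsum_minkowski aen0 (state_energy_ge0 v) (state_energy_ge0 _) h1 hv (fun t k t0 => state_energy_lin k a t0 Cu Cv)).1.
Qed.

Lemma state0 : C 0.
Proof.
have s0 : sqint mu (fun=> 0 : R) by apply: trig_sqint; exact: trig_zero.
have f0 k : power (fun=> 0 : R) k = 0 :> R.
  rewrite /power /fcos /fsin.
  have E (h : torus R d -> R) : \int[mu]_x (0 * h x : R) = 0 by rewrite /Rintegral; under eq_integral do rewrite mul0r; rewrite integral0.
  by rewrite !E expr0n/= addr0.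
apply/stateP; split => //.
apply: (tsum_le _ _).1 => [k|r _]; first exact: state_energy_ge0.
by rewrite big1// => k _; rewrite state_energyE !f0 mulr0 addr0.
Qed.

Lemma state_norm_lin u v a : C u -> C v -> N (a *: u + v) <= `|a| * N u + N v.
Proof.
move=> Cu Cv; have Cw := state_lin a Cu Cv.
have /stateP[u1 u2 hu] := Cu; have /stateP[v1 v2 hv] := Cv.
have [h1 E1] := tsumZ (sqr_ge0 a) (state_energy_ge0 u) hu.
have aen0 k : 0 <= a ^+ 2 * state_energy u k by rewrite mulr_ge0 ?sqr_ge0 ?state_energy_ge0.
have [_] := tsum_minkowski aen0 (state_energy_ge0 v) (state_energy_ge0 _) h1 hv (fun t k t0 => state_energy_lin k a t0 Cu Cv).
rewrite E1 sqrtrM ?sqr_ge0// sqrtr_sqr => h.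
rewrite !state_normE// !sqrtrM//.
by rewrite mulrCA -mulrDr ler_wpM2l// sqrtr_ge0.
Qed.

Lemma state_norm_null u : C u -> (forall c k, mode c u k = (0, 0)) -> N u = 0.
Proof.
move=> Cu h; apply/le_anti; rewrite sqrtr_ge0 andbT; apply: state_norm_le => //.
rewrite expr0n/= mulr0; apply: (tsum_le (state_energy_ge0 u) _).2 => r _.
by rewrite big1// => k _; rewrite /state_energy !h /energy/= expr0n/= mulr0 !addr0.
Qed.

(** In particular the coefficients are continuous on the state space. *)
Lemma mode_bound c u k : C u ->
  (mode c u k).1 ^+ 2 <= (2 * pi) ^+ d * N u ^+ 2 /\ (mode c u k).2 ^+ 2 <= (2 * pi) ^+ d * N u ^+ 2.
Proof.
move=> Cu; rewrite state_norm_sqr//.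
have /stateP[_ _ hu] := Cu; have := tsum_ge_term k (state_energy_ge0 u) hu.
rewrite /state_energy /energy; have := weight_ge1 k.
have := sqr_ge0 (mode true u k).1; have := sqr_ge0 (mode true u k).2.
have := sqr_ge0 (mode false u k).1; have := sqr_ge0 (mode false u k).2.
by case: c => *; split; nra.
Qed.


Definition zsub (z w : R * R) : R * R := (z.1 - w.1, z.2 - w.2).

Lemma mode_sub c u v k : C u -> C v -> mode c (u - v) k = zsub (mode c u k) (mode c v k).
Proof.
move=> Cu Cv; have -> : u - v = (-1) *: v + u by rewrite scaleN1r addrC.
by rewrite mode_lin// /zlin /zsub !mulN1r [- _ + _]addrC [X in (_, X)]addrC.
Qed.

Lemma stateB u v : C u -> C v -> C (u - v).
Proof.
by move=> Cu Cv; rewrite -scaleN1r addrC; exact: state_lin.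
Qed.

Lemma energy_sub k z w : energy k z <= 2 * energy k (zsub z w) + 2 * energy k w.
Proof.
rewrite /energy /zsub /=; have := weight_gt0 k.
have h (x y : R) : x ^+ 2 <= 2 * (x - y) ^+ 2 + 2 * y ^+ 2 by have := sqr_ge0 (x - 2 * y); nra.
by have := h z.1 w.1; have := h z.2 w.2; nra.
Qed.

Let cauchy_real (x : nat -> R) :
  (forall e, 0 < e -> exists n0, forall m n, (n0 <= m)%N -> (n0 <= n)%N -> `|x m - x n| <= e) ->
  cvgn x.
Proof.
move=> h; apply: cauchy_cvg; apply: cauchy_exP => e e0.
have e2 : 0 < e / 2 by rewrite divr_gt0.
have [n0 hn] := h _ e2.
exists (x n0); exists n0 => // n /= nn0; rewrite /ball/=.
by apply: le_lt_trans (hn n0 n (leqnn _) nn0) _; lra.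
Qed.

Lemma cvg_sum_seq (I : Type) (r : seq I) (f : nat -> I -> R) (l : I -> R) :
  (forall i, f n i @[n --> \oo] --> l i) ->
  \sum_(i <- r) f n i @[n --> \oo] --> \sum_(i <- r) l i.
Proof.
move=> h; elim: r => [|i r ih].
  by rewrite big_nil; under eq_fun do rewrite big_nil; exact: cvg_cst.
by rewrite big_cons; under eq_fun do rewrite big_cons; exact: cvgD.
Qed.

Lemma energy_sub_cvg k z (w1 w2 : nat -> R) (l1 l2 : R) :
  w1 m @[m --> \oo] --> l1 -> w2 m @[m --> \oo] --> l2 ->
  energy k (zsub z (w1 m, w2 m)) @[m --> \oo] --> energy k (zsub z (l1, l2)).
Proof.
move=> h1 h2; rewrite /energy /zsub /=.
have s (x : R) (w : nat -> R) (l : R) : w m @[m --> \oo] --> l ->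
    (x - w m) ^+ 2 @[m --> \oo] --> (x - l) ^+ 2.
  move=> h; have hB : (x - w m) @[m --> \oo] --> x - l by apply: cvgB => //; exact: cvg_cst.
  by rewrite expr2; under eq_fun do rewrite expr2; exact: cvgM.
apply: cvgD; last exact: s.
by apply: cvgM; [exact: cvg_cst|exact: s].
Qed.

(** The coefficients converge one by one, and Fatou's lemma turns the Cauchy
    condition into convergence to the state that has the limits as its
    coefficients. *)
Lemma state_complete (U : nat -> St) : (forall n, C (U n)) ->
  (forall e, 0 < e -> exists n0, forall m n, (n0 <= m)%N -> (n0 <= n)%N -> N (U m - U n) <= e) ->
  exists2 u, C u & forall e, 0 < e -> exists n0, forall n, (n0 <= n)%N -> N (U n - u) <= e.
Proof.
move=> CU hU.
have zcauchy c k : cvgn (fun n => (mode c (U n) k).1) /\ cvgn (fun n => (mode c (U n) k).2).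
  have h e : 0 < e -> exists n0, forall m n, (n0 <= m)%N -> (n0 <= n)%N ->
      (2 * pi) ^+ d * N (U m - U n) ^+ 2 <= e ^+ 2.
    move=> e0; have [n0 hn] := hU (e / (1 + (2 * pi) ^+ d)) (divr_gt0 e0 (addr_gt0 ltr01 pp)).
    exists n0 => m n /hn /[apply]; set D := (2 * pi) ^+ d => h.
    have D0 : 0 < D by exact: pp.
    have nn : 0 <= N (U m - U n) by exact: sqrtr_ge0.
    have : N (U m - U n) * (1 + D) <= e by rewrite -ler_pdivlMr// addr_gt0.
    move: nn; set x := N _ => nn hx; have : (x * (1 + D)) ^+ 2 <= e ^+ 2.
      by rewrite ler_pXn2r// nnegrE ?mulr_ge0 ?addr_ge0// ltW.
    by apply: le_trans; have := sqr_ge0 x; nra.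
  have ab (x e : R) : 0 < e -> x ^+ 2 <= e ^+ 2 -> `|x| <= e.
    by move=> e0; rewrite -[x ^+ 2]real_normK ?num_real// ler_pXn2r// nnegrE// ltW.
  split; apply: cauchy_real => e e0; have [n0 hn] := h e e0; exists n0 => m n mn nn;
    apply: ab => //; apply: le_trans (hn m n mn nn);
    have := mode_bound c k (stateB (CU m) (CU n)); rewrite mode_sub//= => -[] //.
pose zl c k : R * R := (limn (fun n => (mode c (U n) k).1), limn (fun n => (mode c (U n) k).2)).
have zl1 c k : (mode c (U n) k).1 @[n --> \oo] --> (zl c k).1 by exact: (zcauchy c k).1.
have zl2 c k : (mode c (U n) k).2 @[n --> \oo] --> (zl c k).2 by exact: (zcauchy c k).2.
pose dn n k := energy k (zsub (mode true (U n) k) (zl true k)) + energy k (zsub (mode false (U n) k) (zl false k)).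
have dn0 n k : 0 <= dn n k by rewrite addr_ge0// energy_ge0.
have fatou e n0 : 0 <= e ->
    (forall m n, (n0 <= m)%N -> (n0 <= n)%N -> N (U m - U n) <= e) ->
    forall n, (n0 <= n)%N -> forall r, uniq r -> \sum_(k <- r) dn n k <= (2 * pi) ^+ d * e ^+ 2.
  move=> e0 hn n nn r ur.
  have cen c k : energy k (zsub (mode c (U n) k) (mode c (U m) k)) @[m --> \oo] -->
      energy k (zsub (mode c (U n) k) (zl c k)).
    by apply: energy_sub_cvg; [exact: zl1|exact: zl2].
  have cs : \sum_(k <- r) state_energy (U n - U m) k @[m --> \oo] --> \sum_(k <- r) dn n k.
    apply: cvg_sum_seq => k; rewrite /state_energy.
    under eq_fun do rewrite !mode_sub//.
    by apply: cvgD; exact: cen.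
  rewrite -(cvg_lim _ cs)//; apply: limr_le; first by apply/cvg_ex; eexists; exact: cs.
  exists n0 => // m /= mn; have Cnm := stateB (CU n) (CU m).
  have /stateP[_ _ s] := Cnm.
  apply: le_trans (tsum_ge (state_energy_ge0 _) s ur) _; rewrite -state_norm_sqr// ler_pM2l//.
  by rewrite ler_pXn2r ?nnegrE ?sqrtr_ge0// hn.
have [n1 hn1] := hU 1 ltr01.
have [|| u Cu uE] := @state_of_coefs zl.
- move=> c k; rewrite /zl/=; congr (_, _); apply/cvg_lim => //.
    have -> : (fun n => tcoef c (U n).1 (negt k)) = (fun n => (if c then 1 else -1) * tcoef c (U n).1 k).
      by apply/funext => n; rewrite tcoef_even//; case/stateP: (CU n).
    by apply: cvgM; [exact: cvg_cst|exact: zl1].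
    have -> : (fun n => tcoef c (U n).2 (negt k)) = (fun n => (if c then 1 else -1) * tcoef c (U n).2 k).
      by apply/funext => n; rewrite tcoef_even//; case/stateP: (CU n).
    by apply: cvgM; [exact: cvg_cst|exact: zl2].
- have /stateP[_ _ s] := CU n1.
  apply: (@tsum_le _ _ _ (2 * ((2 * pi) ^+ d * 1 ^+ 2) + 2 * tsum (state_energy (U n1))) _ _).1.
    by move=> k; rewrite addr_ge0// energy_ge0.
  move=> r ur; have := fatou 1 n1 ler01 hn1 n1 (leqnn _) r ur.
  have := tsum_ge (state_energy_ge0 (U n1)) s ur => h1 h2.
  apply: (@le_trans _ _ (2 * \sum_(k <- r) dn n1 k + 2 * \sum_(k <- r) state_energy (U n1) k)); last by lra.
  rewrite !mulr_sumr -big_split/=; apply: ler_sum => k _; rewrite /dn /state_energy.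
  have sw (z w : R * R) : energy k (zsub z w) = energy k (zsub w z).
    by rewrite /energy /zsub/= -[z.1 - w.1]opprB -[z.2 - w.2]opprB !sqrrN.
  rewrite (sw (mode true _ _)) (sw (mode false _ _)).
  have E (A B A' B' : R) : 2 * (A + B) + 2 * (A' + B') = (2 * A + 2 * A') + (2 * B + 2 * B') by ring.
  rewrite E.
  by apply: lerD; exact: energy_sub.
exists u => // e e0; have [n0 hn] := hU e e0; exists n0 => n nn.
apply: state_norm_le; [exact: stateB|exact: ltW|].
apply: (tsum_le (state_energy_ge0 _) _).2 => r ur; apply: le_trans (fatou e n0 (ltW e0) hn n nn r ur).
by rewrite le_eqVlt; apply/orP; left; apply/eqP/eq_bigr => k _; rewrite /state_energy !mode_sub// !uE.
Qed.

Lemma state_seminorm : complete_seminorm C N.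
Proof.
have N0 u : 0 <= N u by exact: sqrtr_ge0.
have h a u : C u -> N (a *: u) <= `|a| * N u.
  move=> Cu; have := state_norm_lin a Cu state0; rewrite addr0.
  have -> : N 0 = 0; last by rewrite addr0.
  by apply: state_norm_null; [exact: state0|move=> c k; have := mode_sub c k Cu Cu; rewrite subrr => ->; rewrite /zsub !subrr].
split => //.
- exact: state_lin.
- exact: state0.
- move=> a u Cu; apply/le_anti; rewrite h//=.
  have [->|a0] := eqVneq a 0; first by rewrite normr0 mul0r.
  have Ca : C (a *: u) by rewrite -[_ *: _]addr0; apply: state_lin => //; exact: state0.
  have := h a^-1 _ Ca; rewrite scalerA mulVf// scale1r normfV.
  by rewrite mulrC ler_pdivlMr ?normr_gt0// mulrC.
- by move=> u v Cu Cv; have := state_norm_lin 1 Cu Cv; rewrite scale1r normr1 mul1r.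
- exact: state_complete.
Qed.

End states.

(** * The wave group *)

Section sine_cosine_bounds.
Context {R : realType}.
Implicit Types x y : R.

Lemma mvt0 (f df : R -> R) x : (forall y, is_derive y 1 f (df y)) ->
  exists2 y, `|y| <= `|x| & f x - f 0 = df y * x.
Proof.
move=> hf; have cf y : {for y, continuous f}.
  by apply/differentiable_continuous/derivable1_diffP; have [] := hf y.
have [x0|x0] := leP 0 x.
  have [||y yx E] := @MVT_segment R f df 0 x => //.
    by apply: continuous_subspaceT => y; exact: cf.
  exists y; last by rewrite E subr0.
  by move: yx; rewrite in_itv/= => /andP[y0 yx]; rewrite !ger0_norm.
have [||y yx E] := @MVT_segment R f df x 0 => //.
- exact: ltW.
- by apply: continuous_subspaceT => y; exact: cf.
exists y; last by move: E; rewrite sub0r mulrN -opprB => /oppr_inj.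
by move: yx; rewrite in_itv/= => /andP[xy y0]; rewrite !ler0_norm ?lerN2// ltW.
Qed.

Lemma sin_bound x : `|sin x| <= `|x|.
Proof.
have [y _] := @mvt0 sin cos x (@is_derive_sin R); rewrite sin0 subr0 => ->.
by rewrite normrM ler_piMl// cos_max.
Qed.

Lemma cosB1_bound x : `|cos x - 1| <= `|x|.
Proof.
have [y _] := @mvt0 cos (fun y => - sin y) x (@is_derive_cos R); rewrite cos0 => ->.
by rewrite normrM normrN ler_piMl// sin_max.
Qed.

Lemma sin_sub_bound x : `|sin x - x| <= x ^+ 2.
Proof.
have [y yx] := @mvt0 (fun y => sin y - y) (fun y => cos y - 1) x _.
rewrite sin0 !subr0 => ->; rewrite normrM -[x ^+ 2]real_normK ?num_real// expr2.
by rewrite ler_wpM2r// (le_trans (cosB1_bound y)).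
Qed.

Lemma cosB1_sqr_bound x : `|cos x - 1| <= x ^+ 2.
Proof.
have [y yx] := @mvt0 cos (fun y => - sin y) x (@is_derive_cos R); rewrite cos0 => ->.
rewrite normrM normrN -[x ^+ 2]real_normK ?num_real// expr2.
by rewrite ler_wpM2r// (le_trans (sin_bound y)).
Qed.

End sine_cosine_bounds.

Section multipliers.
Context {R : realType} {d : nat}.
Local Notation freq := (d.-tuple int).
Implicit Types (k : freq) (s t : R).

Definition fnorm k : R := Num.sqrt (freq_sqnorm k).

Lemma fnorm_sqr k : fnorm k ^+ 2 = freq_sqnorm k.
Proof. by rewrite sqr_sqrtr// freq_sqnorm_ge0. Qed.

Lemma fnorm_ge0 k : 0 <= fnorm k.
Proof. exact: sqrtr_ge0. Qed.

Lemma fnorm_neg k : fnorm (negt k) = fnorm k.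
Proof. by rewrite /fnorm freq_sqnorm_neg. Qed.

Lemma weightE k : weight k = 1 + fnorm k ^+ 2.
Proof. by rewrite /weight fnorm_sqr. Qed.

Definition wcos k t : R := cos (fnorm k * t).
(** The function sin (|k| t) / |k|, extended by continuity to k = 0. *)
Definition wsin k t : R := if fnorm k == 0 then t else sin (fnorm k * t) / fnorm k.

Lemma fnorm_wsin k t : fnorm k * wsin k t = sin (fnorm k * t).
Proof.
rewrite /wsin; case: eqP => [->|/eqP k0]; first by rewrite !mul0r sin0.
by rewrite mulrC divfK.
Qed.

Lemma wsin_bound k t : `|wsin k t| <= `|t|.
Proof.
rewrite /wsin; case: eqP => [//|/eqP k0].
rewrite normrM normfV ler_pdivrMr ?normr_gt0// mulrC -normrM; exact: sin_bound.
Qed.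

Lemma wcos_max k t : `|wcos k t| <= 1. Proof. exact: cos_max. Qed.

Lemma fnorm_wsin_max k t : `|fnorm k * wsin k t| <= 1.
Proof. by rewrite fnorm_wsin sin_max. Qed.

Lemma wcosB1_bound k t : `|wcos k t - 1| <= fnorm k * `|t|.
Proof. by rewrite -[fnorm k]ger0_norm ?fnorm_ge0// -normrM cosB1_bound. Qed.

Lemma wcosB1_sqr_bound k t : `|wcos k t - 1| <= fnorm k ^+ 2 * `|t| ^+ 2.
Proof. by rewrite real_normK ?num_real// -exprMn cosB1_sqr_bound. Qed.

Lemma wsin_sub_bound k t : `|wsin k t - t| <= fnorm k * `|t| ^+ 2.
Proof.
rewrite /wsin; case: eqP => [->|/eqP k0]; first by rewrite subrr normr0 mul0r.
have kp : 0 < fnorm k by rewrite lt_neqAle eq_sym k0 fnorm_ge0.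
rewrite -(@ler_pM2l _ (fnorm k))// -[X in X * `|_|]gtr0_norm// -normrM mulrBr mulrC divfK//.
by rewrite real_normK ?num_real// mulrA -expr2 -exprMn sin_sub_bound.
Qed.

Lemma wcosD k s t : wcos k (s + t) = wcos k s * wcos k t - fnorm k ^+ 2 * wsin k s * wsin k t.
Proof.
by rewrite /wcos mulrDr cosD -!fnorm_wsin; ring.
Qed.

Lemma wsinD k s t : wsin k (s + t) = wcos k s * wsin k t + wsin k s * wcos k t.
Proof.
have [k0|k0] := eqVneq (fnorm k) 0.
  by rewrite /wsin /wcos k0 eqxx !mul0r cos0; ring.
apply: (mulfI k0); rewrite fnorm_wsin mulrDr sinD mulrDr -!fnorm_wsin /wcos; ring.
Qed.

Lemma wcos0 k : wcos k 0 = 1. Proof. by rewrite /wcos mulr0 cos0. Qed.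
Lemma wsin0 k : wsin k 0 = 0.
Proof. by rewrite /wsin mulr0 sin0 mul0r; case: eqP. Qed.

Lemma wcos_neg k t : wcos (negt k) t = wcos k t.
Proof. by rewrite /wcos fnorm_neg. Qed.
Lemma wsin_neg k t : wsin (negt k) t = wsin k t.
Proof. by rewrite /wsin fnorm_neg. Qed.

(** The flow of z_1' = z_2, z_2' = - |k|^2 z_1. *)
Definition wave_map t k (z : R * R) : R * R :=
  (wcos k t * z.1 + wsin k t * z.2, - (fnorm k ^+ 2 * wsin k t) * z.1 + wcos k t * z.2).

Lemma sqr_le_norm (x y : R) : `|x| <= y -> x ^+ 2 <= y ^+ 2.
Proof.
move=> h; rewrite -[x ^+ 2]real_normK ?num_real//.
by rewrite ler_pXn2r// nnegrE (le_trans _ h).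
Qed.

Lemma sqrD_le (x y : R) : (x + y) ^+ 2 <= 2 * x ^+ 2 + 2 * y ^+ 2.
Proof. by have := sqr_ge0 (x - y); nra. Qed.

(** The flow conserves |k|^2 z_1^2 + z_2^2 and not the energy with the weight
    1 + |k|^2: at k = 0 the first component grows linearly, whence the factor
    t^2. *)
Lemma energy_wave_map t k z : energy k (wave_map t k z) <= (4 + 2 * t ^+ 2) * energy k z.
Proof.
rewrite /energy /wave_map/=; set a := z.1; set b := z.2.
set c := wcos k t; set s := wsin k t.
have c1 : c ^+ 2 <= 1 by rewrite -[leRHS](expr1n R 2); apply: sqr_le_norm; exact: wcos_max.
have s1 : s ^+ 2 <= t ^+ 2.
  by rewrite -[leRHS]real_normK ?num_real//; apply: sqr_le_norm; exact: wsin_bound.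
have s2 : fnorm k ^+ 2 * s ^+ 2 <= 1.
  by rewrite -exprMn -[leRHS](expr1n R 2); apply: sqr_le_norm; exact: fnorm_wsin_max.
have q : 0 <= fnorm k ^+ 2 by rewrite sqr_ge0.
rewrite weightE; set q2 := fnorm k ^+ 2 in s2 q *.
have a2 := sqr_ge0 a; have b2 := sqr_ge0 b; have t2 := sqr_ge0 t; have ss := sqr_ge0 s; have cc := sqr_ge0 c.
have h1 : (1 + q2) * (c * a + s * b) ^+ 2 <= 2 * ((1 + q2) * a ^+ 2) + 2 * ((1 + t ^+ 2) * b ^+ 2).
  apply: (@le_trans _ _ ((1 + q2) * (2 * (c * a) ^+ 2 + 2 * (s * b) ^+ 2))).
    by rewrite ler_wpM2l ?sqrD_le//; lra.
  rewrite !exprMn.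
  have e1 : (1 + q2) * (c ^+ 2 * a ^+ 2) <= (1 + q2) * a ^+ 2.
    by rewrite ler_wpM2l ?ler_piMl//; lra.
  have e2 : ((1 + q2) * s ^+ 2) * b ^+ 2 <= (1 + t ^+ 2) * b ^+ 2.
    by rewrite ler_wpM2r//; lra.
  by lra.
have h2 : (- (q2 * s) * a + c * b) ^+ 2 <= 2 * (q2 * a ^+ 2) + 2 * b ^+ 2.
  apply: le_trans (sqrD_le _ _) _; rewrite !exprMn sqrrN exprMn.
  have e1 : q2 * (q2 * s ^+ 2) * a ^+ 2 <= q2 * 1 * a ^+ 2 by rewrite ler_wpM2r// ler_wpM2l.
  have e2 : c ^+ 2 * b ^+ 2 <= b ^+ 2 by rewrite ler_piMl.
  by rewrite [q2 ^+ 2]expr2; lra.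
have := mulr_ge0 t2 a2; have := mulr_ge0 (mulr_ge0 t2 q) a2; have := mulr_ge0 q a2.
by rewrite mulrDl; lra.
Qed.

Lemma wave_map_lin t k a z w : wave_map t k (zlin a z w) = zlin a (wave_map t k z) (wave_map t k w).
Proof. by rewrite /wave_map /zlin/=; congr (_, _); ring. Qed.

Lemma wave_map_add s t k z : wave_map (s + t) k z = wave_map s k (wave_map t k z).
Proof. by rewrite /wave_map wcosD wsinD/=; congr (_, _); ring. Qed.

Lemma wmap0 k z : wave_map 0 k z = z.
Proof. by case: z => a b; rewrite /wave_map wcos0 wsin0/= mulr0; congr (_, _); ring. Qed.

End multipliers.

Section wave_group.
Context {R : realType} {d : nat}.
Local Notation mu := (@torus_measure R d).
Local Notation freq := (d.-tuple int).
Local Notation St := (@state R d).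
Local Notation C := (@state_space R d).
Local Notation N := (@state_norm R d).
Implicit Types (f g : torus R d -> R) (k l : freq) (u v X Y : St) (c : bool).

Lemma wave_exists t u : exists v, C u -> C v /\ forall c k, mode c v k = wave_map t k (mode c u k).
Proof.
have [Cu|nC] := pselect (C u); last by exists u.
have [||v Cv vE] := @state_of_coefs R d (fun c k => wave_map t k (mode c u k)).
- move=> c k; rewrite mode_even// /wave_map wcos_neg wsin_neg fnorm_neg/=; congr (_, _); ring.
- have /stateP[_ _ hu] := Cu.
  have t0 : 0 <= 4 + 2 * t ^+ 2 by have := sqr_ge0 t; lra.
  apply: (tsum_mono _ (tsumZ t0 (state_energy_ge0 u) hu).1).1 => k.
  rewrite addr_ge0 ?energy_ge0//=.
  by rewrite /state_energy [leRHS]mulrDr lerD// energy_wave_map.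
by exists v => _.
Qed.

(** Coefficients determine a state up to seminorm 0, so that a representative
    has to be chosen. *)
Definition wave t u : St := sval (cid (wave_exists t u)).

Lemma wave_C t u : C u -> C (wave t u).
Proof. by rewrite /wave; case: cid => v h /= /h[]. Qed.

Lemma wave_mode t c u k : C u -> mode c (wave t u) k = wave_map t k (mode c u k).
Proof. by rewrite /wave; case: cid => v h /= /h[_ ->]. Qed.

Lemma state_energy_wave t u k : C u -> state_energy (wave t u) k <= (4 + 2 * t ^+ 2) * state_energy u k.
Proof. by move=> Cu; rewrite /state_energy !wave_mode// mulrDr lerD// energy_wave_map. Qed.

Lemma state_norm_mono (M : R) u v : C u -> C v -> 0 <= M ->
  (forall k, state_energy u k <= M ^+ 2 * state_energy v k) -> N u <= M * N v.
Proof.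
move=> Cu Cv M0 h; apply: state_norm_le => //; first by rewrite mulr_ge0 ?sqrtr_ge0.
rewrite [(_ * N v) ^+ 2]exprMn [leRHS]mulrCA state_norm_sqr//; have /stateP[_ _ hv] := Cv.
rewrite -(tsumZ (sqr_ge0 M) (state_energy_ge0 v) hv).2.
by apply: (tsum_mono _ (tsumZ (sqr_ge0 M) (state_energy_ge0 v) hv).1).2 => k; rewrite state_energy_ge0 h.
Qed.

Lemma wave_bound (T : R) : exists2 M, 0 <= M &
  forall t u, `|t| <= T -> C u -> N (wave t u) <= M * N u.
Proof.
have h0 : 0 <= 4 + 2 * T ^+ 2 by have := sqr_ge0 T; lra.
exists (Num.sqrt (4 + 2 * T ^+ 2)); first exact: sqrtr_ge0.
move=> t u tT Cu; apply: state_norm_mono => //; [exact: wave_C|move=> k].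
apply: le_trans (state_energy_wave t k Cu) _; rewrite sqr_sqrtr// ler_wpM2r ?state_energy_ge0//.
by rewrite lerD2l ler_wpM2l// sqr_le_norm.
Qed.

(** Dominated convergence for states: a summable bound uniform in t, and for
    each k a rate of convergence. *)
Lemma state_small (X : R -> St) (a b : freq -> R) : (forall k, 0 <= a k) -> fsummable a ->
  (forall t, 0 < `|t| <= 1 -> C (X t)) ->
  (forall t k, 0 < `|t| <= 1 -> state_energy (X t) k <= a k) ->
  (forall t k, 0 < `|t| <= 1 -> state_energy (X t) k <= `|t| * b k) ->
  forall e, 0 < e -> exists2 r, 0 < r <= 1 & forall t, 0 < `|t| <= r -> N (X t) <= e.
Proof.
move=> a0 sa CX dom rate e e0.
have pp : 0 < (2 * pi : R) ^+ d by rewrite exprn_gt0// mulr_gt0// pi_gt0.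
have near1 : \forall t \near (0 : R)^', 0 < `|t| <= 1.
  near=> t; rewrite normr_gt0; apply/andP; split; first by near: t; exact: nbhs_dnbhs_neq.
  near: t; apply: dnbhs0_le; exact: ltr01.
have e1 : 0 < (2 * pi) ^+ d * e ^+ 2 by rewrite mulr_gt0// exprn_gt0.
have [] := @tsum_dominated R freq R ((0 : R)^') _ (fun t => state_energy (X t)) a 1 a0 sa ler01 _ _ _ e1.
- near=> t => k; rewrite state_energy_ge0 mul1r/=; apply: dom; near: t; exact: near1.
- move=> k e' e'0; have b1 : 0 < `|b k| + 1 by rewrite ltr_wpDl.
  near=> t; have t1 : 0 < `|t| <= 1 by near: t; exact: near1.
  apply: le_trans (rate t k t1) _.
  have : `|t| <= e' / (`|b k| + 1) by near: t; apply: dnbhs0_le; rewrite divr_gt0.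
  rewrite ler_pdivlMr//; apply: le_trans; rewrite ler_wpM2l//.
  by have := ler_norm (b k); lra.
move=> r /= r0 hr; exists (Num.min 1 (r / 2)).
  by rewrite lt_min ltr01 divr_gt0//= ge_min lexx.
move=> t /andP[t0]; rewrite le_min => /andP[t1 tr].
have t01 : 0 < `|t| <= 1 by rewrite t0.
have [] := hr t; rewrite /ball/= ?sub0r ?normrN.
- by lra.
- by rewrite -normr_gt0.
by move=> _ h; apply: state_norm_le => //; [exact: CX|exact: ltW].
Unshelve. all: by end_near. Qed.


Lemma state_small_cvg (X : R -> St) :
  (forall e, 0 < e -> exists2 r, 0 < r <= 1 & forall t, 0 < `|t| <= r -> N (X t) <= e) ->
  N (X t) @[t --> (0 : R)^'] --> (0 : R).
Proof.
move=> h; apply/cvgrPdist_le => e /h[r /andP[r0 _] hr].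
near=> t; rewrite sub0r normrN ger0_norm ?sqrtr_ge0//; apply: hr.
rewrite normr_gt0; apply/andP; split; first by near: t; exact: nbhs_dnbhs_neq.
by near: t; apply: dnbhs0_le.
Unshelve. all: by end_near. Qed.

Lemma energy_zsub k (z w : R * R) : energy k (zsub z w) <= 2 * energy k z + 2 * energy k w.
Proof.
rewrite /energy /zsub /=; have w0 : 0 < weight k :> R by exact: weight_gt0.
have h (x y : R) : (x - y) ^+ 2 <= 2 * x ^+ 2 + 2 * y ^+ 2 by have := sqr_ge0 (x + y); nra.
have := ler_wpM2l (ltW w0) (h z.1 w.1); have := h z.2 w.2; lra.
Qed.

Lemma wave_cont u : C u ->
  forall e, 0 < e -> exists2 r, 0 < r <= 1 & forall t, 0 < `|t| <= r -> N (wave t u - u) <= e.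
Proof.
move=> Cu; have /stateP[_ _ hu] := Cu.
have [s14 _] := tsumZ (ler0n R 14) (state_energy_ge0 u) hu.
pose bb k (z : R * R) : R := weight k * (2 * (fnorm k ^+ 2 * z.1 ^+ 2) + 2 * z.2 ^+ 2) +
  2 * (fnorm k ^+ 2 * (fnorm k ^+ 2 * z.1 ^+ 2)) + 2 * (fnorm k ^+ 2 * z.2 ^+ 2).
have E t c k : mode c (wave t u - u) k = zsub (wave_map t k (mode c u k)) (mode c u k).
  by rewrite mode_sub ?wave_mode//; exact: wave_C.
apply: (@state_small (fun t => wave t u - u) (fun k => 14 * state_energy u k)
   (fun k => bb k (mode true u k) + bb k (mode false u k))) => //.
- by move=> k; rewrite mulr_ge0 ?state_energy_ge0.
- by move=> t _; apply: stateB => //; exact: wave_C.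
- move=> t k /andP[_ t1]; rewrite /state_energy !E.
  have h z : energy k (zsub (wave_map t k z) z) <= 14 * energy k z.
    apply: le_trans (energy_zsub _ _ _) _; have := energy_wave_map t k z.
    have : t ^+ 2 <= 1 by rewrite -[leRHS](expr1n R 2); exact: sqr_le_norm.
    have := energy_ge0 k z; nra.
  by rewrite mulrDr lerD.
- move=> t k /andP[_ t1]; rewrite /state_energy !E.
  have tt : t ^+ 2 <= `|t| by rewrite -[t ^+ 2]real_normK ?num_real// expr2 ler_piMl.
  have h z : energy k (zsub (wave_map t k z) z) <= `|t| * bb k z.
    apply: (@le_trans _ _ (t ^+ 2 * bb k z)); last first.
      rewrite ler_wpM2r// /bb.
      by do ?[exact: sqr_ge0|exact: weight_ge0|exact: ler0n|apply: addr_ge0|apply: mulr_ge0].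
    have c2 : (wcos k t - 1) ^+ 2 <= fnorm k ^+ 2 * t ^+ 2.
      rewrite -[t ^+ 2]real_normK ?num_real// -exprMn; apply: sqr_le_norm; exact: wcosB1_bound.
    have s2 : wsin k t ^+ 2 <= t ^+ 2.
      by rewrite -[leRHS]real_normK ?num_real//; apply: sqr_le_norm; exact: wsin_bound.
    rewrite /energy /zsub /wave_map/= /bb.
    set a := z.1; set b := z.2; set c := wcos k t in c2 *; set s := wsin k t in s2 *.
    set q := fnorm k ^+ 2 in c2 *; have q0 : 0 <= q by rewrite sqr_ge0.
    have a2 := sqr_ge0 a; have b2 := sqr_ge0 b.
    have h1 : (c * a + s * b - a) ^+ 2 <= t ^+ 2 * (2 * (q * a ^+ 2) + 2 * b ^+ 2).
      have -> : c * a + s * b - a = (c - 1) * a + s * b by ring.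
      apply: le_trans (sqrD_le _ _) _; rewrite !exprMn.
      have := ler_wpM2r a2 c2; have := ler_wpM2r b2 s2; lra.
    have h2 : (- (q * s) * a + c * b - b) ^+ 2 <= t ^+ 2 * (2 * (q * (q * a ^+ 2)) + 2 * (q * b ^+ 2)).
      have -> : - (q * s) * a + c * b - b = - (q * s) * a + (c - 1) * b by ring.
      apply: le_trans (sqrD_le _ _) _; rewrite !exprMn sqrrN exprMn [q ^+ 2]expr2.
      have := ler_wpM2r b2 c2; have := ler_wpM2r a2 (ler_wpM2l q0 (ler_wpM2l q0 s2)); lra.
    have := ler_wpM2l (weight_ge0 k : 0 <= weight k) h1; lra.
  by rewrite mulrDr lerD.
Qed.

Lemma wave_strongly_continuous : strongly_continuous_group C N wave.
Proof.
split.
- move=> t; split; first exact: wave_C.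
    move=> a u v Cu Cv; have Cuv := state_lin a Cu Cv.
    have C1 := wave_C t Cu; have C2 := wave_C t Cv; have C3 := wave_C t Cuv.
    apply: state_norm_null; first by apply: stateB => //; exact: state_lin.
    move=> c k; rewrite mode_sub ?wave_mode//; last exact: state_lin.
    by rewrite !mode_lin// !wave_mode// wave_map_lin /zsub !subrr.
  have [M _ hM] := wave_bound `|t|; exists M => u Cu; exact: hM.
- move=> u Cu; have C1 := wave_C 0 Cu; apply: state_norm_null; first exact: stateB.
  by move=> c k; rewrite mode_sub// wave_mode// wmap0 /zsub !subrr.
- move=> s t u Cu; have C1 := wave_C t Cu; have C2 := wave_C s C1; have C3 := wave_C (s + t) Cu.
  apply: state_norm_null; first exact: stateB.
  by move=> c k; rewrite mode_sub// !wave_mode// wave_map_add /zsub !subrr.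
- move=> u Cu; apply/cvgrPdist_le => e e0; have [r /andP[r0 _] hr] := wave_cont Cu e0.
  exists r => //= t; rewrite /ball_/= !sub0r !normrN => tr; rewrite ger0_norm ?sqrtr_ge0//.
  have [->|t0] := eqVneq t 0.
    have -> : N (wave 0 u - u) = 0; last exact: ltW.
    have C1 := wave_C 0 Cu; apply: state_norm_null; first exact: stateB.
    by move=> c k; rewrite mode_sub// wave_mode// wmap0 /zsub !subrr.
  by apply: hr; rewrite normr_gt0 t0/= ltW.
Qed.

Definition wave_gen k (z : R * R) : R * R := (z.2, - fnorm k ^+ 2 * z.1).

(** The error of the difference quotient of the wave group at frequency k. *)
Definition quot_error h k (z : R * R) : R * R :=
  zsub (zlin h^-1 (zsub (wave_map h k z) z) (0, 0)) (wave_gen k z).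

(** At a fixed frequency the difference quotient converges; the constant is
    not uniform in k, whence the separate domination [quot_error_dom]. *)
Lemma quot_error_rate h k z : h != 0 ->
  `|(quot_error h k z).1| <= `|h| * (fnorm k ^+ 2 * `|z.1| + fnorm k * `|z.2|) /\
  `|(quot_error h k z).2| <= `|h| * (fnorm k ^+ 2 * (fnorm k * `|z.1|) + fnorm k ^+ 2 * `|z.2|).
Proof.
move=> h0; have hp : 0 < `|h| by rewrite normr_gt0.
have c2 := wcosB1_sqr_bound k h; have s2 := wsin_sub_bound k h.
rewrite /quot_error /zsub /zlin /wave_map /wave_gen/=; set a := z.1; set b := z.2.
set c := wcos k h in c2 *; set s := wsin k h in s2 *; set q := fnorm k in c2 s2 *.
split.
- have -> : h^-1 * (c * a + s * b - a) + 0 - b = h^-1 * ((c - 1) * a + (s - h) * b) by field.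
  rewrite normrM normfV ler_pdivrMl//; apply: le_trans (ler_normD _ _) _; rewrite !normrM.
  by have := ler_wpM2r (normr_ge0 a) c2; have := ler_wpM2r (normr_ge0 b) s2; lra.
- have -> : h^-1 * (- (q ^+ 2 * s) * a + c * b - b) + 0 - - q ^+ 2 * a =
    h^-1 * (- (q ^+ 2) * ((s - h) * a) + (c - 1) * b) by field.
  rewrite normrM normfV ler_pdivrMl//; apply: le_trans (ler_normD _ _) _; rewrite !normrM normrN.
  have q0 : 0 <= q ^+ 2 by rewrite sqr_ge0.
  rewrite (ger0_norm q0).
  have := ler_wpM2l q0 (ler_wpM2r (normr_ge0 a) s2); have := ler_wpM2r (normr_ge0 b) c2; lra.
Qed.

(** A bound independent of h. Its sum over k is finite when the position is in
    H^2 and the velocity in H^1. *)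
Lemma quot_error_dom h k z : h != 0 ->
  energy k (quot_error h k z) <= 10 * (weight k ^+ 2 * z.1 ^+ 2 + weight k * z.2 ^+ 2).
Proof.
move=> h0; have hp : 0 < `|h| by rewrite normr_gt0.
have c1 := wcosB1_bound k h; have s1 := wsin_bound k h.
rewrite /energy /quot_error /zsub /zlin /wave_map /wave_gen/=; set a := z.1; set b := z.2.
set c := wcos k h in c1 *; set s := wsin k h in s1 *.
set C' := (c - 1) / h; set S' := s / h - 1.
have C2 : C' ^+ 2 <= fnorm k ^+ 2.
  by apply: sqr_le_norm; rewrite /C' normrM normfV ler_pdivrMr.
have S2 : S' ^+ 2 <= 4.
  have -> : 4 = 2 ^+ 2 :> R by rewrite -natrX.
  apply: sqr_le_norm; apply: le_trans (ler_normB _ _) _; rewrite normr1.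
  have : `|s / h| <= 1 by rewrite normrM normfV ler_pdivrMr// mul1r.
  by lra.
rewrite weightE; set q := fnorm k ^+ 2 in C2 *; have q0 : 0 <= q by rewrite sqr_ge0.
have -> : h^-1 * (c * a + s * b - a) + 0 - b = C' * a + S' * b by rewrite /C' /S'; field.
have -> : h^-1 * (- (q * s) * a + c * b - b) + 0 - - q * a = (- q * S') * a + C' * b.
  by rewrite /C' /S'; field.
clearbody C' S'; have a2 := sqr_ge0 a; have b2 := sqr_ge0 b.
have h1 : (C' * a + S' * b) ^+ 2 <= 2 * (q * a ^+ 2) + 8 * b ^+ 2.
  apply: le_trans (sqrD_le _ _) _; rewrite !exprMn.
  by have := ler_wpM2r a2 C2; have := ler_wpM2r b2 S2; lra.
have h2 : ((- q * S') * a + C' * b) ^+ 2 <= 8 * (q * (q * a ^+ 2)) + 2 * (q * b ^+ 2).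
  apply: le_trans (sqrD_le _ _) _; rewrite !exprMn sqrrN [q ^+ 2]expr2.
  by have := ler_wpM2r a2 (ler_wpM2l q0 (ler_wpM2l q0 S2)); have := ler_wpM2r b2 C2; lra.
have q1 : 0 <= 1 + q by rewrite addr_ge0.
have := ler_wpM2l q1 h1; rewrite [(1 + q) ^+ 2]expr2.
have := mulr_ge0 q0 a2; have := mulr_ge0 q0 b2; have := mulr_ge0 q0 (mulr_ge0 q0 a2).
by lra.
Qed.

Lemma mode_zero c k : mode c (0 : St) k = (0, 0).
Proof.
have -> : (0 : St) = 0 - 0 by rewrite subrr.
by rewrite mode_sub ?/zsub ?subrr//; exact: state0.
Qed.

Lemma mode_quot_error c h u v k : C u -> C v -> mode c v k = wave_gen k (mode c u k) ->
  mode c (h^-1 *: (wave h u - u) - v) k = quot_error h k (mode c u k).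
Proof.
move=> Cu Cv vE; have C1 := wave_C h Cu; have C2 := stateB C1 Cu.
have C3 : C (h^-1 *: (wave h u - u)).
  by rewrite -[_ *: _]addr0; apply: state_lin => //; exact: state0.
rewrite mode_sub// vE /quot_error; congr zsub.
rewrite -[_ *: _]addr0 mode_lin//; last exact: state0.
by rewrite mode_sub// wave_mode// mode_zero.
Qed.

(** The wave operator read off the Fourier coefficients. *)
Lemma wave_operatorP u v : C u -> C v ->
  wave_operator u v <-> forall c k, mode c v k = wave_gen k (mode c u k).
Proof.
move=> Cu Cv; have /stateP[u1 u2 hu] := Cu; have /stateP[v1 v2 hv] := Cv; split.
- move=> [_ _ uv lap] c k; rewrite /mode /wave_gen/=; congr (_, _).
    by case: c; apply: eq_ae_fun => //; [exact: trig_cos|exact: trig_sin].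
  have := lap k; rewrite !fourierE => /eqP; rewrite eq_complex/= => /andP[/eqP Re /eqP Im].
  rewrite fnorm_sqr; case: c => /=; first by rewrite Re; ring.
  by move: Im; rewrite mul0r addr0 mulrN => /oppr_inj ->.
- move=> h.
  have h1 c k : tcoef c v.1 k = tcoef c u.2 k by have [->] := h c k.
  have h2 c k : tcoef c v.2 k = - fnorm k ^+ 2 * tcoef c u.1 k by have [_ ->] := h c k.
  have en0 := state_energy_ge0 u; have env0 := state_energy_ge0 v.
  split.
  + apply/sobolevP; split => //.
    have s2 := tsumD (fun k => mulr_ge0 (ler0n R 2) (en0 k)) (fun k => mulr_ge0 (ler0n R 2) (env0 k))
      (tsumZ (ler0n R 2) en0 hu).1 (tsumZ (ler0n R 2) env0 hv).1.
    apply: (tsum_mono _ s2.1).1 => k; rewrite weight_power_ge0/= !state_energyE !power_tcoef !h2.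
    rewrite !exprMn sqrrN weightE; set q := fnorm k ^+ 2.
    set A := tcoef true u.1 k; set B := tcoef false u.1 k.
    have q0 : 0 <= q by rewrite sqr_ge0.
    have P1 := mulr_ge0 (weight_ge0 k : 0 <= weight k) (power_ge0 v.1 k).
    have P2 := power_ge0 u.2 k; move: P1 P2; rewrite weightE -/q !power_tcoef => P1 P2.
    have A2 := sqr_ge0 A; have B2 := sqr_ge0 B.
    have := mulr_ge0 q0 (mulr_ge0 q0 A2); have := mulr_ge0 q0 (mulr_ge0 q0 B2).
    have := mulr_ge0 q0 A2; have := mulr_ge0 q0 B2.
    rewrite [(1 + q) ^+ 2]expr2 [q ^+ 2]expr2; lra.
  + apply/sobolevP; split => //.
    apply: (tsum_mono _ hv).1 => k; rewrite weight_power_ge0/= state_energyE expr1 !power_tcoef !h1.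
    by rewrite lerDl addr_ge0 ?sqr_ge0.
  + by apply: ae_eq_fun => // k; [exact: (h1 true)|exact: (h1 false)].
  + move=> k; rewrite !fourierE; apply/eqP; rewrite eq_complex/=; apply/andP; split; apply/eqP.
      by rewrite -/(tcoef true v.2 k) h2 fnorm_sqr /=; ring.
    by rewrite -/(tcoef false v.2 k) h2 fnorm_sqr /=; ring.
Qed.

(** On the domain the difference quotients converge by dominated convergence.
    Conversely, if they converge in norm, their coefficients converge, to
    those of the limit. *)
Lemma wave_generates : generates C N wave_operator wave.
Proof.
split; first exact: wave_strongly_continuous.
move=> u v Cu Cv; rewrite wave_operatorP//; split; last first.
  move=> vE; apply: state_small_cvg.
  have /stateP[u1 u2 hu] := Cu.
  have [] := (wave_operatorP Cu Cv).2 vE => /sobolevP[_ s1] /sobolevP[_ s2] _ _.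
  pose rt k (z : R * R) : R := weight k * (fnorm k ^+ 2 * `|z.1| + fnorm k * `|z.2|) ^+ 2 +
    (fnorm k ^+ 2 * (fnorm k * `|z.1|) + fnorm k ^+ 2 * `|z.2|) ^+ 2.
  have [s3 _] := tsumD (weight_power_ge0 2 u.1) (weight_power_ge0 1 u.2) s1 s2.
  have p3 k : 0 <= weight k ^+ 2 * power u.1 k + weight k ^+ 1 * power u.2 k.
    by rewrite addr_ge0 ?weight_power_ge0.
  have [s4 _] := tsumZ (ler0n R 10) p3 s3.
  apply: (@state_small (fun h => h^-1 *: (wave h u - u) - v)
    (fun k => 10 * (weight k ^+ 2 * power u.1 k + weight k ^+ 1 * power u.2 k))
    (fun k => rt k (mode true u k) + rt k (mode false u k))) => //.
  - by move=> k; rewrite mulr_ge0.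
  - move=> t _; apply: stateB => //; rewrite -[_ *: _]addr0; apply: state_lin; last exact: state0.
    by apply: stateB => //; exact: wave_C.
  - move=> t k /andP[t0 _]; rewrite normr_gt0 in t0; rewrite /state_energy !mode_quot_error//.
    have := quot_error_dom k (mode true u k) t0; have := quot_error_dom k (mode false u k) t0.
    by rewrite !power_tcoef expr1 /=; lra.
  - move=> t k /andP[t0 t1]; rewrite normr_gt0 in t0; rewrite /state_energy !mode_quot_error//.
    have tt : t ^+ 2 <= `|t| by rewrite -[t ^+ 2]real_normK ?num_real// expr2 ler_piMl.
    have hh z : energy k (quot_error t k z) <= `|t| * rt k z.
      have [q1 q2] := quot_error_rate k z t0; rewrite /energy /rt.
      move: (sqr_le_norm q1) (sqr_le_norm q2); rewrite !exprMn real_normK ?num_real//.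
      set X := (_ + _) ^+ 2; set Y := (_ + _) ^+ 2 => e1 e2.
      have X0 : 0 <= X by exact: sqr_ge0.
      have Y0 : 0 <= Y by exact: sqr_ge0.
      have w0 : 0 <= weight k :> R by exact: weight_ge0.
      have := ler_wpM2l w0 (le_trans e1 (ler_wpM2r X0 tt)).
      have := le_trans e2 (ler_wpM2r Y0 tt); lra.
    by rewrite mulrDr lerD.
move=> cv c k.
have C3 h : C (h^-1 *: (wave h u - u)).
  rewrite -[_ *: _]addr0; apply: state_lin; last exact: state0.
  by apply: stateB => //; exact: wave_C.
have pp : 0 < (2 * pi : R) ^+ d by rewrite exprn_gt0// mulr_gt0// pi_gt0.
set D := Num.sqrt ((2 * pi : R) ^+ d).
have bnd h : h != 0 ->
   zsub (mode c (h^-1 *: (wave h u - u)) k) (wave_gen k (mode c u k)) = quot_error h k (mode c u k).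
  move=> h0; rewrite /quot_error; congr zsub.
  rewrite -[_ *: _]addr0 mode_lin//; [|by apply: stateB => //; exact: wave_C|exact: state0].
  rewrite mode_sub ?wave_mode//; last exact: wave_C.
  by rewrite mode_zero.
have key e : 0 < e -> exists2 h, h != 0 & `|h| <= e /\ N (h^-1 *: (wave h u - u) - v) <= e.
  move=> e0; have /cvgrPdist_le/(_ e e0) near1 := cv.
  have near2 : \forall h \near (0 : R)^', h != 0 /\ `|h| <= e.
    by near=> h; split; near: h; [exact: nbhs_dnbhs_neq|exact: dnbhs0_le].
  have [h []] := filter_ex (filterI near1 near2).
  rewrite sub0r normrN ger0_norm ?sqrtr_ge0// => h1 [h2 h3].
  by exists h.
have fin (x B : R) : 0 <= B -> (forall e, 0 < e -> `|x| <= e * B) -> x = 0.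
  move=> B0 hx; apply/eqP; rewrite -normr_le0; apply/ler_addgt0Pr => e e0; rewrite add0r.
  have B1 : 0 < B + 1 by rewrite ltr_wpDl.
  apply: le_trans (hx (e / (B + 1)) (divr_gt0 e0 B1)) _.
  by rewrite mulrAC ler_pdivrMr// ler_wpM2l ?lerDl// ltW.
have nrm (x y : R) : 0 <= y -> x ^+ 2 <= (2 * pi) ^+ d * y ^+ 2 -> `|x| <= D * y.
  move=> y0 hx; rewrite -(@ler_pXn2r _ 2)// ?nnegrE ?mulr_ge0 ?sqrtr_ge0//.
  by rewrite real_normK ?num_real// exprMn sqr_sqrtr// ltW.
have D0 : 0 <= D by exact: sqrtr_ge0.
have num (w z g h n Q e : R) : 0 <= Q -> `|h| <= e -> n <= e -> `|w - z| <= D * n ->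
    `|w - g| <= `|h| * Q -> `|z - g| <= e * (D + Q).
  move=> Q0 he ne h1 h2; have -> : z - g = (w - g) - (w - z) by ring.
  apply: le_trans (ler_normB _ _) _.
  have := le_trans h2 (ler_wpM2r Q0 he); have := le_trans h1 (ler_wpM2l D0 ne); lra.
have main : (mode c v k).1 - (wave_gen k (mode c u k)).1 = 0 /\ (mode c v k).2 - (wave_gen k (mode c u k)).2 = 0.
  have Q1 : 0 <= fnorm k ^+ 2 * `|(mode c u k).1| + fnorm k * `|(mode c u k).2|.
    by rewrite !addr_ge0// mulr_ge0 ?sqr_ge0 ?fnorm_ge0.
  have Q2 : 0 <= fnorm k ^+ 2 * (fnorm k * `|(mode c u k).1|) + fnorm k ^+ 2 * `|(mode c u k).2|.
    by rewrite !addr_ge0// !mulr_ge0 ?sqr_ge0 ?fnorm_ge0.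
  split.
  - apply: (fin _ _ (addr_ge0 D0 Q1)) => e e0; have [h h0 [he hN]] := key e e0.
    have [b1 _] := mode_bound c k (stateB (C3 h) Cv); have [q1 _] := quot_error_rate k (mode c u k) h0.
    rewrite mode_sub// in b1; rewrite -bnd// in q1.
    exact: (num _ _ _ _ _ _ _ Q1 he hN (nrm _ _ (sqrtr_ge0 _) b1) q1).
  - apply: (fin _ _ (addr_ge0 D0 Q2)) => e e0; have [h h0 [he hN]] := key e e0.
    have [_ b1] := mode_bound c k (stateB (C3 h) Cv); have [_ q1] := quot_error_rate k (mode c u k) h0.
    rewrite mode_sub// in b1; rewrite -bnd// in q1.
    exact: (num _ _ _ _ _ _ _ Q2 he hN (nrm _ _ (sqrtr_ge0 _) b1) q1).
case: main => /eqP; rewrite subr_eq0 => /eqP m1 /eqP; rewrite subr_eq0 => /eqP m2.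
by rewrite [LHS]surjective_pairing m1 m2.
Unshelve. all: by end_near. Qed.

End wave_group.

(** * Trigonometric polynomials in the space of states *)

Section trig_states.
Context {R : realType} {d : nat}.
Local Notation mu := (@torus_measure R d).
Local Notation freq := (d.-tuple int).
Local Notation St := (@state R d).
Local Notation C := (@state_space R d).
Local Notation N := (@state_norm R d).
Implicit Types (f g p : torus R d -> R) (k l : freq) (u v X Y : St) (c : bool) (r : seq freq).

Lemma fsummable_finite (a : freq -> R) r : (forall k, 0 <= a k) ->
  (forall k, k \notin r -> a k = 0) -> fsummable a.
Proof.
move=> a0 hr; apply: (@tsum_le _ _ a (\sum_(k <- undup r) a k) a0 _).1 => s us.
rewrite (bigID (mem r))/= [X in _ + X]big1 ?addr0; last by move=> k /hr.
rewrite -big_filter [leRHS](bigID (mem s))/= -[leLHS]addr0 lerD//; last exact: sumr_ge0.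
rewrite -[leRHS]big_filter le_eqVlt; apply/orP; left; apply/eqP/perm_big/uniq_perm.
- by rewrite filter_uniq.
- by rewrite filter_uniq// undup_uniq.
- by move=> k; rewrite !mem_filter mem_undup andbC.
Qed.

Definition finite_spectrum f := exists r, forall c k, k \notin r -> tcoef c f k = 0.

Lemma trig_finite_spectrum f : trig_poly f -> finite_spectrum f.
Proof.
elim=> [l|l|a g h tg [r1 h1] th [r2 h2]].
- exists [:: l; negt l] => c k; rewrite !inE negb_or => /andP[/negbTE h1 /negbTE h2].
  have [e1 e2 _ _] := @product_integrals R d k l.
  by case: c; rewrite /tcoef ?e1 ?e2 ?h1 ?h2//= addr0 mulr0.
- exists [:: l; negt l] => c k; rewrite !inE negb_or => /andP[/negbTE h1 /negbTE h2].
  have [_ _ e1 e2] := @product_integrals R d k l.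
  by case: c; rewrite /tcoef ?e1 ?e2 ?h1 ?h2//= subrr mulr0.
exists (r1 ++ r2) => c k; rewrite mem_cat negb_or => /andP[/h1 e1 /h2 e2].
have := tcoef_lin c a k (trig_sqint tg) (trig_sqint th); rewrite e1 e2 mulr0 addr0; exact.
Qed.

Lemma finite_spectrum_sobolev s f : sqint mu f -> finite_spectrum f -> sobolev s f.
Proof.
move=> sf [r hr]; apply/sobolevP; split => //.
apply: (@fsummable_finite _ r) => k; first exact: weight_power_ge0.
by move=> kr; rewrite power_tcoef !hr// expr0n/= addr0 mulr0.
Qed.

Lemma finite_spectrum_trig f : sqint mu f -> finite_spectrum f ->
  exists p, trig_poly p /\ forall c k, tcoef c p k = tcoef c f k.
Proof.
move=> sf [r hr]; have [n rn] := sym_freqs_cover r.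
exists (fsum (sym_freqs n) (fcos f) (fsin f)); split; first exact: trig_fsum.
move=> c k.
have [e1 e2] := coef_fsum k (sym_freqs_symmetric n) (@fcos_even R d f) (fsin_odd (sqint_integrable sf)).
have [kn|kn] := boolP (k \in sym_freqs n).
  by case: c; rewrite /tcoef ?e1 ?e2 kn mul1r.
have kr : k \notin r by apply: contraNN kn; exact: rn.
rewrite hr//; case: c; rewrite /tcoef ?e1 ?e2; case: (k \in _) kn => // _; exact: mul0r.
Qed.

Lemma ae_zero_coef f : sqint mu f -> ae_zero f <-> forall c k, tcoef c f k = 0.
Proof.
move=> sf; split=> [f0 c k|h]; last first.
  apply: fourier_unique0; [exact: sqint_integrable|exact: (h true)|exact: (h false)].
have s0 : sqint mu (cst 0 : torus R d -> R) by apply: trig_sqint; exact: trig_zero.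
have h p : trig_poly p -> \int[mu]_x (f x * p x) = 0.
  move=> tu; rewrite (eq_ae_fun sf s0 f0 tu) /Rintegral.
  by under eq_integral do rewrite mul0r; rewrite integral0.
by case: c; apply: h; [exact: trig_cos|exact: trig_sin].
Qed.

Lemma tcoef_zero c k : tcoef c (cst 0 : torus R d -> R) k = 0.
Proof.
apply: (ae_zero_coef _).1; last by apply: nearW.
by apply: trig_sqint; exact: trig_zero.
Qed.

Lemma trig_state f g : trig_poly f -> sqint mu g -> C (f, g).
Proof.
move=> tf sg; split => /=; last exact/L2P.
by apply: finite_spectrum_sobolev; [exact: trig_sqint|exact: trig_finite_spectrum].
Qed.

(** ** Density *)

(** The truncated Fourier series of both components. *)
Lemma trunc_state u (e : R) : C u -> 0 < e -> exists r,
  let u' : St := (fsum r (fcos u.1) (fsin u.1), fsum r (fcos u.2) (fsin u.2)) in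
  N (u - u') <= e /\ forall c k, k \notin r -> mode c u' k = (0, 0).
Proof.
move=> Cu e0; have /stateP[u1 u2 hu] := Cu.
have e1 : 0 < (2 * pi : R) ^+ d * e ^+ 2.
  by rewrite mulr_gt0// exprn_gt0// ?mulr_gt0// pi_gt0.
have [r0 _ hr] := tsum_tail (state_energy_ge0 u) hu e1; have [n rn] := sym_freqs_cover r0.
exists (sym_freqs n); set r := sym_freqs n; set u' := (_, _).
have sr : sym_list r by exact: sym_freqs_symmetric.
have Cu' : C u' by apply: trig_state; [exact: trig_fsum|exact: sqint_fsum].
have E c k : mode c u' k = if k \in r then mode c u k else (0, 0).
  have [e1' e2] := coef_fsum k sr (@fcos_even R d u.1) (fsin_odd (sqint_integrable u1)).
  have [e3 e4] := coef_fsum k sr (@fcos_even R d u.2) (fsin_odd (sqint_integrable u2)).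
  rewrite /mode /u'/=; case: c; rewrite /tcoef ?e1' ?e2 ?e3 ?e4; case: (k \in r);
   by rewrite ?mul1r ?mul0r.
split; last by move=> c k kr; rewrite E (negbTE kr).
apply: state_norm_le; [exact: stateB|exact: ltW|].
apply: (tsum_le (state_energy_ge0 _) _).2 => s us.
have state_energyE' k : state_energy (u - u') k = if k \in r then 0 else state_energy u k.
  rewrite /state_energy !mode_sub// !E; case: ifP => _; rewrite /zsub /energy/=.
    by rewrite !subrr expr0n/= mulr0 !addr0.
  by rewrite !subr0.
under eq_bigr do rewrite state_energyE'.
rewrite (bigID (mem r))/= big1 ?add0r; last by move=> k ->.
rewrite (eq_bigr (state_energy u)); last by move=> k /negbTE ->.
rewrite -big_filter; apply: hr; first by rewrite filter_uniq.
by move=> k; rewrite mem_filter => /andP[kr _]; apply: contraNN kr; exact: rn.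
Qed.

(** Trigonometric polynomials belong to the domain. *)
Lemma wave_domain_dense u (e : R) : C u -> 0 < e ->
  exists u' v', [/\ C u', C v', wave_operator u' v' & N (u - u') <= e].
Proof.
move=> Cu e0; have [r [hN hr]] := trunc_state Cu e0; set u' := (_, _) in hN hr.
have Cu' : C u' by apply: trig_state; [exact: trig_fsum|exact: sqint_fsum].
have [||v' Cv' vE] := @state_of_coefs R d (fun c k => wave_gen k (mode c u' k)).
- by move=> c k; rewrite mode_even// /wave_gen fnorm_neg/=; congr (_, _); ring.
- apply: (@fsummable_finite _ r) => k; first by rewrite addr_ge0// energy_ge0.
  by move=> kr; rewrite !hr// /wave_gen /energy/= !mulr0 expr0n/= mulr0 !addr0.
by exists u', v'; split => //; apply/wave_operatorP.
Qed.

(** ** Multiplication by trigonometric polynomials *)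

(** Peetre's inequality. *)
Lemma weight_shift k l : weight k <=  2 * weight l * weight (addt k l) :> R.
Proof.
have h : freq_sqnorm k <= 2 * freq_sqnorm (addt k l) + 2 * freq_sqnorm l :> R.
  rewrite /freq_sqnorm !mulr_sumr -big_split/=; apply: ler_sum => i _.
  rewrite tnth_mktuple rmorphD/=; set x : R := (tnth k i)%:~R; set y : R := (tnth l i)%:~R.
  by have := sqr_ge0 (x + 2 * y); nra.
rewrite /weight; have := freq_sqnorm_ge0 l : 0 <= freq_sqnorm l :> R.
have := freq_sqnorm_ge0 (addt k l) : 0 <= freq_sqnorm (addt k l) :> R.
move: h; set x := freq_sqnorm k; set y := freq_sqnorm l; set z := freq_sqnorm _; nra.
Qed.

Lemma fsummable_shift (a : freq -> R) l : (forall k, 0 <= a k) -> fsummable a ->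
  fsummable (fun k => a (addt k l)).
Proof.
move=> a0 sa; apply: (@tsum_le _ _ _ (tsum a) _ _).1 => // r ur.
rewrite -(big_map (fun k => addt k l) xpredT a); apply: tsum_ge => //.
by rewrite map_inj_uniq// => k k' E; rewrite -(addtK k l) E addtK.
Qed.

(** A function whose coefficients are half sums of two shifts of those of g
    decays like g. *)
Lemma two_shifts f g l : fsummable (fun k => weight k ^+ 1 * power g k) ->
  (forall c k, exists c1 c2, exists e1 e2 : R, [/\
    tcoef c f k = 2^-1 * (e1 * tcoef c1 g (addt k l) + e2 * tcoef c2 g (addt k (negt l))),
    e1 ^+ 2 = 1 & e2 ^+ 2 = 1]) ->
  fsummable (fun k => weight k ^+ 1 * power f k).
Proof.
move=> hg hF; have W0 k : 0 <= weight k ^+ 1 * power g k by exact: weight_power_ge0.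
have l4 : 0 <= 4 * weight l :> R by rewrite mulr_ge0// weight_ge0.
have [s1 _] := tsumZ l4 (fun k => W0 (addt k l)) (fsummable_shift l W0 hg).
have [s2 _] := tsumZ l4 (fun k => W0 (addt k (negt l))) (fsummable_shift (negt l) W0 hg).
have [s3 _] := tsumD (fun k => mulr_ge0 l4 (W0 (addt k l)))
  (fun k => mulr_ge0 l4 (W0 (addt k (negt l)))) s1 s2.
apply: (tsum_mono _ s3).1 => k; rewrite weight_power_ge0/= !expr1.
have b c : tcoef c f k ^+ 2 <= 2^-1 * (power g (addt k l) + power g (addt k (negt l))).
  have [c1 [c2 [e1 [e2 [-> E1 E2]]]]] := hF c k.
  set x := tcoef c1 _ _; set y := tcoef c2 _ _.
  have px : x ^+ 2 <= power g (addt k l).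
    by rewrite power_tcoef /x; case: c1 @x; rewrite ?lerDl ?lerDr sqr_ge0.
  have py : y ^+ 2 <= power g (addt k (negt l)).
    by rewrite power_tcoef /y; case: c2 @y; rewrite ?lerDl ?lerDr sqr_ge0.
  have := sqrD_le (e1 * x) (e2 * y); rewrite !exprMn E1 E2 !mul1r => hh.
  have -> : 2^-1 ^+ 2 = 4^-1 :> R by rewrite exprVn -natrX.
  by lra.
have w1 := weight_shift k l; have w2 := weight_shift k (negt l).
have wl : weight (negt l) = weight l :> R by rewrite /weight freq_sqnorm_neg.
rewrite wl in w2; rewrite power_tcoef.
have p1 := power_ge0 g (addt k l); have p2 := power_ge0 g (addt k (negt l)).
have := ler_wpM2l (weight_ge0 k : 0 <= weight k :> R) (lerD (b true) (b false)).
have := mulr_ge0 (mulr_ge0 (weight_ge0 l : 0 <= weight l :> R) (weight_ge0 (addt k l))) p1.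
have := mulr_ge0 (mulr_ge0 (weight_ge0 l : 0 <= weight l :> R) (weight_ge0 (addt k (negt l)))) p2.
by have := ler_wpM2r p1 w1; have := ler_wpM2r p2 w2; lra.
Qed.

(** By the product formulas, multiplication by a cosine or a sine of frequency
    l shifts the coefficients by l and by - l, so that no derivative is
    needed. *)
Lemma sobolev_trigM f g : trig_poly f -> sobolev 1 g -> sobolev 1 (fun x => f x * g x).
Proof.
move=> tf /sobolevP[sg hg].
have sm h : trig_poly h -> sqint mu (fun x => h x * g x).
  by move=> th; have [M _ hM] := trig_bounded th; apply: sqint_mul_bounded hM sg; exact: trig_measurable.
have lin a h h' : sobolev 1 (fun x => h x * g x) -> sobolev 1 (fun x => h' x * g x) ->
    sobolev 1 (fun x => (a * h x + h' x) * g x).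
  move=> s1 s2.
  have z0 : sqint mu (cst 0 : torus R d -> R) by apply: trig_sqint; exact: trig_zero.
  have C1 : C (fun x => h x * g x, cst 0) by split => //=; exact/L2P.
  have C2 : C (fun x => h' x * g x, cst 0) by split => //=; exact/L2P.
  have [+ _] := state_lin a C1 C2; congr sobolev.
  by apply/funext => x; rewrite mulrDl -mulrA.
have ig := sqint_integrable sg.
have It h : trig_poly h -> mu.-integrable setT (EFin \o (fun x => g x * h x)) by exact: integrable_trigM.
have int2 (e1 e2 : R) h1 h2 : trig_poly h1 -> trig_poly h2 ->
    \int[mu]_x (2^-1 * (e1 * (g x * h1 x) + e2 * (g x * h2 x))) =
    2^-1 * (e1 * \int[mu]_x (g x * h1 x) + e2 * \int[mu]_x (g x * h2 x)).
  move=> t1 t2; rewrite RintegralZl//; last first.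
    by apply: integrableA; apply: integrableZ; exact: It.
  by rewrite RintegralD ?RintegralZl//; try (apply: integrableZ); exact: It.
elim: tf => [l|l|a h h' th s1 th' s2]; last exact: lin.
- apply/sobolevP; split; first by apply: sm; exact: trig_cos.
  apply: (two_shifts hg) => -[] k.
    exists true, true, 1, 1; rewrite !expr1n; split => //.
    rewrite /tcoef -int2; [|exact: trig_cos..]; apply: eq_Rintegral => x _.
    by rewrite !freq_dotD freq_dotN !cosD cosN sinN; field.
  exists false, false, 1, 1; rewrite !expr1n; split => //.
  rewrite /tcoef -int2; [|exact: trig_sin..]; apply: eq_Rintegral => x _.
  by rewrite !freq_dotD freq_dotN !sinD cosN sinN; field.
- apply/sobolevP; split; first by apply: sm; exact: trig_sin.
  apply: (two_shifts hg) => -[] k.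
    exists false, false, 1, (-1); rewrite sqrrN !expr1n; split => //.
    rewrite /tcoef -int2; [|exact: trig_sin..]; apply: eq_Rintegral => x _.
    by rewrite !freq_dotD freq_dotN !sinD cosN sinN; field.
  exists true, true, (-1), 1; rewrite sqrrN !expr1n; split => //.
  rewrite /tcoef -int2; [|exact: trig_cos..]; apply: eq_Rintegral => x _.
  by rewrite !freq_dotD freq_dotN !cosD cosN sinN; field.
Qed.

End trig_states.

(** * Kicks *)

Section kicks.
Context {R : realType} {d : nat}.
Local Notation mu := (@torus_measure R d).
Local Notation freq := (d.-tuple int).
Local Notation St := (@state R d).
Local Notation C := (@state_space R d).
Local Notation N := (@state_norm R d).
Local Notation B := (@control_term R d).
Local Notation wave := (@wave R d).
Local Notation "'reach'" := (reach C N wave B).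
Local Notation "'NR'" := (near_reach C N wave B).
Implicit Types (f g p phi : torus R d -> R) (k l : freq) (u v X Y Z : St) (c : bool).

Let csN := @state_seminorm R d.

Definition push phi u : St := (cst 0, fun x => phi x * u.1 x).

Lemma sqint_trigM phi f : trig_poly phi -> sqint mu f -> sqint mu (fun x => phi x * f x).
Proof.
move=> tp sf; have [M _ hM] := trig_bounded tp.
by apply: sqint_mul_bounded hM sf; exact: trig_measurable.
Qed.

Lemma state_snd g : sqint mu g -> C (cst 0, g).
Proof. by move=> sg; apply: trig_state => //; exact: trig_zero. Qed.

Lemma norm_snd g : sqint mu g -> N (cst 0, g) ^+ 2 = ip mu g g.
Proof.
move=> sg; have Cg := state_snd sg; have pp : 0 < (2 * pi : R) ^+ d.
  by rewrite exprn_gt0// mulr_gt0// pi_gt0.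
apply: (mulfI (lt0r_neq0 pp)); rewrite state_norm_sqr// parseval// mulrA mulfV ?lt0r_neq0// mul1r.
congr tsum; apply/funext => k; rewrite state_energyE/= !power_tcoef !tcoef_zero.
by rewrite expr0n/= addr0 mulr0 add0r.
Qed.

Lemma ip_fst_le u : C u -> ip mu u.1 u.1 <= N u ^+ 2.
Proof.
move=> Cu; have /stateP[u1 u2 hu] := Cu; have pp : 0 < (2 * pi : R) ^+ d.
  by rewrite exprn_gt0// mulr_gt0// pi_gt0.
rewrite -(ler_pM2l pp) state_norm_sqr// parseval// mulrA mulfV ?lt0r_neq0// mul1r.
apply: (tsum_mono _ hu).2 => k; rewrite power_ge0/= state_energyE.
have := power_ge0 u.1 k; have := power_ge0 u.2 k; have := weight_ge1 k : 1 <= weight k :> R; nra.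
Qed.

Lemma push_C phi u : trig_poly phi -> sqint mu u.1 -> C (push phi u).
Proof. by move=> tp su; apply: state_snd; exact: sqint_trigM. Qed.

Lemma ip_mul_le phi f (M : R) : trig_poly phi -> (forall x, `|phi x| <= M) -> sqint mu f ->
  ip mu (fun x => phi x * f x) (fun x => phi x * f x) <= M ^+ 2 * ip mu f f.
Proof.
move=> tp hM sf; have sg := sqint_trigM tp sf.
rewrite /ip -RintegralZl//; last exact: sqint_mul.
apply: le_Rintegral => //; first exact: sqint_mul.
  by apply: integrableZ; exact: sqint_mul.
move=> x _; rewrite -!expr2 exprMn ler_wpM2r ?sqr_ge0//; exact: sqr_le_norm.
Qed.

(** Only the L^2 norm of the first component enters. In [kick_square] a push
    is applied to a function that is small in L^2 and not in H^1. *)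
Lemma push_bound phi : trig_poly phi -> exists2 M, 0 <= M &
  forall u (e : R), 0 <= e -> sqint mu u.1 -> ip mu u.1 u.1 <= e ^+ 2 -> N (push phi u) <= M * e.
Proof.
move=> tp; have [M M0 hM] := trig_bounded tp; exists M => // u e e0 su ue.
rewrite -(@ler_pXn2r _ 2)// ?nnegrE ?mulr_ge0 ?sqrtr_ge0//.
rewrite norm_snd; last exact: sqint_trigM.
apply: le_trans (ip_mul_le tp hM su) _.
by rewrite exprMn ler_wpM2l ?sqr_ge0.
Qed.

Lemma control_fun_trig j : trig_poly (@control_fun R d j).
Proof.
case: j => -[|m] jm /=; first exact: trig_cst.
have md : (m./2 < d)%N.
  rewrite -ltn_double; apply: (@leq_ltn_trans m) => //.
  by rewrite -{2}(odd_double_half m) leq_addl.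
have E (x : torus R d) : freq_dot (unit_freq (Ordinal md)) x = nth 0 (x : d.-tuple R) m./2.
  by rewrite freq_dot_unit (tnth_nth 0).
rewrite /control_fun/=; case: (odd m).
  by apply: (trig_eq _ (trig_sin (unit_freq (Ordinal md)))) => x; rewrite E.
by apply: (trig_eq _ (trig_cos (unit_freq (Ordinal md)))) => x; rewrite E.
Qed.

Definition ctrl (q : 'rV[R]_(d.*2.+1)) : torus R d -> R :=
  fun x => \sum_j q 0 j * control_fun j x.

Lemma trig_ctrl q : trig_poly (ctrl q).
Proof. by apply: trig_sum => j; apply: trigZ; exact: control_fun_trig. Qed.

Lemma control_termE q u : B q u = push (ctrl q) u.
Proof.
by congr pair; apply/funext => x; rewrite /ctrl mulr_suml.
Qed.

Lemma B_C q u : C u -> C (B q u).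
Proof. by move=> /stateP[u1 _ _]; rewrite control_termE; apply: push_C; [exact: trig_ctrl|]. Qed.

Lemma B_lin q a u v : B q (a *: u + v) = a *: B q u + B q v.
Proof.
rewrite !control_termE /push; congr pair; apply/funext => x /=.
  by rewrite /cst/= scaler0 addr0.
rewrite -[LHS]/(ctrl q x * (a * u.1 x + v.1 x)).
by rewrite -[RHS]/(a * (ctrl q x * u.1 x) + ctrl q x * v.1 x); ring.
Qed.

Lemma ctrlZ a q x : ctrl (a *: q) x = a * ctrl q x.
Proof. by rewrite /ctrl mulr_sumr; apply: eq_bigr => j _; rewrite mxE mulrA. Qed.

Lemma B_Z a q u : B (a *: q) u = a *: B q u.
Proof.
rewrite !control_termE /push; congr pair; apply/funext => x /=.
  by rewrite /cst/= scaler0.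
by rewrite ctrlZ -[RHS]/(a * (ctrl q x * u.1 x)) mulrA.
Qed.

Lemma B_bound q : exists2 b, 0 <= b & forall u, C u -> N (B q u) <= b * N u.
Proof.
have [M M0 hM] := push_bound (trig_ctrl q); exists M => // u Cu.
rewrite control_termE; apply: hM; [exact: sqrtr_ge0|by case/stateP: Cu|exact: ip_fst_le].
Qed.

Lemma B_nil q u : C u -> N (B q (B q u)) = 0.
Proof.
move=> Cu; rewrite !control_termE.
have -> : push (ctrl q) (push (ctrl q) u) = 0.
  by congr pair; apply/funext => x /=; rewrite mulr0.
exact: sn0 csN.
Qed.

Let gS := @wave_strongly_continuous R d.
Let bS := @wave_bound R d.

Lemma NR_trans X Y Z : C X -> C Y -> C Z -> NR X Y -> NR Y Z -> NR X Z.
Proof. exact: (near_reach_trans csN gS bS B_C B_lin B_Z B_bound). Qed.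

Definition kick phi u : St := (u.1, fun x => u.2 x + phi x * u.1 x).

Lemma kickE phi u : kick phi u = u + push phi u.
Proof.
by rewrite /kick; congr pair; apply/funext => x; rewrite -[RHS]/(u.1 x + 0) addr0.
Qed.

Lemma kick_C phi u : trig_poly phi -> C u -> C (kick phi u).
Proof.
move=> tp Cu; rewrite kickE; apply: (csD csN) => //; apply: push_C => //.
by case/stateP: Cu.
Qed.

(** Impulses give the kicks by combinations of the control functions
    ([kicks_ctrl]); the other ones are limits of compositions of kicks and
    free flows. *)
Definition kicks phi := trig_poly phi /\ forall X, C X -> NR X (kick phi X).

Lemma kicks_eq phi psi : (forall x, phi x = psi x) -> kicks phi -> kicks psi.
Proof. by move=> /funext ->. Qed.

Lemma kicks_add phi psi : kicks phi -> kicks psi -> kicks (fun x => phi x + psi x).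
Proof.
move=> [t1 k1] [t2 k2]; split; first exact: trigD.
move=> X CX; have -> : kick (fun x => phi x + psi x) X = kick psi (kick phi X).
  by congr pair; apply/funext => x /=; rewrite mulrDl addrA.
have C1 := kick_C t1 CX.
by apply: NR_trans (k1 X CX) (k2 _ C1) => //; exact: kick_C.
Qed.

Lemma kicks_ctrl q : kicks (ctrl q).
Proof.
split=> [|X CX]; first exact: trig_ctrl.
rewrite kickE -control_termE.
exact: (impulse csN gS bS B_C B_lin B_Z B_bound B_nil).
Qed.

(** Kick by s phi, let the waves flow during s^-2, kick by - s phi. The first
    kick adds the velocity s phi u, which moves the position by s^-1 phi u
    during the flow; the last kick turns this displacement into the
    velocity - phi^2 u and cancels the first one. Everything else tends to
    0. *)
Lemma kick_square phi : (forall a, kicks (fun x => a * phi x)) -> kicks (fun x => - (phi x) ^+ 2).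
Proof.
move=> hk; have tp : trig_poly phi by apply: (trig_eq _ (hk 1).1) => x; rewrite mul1r.
have t2 : trig_poly (fun x => - (phi x) ^+ 2).
  by apply: (trig_eq _ (trigZ (-1) (trigX 2 tp))) => x; rewrite mulN1r.
split=> // X CX; have /stateP[X1 X2 hX] := CX; set target := kick _ X.
have Ct : C target by exact: kick_C.
pose psi : torus R d -> R := fun x => phi x * X.1 x.
have Spsi : sobolev 1 psi by apply: sobolev_trigM => //; case: CX.
have spsi : sqint mu psi by exact: sqint_trigM.
have z0 : sqint mu (cst 0 : torus R d -> R) by apply: trig_sqint; exact: trig_zero.
pose P0 : St := (psi, cst 0).
have CP0 : C P0 by split => //=; exact/L2P.
pose P1 : St := (cst 0, psi).
have CP1 : C P1 by exact: state_snd.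
have [M M0 hM] := push_bound tp.
have N0 u : 0 <= N u by exact: sqrtr_ge0.
move=> tau tau0; apply: (reach_closed csN) => // e e0.
(* sg = 1 / s is small with respect to tau and to e / K, where K collects the
   constants of the estimates b1 and b2 below *)
pose K := 2 * N P0 + M * (2 * (N X + N P0)) + 1.
have K0 : 0 < K by rewrite ltr_wpDl// addr_ge0 ?mulr_ge0 ?addr_ge0.
have e2 : 0 < e / 2 by rewrite divr_gt0.
have [r /andP[r0 r1] hr] := wave_cont CX e2.
pose sg := Num.min (Num.min 1 r) (Num.min (tau / 4) (e / (2 * K))).
have sg0 : 0 < sg by rewrite !lt_min ltr01 r0 !divr_gt0// mulr_gt0.
have sg1 : sg <= 1 by rewrite !ge_min lexx.
have sgr : sg <= r by rewrite !ge_min lexx !orbT.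
have sgt : sg <= tau / 4 by rewrite !ge_min lexx !orbT.
have sge : K * sg <= e / 2.
  have : sg <= e / (2 * K) by rewrite !ge_min lexx !orbT.
  by rewrite ler_pdivlMr ?mulr_gt0// => h; lra.
pose dl := sg ^+ 2; have dl0 : 0 < dl by rewrite exprn_gt0.
have dlsg : dl <= sg by rewrite /dl expr2 ler_piMl// ltW.
pose s := sg^-1; have ssg : s * sg = 1 by rewrite mulVf// gt_eqF.
have s0 : 0 < s by rewrite invr_gt0.
pose P := kick (fun x => s * phi x) X.
have CP : C P by apply: kick_C => //; exact: trigZ.
pose W := wave dl P; have CW : C W by exact: wave_C.
pose Y := kick (fun x => - s * phi x) W.
have CY : C Y by apply: kick_C => //; exact: trigZ.
exists Y; split => //.
  have r1' : reach (tau / 4) X P by apply: (hk s).2 => //; rewrite divr_gt0.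
  have r2' : reach (tau / 4) P W.
    by apply: reach_le (reach_free csN gS bS B_C B_Z dl0 CP); exact: le_trans dlsg sgt.
  have r3' : reach (tau / 4) W Y by apply: (hk (- s)).2 => //; rewrite divr_gt0.
  have rt := reach_trans csN gS bS B_C B_lin B_Z B_bound.
  have := rt _ _ _ _ _ CX CW CY (rt _ _ _ _ _ CX CP CW r1' r2') r3'.
  by apply: reach_le; lra.
pose Z := s *: (W - P) - P0.
have CWP : C (W - P) by exact: stateB.
have CZ : C Z by apply: stateB => //; exact: (csZ csN).
have YE : Y - target = (W - P) - push phi Z.
  congr pair; apply/funext => x /=.
    by rewrite -[LHS]/(W.1 x - X.1 x) -[RHS]/((W.1 x - X.1 x) - 0) subr0.
  rewrite -[LHS]/((W.2 x + - s * phi x * W.1 x) - (X.2 x + - (phi x ^+ 2) * X.1 x)).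
  rewrite -[RHS]/((W.2 x - (X.2 x + s * phi x * X.1 x)) - phi x * (s * (W.1 x - X.1 x) - phi x * X.1 x)).
  ring.
have Cp : C (push phi Z) by apply: push_C => //; case/stateP: CZ.
rewrite YE; apply: le_trans (snB csN CWP Cp) _.
(* W - P and Z are estimated frequency by frequency; Z is the error made on
   the displacement multiplied by s *)
have PE : P = s *: P1 + X.
  congr pair; apply/funext => x /=.
    by rewrite -[RHS]/(s * 0 + X.1 x) mulr0 add0r.
  by rewrite -[RHS]/(s * (phi x * X.1 x) + X.2 x); ring.
have zP1 c k : mode c P1 k = (0, tcoef c psi k) by rewrite /mode /P1/= tcoef_zero.
have zP0 c k : mode c P0 k = (tcoef c psi k, 0) by rewrite /mode /P0/= tcoef_zero.
have zP c k : mode c P k = zlin s (mode c P1 k) (mode c X k) by rewrite PE mode_lin.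
have b1 : N (W - P) <= e / 2 + 2 * N P0 * sg.
  pose D1 := wave dl X - X; pose D2 := s *: (wave dl P1 - P1).
  have CD1 : C D1 by apply: stateB => //; exact: wave_C.
  have CB : C (wave dl P1 - P1) by apply: stateB => //; exact: wave_C.
  have CD2 : C D2 by exact: (csZ csN).
  have h0 : N ((W - P) - (D1 + D2)) = 0.
    apply: state_norm_null; first by apply: stateB => //; exact: (csD csN).
    move=> c k; rewrite mode_sub//; last exact: (csD csN).
    rewrite mode_sub// [D1 + D2]addrC /D2 mode_lin// !mode_sub ?wave_mode//; try exact: wave_C.
    rewrite zP wave_map_lin; set w1 := wave_map _ _ _; set w2 := wave_map _ _ _.
    by rewrite /zsub /zlin/=; congr (_, _); ring.
  rewrite (sn_eq csN CWP (csD csN CD1 CD2) h0).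
  apply: le_trans (snD csN CD1 CD2) _; apply: lerD.
    by apply: hr; rewrite gtr0_norm// dl0 (le_trans dlsg).
  have -> : 2 * N P0 * sg = (2 * sg) * N P0 by ring.
  apply: state_norm_mono => //; first by rewrite mulr_ge0// ltW.
  move=> k; have E c : mode c D2 k = zlin s (zsub (wave_map dl k (mode c P1 k)) (mode c P1 k)) (0, 0).
    rewrite /D2 -[s *: _]addr0 mode_lin//; last exact: state0.
    by rewrite mode_sub ?wave_mode ?mode_zero//; exact: wave_C.
  rewrite /state_energy !E !zP1 !zP0 /energy /zsub /zlin /wave_map/=.
  have hs : (s * wsin k dl) ^+ 2 <= sg ^+ 2.
    apply: sqr_le_norm; rewrite normrM gtr0_norm//.
    apply: le_trans (ler_wpM2l (ltW s0) (wsin_bound k dl)) _.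
    by rewrite gtr0_norm// /dl expr2 mulrA ssg mul1r.
  have hc : (s * (wcos k dl - 1)) ^+ 2 <= fnorm k ^+ 2 * sg ^+ 2.
    rewrite -exprMn; apply: sqr_le_norm; rewrite normrM gtr0_norm//.
    apply: le_trans (ler_wpM2l (ltW s0) (wcosB1_bound k dl)) _.
    by rewrite gtr0_norm// /dl expr2 mulrCA [s * (_ * _)]mulrA ssg mul1r.
  have hE (z : R) : weight k * (s * (wcos k dl * 0 + wsin k dl * z - 0) + 0) ^+ 2 +
      (s * (- (fnorm k ^+ 2 * wsin k dl) * 0 + wcos k dl * z - z) + 0) ^+ 2 <=
      (2 * sg) ^+ 2 * (weight k * z ^+ 2 + 0 ^+ 2).
    have -> : s * (wcos k dl * 0 + wsin k dl * z - 0) + 0 = (s * wsin k dl) * z by ring.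
    have -> : s * (- (fnorm k ^+ 2 * wsin k dl) * 0 + wcos k dl * z - z) + 0 = (s * (wcos k dl - 1)) * z by ring.
    rewrite ![(_ * z) ^+ 2]exprMn; have w0 := weight_ge0 k : 0 <= weight k :> R.
    have z2 := sqr_ge0 z; have g2 := sqr_ge0 sg.
    have kw : fnorm k ^+ 2 <= weight k :> R by rewrite weightE; lra.
    have := ler_wpM2l w0 (ler_wpM2r z2 hs); have := ler_wpM2r z2 hc.
    have := ler_wpM2r z2 (ler_wpM2r g2 kw); have := mulr_ge0 w0 (mulr_ge0 g2 z2).
    rewrite [(2 * sg) ^+ 2]exprMn; lra.
  by rewrite [leRHS]mulrDr lerD//; exact: hE.
have b2 : ip mu Z.1 Z.1 <= (2 * (N X + N P0) * sg) ^+ 2.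
  have /stateP[Z1 _ _] := CZ; have pp : 0 < (2 * pi : R) ^+ d.
    by rewrite exprn_gt0// mulr_gt0// pi_gt0.
  rewrite -(ler_pM2l pp) parseval// mulrA mulfV ?lt0r_neq0// mul1r.
  have /stateP[_ _ hP0] := CP0.
  have [sD D] := tsumD (state_energy_ge0 X) (state_energy_ge0 P0) hX hP0.
  have q0 : 0 <= 3 * sg ^+ 2 by rewrite mulr_ge0 ?sqr_ge0.
  have [sZ EZ] := tsumZ q0 (fun k => addr_ge0 (state_energy_ge0 X k) (state_energy_ge0 P0 k)) sD.
  apply: (@le_trans _ _ (3 * sg ^+ 2 * (tsum (state_energy X) + tsum (state_energy P0)))).
    rewrite -D -EZ; apply: (tsum_mono _ sZ).2 => k; rewrite power_ge0/=.
    have E c : mode c Z k = zsub (zlin s (zsub (wave_map dl k (mode c P k)) (mode c P k)) (0, 0)) (mode c P0 k).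
      rewrite mode_sub//; last exact: (csZ csN).
      rewrite -[s *: _]addr0 mode_lin//; last exact: state0.
      by rewrite mode_sub ?wave_mode ?mode_zero.
    have E1 c : tcoef c Z.1 k = (s * (wcos k dl - 1)) * tcoef c X.1 k +
        ((s * wsin k dl) * tcoef c X.2 k + (s ^+ 2 * wsin k dl - 1) * tcoef c psi k).
      have : (mode c Z k).1 = tcoef c Z.1 k by [].
      by rewrite E zP zP1 zP0 => <-; rewrite /zsub /zlin /wave_map/=; ring.
    have hs : (s * wsin k dl) ^+ 2 <= sg ^+ 2.
      apply: sqr_le_norm; rewrite normrM gtr0_norm//.
      apply: le_trans (ler_wpM2l (ltW s0) (wsin_bound k dl)) _.
      by rewrite gtr0_norm// /dl expr2 mulrA ssg mul1r.
    have hc : (s * (wcos k dl - 1)) ^+ 2 <= fnorm k ^+ 2 * sg ^+ 2.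
      rewrite -exprMn; apply: sqr_le_norm; rewrite normrM gtr0_norm//.
      apply: le_trans (ler_wpM2l (ltW s0) (wcosB1_bound k dl)) _.
      by rewrite gtr0_norm// /dl expr2 mulrCA [s * (_ * _)]mulrA ssg mul1r.
    have hd : (s ^+ 2 * wsin k dl - 1) ^+ 2 <= fnorm k ^+ 2 * sg ^+ 2.
      rewrite -exprMn; apply: sqr_le_norm.
      have sd : s ^+ 2 * dl = 1 by rewrite /dl -exprMn ssg expr1n.
      have -> : s ^+ 2 * wsin k dl - 1 = s ^+ 2 * (wsin k dl - dl) by rewrite mulrBr sd.
      rewrite normrM ger0_norm ?sqr_ge0//.
      apply: le_trans (ler_wpM2l (sqr_ge0 s) (wsin_sub_bound k dl)) _.
      rewrite gtr0_norm// mulrCA expr2 [s ^+ 2 * (_ * _)]mulrA sd mul1r.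
      by rewrite ler_wpM2l// fnorm_ge0.
    have sq3 (a b c : R) : (a + (b + c)) ^+ 2 <= 3 * (a ^+ 2 + b ^+ 2 + c ^+ 2).
      by have := sqr_ge0 (a - b); have := sqr_ge0 (a - c); have := sqr_ge0 (b - c); nra.
    have main c : tcoef c Z.1 k ^+ 2 <= 3 * sg ^+ 2 * (weight k * tcoef c X.1 k ^+ 2 + tcoef c X.2 k ^+ 2 + weight k * tcoef c psi k ^+ 2).
      rewrite E1; apply: le_trans (sq3 _ _ _) _; rewrite ![(_ * tcoef _ _ _) ^+ 2]exprMn.
      set x := tcoef c X.1 k; set y := tcoef c X.2 k; set z := tcoef c psi k.
      have x2 := sqr_ge0 x; have y2 := sqr_ge0 y; have z2 := sqr_ge0 z; have g2 := sqr_ge0 sg.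
      have kw : fnorm k ^+ 2 * sg ^+ 2 <= weight k * sg ^+ 2 :> R by rewrite ler_wpM2r// weightE; lra.
      have := ler_wpM2r x2 (le_trans hc kw); have := ler_wpM2r y2 hs.
      have := ler_wpM2r z2 (le_trans hd kw); lra.
    rewrite power_tcoef (state_energyE X) !power_tcoef /state_energy !zP0 /energy /fst /snd.
    apply: le_trans (lerD (main true) (main false)) _.
    by rewrite -mulrDr le_eqVlt; apply/orP; left; apply/eqP; congr (_ * _); ring.
  rewrite -!state_norm_sqr//.
  have x0 := N0 X; have y0 := N0 P0; have g2 := sqr_ge0 sg.
  set x := N X in x0 *; set y := N P0 in y0 *; set D' := (2 * pi) ^+ d in pp *.
  have -> : 3 * sg ^+ 2 * (D' * x ^+ 2 + D' * y ^+ 2) = D' * (sg ^+ 2 * (3 * (x ^+ 2 + y ^+ 2))) by ring.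
  rewrite [(_ * sg) ^+ 2]exprMn [_ ^+ 2 * sg ^+ 2]mulrC ler_pM2l// ler_wpM2l//.
  by rewrite exprMn; have := mulr_ge0 x0 y0; nra.
have g0 : 0 <= 2 * (N X + N P0) * sg by rewrite !mulr_ge0 ?addr_ge0// ltW.
have /stateP[Z1 _ _] := CZ.
have b3 := hM Z _ g0 Z1 b2; rewrite /K in sge.
have := b1; lra.
Qed.

End kicks.

(** * Kicks by all trigonometric polynomials *)

Section all_kicks.
Context {R : realType} {d : nat}.
Local Notation mu := (@torus_measure R d).
Local Notation freq := (d.-tuple int).
Local Notation kicks := (@kicks R d).
Implicit Types (f g p phi psi : torus R d -> R) (k l : freq).

(** Squares come with a negative sign, so that a function and its opposite
    have to be obtained separately; only then linear combinations are
    available. *)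
Definition kickable phi := forall a, kicks (fun x => a * phi x).

Lemma kickable_eq phi psi : (forall x, phi x = psi x) -> kickable phi -> kickable psi.
Proof. by move=> /funext ->. Qed.

Lemma kickable_lin a phi psi : kickable phi -> kickable psi -> kickable (fun x => a * phi x + psi x).
Proof.
move=> g1 g2 b; apply: kicks_eq (kicks_add (g1 (b * a)) (g2 b)) => x; ring.
Qed.

Lemma kickable_ctrl q : kickable (ctrl q).
Proof. by move=> a; apply: kicks_eq (kicks_ctrl (a *: q)) => x; rewrite ctrlZ. Qed.

Lemma kickable_control_fun j : kickable (@control_fun R d j).
Proof.
apply: kickable_eq (kickable_ctrl (delta_mx 0 j)) => x.
rewrite /ctrl (bigD1 j)//= mxE !eqxx mul1r big1 ?addr0// => i ij.
by rewrite mxE eqxx (negbTE ij) mul0r.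
Qed.

Lemma kickable1 : kickable (fun=> 1).
Proof. exact: kickable_eq (kickable_control_fun ord0). Qed.

Lemma kickable0 : kickable (fun=> 0).
Proof. by apply: kickable_eq (kickable_lin (-1) kickable1 kickable1) => x; ring. Qed.

Lemma kickableZ a phi : kickable phi -> kickable (fun x => a * phi x).
Proof. by move=> g; apply: kickable_eq (kickable_lin a g kickable0) => x; rewrite addr0. Qed.

Lemma kickableD phi psi : kickable phi -> kickable psi -> kickable (fun x => phi x + psi x).
Proof. by move=> g h; apply: kickable_eq (kickable_lin 1 g h) => x; rewrite mul1r. Qed.

Lemma kickableB phi psi : kickable phi -> kickable psi -> kickable (fun x => phi x - psi x).
Proof. by move=> g h; apply: kickable_eq (kickable_lin (-1) h g) => x; ring. Qed.

(** Squares only come with a negative sign; a function which is both one minus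
    a sum of squares and a sum of squares minus one is reached with both signs. *)
Lemma kickable_squares phi f g f' g' : kickable f -> kickable g -> kickable f' -> kickable g' ->
  (forall x, phi x = 1 - (f x ^+ 2 + g x ^+ 2) / 2) ->
  (forall x, phi x = (f' x ^+ 2 + g' x ^+ 2) / 2 - 1) -> kickable phi.
Proof.
have neg h b : kickable h -> 0 <= b -> kicks (fun x => - (b * h x ^+ 2)).
  move=> gh b0; have [|_ k] := @kick_square R d (fun x => Num.sqrt b * h x).
    by move=> a; apply: kicks_eq (gh (a * Num.sqrt b)) => x; rewrite mulrA.
  have := @kick_square R d (fun x => Num.sqrt b * h x) (fun a => kicks_eq (fun x => esym (mulrA _ _ _)) (gh (a * Num.sqrt b))).
  by apply: kicks_eq => x; rewrite exprMn sqr_sqrtr.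
move=> gf gg gf' gg' E E' a; have [a0|a0] := leP 0 a.
  have a2 : 0 <= a / 2 by rewrite divr_ge0.
  apply: kicks_eq (kicks_add (kicks_add (neg f _ gf a2) (neg g _ gg a2)) (kickable1 a)) => x.
  by rewrite E; field.
have a2 : 0 <= - a / 2 by rewrite divr_ge0// oppr_ge0 ltW.
apply: kicks_eq (kicks_add (kicks_add (neg f' _ gf' a2) (neg g' _ gg' a2)) (kickable1 (- a))) => x.
by rewrite E'; field.
Qed.

Definition kickable_freq k := kickable (fun x => cos (freq_dot k x)) /\ kickable (fun x => sin (freq_dot k x)).

Lemma kickable_freq0 : kickable_freq zerot.
Proof.
split; [apply: kickable_eq kickable1|apply: kickable_eq kickable0] => x; by rewrite freq_dot0 ?cos0 ?sin0.
Qed.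

Lemma kickable_freqN k : kickable_freq k -> kickable_freq (negt k).
Proof.
move=> [c s]; split; first by apply: kickable_eq c => x; rewrite freq_dotN cosN.
by apply: kickable_eq (kickableZ (-1) s) => x; rewrite freq_dotN sinN mulN1r.
Qed.

(** Indeed (cos k + cos l)^2 + (sin k - sin l)^2 = 2 + 2 cos (k + l) and (cos
    k - cos l)^2 + (sin k + sin l)^2 = 2 - 2 cos (k + l), and similarly for
    the sine. *)
Lemma kickable_freqD k l : kickable_freq k -> kickable_freq l -> kickable_freq (addt k l).
Proof.
move=> [ck sk] [cl sl]; split.
- apply: (kickable_squares (kickableB ck cl) (kickableD sk sl) (kickableD ck cl) (kickableB sk sl)) => x;
    rewrite freq_dotD cosD; have := cos2Dsin2 (freq_dot k x); have := cos2Dsin2 (freq_dot l x); lra.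
- apply: (kickable_squares (kickableB sk cl) (kickableB ck sl) (kickableD sk cl) (kickableD ck sl)) => x;
    rewrite freq_dotD sinD; have := cos2Dsin2 (freq_dot k x); have := cos2Dsin2 (freq_dot l x); lra.
Qed.

Lemma kickable_freq_unit (i : 'I_d) : kickable_freq (unit_freq i).
Proof.
have j1 : (i.*2.+1 < d.*2.+1)%N by rewrite ltnS ltn_double.
have j2 : (i.*2.+2 < d.*2.+1)%N by rewrite ltnS -doubleS leq_double.
split.
- apply: kickable_eq (kickable_control_fun (Ordinal j1)) => x.
  by rewrite freq_dot_unit /control_fun/= odd_double doubleK (tnth_nth 0).
- apply: kickable_eq (kickable_control_fun (Ordinal j2)) => x.
  by rewrite freq_dot_unit /control_fun/= odd_double/= uphalf_double (tnth_nth 0).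
Qed.

(** The unit frequencies generate all frequencies. *)
Lemma kickable_freq_all k : kickable_freq k.
Proof.
pose mult (i : 'I_d) (n : int) : freq := [tuple (j == i)%:R * n | j < d].
have hm i n : kickable_freq (mult i n).
  have pos m : kickable_freq (mult i m%:Z).
    elim: m => [|m ih].
      have -> : mult i 0%:Z = zerot by apply: eq_from_tnth => j; rewrite !tnth_mktuple mulr0.
      exact: kickable_freq0.
    have -> : mult i m.+1%:Z = addt (unit_freq i) (mult i m%:Z).
      by apply: eq_from_tnth => j; rewrite !tnth_mktuple -addn1 PoszD mulrDr mulr1 addrC.
    by apply: kickable_freqD => //; exact: kickable_freq_unit.
  case: n => m; first exact: pos.
  have -> : mult i (Negz m) = negt (mult i m.+1%:Z).
    by apply: eq_from_tnth => j; rewrite !tnth_mktuple NegzE mulrN.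
  exact: kickable_freqN.
have -> : k = \big[addt/zerot]_(i < d) mult i (tnth k i).
  apply: eq_from_tnth => j.
  have -> : tnth (\big[addt/zerot]_(i < d) mult i (tnth k i)) j = \sum_(i < d) tnth (mult i (tnth k i)) j.
    by apply: (big_morph (fun t : freq => tnth t j)) => [x y|]; rewrite tnth_mktuple.
  rewrite (bigD1 j)//= tnth_mktuple eqxx mul1r big1 ?addr0// => i ij.
  by rewrite tnth_mktuple eq_sym (negbTE ij) mul0r.
apply: (big_ind kickable_freq) => [|x y|i _]; [exact: kickable_freq0|exact: kickable_freqD|exact: hm].
Qed.

Lemma trig_kicks phi : trig_poly phi -> kicks phi.
Proof.
move=> tp; have : kickable phi.
  elim: tp => [k|k|a f g _ h1 _ h2]; [exact: (kickable_freq_all k).1|exact: (kickable_freq_all k).2|].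
  exact: kickable_lin.
by move=> /(_ 1); apply: kicks_eq => x; rewrite mul1r.
Qed.

(** ** Multiples of a trigonometric polynomial *)

Lemma ip_lin2 f g : sqint mu f -> sqint mu g ->
  ip mu (fun x => f x + g x) (fun x => f x + g x) <= 2 * ip mu f f + 2 * ip mu g g.
Proof.
move=> sf sg; have h a : 0 <= ip mu (fun x => a * f x + g x) (fun x => a * f x + g x) by exact: ip_ge0.
have := h (-1); rewrite ip_expand// => h1.
have := ip_expand 1 sf sg; have -> : (fun x => 1 * f x + g x) = (fun x => f x + g x).
  by apply/funext => x; rewrite mul1r.
by move=> ->; move: h1; lra.
Qed.

Let quarter_le (m y e : R) : 0 <= y -> y * (4 * (m + 1)) <= e -> m * y <= e / 4.
Proof. by move=> y0 h; lra. Qed.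

Let four_quarters (m x y e : R) : y <= m -> m <= e / 4 -> x <= e / 4 -> 2 * y + 2 * x <= e.
Proof. by move=> ym me xe; lra. Qed.

(** As f is nonzero almost everywhere, f^2 g / (f^2 + delta) tends to g in L^2
    when delta tends to 0. The factor f g / (f^2 + delta) is square
    integrable, hence approximated by the partial sums of its Fourier
    series. *)
Lemma trig_multiples_dense f g (e : R) : trig_poly f -> ~ ae_zero f -> sqint mu g -> 0 < e ->
  exists2 phi, trig_poly phi &
    ip mu (fun x => phi x * f x - g x) (fun x => phi x * f x - g x) <= e.
Proof.
move=> tf fn0 sg e0; have f0 := trig_ae_neq0 tf fn0.
have mf := trig_measurable tf; have mg : measurable_fun setT g by case: sg.
pose dl n : R := n.+1%:R^-1; have dl0 n : 0 < dl n by rewrite invr_gt0.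
pose psi n x := f x / (f x ^+ 2 + dl n) * g x.
have den n x : 0 < f x ^+ 2 + dl n by rewrite ltr_wpDl ?sqr_ge0.
have spsi n : sqint mu (psi n).
  apply: (@sqint_mul_bounded _ _ _ mu g (fun x => f x / (f x ^+ 2 + dl n)) (1 + (dl n)^-1)) => //.
  - have cq : continuous (fun y : R => y / (y ^+ 2 + dl n)).
      move=> y; apply: cvgM; first exact: cvg_id.
      apply: cvgV; first by rewrite gt_eqF// ltr_wpDl ?sqr_ge0.
      by apply: cvgD; [exact: exprn_continuous|exact: cvg_cst].
    apply: (measurableT_comp (f := fun y : R => y / (y ^+ 2 + dl n))) => //.
    exact: continuous_measurable_fun.
  - move=> x; rewrite normrM normfV ler_pdivrMr ?normr_gt0 ?gt_eqF// [`|_ + dl n|]gtr0_norm//.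
    have := ler_norm (f x); have a0 : 0 <= `|f x| by [].
    have -> : f x ^+ 2 = `|f x| ^+ 2 by rewrite real_normK ?num_real.
    rewrite mulrDl mul1r mulrDr mulVf ?gt_eqF//.
    have : 0 <= (dl n)^-1 * `|f x| ^+ 2 by rewrite mulr_ge0 ?sqr_ge0// invr_ge0 ltW.
    by have := dl0 n; nra.
pose r n x := psi n x * f x - g x.
have rE n x : r n x = - (dl n / (f x ^+ 2 + dl n)) * g x.
  by rewrite /r /psi; field; rewrite gt_eqF.
have q01 n x : 0 <= dl n / (f x ^+ 2 + dl n) <= 1.
  rewrite divr_ge0 ?(ltW (den _ _)) ?(ltW (dl0 _))//= ler_pdivrMr// mul1r lerDr sqr_ge0 //.
have sr n : sqint mu (r n).
  have := sqint_lin (-1) sg (sqint_trigM tf (spsi n)); congr sqint; apply/funext => x.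
  by rewrite /r mulN1r addrC [psi n x * _]mulrC.
have lim : ip mu (r n) (r n) @[n --> \oo] --> (0 : R).
  have mr n : measurable_fun setT (r n) by case: (sr n).
  have [] := @dominated_convergence _ _ _ mu setT measurableT
    (fun n x => (r n x * r n x)%:E) (fun=> 0%E) (fun x => (g x * g x)%:E).
  - by move=> n; apply/measurable_EFinP; exact: measurable_funM.
  - exact: measurable_cst.
  - apply: filterS f0 => x fx _; apply: cvg_EFin; first by near=> n.
    have rx : r n x @[n --> \oo] --> (0 : R).
      have h : - (dl n / (f x ^+ 2 + dl n)) * g x @[n --> \oo] --> - (0 / (f x ^+ 2 + 0)) * g x.
        apply: cvgM; last exact: cvg_cst.
        apply: cvgN; apply: cvgM; first exact: cvg_harmonic.
        apply: cvgV; first by rewrite addr0 sqrf_eq0.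
        by apply: cvgD; [exact: cvg_cst|exact: cvg_harmonic].
      by move: h; rewrite mul0r oppr0 mul0r; under eq_fun do rewrite -rE.
    have h : r n x * r n x @[n --> \oo] --> (0 : R) by rewrite -[X in _ --> X](mulr0 0); exact: (cvgM rx rx).
    exact: h.
  - exact: sqint_mul.
  - apply: nearW => x n _ /=; rewrite lee_fin rE; have /andP[q0 q1] := q01 n x.
    set q := _ / _ in q0 q1 *; rewrite -!expr2 ger0_norm ?sqr_ge0// exprMn sqrrN.
    by rewrite ler_piMl ?sqr_ge0// exprn_ile1.
  move=> _ _; rewrite integral0 => h; rewrite /ip /Rintegral.
  by apply: fine_cvg h.
have [n hn] : exists n, ip mu (r n) (r n) <= e / 4.
  move/cvgrPdist_le : lim => /(_ (e / 4))[|n _ /(_ n (leqnn n))]; first by rewrite divr_gt0.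
  by rewrite sub0r normrN => h; exists n; apply: le_trans (ler_norm _) h.
have [M M0 hM] := trig_bounded tf.
have e1 : 0 < e / (4 * (M ^+ 2 + 1)) by rewrite divr_gt0// mulr_gt0// ltr_wpDl// sqr_ge0.
have [rr _ hr] := fourier_approx (spsi n) e1; set S := fsum rr _ _ in hr.
have tS : trig_poly S by exact: trig_fsum.
exists S => //.
pose a x := - 1 * S x + psi n x; have sa : sqint mu a by apply: sqint_lin => //; exact: trig_sqint.
have -> : (fun x => S x * f x - g x) = (fun x => - 1 * (f x * a x) + r n x).
  by apply/funext => x; rewrite /a /r; ring.
have sfa := sqint_trigM tf sa.
have z0 : sqint mu (fun x => - 1 * (f x * a x)).
  have := sqint_lin (-1) sfa (trig_sqint (trig_cst 0 : trig_poly (fun=> 0 : R))).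
  by congr sqint; apply/funext => x; rewrite addr0.
apply: le_trans (ip_lin2 z0 (sr n)) _.
have -> : ip mu (fun x => - 1 * (f x * a x)) (fun x => - 1 * (f x * a x)) = ip mu (fun x => f x * a x) (fun x => f x * a x).
  by apply: eq_Rintegral => x _; rewrite mulN1r mulrNN.
have h1 := ip_mul_le tf hM sa.
have h2 : M ^+ 2 * ip mu a a <= e / 4.
  have M2 : 0 < M ^+ 2 + 1 by rewrite ltr_wpDl// sqr_ge0.
  have ip0 : 0 <= ip mu a a by exact: ip_ge0.
  have : ip mu a a * (4 * (M ^+ 2 + 1)) <= e by rewrite -ler_pdivlMr// mulr_gt0.
  exact: quarter_le.
exact: (four_quarters h1 h2 hn).
Unshelve. all: by end_near. Qed.

End all_kicks.

(** * Reachable states *)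

Section reachable.
Context {R : realType} {d : nat}.
Local Notation mu := (@torus_measure R d).
Local Notation freq := (d.-tuple int).
Local Notation St := (@state R d).
Local Notation C := (@state_space R d).
Local Notation N := (@state_norm R d).
Local Notation B := (@control_term R d).
Local Notation wave := (@wave R d).
Local Notation "'reach'" := (reach C N wave B).
Local Notation "'NR'" := (near_reach C N wave B).
Implicit Types (f g p q v y phi : torus R d -> R) (k l : freq) (u X Y Z : St) (c : bool).

Let csN := @state_seminorm R d.
Let gS := @wave_strongly_continuous R d.
Let bS := @wave_bound R d.

Let rtrans := reach_trans csN gS bS (@B_C R d) (@B_lin R d) (@B_Z R d) (@B_bound R d).
Let rfree := reach_free csN gS bS (@B_C R d) (@B_Z R d).
Let N0 u : 0 <= N u. Proof. exact: sqrtr_ge0. Qed.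

Lemma mode_eq_null X Y : C X -> C Y -> (forall c k, mode c X k = mode c Y k) -> N (X - Y) = 0.
Proof.
move=> CX CY h; apply: state_norm_null; first exact: stateB.
by move=> c k; rewrite mode_sub// h /zsub !subrr.
Qed.

Lemma NR_eq X Y : C X -> C Y -> (forall c k, mode c X k = mode c Y k) -> NR X Y.
Proof.
move=> CX CY h; apply: (near_reach_null csN gS (@B_C R d) CX CY); exact: mode_eq_null.
Qed.

(** A kick by phi adds phi p to the velocity, and such products are dense. *)
Lemma NR_velocity p v g : trig_poly p -> ~ ae_zero p -> sqint mu v -> sqint mu g ->
  NR (p, v) (p, g).
Proof.
move=> tp pn0 sv sg; have CX : C (p, v) by exact: trig_state.
have CY : C (p, g) by exact: trig_state.
apply: (near_reach_closed csN CX CY) => e e0.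
have sgv : sqint mu (fun x => - 1 * v x + g x) by exact: sqint_lin.
have e2 : 0 < e ^+ 2 by rewrite exprn_gt0.
have [phi tphi hphi] := trig_multiples_dense tp pn0 sgv e2.
exists (kick phi (p, v)); split; [exact: kick_C|exact: (trig_kicks tphi).2|].
have E : kick phi (p, v) - (p, g) = (cst 0, fun x => phi x * p x - (- 1 * v x + g x)).
  congr pair; apply/funext => x /=; first by rewrite -[LHS]/(p x - p x) subrr.
  by rewrite -[LHS]/(v x + phi x * p x - g x); ring.
have s : sqint mu (fun x => phi x * p x - (- 1 * v x + g x)).
  have := sqint_lin (-1) sgv (sqint_trigM tphi (trig_sqint tp)); congr sqint.
  by apply/funext => x; ring.
by rewrite E -(@ler_pXn2r _ 2)// ?nnegrE ?N0 ?(ltW e0)// norm_snd.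
Qed.

Lemma NR_spectrum f v g p : sqint mu f -> finite_spectrum f -> ~ ae_zero f -> sqint mu v ->
  sqint mu g -> trig_poly p -> (forall c k, tcoef c p k = tcoef c f k) -> NR (f, v) (p, g).
Proof.
move=> sf ff fn0 sv sg tp pf.
have Cf : C (f, v) by split => /=; [exact: finite_spectrum_sobolev|exact/L2P].
have Cp : C (p, v) by exact: trig_state.
have Cg : C (p, g) by exact: trig_state.
have pn0 : ~ ae_zero p.
  move=> /(ae_zero_coef (trig_sqint tp)) h; apply: fn0; apply/(ae_zero_coef sf) => c k.
  by rewrite -pf.
apply: (NR_trans Cf Cp Cg); last exact: NR_velocity.
by apply: NR_eq => // c k; rewrite /mode/= pf.
Qed.

Lemma norm_fst_gt0 f : trig_poly f -> ~ ae_zero f -> 0 < N (f, cst 0).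
Proof.
move=> tf fn0; rewrite lt_neqAle eq_sym N0 andbT; apply/eqP => n0; apply: fn0.
have s0 : sqint mu (cst 0 : torus R d -> R) by apply: trig_sqint; exact: trig_zero.
have Cf : C (f, cst 0) by exact: trig_state.
apply/(ae_zero_coef (trig_sqint tf)) => c k.
have [+ _] := mode_bound c k Cf; rewrite n0 expr0n/= mulr0 => h.
by apply/eqP; rewrite -sqrf_eq0 eq_le h sqr_ge0.
Qed.

(** Prescribe the velocity (q - p) / dl and let the waves flow during dl: the
    position becomes almost q and remains a trigonometric polynomial, so that
    the velocity can be prescribed once more. *)
Lemma NR_trig p v q y : trig_poly p -> ~ ae_zero p -> sqint mu v ->
  trig_poly q -> ~ ae_zero q -> sqint mu y -> NR (p, v) (q, y).
Proof.
move=> tp pn0 sv tq qn0 sy tau tau0.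
have CX : C (p, v) by exact: trig_state.
have CZ : C (q, y) by exact: trig_state.
apply: (reach_closed csN CX CZ) => e e0.
have pp : 0 < (2 * pi : R) ^+ d by rewrite exprn_gt0// mulr_gt0// pi_gt0.
have sp := trig_sqint tp; have sq := trig_sqint tq.
have [_ hp] := (sobolevP 2 p).1 (finite_spectrum_sobolev 2 sp (trig_finite_spectrum tp)).
have [_ hq] := (sobolevP 2 q).1 (finite_spectrum_sobolev 2 sq (trig_finite_spectrum tq)).
have [hs _] := tsumD (weight_power_ge0 2 p) (weight_power_ge0 2 q) hp hq.
pose a k := weight k ^+ 2 * power p k + weight k ^+ 2 * power q k.
have a0 k : 0 <= a k by rewrite addr_ge0 ?weight_power_ge0.
pose K := Num.sqrt (6 * tsum a / (2 * pi) ^+ d).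
have K0 : 0 <= K by exact: sqrtr_ge0.
have KE : (2 * pi) ^+ d * K ^+ 2 = 6 * tsum a.
  rewrite sqr_sqrtr; last by rewrite divr_ge0 ?mulr_ge0 ?tsum_ge0// ltW.
  by rewrite mulrC divfK// gt_eqF.
have nq := norm_fst_gt0 tq qn0; set n0 := N (q, cst 0) in nq.
(* an error below n0 / 2 keeps the new position away from 0 *)
pose m := Num.min e (n0 / 2); have m0 : 0 < m by rewrite lt_min e0 divr_gt0.
have K1 : 0 < K + 1 by rewrite ltr_wpDl.
pose dl := Num.min (tau / 4) (m / (K + 1)).
have dl0 : 0 < dl by rewrite lt_min !divr_gt0.
have dlt : dl <= tau / 4 by rewrite ge_min lexx.
have dlm : dl * K <= m.
  have : dl * (K + 1) <= m by rewrite -ler_pdivlMr// ge_min lexx orbT.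
  by have := ltW dl0; nra.
pose g x := dl^-1 * (q x - p x).
have tg : trig_poly g.
  by apply: trigZ; apply: (trig_eq _ (trig_lin (-1) tp tq)) => x; ring.
have sg := trig_sqint tg; have Cg : C (p, g) by exact: trig_state.
have gE c k : tcoef c g k = dl^-1 * (tcoef c q k - tcoef c p k).
  have -> : g = dl^-1 *: ((-1) *: p + q) + cst 0.
    by apply/funext => x; rewrite /g -[RHS]/(dl^-1 * (-1 * p x + q x) + 0); ring.
  have s0 : sqint mu (cst 0 : torus R d -> R) by apply: trig_sqint; exact: trig_zero.
  by rewrite tcoef_lin//; [rewrite tcoef_lin// tcoef_zero; ring|exact: sqint_lin].
pose U := wave dl (p, g); have CU : C U by exact: wave_C.
have U1 c k : tcoef c U.1 k = wcos k dl * tcoef c p k + wsin k dl * (dl^-1 * (tcoef c q k - tcoef c p k)).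
  have : (mode c U k).1 = tcoef c U.1 k by [].
  by rewrite wave_mode// => <-; rewrite /wave_map /mode/= -!/(tcoef c _ k) gE.
have /stateP[sU1 sU2 _] := CU.
have fU : finite_spectrum U.1.
  have [r1 h1] := trig_finite_spectrum tp; have [r2 h2] := trig_finite_spectrum tq.
  exists (r1 ++ r2) => c k; rewrite mem_cat negb_or => /andP[kr1 kr2].
  by rewrite U1 h1// h2// subrr !mulr0 addr0.
have [p' [tp' p'E]] := finite_spectrum_trig sU1 fU.
have sp' := trig_sqint tp'.
have CY : C (p', y) by exact: trig_state.
have close : N ((p', y) - (q, y)) <= dl * K.
  apply: state_norm_le; [exact: stateB|by rewrite mulr_ge0// ltW|].
  have c0 : 0 <= 6 * dl ^+ 2 by rewrite mulr_ge0 ?sqr_ge0.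
  have [sT TE] := tsumZ c0 a0 hs.
  have -> : (2 * pi) ^+ d * (dl * K) ^+ 2 = 6 * dl ^+ 2 * tsum a.
    by rewrite [(dl * K) ^+ 2]exprMn mulrCA KE; ring.
  rewrite -TE; apply: (tsum_mono _ sT).2 => k; rewrite state_energy_ge0/=.
  have wq : wsin k dl / dl - 1 = (wsin k dl - dl) / dl by field; rewrite gt_eqF.
  have b1 : (wcos k dl - 1) ^+ 2 <= (fnorm k * dl) ^+ 2.
    by apply: sqr_le_norm; rewrite -[in leRHS](gtr0_norm dl0); exact: wcosB1_bound.
  have b2 : (wsin k dl / dl - 1) ^+ 2 <= (fnorm k * dl) ^+ 2.
    apply: sqr_le_norm; rewrite wq normrM normfV [`|dl|]gtr0_norm// ler_pdivrMr//.
    by rewrite -mulrA -expr2 -[in leRHS](gtr0_norm dl0); exact: wsin_sub_bound.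
  have main c : weight k * (tcoef c p' k - tcoef c q k) ^+ 2 <=
     6 * dl ^+ 2 * (weight k ^+ 2 * tcoef c p k ^+ 2 + weight k ^+ 2 * tcoef c q k ^+ 2).
    rewrite p'E U1; set x := tcoef c p k; set z := tcoef c q k.
    have -> : wcos k dl * x + wsin k dl * (dl^-1 * (z - x)) - z =
       (wcos k dl - 1) * x + (wsin k dl / dl - 1) * (z - x) by field; rewrite gt_eqF.
    move: b1 b2; set A := wcos k dl - 1; set A' := wsin k dl / dl - 1.
    rewrite exprMn => b1 b2; have kw : fnorm k ^+ 2 <= weight k :> R by rewrite weightE; lra.
    have w0 := weight_ge0 k : 0 <= weight k :> R; have d2 := sqr_ge0 dl.
    have x2 := sqr_ge0 x; have zx2 := sqr_ge0 (z - x).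
    have h1 : (A * x + A' * (z - x)) ^+ 2 <= 2 * (weight k * dl ^+ 2 * x ^+ 2) + 2 * (weight k * dl ^+ 2 * (z - x) ^+ 2).
      apply: le_trans (sqrD_le _ _) _; rewrite ![(_ * _) ^+ 2]exprMn.
      have kd := ler_wpM2r d2 kw.
      have := ler_wpM2r x2 (le_trans b1 kd); have := ler_wpM2r zx2 (le_trans b2 kd); lra.
    have h2 : (z - x) ^+ 2 <= 2 * z ^+ 2 + 2 * x ^+ 2 by have := sqr_ge0 (z + x); lra.
    have wd : 0 <= weight k * dl ^+ 2 by rewrite mulr_ge0.
    have h3 := ler_wpM2l wd h2.
    have h4 : (A * x + A' * (z - x)) ^+ 2 <= 6 * dl ^+ 2 * (weight k * x ^+ 2 + weight k * z ^+ 2).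
      by have := mulr_ge0 wd (sqr_ge0 z); lra.
    have := ler_wpM2l w0 h4; rewrite [weight k ^+ 2]expr2; lra.
  have zE c : mode c ((p', y) - (q, y)) k = (tcoef c p' k - tcoef c q k, 0).
    by rewrite mode_sub// /zsub/= subrr.
  rewrite /state_energy !zE /energy /a !power_tcoef /fst /snd expr0n/= !addr0.
  have := main true; have := main false; rewrite /tcoef/=; lra.
have U0 : ~ ae_zero U.1.
  move=> /(ae_zero_coef sU1) h.
  have : n0 <= dl * K.
    apply: le_trans close; rewrite le_eqVlt; apply/orP; left; apply/eqP.
    have s0 : sqint mu (cst 0 : torus R d -> R) by apply: trig_sqint; exact: trig_zero.
    have Cq : C (q, cst 0) by exact: trig_state.
    have CB : C ((p', y) - (q, y)) by exact: stateB.
    have CN : C (- (q, cst 0) : St) by exact: (csNN csN).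
    rewrite /n0 -(snN csN Cq); apply: (sn_eq csN CN CB); apply: mode_eq_null => // c k.
    have -> : - ((q, cst 0) : St) = 0 - (q, cst 0) by rewrite sub0r.
    rewrite !mode_sub//; last exact: state0.
    by rewrite mode_zero /zsub/= p'E h !sub0r subrr tcoef_zero oppr0.
  have : dl * K <= n0 / 2 by apply: le_trans dlm _; rewrite ge_min lexx orbT.
  by move: nq; lra.
exists (p', y); split => //; last by apply: le_trans close (le_trans dlm _); rewrite ge_min lexx.
have t4 : 0 < tau / 4 by rewrite divr_gt0.
have r1 : reach (tau / 4) (p, v) (p, g) by exact: (NR_velocity tp pn0 sv sg).
have r2 : reach (tau / 4) (p, g) U by apply: reach_le (rfree dl0 Cg).
have r3 : reach (tau / 4) U (p', y).
  rewrite [U]surjective_pairing.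
  exact: (NR_spectrum sU1 fU U0 sU2 sy tp' p'E).
have := rtrans CX CU CY (rtrans CX Cg CU r1 r2) r3; apply: reach_le; lra.
Qed.

Lemma NR_all p v Z : trig_poly p -> ~ ae_zero p -> sqint mu v -> C Z -> NR (p, v) Z.
Proof.
move=> tp pn0 sv CZ; have CX : C (p, v) by exact: trig_state.
apply: (near_reach_closed csN CX CZ) => e e0.
have e2 : 0 < e / 2 by rewrite divr_gt0.
have [r [hN _]] := trunc_state CZ e2; set Z' := (_, _) in hN.
have tq : trig_poly Z'.1 by exact: trig_fsum.
have sy : sqint mu Z'.2 by exact: sqint_fsum.
have CZ' : C Z' by exact: trig_state.
have [q0|qn0] := pselect (ae_zero Z'.1); last first.
  exists Z'; split => //; first exact: NR_trig.
  by rewrite (snC csN)//; apply: le_trans hN _; lra.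
(* a small constant is added to a vanishing position *)
pose one : torus R d -> R := fun x => cos (freq_dot zerot x).
have t1 : trig_poly one by exact: trig_cos.
have s0 : sqint mu (cst 0 : torus R d -> R) by apply: trig_sqint; exact: trig_zero.
pose O : St := (one, cst 0); have CO : C O by exact: trig_state.
pose eta := e / (2 * (N O + 1)).
have NO : 0 < N O + 1 by rewrite ltr_wpDl.
have eta0 : 0 < eta by rewrite divr_gt0// mulr_gt0.
have tY : trig_poly (fun x => eta * one x + Z'.1 x) by exact: trig_lin.
exists (fun x => eta * one x + Z'.1 x, Z'.2); split; first exact: trig_state.
  apply: NR_trig => // /(ae_zero_coef (trig_sqint tY)) /(_ true zerot).
  have := tcoef_lin true eta zerot (trig_sqint t1) (trig_sqint tq).
  rewrite ((ae_zero_coef (trig_sqint tq)).1 q0) addr0 => -> /eqP.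
  rewrite mulf_eq0 gt_eqF//= /tcoef coef_trig_cos eqxx.
  have -> : negt zerot = zerot :> freq by apply: eq_from_tnth => i; rewrite !tnth_mktuple oppr0.
  by rewrite eqxx !mulf_eq0 expf_eq0 mulf_eq0 !gt_eqF ?andbF ?invr_gt0 ?pi_gt0.
have E : (fun x => eta * one x + Z'.1 x, Z'.2) - Z = eta *: O + (Z' - Z).
  congr pair; apply/funext => x /=.
    by rewrite -[LHS]/(eta * one x + Z'.1 x - Z.1 x) -[RHS]/(eta * one x + (Z'.1 x - Z.1 x)) addrA.
  by rewrite -[LHS]/(Z'.2 x - Z.2 x) -[RHS]/(eta * 0 + (Z'.2 x - Z.2 x)) mulr0 add0r.
rewrite E; apply: le_trans (state_norm_lin eta CO (stateB CZ' CZ)) _.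
rewrite gtr0_norm// [N (Z' - Z)](snC csN)//.
have : eta * (N O + 1) = e / 2 by rewrite /eta; field; rewrite gt_eqF.
by rewrite mulrDr mulr1 => h; move: hN h eta0; lra.
Qed.

Lemma NR_position f v Z : C (f, v) -> finite_spectrum f -> ~ ae_zero f -> C Z -> NR (f, v) Z.
Proof.
move=> CX ff fn0 CZ; have /stateP[sf sv _] := CX.
have [p [tp pf]] := finite_spectrum_trig sf ff.
have Cp : C (p, v) by exact: trig_state.
apply: (NR_trans CX Cp CZ); first by apply: NR_spectrum.
apply: NR_all => // /(ae_zero_coef (trig_sqint tp)) h; apply: fn0.
by apply/(ae_zero_coef sf) => c k; rewrite -pf.
Qed.

(** After a free flow of duration dl the position has the coefficients of the
    velocity multiplied by sin (|k| dl) / |k|: it has a finite spectrum, and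
    is nonzero for small dl. *)
Lemma NR_rest f v Z : C (f, v) -> ae_zero f -> finite_spectrum v -> ~ ae_zero v -> C Z ->
  NR (f, v) Z.
Proof.
move=> CX f0 fv vn0 CZ tau tau0; have /stateP[sf sv _] := CX.
have fE := (ae_zero_coef sf).1 f0.
have [c0 [k0 vk]] : exists c k, tcoef c v k != 0.
  apply: contrapT => h; apply: vn0; apply/(ae_zero_coef sv) => c k.
  by apply/eqP/negP => /negP ck; apply: h; exists c, k.
(* |k0| dl < 1, so that the coefficient at k0 does not vanish *)
pose dl := Num.min (tau / 2) (1 / (2 * (fnorm k0 + 1))).
have k1 : 0 < fnorm k0 + 1 :> R by rewrite ltr_wpDl// fnorm_ge0.
have dl0 : 0 < dl by rewrite lt_min !divr_gt0// mulr_gt0.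
have dlt : dl <= tau / 2 by rewrite ge_min lexx.
have dlk : fnorm k0 * dl < 1.
  have : dl * (2 * (fnorm k0 + 1)) <= 1 by rewrite -ler_pdivlMr ?mulr_gt0// ge_min lexx orbT.
  by have := fnorm_ge0 k0 : 0 <= fnorm k0 :> R; have := mulr_ge0 (fnorm_ge0 k0 : 0 <= fnorm k0 :> R) (ltW dl0); lra.
pose U := wave dl (f, v); have CU : C U by exact: wave_C.
have /stateP[sU1 _ _] := CU.
have U1 c k : tcoef c U.1 k = wsin k dl * tcoef c v k.
  have : (mode c U k).1 = tcoef c U.1 k by [].
  by rewrite wave_mode// => <-; rewrite /wave_map /mode/= -!/(tcoef c _ k) fE mulr0 add0r.
have r1 : reach (tau / 2) (f, v) U by apply: reach_le (rfree dl0 CX).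
have r2 : reach (tau / 2) U Z.
  have := @NR_position U.1 U.2 Z; rewrite -surjective_pairing; apply => //; last by rewrite divr_gt0.
    by have [r hr] := fv; exists r => c k kr; rewrite U1 hr// mulr0.
  move=> /(ae_zero_coef sU1) /(_ c0 k0); rewrite U1 => /eqP.
  rewrite mulf_eq0 (negbTE vk) orbF => /eqP w0.
  have := wsin_sub_bound k0 dl; rewrite w0 sub0r normrN gtr0_norm// expr2 mulrA.
  by rewrite ler_pMl// leNgt dlk.
have := rtrans CX CU CZ r1 r2; apply: reach_le; lra.
Qed.

End reachable.

(** * Control laws and mild solutions *)

Section control_laws.
Context {R : realType} {Q : lmodType R}.
Implicit Types (c : seq (R * Q)) (a : R).

Fixpoint endpoints a c : seq R :=
  if c is p :: c' then a + p.1 :: endpoints (a + p.1) c' else [::].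

Lemma endpoints_partition a c : wpos c -> itv_partition a (a + wdur c) (endpoints a c).
Proof.
elim: c a => [|p c ih] a /=; first by move=> _; split => //=; rewrite addr0.
move=> /wpos_cons[p0 pc]; have [h1 h2] := ih (a + p.1) pc.
by split; rewrite /= ?ltrDl ?p0// addrA.
Qed.

Lemma endpoints_ge a c i : wpos c -> (i < size (endpoints a c))%N -> a <= nth 0 (a :: endpoints a c) i.
Proof.
elim: c a i => [|p c ih] a [|i] //= /wpos_cons[p0 pc] ic.
by apply: le_trans (ih (a + p.1) i pc ic); rewrite lerDl ltW.
Qed.

Lemma wctrl_constant a c i : wpos c -> (i < size (endpoints a c))%N ->
  {in `[nth 0 (a :: endpoints a c) i, nth 0 (endpoints a c) i[ &,
    forall x y, wctrl c (x - a) = wctrl c (y - a)}.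
Proof.
elim: c a i => [|p c ih] a [|i] //= /wpos_cons[p0 pc] ic x y; rewrite !in_itv/=.
  by move=> /andP[_ x1] /andP[_ y1]; rewrite !ltrBlDl x1 y1.
move=> hx hy; have le := endpoints_ge pc ic.
have h z : nth 0 (a + p.1 :: endpoints (a + p.1) c) i <= z < nth 0 (endpoints (a + p.1) c) i ->
    (if z - a < p.1 then p.2 else wctrl c (z - a - p.1)) = wctrl c (z - (a + p.1)).
  move=> /andP[h1 _]; rewrite ifF; first by rewrite opprD addrA.
  by rewrite ltrBlDl; apply/negbTE; rewrite -leNgt; exact: le_trans le h1.
by rewrite (h x hx) (h y hy); apply: (ih _ _ pc ic); rewrite in_itv.
Qed.

End control_laws.

Section bochner.
Context {R : realType} {V : lmodType R} (C : set V) (N : V -> R).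
Hypothesis csN : complete_seminorm C N.

Lemma bochner_congr (D : set R) (F F' : R -> V) (I I' : V) :
  (forall x, D x -> C (F x)) -> (forall x, D x -> C (F' x)) -> C I -> C I' ->
  (forall x, D x -> N (F x - F' x) = 0) -> N (I - I') = 0 ->
  is_bochner_integral C N D F I -> is_bochner_integral C N D F' I'.
Proof.
move=> CF CF' CI CI' FF II [s [hs ms is' es]].
have E n x : D x -> N (F x - simple_eval (s n) x) = N (F' x - simple_eval (s n) x).
  move=> Dx; have Cs := simple_eval_C csN x (hs n).
  by apply: (sn_eq_sub csN (CF _ Dx) Cs (CF' _ Dx) Cs); [exact: FF|rewrite subrr (sn0 csN)].
exists s; split.
- exact: hs.
- by move=> n; apply: eq_measurable_fun (ms n) => x; rewrite inE; exact: E.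
- have -> : (fun n => (\int[lebesgue_measure]_(x in D) (N (F' x - simple_eval (s n) x))%:E)%E) =
      (fun n => (\int[lebesgue_measure]_(x in D) (N (F x - simple_eval (s n) x))%:E)%E).
    apply/funext => n; apply: eq_integral => x; rewrite inE => Dx; by rewrite E.
  exact: is'.
- have -> : (fun n => N (simple_integral (s n) - I')) = (fun n => N (simple_integral (s n) - I)).
    apply/funext => n; have Cs := simple_integral_C csN (hs n).
    by rewrite -(sn_eq_sub csN Cs CI Cs CI' _ II)// subrr (sn0 csN).
  exact: es.
Qed.

End bochner.

Section conclusion.
Context {R : realType} {d : nat}.
Local Notation St := (@state R d).
Local Notation C := (@state_space R d).
Local Notation N := (@state_norm R d).
Local Notation B := (@control_term R d).
Local Notation wave := (@wave R d).
Local Notation "'NR'" := (near_reach C N wave B).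
Implicit Types (X Z : St) (W : R -> St).

Let csN := @state_seminorm R d.
Let gS := @wave_strongly_continuous R d.
Let bS := @wave_bound R d.

Lemma cont_on_path T W : cont_on C N 0 T W <-> continuous_path C N T W.
Proof.
split=> -[CW h]; split => // t tT.
  apply/cvgrPdist_le => e e0; have [r r0 hr] := h t tT e e0.
  rewrite near_withinE; exists r => //= s st sT.
  rewrite sub0r normrN ger0_norm ?sqrtr_ge0//; apply: hr => //.
  by move: st; rewrite /ball_/= distrC.
move=> e e0; have /cvgrPdist_le/(_ e e0) := h t tT.
rewrite near_withinE => -[r /= r0 hr]; exists r => // s sT st.
have := hr s; rewrite /ball_/= distrC => /(_ st sT).
by rewrite sub0r normrN ger0_norm ?sqrtr_ge0.
Qed.

Lemma mild_solutionP T p X W : mild C N wave T (fun s => B (p s)) X W -> mild_solution T p X W.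
Proof.
move=> [cW h]; exists wave; first exact: wave_generates.
by split; [exact/cont_on_path|].
Qed.

(** The group in the definition of a solution is given by its generator, which
    determines it. *)
Lemma mild_solution_mild T p X W : C X -> mild_solution T p X W ->
  mild C N wave T (fun s => B (p s)) X W.
Proof.
move=> CX [S' gS' [/cont_on_path cW h]]; split => // t tT.
have eqS s u : C u -> N (S' s u - wave s u) = 0.
  move=> Cu; apply: (generator_group_eq csN (@wave_generates R d) gS' bS s Cu).
  by move=> e e0; exact: wave_domain_dense.
have CS' s u : C u -> C (S' s u) by have [bl _ _ _] := gS'.1; have [+ _ _] := bl s; apply.
have CW s : s \in `[0, T] -> C (W s) by case: cW => + _; apply.
have sub s : `[0, t]%classic s -> s \in `[0, T].
  by move: tT; rewrite /= !in_itv/= => /andP[_ tT] /andP[-> st]; exact: le_trans st tT.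
apply: (bochner_congr csN) (h t tT) => [s st|s st|||s st|].
- by apply: CS'; apply: B_C; apply: CW; exact: sub.
- by apply: wave_C; apply: B_C; apply: CW; exact: sub.
- by apply: stateB; [exact: CW|exact: CS'].
- by apply: stateB; [exact: CW|exact: wave_C].
- by apply: eqS; apply: B_C; apply: CW; exact: sub.
- rewrite opprB addrC subrKA (snC csN); [exact: eqS|exact: wave_C|exact: CS'].
Qed.

Lemma mild_solution_unique T (c : seq (R * 'rV[R]_(d.*2.+1))) X W W' : C X ->
  mild_solution T (wctrl c) X W -> mild_solution T (wctrl c) X W' ->
  forall t, t \in `[0, T] -> N (W' t - W t) = 0.
Proof.
move=> CX /(mild_solution_mild CX) mW /(mild_solution_mild CX) mW' t tT.
have [M M0 hM] := bS T; have [b b0 hb] := wctrl_bound csN (@B_Z R d) (@B_bound R d) c.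
have BC s u : C u -> C (B (wctrl c s) u) by exact: B_C.
have Bb s u v : s \in `[0, T] -> C u -> C v ->
    N (B (wctrl c s) u - B (wctrl c s) v) <= b * N (u - v).
  move=> _ Cu Cv; have -> : B (wctrl c s) u - B (wctrl c s) v = B (wctrl c s) (u - v).
    by have := B_lin (wctrl c s) (-1) v u; rewrite !scaleN1r ![- _ + _]addrC.
  by apply: hb; exact: stateB.
have := mild_dist csN gS M0 b0 CX CX hM BC Bb mW' mW tT.
rewrite subrr (sn0 csN) !mulr0 mul0r => h; apply/eqP.
by rewrite eq_le h sqrtr_ge0.
Qed.

(** From near reachability to control in the prescribed time: the state
    wave (- T) Z is reached quickly, then the waves flow freely up to time T. *)
Lemma control_in_time X Z T eps : C X -> C Z -> (forall Y, C Y -> NR X Y) ->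
  0 < T -> 0 < eps -> exists c : seq (R * 'rV[R]_(d.*2.+1)), exists W,
  [/\ wpos c, wdur c = T, mild_solution T (wctrl c) X W & N (W T - Z) < eps].
Proof.
move=> CX CZ hX T0 e0; have [M M0 hM] := bS T.
have e4 : 0 < eps / 4 by rewrite divr_gt0.
have [r /andP[r0 _] hr] := wave_cont CZ e4.
pose tau := Num.min r (T / 2); have tau0 : 0 < tau by rewrite lt_min r0 divr_gt0.
have M1 : 0 < M + 1 by rewrite ltr_wpDl.
have e1 : 0 < eps / (4 * (M + 1)) by rewrite divr_gt0// mulr_gt0.
pose Y := wave (- T) Z; have CY : C Y by exact: wave_C.
have [c [Y' [pc dc CY' sc nY]]] := hX Y CY tau tau0 _ e1.
have th0 := wdur_ge0 pc; set th := wdur c in dc th0.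
have thT : th <= T / 2 by apply: le_trans dc _; rewrite ge_min lexx orbT.
have thr : th <= r by apply: le_trans dc _; rewrite ge_min lexx.
have Tth : 0 < T - th by lra.
have pf : wpos [:: (T - th, 0 : 'rV[R]_(d.*2.+1))] by move=> q; rewrite inE => /eqP ->.
have CF : C (wave (T - th) Y') by exact: wave_C.
have [W [sW nW]] := steer_cat csN gS (@B_C R d) pc pf CX CY' CF sc
   (steer_free csN gS bS (@B_C R d) (@B_Z R d) Tth CY').
have dE : wdur (c ++ [:: (T - th, 0 : 'rV[R]_(d.*2.+1))]) = T.
  by rewrite wdur_cat /= addr0 -/th; ring.
exists (c ++ [:: (T - th, 0)]), W; split => //.
- exact: wpos_cat.
- rewrite dE in sW; apply: mild_solutionP; apply: (csol_mild csN gS) sW => s u; exact: B_C.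
have CW : C (W T).
  by case: sW => -[+ _] _; apply; rewrite dE in_itv/= lexx ltW.
rewrite dE in nW.
have CG : C (wave (T - th) Y) by exact: wave_C.
have n1 : N (W T - wave (T - th) Y) <= eps / 4.
  apply: le_trans (sn_dist csN CW CF CG) _; rewrite nW add0r.
  have [bl _ _ _] := gS; rewrite (bl_distE csN (bl (T - th)) CY' CY).
  apply: le_trans (hM _ _ _ (stateB CY' CY)) _; first by rewrite gtr0_norm//; lra.
  apply: le_trans (ler_wpM2l M0 nY) _; rewrite mulrA ler_pdivrMr ?mulr_gt0//.
  by have := ltW e0; nra.
have n2 : N (wave (T - th) Y - Z) <= eps / 4.
  have Cth : C (wave (- th) Z) by exact: wave_C.
  have [_ h0 hadd _] := gS.
  have E : N (wave (T - th) Y - wave (- th) Z) = 0.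
    have := hadd (T - th) (- T) Z CZ; have -> : T - th + - T = - th by ring.
    by rewrite (snC csN).
  apply: le_trans (sn_dist csN CG Cth CZ) _; rewrite E add0r.
  have [->|thn0] := eqVneq th 0; first by rewrite oppr0 h0// ltW.
  by apply: hr; rewrite normrN normr_gt0 thn0/= ger0_norm.
by apply: le_lt_trans (sn_dist csN CW CG CZ) _; lra.
Qed.

End conclusion.

Lemma finite_spectrum_fourier {R : realType} d (f : torus R d -> R) :
  finite_set [set k | fourier f k <> 0] -> finite_spectrum f.
Proof.
move=> /finite_seqP[r hr]; exists r => c k kr.
have : fourier f k = 0.
  apply: contrapT => h; have : [set k | fourier f k <> 0] k by [].
  by rewrite hr /= (negbTE kr).
rewrite fourierE => /eqP; rewrite eq_complex/= => /andP[/eqP h1 /eqP h2].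
by case: c; rewrite /tcoef// -[LHS]opprK h2 oppr0.
Qed.

Theorem theorem1 (R : realType) (d : nat) (d_ge1 : (1 <= d)%N)
    (w0 dw0 : torus R d -> R) (w0_H1 : sobolev 1 w0) (dw0_L2 : L2 dw0)
    (W0_neq0 : ~ (ae_zero w0 /\ ae_zero dw0))
    (W0_finite :
      (~ ae_zero w0 /\ finite_set [set k | fourier w0 k <> 0]) \/
      [/\ ae_zero w0, ~ ae_zero dw0 & finite_set [set k | fourier dw0 k <> 0]])
    (w1 dw1 : torus R d -> R) (w1_H1 : sobolev 1 w1) (dw1_L2 : L2 dw1)
    (eps T : R) (eps_gt0 : 0 < eps) (T_gt0 : 0 < T) :
  exists p : R -> 'rV[R]_(d.*2.+1), piecewise_constant T p /\
  exists W : R -> state,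
    [/\ mild_solution T p (w0, dw0) W,
        forall W', mild_solution T p (w0, dw0) W' ->
          forall t : R, t \in `[0, T] -> state_norm (W' t - W t) = 0
      & state_norm (W T - (w1, dw1)) < eps].
Proof.
have CX : state_space (w0, dw0) by split.
have CZ : state_space (w1, dw1) by split.
have hX Y : state_space Y -> near_reach (@state_space R d) (@state_norm R d) (@wave R d) (@control_term R d) (w0, dw0) Y.
  move=> CY; case: W0_finite => [[n0 /finite_spectrum_fourier fin]|[z0 n0 /finite_spectrum_fourier fin]].
    exact: NR_position.
  exact: NR_rest.
have [c [W [pc dE mW nW]]] := control_in_time CX CZ hX T_gt0 eps_gt0.
exists (wctrl c); split; last first.
  by exists W; split => // W' mW' t tT; exact: (mild_solution_unique CX mW mW').
exists (endpoints 0 c); first by rewrite -[T]add0r -dE; exact: endpoints_partition.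
move=> i ic x y xi yi; have := wctrl_constant pc ic xi yi.
by rewrite !subr0.
Qed.
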